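(* The valued constraint language consisting of all submodular piecewise linear homogeneous cost functions over $\mathbb Q$ is maximally tractable within the class of piecewise linear homogeneous valued constraint languages over $\mathbb Q$. That is: (i) for every finite sublanguage $\Gamma'$ of it, $\mathrm{VCSP}(\Gamma')$ is solvable in polynomial time; and (ii) for every valued constraint language $\Delta$ over $\mathbb Q$ all of whose cost functions are piecewise linear homogeneous and which properly contains it (i.e. contains some piecewise linear homogeneous cost function that is not submodular), there is a finite sublanguage $\Delta'$ of $\Delta$ such that $\mathrm{VCSP}(\Delta')$ is NP-hard.
   Context: A valued constraint language $\Gamma$ over a domain $D$ consists of a signature $\tau$ of function symbols $f$ with arities $\mathrm{ar}(f)$ and, for each $f\in\tau$, a cost function $f^\Gamma\colon D^{\mathrm{ar}(f)}\to\mathbb Q\cup\{+\infty\}$, where $(+\infty)+c=c+(+\infty)=+\infty$ and $c<+\infty$ iff $c\in\mathbb Q$. A sublanguage is obtained by dropping some cost functions. For finite $\tau$, an instance $I$ of $\mathrm{VCSP}(\Gamma)$ consists of a finite set of variables $V_I$, an expression $\phi_I=\sum_{i=1}^m f_i(x^i_1,\dots,x^i_{\mathrm{ar}(f_i)})$ with $f_i\in\tau$ and $x^i_j\in V_I$, and a value $u_I\in\mathbb Q\cup\{+\infty\}$; the task is to decide whether there is a map $\alpha\colon V_I\to D$ whose cost $\sum_i f_i^\Gamma(\alpha(x^i_1),\dots,\alpha(x^i_{\mathrm{ar}(f_i)}))$ is finite, and if so whether there is one with cost at most $u_I$. A cost function $f\colon\mathbb Q^n\to\mathbb Q\cup\{+\infty\}$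 is viewed as a partial function with domain $\{t: f(t)<+\infty\}$; it is piecewise linear homogeneous (PLH) if this partial function is first-order definable over the structure $\mathfrak L=(\mathbb Q;<,1,(c\cdot)_{c\in\mathbb Q})$ ($<$ the strict order, $1$ the constant one, $c\cdot$ multiplication by $c$), i.e. there is a first-order formula $\phi(x_0,\dots,x_n)$ such that for $(a_1,\dots,a_n)$ in the domain of $f$, $\mathfrak L\models\phi(a_0,\dots,a_n)$ iff $a_0=f(a_1,\dots,a_n)$, and for $(a_1,\dots,a_n)$ outside the domain no $a_0$ satisfies $\phi$. A cost function $f\colon\mathbb Q^n\to\mathbb Q\cup\{+\infty\}$ is submodular if $f(\max(x,y))+f(\min(x,y))\le f(x)+f(y)$ for all $x,y\in\mathbb Q^n$, with $\max,\min$ taken componentwise. *)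

(* Defs.v *)
From mathcomp Require Import all_boot all_order all_algebra.

Set Implicit Arguments.
Unset Strict Implicit.
Unset Printing Implicit Defensive.

Import Order.TTheory GRing.Theory Num.Theory.

(** * Costs: [Some c] is the rational [c], [None] is +oo *)

Definition cost := option rat.

Definition addc (a b : cost) : cost :=
  match a, b with
  | Some x, Some y => Some (x + y)%R
  | _, _ => None
  end.

Definition lec (a b : cost) : bool :=
  match a, b with
  | _, None => true
  | None, Some _ => false
  | Some x, Some y => (x <= y)%R
  end.

(** * Valued constraint languages *)

Record cost_fun (D : Type) := CostFun {
  arity : nat;
  eval :> arity.-tuple D -> cost
}.

Record vlang (D : Type) := VLang {
  symb : Type;
  interp : symb -> cost_fun D
}.

Record fin_vlang (D : Type) := FinVLang {
  fsymb : finType;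
  finterp : fsymb -> cost_fun D
}.

Definition vlang_of_fin (D : Type) (G : fin_vlang D) : vlang D :=
  VLang (@finterp D G).
Coercion vlang_of_fin : fin_vlang >-> vlang.

(* Up to renaming of the symbols, [G'] is obtained from [G] by dropping
   function symbols. *)
Definition sublanguage (D : Type) (G' G : vlang D) : Prop :=
  exists h : symb G' -> symb G,
    injective h /\ forall f, interp f = interp (h f).

(** * VCSP instances; the set of variables is {0, ..., nvars - 1} *)

Record instance (D : Type) (G : fin_vlang D) := Instance {
  nvars : nat;
  summands : seq {f : fsymb G & (arity (finterp f)).-tuple 'I_nvars};
  threshold : cost
}.

Definition assignment_cost (D : Type) (G : fin_vlang D) (I : instance G)
    (alpha : 'I_(nvars I) -> D) : cost :=
  \big[addc/Some 0%R]_(t <- summands I)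
    finterp (tag t) (map_tuple alpha (tagged t)).

Definition has_finite_cost (D : Type) (G : fin_vlang D) (I : instance G) : Prop :=
  exists alpha : 'I_(nvars I) -> D, isSome (assignment_cost alpha).

(* Finiteness is required separately because the threshold may be +oo. *)
Definition has_cost_below (D : Type) (G : fin_vlang D) (I : instance G) : Prop :=
  exists alpha : 'I_(nvars I) -> D,
    isSome (assignment_cost alpha) /\
    lec (assignment_cost alpha) (threshold I).

(** * Binary encodings, all of them prefix-free *)

Definition encode_seq (T : Type) (enc : T -> seq bool) (s : seq T) : seq bool :=
  flatten [seq true :: enc x | x <- s] ++ [:: false].

(* Binary digits, least significant first. *)
Definition binary (n : nat) : seq bool :=
  [seq odd (n %/ 2 ^ i) | i <- iota 0 (trunc_log 2 n).+1].

Definition encode_nat (n : nat) : seq bool :=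
  encode_seq (fun b => [:: b]) (binary n).

Definition encode_int (z : int) : seq bool :=
  (z < 0)%R :: encode_nat `|z|%N.

Definition encode_rat (q : rat) : seq bool :=
  encode_int (numq q) ++ encode_int (denq q).

Definition encode_cost (c : cost) : seq bool :=
  if c is Some q then true :: encode_rat q else [:: false].

Definition encode_pair (w c : seq bool) : seq bool :=
  encode_seq (fun b => [:: b]) w ++ c.

Definition encode_instance (D : Type) (G : fin_vlang D) (I : instance G) :
    seq bool :=
  encode_seq (fun v : 'I_(nvars I) => encode_nat v) (enum 'I_(nvars I)) ++
  encode_seq
    (fun t : {f : fsymb G & (arity (finterp f)).-tuple 'I_(nvars I)} =>
       encode_nat (enum_rank (tag t)) ++
       encode_seq (fun v : 'I_(nvars I) => encode_nat v) (tagged t))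
    (summands I) ++
  encode_cost (threshold I).

(** * Deterministic multitape Turing machines *)

Inductive move := MoveLeft | MoveRight | Stay.

(* [None] is the blank; [A] contains the tape symbols other than bits. *)
Definition tape_symbol (A : Type) := option (bool + A).

(* Two-way infinite tape: cells left of the head (nearest first), scanned cell,
   cells right of the head; cells that are not listed are blank. *)
Record tape (A : Type) := Tape {
  tleft : seq (tape_symbol A);
  tscan : tape_symbol A;
  tright : seq (tape_symbol A)
}.

Definition blank_tape (A : Type) : tape A := Tape [::] None [::].

Definition input_tape (A : Type) (w : seq bool) : tape A :=
  if w is b :: w' then Tape [::] (Some (inl b)) [seq Some (inl x) | x <- w']
  else blank_tape A.

Definition write_and_move (A : Type) (t : tape A) (a : tape_symbol A)
    (m : move) : tape A :=
  match m with
  | Stay => Tape (tleft t) a (tright t)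
  | MoveLeft =>
      if tleft t is b :: l then Tape l b (a :: tright t)
      else Tape [::] None (a :: tright t)
  | MoveRight =>
      if tright t is b :: r then Tape (a :: tleft t) b r
      else Tape (a :: tleft t) None [::]
  end.

Fixpoint leading_bits (A : Type) (s : seq (tape_symbol A)) : seq bool :=
  if s is Some (inl b) :: s' then b :: leading_bits s' else [::].

Record machine := Machine {
  ntapes : nat; (* the machine has [ntapes.+1] tapes *)
  extra : finType;
  state : finType;
  start : state;
  halting : pred state;
  trans : state -> {ffun 'I_ntapes.+1 -> tape_symbol extra} ->
          state * {ffun 'I_ntapes.+1 -> tape_symbol extra * move}
}.

Definition config (M : machine) : Type :=
  (state M * {ffun 'I_(ntapes M).+1 -> tape (extra M)})%type.

Definition init_config (M : machine) (w : seq bool) : config M :=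
  (start M,
   [ffun i => if i == ord0 then input_tape (extra M) w
              else blank_tape (extra M)]).

Definition step (M : machine) (c : config M) : config M :=
  if halting c.1 then c
  else let r := trans c.1 [ffun i => tscan (c.2 i)] in
       (r.1, [ffun i => write_and_move (c.2 i) (r.2 i).1 (r.2 i).2]).

(* The bits on the first tape, from the head up to the first non-bit. *)
Definition output (M : machine) (c : config M) : seq bool :=
  leading_bits (tscan (c.2 ord0) :: tright (c.2 ord0)).

(** * Polynomial time, NP and NP-hardness *)

Definition polytime (f : seq bool -> seq bool) : Prop :=
  exists (M : machine) (p : {poly nat}), forall w : seq bool,
    exists2 t : nat, t <= p.[size w]%R &
      let c := iter t (@step M) (init_config M w) in
      halting c.1 /\ output c = f w.

(* A decision problem is the set [P] of its yes-instances, together with the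
   encoding [enc] of its instances. *)
Definition polytime_decidable (T : Type) (enc : T -> seq bool)
    (P : T -> Prop) : Prop :=
  exists d : seq bool -> bool,
    polytime (fun w => [:: d w]) /\ forall x : T, P x <-> d (enc x).

Definition in_NP (L : seq bool -> Prop) : Prop :=
  exists (V : seq bool -> bool) (p : {poly nat}),
    polytime (fun w => [:: V w]) /\
    forall w, L w <->
      exists2 c : seq bool, size c <= p.[size w]%R & V (encode_pair w c).

Definition NP_hard (T : Type) (enc : T -> seq bool) (P : T -> Prop) : Prop :=
  forall L : seq bool -> Prop, in_NP L ->
    exists r : seq bool -> T,
      polytime (fun w => enc (r w)) /\ forall w, L w <-> P (r w).

Definition VCSP_polytime (D : Type) (G : fin_vlang D) : Prop :=
  polytime_decidable (@encode_instance D G) (@has_finite_cost D G) /\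
  polytime_decidable (@encode_instance D G) (@has_cost_below D G).

(* [has_finite_cost] is the case of threshold +oo of [has_cost_below]. *)
Definition VCSP_NP_hard (D : Type) (G : fin_vlang D) : Prop :=
  NP_hard (@encode_instance D G) (@has_cost_below D G).

(** * First-order logic over (Q; <, 1, (c.)_(c in Q)) *)

Inductive term (n : nat) : Type :=
  | Var of 'I_n
  | One
  | Scale of rat & term n.

(* [formula n] has its free variables among 0, ..., n - 1; the quantifiers bind
   the variable 0 of their body and shift the others. *)
Inductive formula : nat -> Type :=
  | FEq n : term n -> term n -> formula n
  | FLt n : term n -> term n -> formula n
  | FNot n : formula n -> formula n
  | FAnd n : formula n -> formula n -> formula n
  | FOr n : formula n -> formula n -> formula n
  | FExists n : formula n.+1 -> formula n
  | FForall n : formula n.+1 -> formula n.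

Fixpoint term_value (n : nat) (e : n.-tuple rat) (t : term n) : rat :=
  match t with
  | Var i => tnth e i
  | One => 1%R
  | Scale c t' => (c * term_value e t')%R
  end.

Fixpoint holds (n : nat) (phi : formula n) : n.-tuple rat -> Prop :=
  match phi in formula n return n.-tuple rat -> Prop with
  | FEq _ s t => fun e => term_value e s = term_value e t
  | FLt _ s t => fun e => (term_value e s < term_value e t)%R
  | FNot _ f => fun e => ~ holds f e
  | FAnd _ f g => fun e => holds f e /\ holds g e
  | FOr _ f g => fun e => holds f e \/ holds g e
  | FExists _ f => fun e => exists a : rat, holds f (cons_tuple a e)
  | FForall _ f => fun e => forall a : rat, holds f (cons_tuple a e)
  end.

(** * Piecewise linear homogeneous and submodular cost functions *)

(* Variable 0 of [phi] is the value of [F], variables 1, ..., n its arguments. *)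
Definition PLH (F : cost_fun rat) : Prop :=
  exists phi : formula (arity F).+1,
    forall (a0 : rat) (a : (arity F).-tuple rat),
      holds phi (cons_tuple a0 a) <-> F a = Some a0.

Definition tuple_max (n : nat) (x y : n.-tuple rat) : n.-tuple rat :=
  [tuple Num.max (tnth x i) (tnth y i) | i < n].

Definition tuple_min (n : nat) (x y : n.-tuple rat) : n.-tuple rat :=
  [tuple Num.min (tnth x i) (tnth y i) | i < n].

Definition submodular (F : cost_fun rat) : Prop :=
  forall x y : (arity F).-tuple rat,
    lec (addc (F (tuple_max x y)) (F (tuple_min x y))) (addc (F x) (F y)).

Definition submodular_PLH : vlang rat :=
  VLang (fun f : {F : cost_fun rat | submodular F /\ PLH F} => sval f).

(* Main.v *)
(** Tractability.  By quantifier elimination over [(Q; <, 1, (c.))], a PLH cost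
    function is a finite table: the signs of the comparisons [c x_i < d x_j] (with
    [x_0 = 1]) select a term [c x_j] or +oo.  Feasibility of a threshold only asks
    for a solution of homogeneous constraints with two variables each, and a vertex
    argument shows that the solution can be taken among polynomially many values
    (monomials in the coefficients and in a large number [R]).  On this finite chain
    the instance is a sum of submodular functions of bounded arity; encoding
    variables by up-sets of the chain and penalising inconsistent sets turns it
    into the minimization of a sum of submodular set functions, which a push-relabel
    algorithm on the bases of the summands solves with polynomially many passes.

    Hardness.  If [f] is not submodular at [x, y], put [lo = min x y], [hi = max x y];
    blocks of variables restricted to [{lo, hi}] act as Boolean variables, and [f]
    evaluated on a mixture of two blocks, corrected by a modular function, penalises
    the selection of both.  This gives an independent set problem.  A computation of
    a nondeterministic machine is an independent set of local views (time, state,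
    head positions, scanned symbols, times of the previous visits), since the
    consistency of a run is a condition on pairs of views. *)
Require Import Defs.
From HB Require Import structures.
From mathcomp Require Import all_boot all_order all_algebra.
From mathcomp Require Import zify ring lra.
From Stdlib Require Import FunctionalExtensionality Classical.

Set Implicit Arguments.
Unset Strict Implicit.
Unset Printing Implicit Defensive.

Import Order.TTheory GRing.Theory Num.Theory.

(** * Stack programs *)

(** Polynomial time refers to Turing machines, so every algorithm below has to be a machine. The
    class [PT] of functions between encoded types serves this purpose: it rests on stack programs
    and is closed under pattern matching and under folds whose intermediate results stay polynomial
    in size. Hence algorithms are written as folds over lists, with explicit size bounds. The
    obstacle on the tractable side is strictness: a system of strict homogeneous constraints has no
    vertices. Each is tightened by the factor 1 - 1/R, which is correct only for an R that depends
    on the unknown solution. Up to a common factor the coordinates of a vertex are integer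
    polynomials in R, and the signs of such polynomials are constant beyond an explicit bound of
    polynomial bit length, so a known R does as well. On the hard side two cases arise. If f is
    finite at the minimum or at the maximum, a modular function isolates the excess cost of one
    corner. If both are infinite, f only says that two blocks are complementary, and the conflict
    has to come from an implication. *)

Definition store := nat -> seq bool.

Definition upd (s : store) (r : nat) (v : seq bool) : store :=
  fun i => if i == r then v else s i.

Inductive cmd :=
  | Skip
  | Push of nat & bool
  | Pop of nat
  | Seq of cmd & cmd
  | If of nat & cmd & cmd & cmd
  | While of nat & cmd.

(* [If r] branches on the top of register [r] (true, false, empty);
   [While r] runs until register [r] is empty. *)
Inductive exec : cmd -> store -> store -> nat -> Prop :=
  | ESkip s : exec Skip s s 0
  | EPush r b s : exec (Push r b) s (upd s r (b :: s r)) 1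
  | EPop r s : exec (Pop r) s (upd s r (behead (s r))) 1
  | ESeq c1 c2 s s1 s2 t1 t2 :
      exec c1 s s1 t1 -> exec c2 s1 s2 t2 -> exec (Seq c1 c2) s s2 (t1 + t2)
  | EIf r c1 c2 c3 s s' t :
      exec (if s r is b :: _ then if b then c1 else c2 else c3) s s' t ->
      exec (If r c1 c2 c3) s s' t.+2
  | EWhile0 r c s : s r = [::] -> exec (While r c) s s 1
  | EWhileS r c s s1 s2 t1 t2 :
      s r <> [::] -> exec c s s1 t1 -> exec (While r c) s1 s2 t2 ->
      exec (While r c) s s2 (t1 + t2).+2.

Inductive instr :=
  | IPush of nat & bool
  | IPop of nat
  | IBranch of nat & nat & nat & nat.

Definition jump (e : nat) := IBranch 0 e e e.

Fixpoint clen (c : cmd) : nat :=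
  match c with
  | Skip => 0
  | Push _ _ | Pop _ => 1
  | Seq c1 c2 => clen c1 + clen c2
  | If _ c1 c2 c3 => (clen c1 + clen c2 + clen c3).+4
  | While _ c => (clen c).+2
  end.

Fixpoint compile (p : nat) (c : cmd) : seq instr :=
  match c with
  | Skip => [::]
  | Push r b => [:: IPush r b]
  | Pop r => [:: IPop r]
  | Seq c1 c2 => compile p c1 ++ compile (p + clen c1) c2
  | If r c1 c2 c3 =>
      let e := p + (clen c1 + clen c2 + clen c3).+4 in
      [:: IBranch r p.+1 (p + clen c1).+2 (p + clen c1 + clen c2).+3] ++
      compile p.+1 c1 ++ [:: jump e] ++
      compile (p + clen c1).+2 c2 ++ [:: jump e] ++
      compile (p + clen c1 + clen c2).+3 c3 ++ [:: jump e]
  | While r c =>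
      [:: IBranch r p.+1 p.+1 (p + (clen c).+2)] ++
      compile p.+1 c ++ [:: jump p]
  end.

Lemma size_compile p c : size (compile p c) = clen c.
Proof.
elim: c p => //= [c1 IH1 c2 IH2|r c1 IH1 c2 IH2 c3 IH3|r c IH] p.
- by rewrite size_cat IH1 IH2.
- by rewrite !size_cat /= !size_cat /= !size_cat /= IH1 IH2 IH3; lia.
- by rewrite size_cat /= IH; lia.
Qed.

(** Past the end of the program the default instruction jumps to itself, so a finished run is a
    fixed point. *)
Definition istep (prog : seq instr) (c : nat * store) : nat * store :=
  match nth (jump c.1) prog c.1 with
  | IPush r b => (c.1.+1, upd c.2 r (b :: c.2 r))
  | IPop r => (c.1.+1, upd c.2 r (behead (c.2 r)))
  | IBranch r n1 n2 n3 =>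
      (if c.2 r is b :: _ then if b then n1 else n2 else n3, c.2)
  end.

(** Required for every default [d], because the default that [istep] passes to [nth] depends on the
    program counter. *)
Definition code_at (prog : seq instr) p (l : seq instr) :=
  forall d i, i < size l -> nth d prog (p + i) = nth d l i.

Lemma code_at_cat prog p l1 l2 :
  code_at prog p (l1 ++ l2) ->
  code_at prog p l1 /\ code_at prog (p + size l1) l2.
Proof.
move=> H; split=> d i Hi.
  by rewrite H ?size_cat ?nth_cat ?Hi //; lia.
rewrite -addnA H ?size_cat ?nth_cat; last by lia.
by rewrite ltnNge leq_addr /= addKn.
Qed.

Lemma code_at_cons prog p x l : code_at prog p (x :: l) ->
  (forall d, nth d prog p = x) /\ code_at prog p.+1 l.
Proof.
move=> H; split=> [d|d i Hi]; first by have := H d 0 isT; rewrite addn0.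
by have := H d i.+1 Hi; rewrite addnS.
Qed.

(** The times in [exec] are exact for this code: an [If] adds its branch and the closing jump, each
    round of a [While] its test and the jump back. *)
Lemma compile_correct prog c s s' t : exec c s s' t ->
  forall p, code_at prog p (compile p c) ->
  iter t (istep prog) (p, s) = (p + clen c, s').
Proof.
elim=> {c s s' t}.
- by move=> s p _; rewrite addn0.
- by move=> r b s p /code_at_cons[H _] /=; rewrite /istep /= H addn1.
- by move=> r s p /code_at_cons[H _] /=; rewrite /istep /= H addn1.
- move=> c1 c2 s s1 s2 t1 t2 _ IH1 _ IH2 p /= /code_at_cat[H1].
  rewrite size_compile => H2.
  by rewrite addnC iterD IH1 // IH2 // addnA.
- move=> r c1 c2 c3 s s' t _ IH p; rewrite [compile _ _]/=.
  move=> /code_at_cons[Hb /code_at_cat[H1]]; rewrite size_compile.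
  move=> /code_at_cons[J1 /code_at_cat[H2]]; rewrite size_compile.
  move=> /code_at_cons[J2 /code_at_cat[H3]]; rewrite size_compile.
  move=> /code_at_cons[J3 _].
  have jmp q e s1 : (forall d, nth d prog q = jump e) ->
      istep prog (q, s1) = (e, s1).
    by move=> h; rewrite /istep h /=; case: (s1 0) => [//|[]].
  rewrite iterSr iterS {3}/istep /= Hb /=.
  case: (s r) IH => [|[] l] IH.
  + by rewrite IH ?(jmp _ _ _ J3).
  + by rewrite IH ?(jmp _ _ _ J1).
  + by rewrite IH ?(jmp _ _ _ J2).
- move=> r c s Hs p /= /code_at_cons[H _].
  by rewrite /istep /= H Hs.
- move=> r c s s1 s2 t1 t2 Hs _ IH1 _ IH2 p Hc.
  have IH := IH2 p Hc.
  case: (code_at_cons Hc) => H /code_at_cat[H1 /code_at_cons[J _]].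
  rewrite (_ : (t1 + t2).+2 = t2 + (1 + (t1 + 1))); last by lia.
  rewrite iterD (iterD 1) (iterD t1).
  have -> : iter 1 (istep prog) (p, s) = (p.+1, s).
    by rewrite /= /istep /= H; case: (s r) Hs => // [[]].
  rewrite IH1 //; rewrite size_compile in J.
  rewrite -IH; congr iter; rewrite /= /istep /= J /=; by case: (s1 0) => [|[]].
Qed.

Definition instr_reg i :=
  match i with IPush r _ | IPop r => r | IBranch r _ _ _ => r end.

Definition instr_target i :=
  if i is IBranch _ a b c then maxn a (maxn b c) else 0.

(** * Simulation of stack programs by multitape machines *)

Section Simulation.

Variable prog : seq instr.

Let K := \max_(i <- prog) instr_reg i.
Let B := maxn (size prog) (\max_(i <- prog) instr_target i).

Let tsym := tape_symbol void.

(** One tape per register, with the top of the stack under the head. A machine writes before it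
    moves, so a push takes two steps, told apart by the boolean of the state: a move to the left,
    then the write. *)
Definition sim_trans (q : 'I_B.+1 * bool) (a : {ffun 'I_K.+1 -> tsym}) :
    ('I_B.+1 * bool) * {ffun 'I_K.+1 -> tsym * move} :=
  match nth (jump q.1) prog q.1 with
  | IPush r b =>
      if q.2 then ((inord q.1.+1, false),
        [ffun i => if i == inord r then (Some (inl b), Stay) else (a i, Stay)])
      else ((q.1, true),
        [ffun i => (a i, if i == inord r then MoveLeft else Stay)])
  | IPop r => ((inord q.1.+1, false),
        [ffun i => if i == inord r then (None, MoveRight) else (a i, Stay)])
  | IBranch r n1 n2 n3 =>
      ((inord (if a (inord r) is Some (inl b) then if b then n1 else n2 else n3),
        false), [ffun i => (a i, Stay)])
  end.

Definition sim_machine : machine :=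
  @Machine K void _ (ord0 : 'I_B.+1, false)
    (fun q => size prog <= q.1) sim_trans.

(** The stack grows to the left, where all cells are blank. Blanks after the stack are allowed
    because the head scans one already when the stack is empty. *)
Definition represents (t : tape void) (s : seq bool) :=
  (exists j, tleft t = nseq j None) /\
  exists m, tscan t :: tright t = map (fun b => Some (inl b)) s ++ nseq m None.

Definition simulates (cf : config sim_machine) (c : nat * store) :=
  [/\ c.1 <= B, cf.1 = (inord c.1, false) &
      forall r, r <= K -> represents (cf.2 (inord r)) (c.2 r)].

Lemma represents_push t s b : represents t s ->
  represents (write_and_move (write_and_move t (tscan t) MoveLeft)
    (Some (inl b)) Stay) (b :: s).
Proof.
case: t => l c r [[j /= ->]] [m /= H]; split.
  by case: j => [|j] /=; [exists 0 | exists j].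
by exists m; case: j => [|j] /=; rewrite H.
Qed.

Lemma represents_pop t s : represents t s ->
  represents (write_and_move t None MoveRight) (behead s).
Proof.
case: t => l c r [[j /= ->]] [m /= H]; split.
  by case: r H => [|x r] H /=; exists j.+1.
case: s H => [|x s] /= H.
  case: m H => // m [_ ->]; case: m => [|m] /=; first by exists 1.
  by exists m.+1.
case: H => _ ->; case: s => [|y s] /=; last by exists m.
by case: m => [|m] /=; [exists 1 | exists m.+1].
Qed.

Lemma represents_scan t s : represents t s ->
  tscan t = if s is b :: _ then Some (inl b) else None.
Proof. by case=> _ [m]; case: s => [|b s]; [case: m => // m|]; case. Qed.

Lemma mem_max (T : Type) (F : T -> nat) (l : seq T) d i :
  i < size l -> F (nth d l i) <= \max_(x <- l) F x.
Proof.
elim: l i => // x l IH [|i] /= Hi; rewrite big_cons leq_max ?leqnn //.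
by rewrite IH ?orbT.
Qed.

Lemma step_simulates cf c : simulates cf c -> c.1 < size prog ->
  exists2 k, k <= 2 & simulates (iter k (@step _) cf) (istep prog c).
Proof.
case: c cf => pc s [[q ph] tp] [/= HB [-> ->] Hr Hpc].
have nh : size prog <= (inord pc : 'I_B.+1) = false.
  by apply/negbTE; rewrite inordK // -ltnNge.
have Breg := mem_max instr_reg (jump pc) Hpc.
have Btar := mem_max instr_target (jump pc) Hpc.
have HBS : pc.+1 <= B by rewrite leq_max Hpc.
rewrite /istep /=; case E: (nth _ prog pc) Breg Btar => [r b|r|r n1 n2 n3] /= Br Bt.
- exists 2 => //; rewrite /= {2}/step /= nh /sim_trans /= inordK //= E /=.
  rewrite /step /= nh /sim_trans /= inordK //= E /=; split=> //= r' Hr'.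
  rewrite !ffunE; case: eqP => [e|ne]; rewrite /upd.
    have -> : r' = r by have := congr1 (@nat_of_ord _) e; rewrite !inordK.
    rewrite eqxx; exact: represents_push (Hr _ Br).
  case: eqP => [e|_]; first by rewrite e in ne.
  by have := Hr _ Hr'; case: (tp (inord r')).
- exists 1 => //; rewrite /= /step /= nh /sim_trans /= inordK //= E /=; split=> //= r' Hr'.
  rewrite !ffunE; case: eqP => [e|ne]; rewrite /upd.
    have -> : r' = r by have := congr1 (@nat_of_ord _) e; rewrite !inordK.
    rewrite eqxx; exact: represents_pop (Hr _ Br).
  case: eqP => [e|_]; first by rewrite e in ne.
  by have := Hr _ Hr'; case: (tp (inord r')).
- exists 1 => //; rewrite /= /step /= nh /sim_trans /= inordK //= E /=.
  rewrite ffunE (represents_scan (Hr _ Br)); split=> //=.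
  + have BB : maxn n1 (maxn n2 n3) <= B by rewrite leq_max Bt orbT.
    move: BB; rewrite !geq_max => /and3P[h1 h2 h3].
    by case: (s r) => [|[]].
  + by case: (s r) => [|[]].
  + by move=> r' Hr'; rewrite !ffunE; have := Hr _ Hr'; case: (tp (inord r')).
Qed.

Lemma istep_halt c : size prog <= c.1 -> istep prog c = c.
Proof.
by case: c => pc s /= H; rewrite /istep nth_default //=; case: (s 0) => [|[]].
Qed.

Lemma iter_simulates t cf c : simulates cf c ->
  exists2 k, k <= t.*2 & simulates (iter k (@step _) cf) (iter t (istep prog) c).
Proof.
elim: t cf c => [|t IH] cf c H; first by exists 0.
rewrite iterSr; have [Hs|Hs] := ltnP c.1 (size prog); last first.
  rewrite istep_halt //; have [k Hk Hk'] := IH _ _ H; exists k => //; lia.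
have [k1 L1 S1] := step_simulates H Hs.
have [k2 L2 S2] := IH _ _ S1.
by exists (k2 + k1); [lia | rewrite iterD].
Qed.

Lemma leading_bits_represents t s : represents t s ->
  leading_bits (tscan t :: tright t) = s.
Proof.
case=> _ [m ->]; elim: s => [|b s IH] /=; first by case: m.
by rewrite IH.
Qed.

Lemma sim_halts w s t :
  iter t (istep prog) (0, upd (fun=> [::]) 0 w) = (size prog, s) ->
  exists2 k, k <= t.*2 &
    let c := iter k (@step sim_machine) (init_config _ w) in
    halting c.1 /\ output c = s 0.
Proof.
move=> H.
have S0 : simulates (init_config sim_machine w) (0, upd (fun=> [::]) 0 w).
  split=> //=; first by congr (_, _); apply/val_inj; rewrite /= inordK.
  move=> r Hr; rewrite ffunE /upd.
  have -> : (inord r == ord0 :> 'I_K.+1) = (r == 0).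
    by rewrite -val_eqE /= inordK.
  case: (r == 0); last by split; [exists 0 | exists 1].
  case: w {H} => [|b w]; split; try by [exists 0 | exists 1].
  by exists 0; rewrite /= cats0.
have [k Hk [_ Hq Hs]] := iter_simulates t S0; exists k => //.
move: Hq Hs; rewrite H /= => -> Hs; split.
  by rewrite inordK // ltnS leq_maxl.
rewrite /output; have := leading_bits_represents (Hs 0 isT).
by rewrite (_ : inord 0 = ord0) //; apply/val_inj; rewrite /= inordK.
Qed.

End Simulation.

Lemma polytime_of_cmd (c : cmd) (f : seq bool -> seq bool) (d : nat) :
  (forall w, exists s t, [/\ exec c (upd (fun=> [::]) 0 w) s t, s 0 = f w &
     t <= (size w + 2) ^ d]) -> polytime f.
Proof.
move=> H; exists (sim_machine (compile 0 c)), (('X + 2%:R%:P) ^+ d *+ 2)%R => w.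
have [s [t [He Hs Ht]]] := H w.
have Hc : code_at (compile 0 c) 0 (compile 0 c) by [].
have := compile_correct He Hc; rewrite add0n -(size_compile 0) => E.
have [k Hk] := sim_halts E.
rewrite Hs => Hk'; exists k => //.
rewrite hornerMn horner_exp hornerD hornerX hornerC.
apply: leq_trans Hk _.
rewrite -muln2 (_ : (_ *+ 2)%R = ((size w + 2) ^ d * 2)%N); first by rewrite leq_mul2r Ht orbT.
rewrite mulr2n muln2 -addnn; congr (_ + _); elim: d {H Ht} => //= d IH; rewrite exprS expnS IH //.
Qed.

(** * Polynomial-time functions on trees *)

(** An upper bound in place of the exact time, since bounds are rounded up when programs are
    combined. *)
Definition runs c s s' n := exists2 t, t <= n & exec c s s' t.

Lemma runs_le c s s' n m : runs c s s' n -> n <= m -> runs c s s' m.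
Proof. by case=> t h e hm; exists t => //; exact: leq_trans hm. Qed.

Lemma runs_ext c s s1 s2 n : runs c s s1 n -> s1 =1 s2 -> runs c s s2 n.
Proof. by move=> h /functional_extensionality <-. Qed.

Lemma runs_seq c1 c2 s s1 s2 n1 n2 :
  runs c1 s s1 n1 -> runs c2 s1 s2 n2 -> runs (Seq c1 c2) s s2 (n1 + n2).
Proof.
by case=> t1 h1 e1 [t2 h2 e2]; exists (t1 + t2); [exact: leq_add | exact: ESeq e1 e2].
Qed.

Lemma runs_skip s : runs Skip s s 0.
Proof. by exists 0 => //; exact: ESkip. Qed.

Lemma runs_push r b s : runs (Push r b) s (upd s r (b :: s r)) 1.
Proof. by exists 1 => //; exact: EPush. Qed.

Lemma runs_pop r s : runs (Pop r) s (upd s r (behead (s r))) 1.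
Proof. by exists 1 => //; exact: EPop. Qed.

Lemma runs_if r c1 c2 c3 s s' n :
  runs (if s r is b :: _ then if b then c1 else c2 else c3) s s' n ->
  runs (If r c1 c2 c3) s s' n.+2.
Proof. by case=> t h e; exists t.+2 => //; exact: EIf. Qed.

Lemma runs_while0 r c s : s r = [::] -> runs (While r c) s s 1.
Proof. by move=> h; exists 1 => //; exact: EWhile0. Qed.

Lemma runs_whileS r c s s1 s2 n1 n2 : s r <> [::] ->
  runs c s s1 n1 -> runs (While r c) s1 s2 n2 ->
  runs (While r c) s s2 (n1 + n2).+2.
Proof.
move=> h [t1 h1 e1] [t2 h2 e2]; exists (t1 + t2).+2; last exact: EWhileS e2.
by rewrite !ltnS leq_add.
Qed.

(** A step pushes at most one bit; hence a time bound is also a bound on the size of the result. *)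
Lemma exec_size c s s' t r : exec c s s' t -> size (s' r) <= size (s r) + t.
Proof.
move=> e; elim: e => {c s s' t} /=.
- by move=> s; rewrite addn0.
- by move=> r' b s; rewrite /upd; case: eqP => [->|_] /=; lia.
- by move=> r' s; rewrite /upd; case: eqP => [->|_] /=; rewrite ?size_behead; lia.
- by move=> *; lia.
- by move=> *; lia.
- by move=> *; lia.
- by move=> *; lia.
Qed.

Ltac upd_cases := rewrite /upd;
  repeat match goal with
  | |- context [if ?a == ?b then _ else _] => case: (eqVneq a b) => ?
  end; subst; try (exfalso; lia).

Ltac store_eq := let i := fresh in move=> i; upd_cases; try (rewrite /=; congruence).

Definition clear r := While r (Pop r).

Lemma runs_clear r s : runs (clear r) s (upd s r [::]) (3 * size (s r) + 1).
Proof.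
move E: (s r) => u; elim: u s E => [|b u IH] s E.
  by apply: runs_ext; [exact: runs_while0 | store_eq].
apply: runs_le.
  apply: runs_ext.
    apply: runs_whileS; [by rewrite E | exact: runs_pop |].
    by apply: IH; rewrite /upd eqxx E.
  by store_eq.
by rewrite /=; lia.
Qed.

Definition mv a b :=
  While a (If a (Seq (Pop a) (Push b true)) (Seq (Pop a) (Push b false)) Skip).

Lemma runs_mv a b s : a <> b ->
  runs (mv a b) s (upd (upd s a [::]) b (catrev (s a) (s b))) (6 * size (s a) + 1).
Proof.
move=> ab; move E: (s a) => u; elim: u s E => [|x u IH] s E.
  by apply: runs_ext; [exact: runs_while0 | store_eq].
apply: runs_le.
  apply: runs_ext.
    apply: runs_whileS; first by rewrite E.
      apply: runs_if; rewrite E /=.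
      instantiate (2 := upd (upd s a u) b (x :: s b)).
      case: x {E} (E) => E; apply: runs_ext; try (apply: runs_seq;
        [exact: runs_pop | exact: runs_push]); rewrite E; store_eq.
    by apply: IH; upd_cases.
  by store_eq.
by rewrite /=; lia.
Qed.

Definition mv2 a b c :=
  While a (If a (Seq (Pop a) (Seq (Push b true) (Push c true)))
                (Seq (Pop a) (Seq (Push b false) (Push c false))) Skip).

Lemma runs_mv2 a b c s : a <> b -> a <> c -> b <> c ->
  runs (mv2 a b c) s
    (upd (upd (upd s a [::]) b (catrev (s a) (s b))) c (catrev (s a) (s c)))
    (7 * size (s a) + 1).
Proof.
move=> ab ac bc; move E: (s a) => u; elim: u s E => [|x u IH] s E.
  by apply: runs_ext; [exact: runs_while0 | store_eq].
apply: runs_le.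
  apply: runs_ext.
    apply: runs_whileS; first by rewrite E.
      apply: runs_if; rewrite E /=.
      instantiate (2 := upd (upd (upd s a u) b (x :: s b)) c (x :: s c)).
      case: x {E} (E) => E; apply: runs_ext; try (apply: runs_seq;
        [exact: runs_pop | apply: runs_seq; exact: runs_push]); rewrite E; store_eq.
    by apply: IH; upd_cases.
  by store_eq.
by rewrite /=; lia.
Qed.

(** Each move reverses a stack; passing through [tmp] restores the order. *)
Definition copy r k tmp := Seq (mv r tmp) (mv2 tmp r k).

Lemma runs_copy r k tmp s : r <> k -> r <> tmp -> k <> tmp ->
  s k = [::] -> s tmp = [::] ->
  runs (copy r k tmp) s (upd s k (s r)) (13 * size (s r) + 2).
Proof.
move=> rk rt kt Hk Ht; apply: runs_le.
  apply: runs_ext; first by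
    apply: runs_seq; [apply: runs_mv; exact: rt | apply: runs_mv2; lia].
  have e u : catrev (catrev u [::]) [::] = u by rewrite !catrevE !cats0 revK.
  by store_eq; rewrite ?Hk ?Ht e.
by rewrite /upd eqxx Ht catrevE size_cat size_rev /=; lia.
Qed.

Definition mvo r k tmp := Seq (mv r tmp) (mv tmp k).

Lemma runs_mvo r k tmp s : r <> k -> r <> tmp -> k <> tmp -> s tmp = [::] ->
  runs (mvo r k tmp) s (upd (upd s r [::]) k (s r ++ s k)) (12 * size (s r) + 2).
Proof.
move=> rk rt kt Ht; apply: runs_le.
  apply: runs_ext; first by
    apply: runs_seq; [apply: runs_mv; exact: rt | apply: runs_mv; lia].
  have e u v : catrev (catrev u [::]) v = u ++ v by rewrite !catrevE cats0 revK.
  by store_eq; rewrite ?Ht e.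
by rewrite /upd eqxx Ht catrevE size_cat size_rev /=; lia.
Qed.

Fixpoint push_all r l := if l is x :: l' then Seq (push_all r l') (Push r x) else Skip.

Lemma runs_push_all r l s : runs (push_all r l) s (upd s r (l ++ s r)) (size l).
Proof.
elim: l => [|x l IH]; first by apply: runs_ext; [exact: runs_skip | store_eq].
apply: runs_le.
  by apply: runs_ext; [apply: runs_seq; [exact: IH | exact: runs_push] | store_eq].
by rewrite addn1.
Qed.

(** * Trees as the common data type *)

Inductive tree := Leaf | Node of tree & tree.

(** Preorder code with one bit per vertex. It is self-delimiting, so the two parts of a pair can be
    separated without a length field. *)
Fixpoint code (x : tree) : seq bool :=
  if x is Node a b then true :: code a ++ code b else [:: false].

Definition treesz x := size (code x).

Lemma treesz_gt0 x : 0 < treesz x.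
Proof. by case: x. Qed.

Lemma treesz_node a b : treesz (Node a b) = (treesz a + treesz b).+1.
Proof. by rewrite /treesz /= size_cat. Qed.

Lemma code_inj x y u v : code x ++ u = code y ++ v -> x = y /\ u = v.
Proof.
elim: x y u v => [|a IHa b IHb] [|c d] u v //=; first by case.
by case; rewrite -!catA => /IHa[<-] /IHb[<-].
Qed.

(** The base is at least 2, so its powers absorb constants and sums, and a single exponent describes
    a polynomial bound. *)
Definition PB (T : Type) (m f : T -> nat) :=
  exists d, forall x, f x <= (m x + 2) ^ d.

Lemma PB_le T (m f g : T -> nat) : PB m g -> (forall x, f x <= g x) -> PB m f.
Proof. by case=> d H h; exists d => x; exact: leq_trans (H x). Qed.

Lemma PB_const T (m : T -> nat) c : PB m (fun=> c).
Proof.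
exists c => x; apply: leq_trans (ltnW (ltn_expl c (isT : 1 < 2))) _.
by case: c => // c; rewrite leq_exp2r //; lia.
Qed.

Lemma PB_id T (m : T -> nat) : PB m m.
Proof. by exists 1 => x; rewrite expn1 leq_addr. Qed.

Lemma expn_le_bound n a b : a <= b -> (n + 2) ^ a <= (n + 2) ^ b.
Proof. by move=> h; rewrite leq_pexp2l // addn2. Qed.

Lemma PB_add T (m f g : T -> nat) : PB m f -> PB m g -> PB m (fun x => f x + g x).
Proof.
case=> a Ha [b Hb]; exists (a + b).+1 => x.
have := Ha x; have := Hb x.
have := expn_le_bound (m x) (leq_addr b a); have := expn_le_bound (m x) (leq_addl a b).
by rewrite expnS; nia.
Qed.

Lemma PB_mul T (m f g : T -> nat) : PB m f -> PB m g -> PB m (fun x => f x * g x).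
Proof. by case=> a Ha [b Hb]; exists (a + b) => x; rewrite expnD leq_mul. Qed.

Lemma PB_exp T (m f : T -> nat) k : PB m f -> PB m (fun x => f x ^ k).
Proof.
move=> H; elim: k => [|k IH]; first exact: PB_const.
by apply: PB_le; [apply: (PB_mul H IH) | move=> x; rewrite expnS].
Qed.

Ltac pb := repeat first [exact: PB_id | exact: PB_const | assumption
  | apply: PB_add | apply: PB_mul | apply: PB_exp].

(* [e] encodes the input.  The command works on register 0; registers 1 to
   K - 1 are scratch space, and those from K on are a frame that it keeps. *)
Definition PTg (X : Type) (e f : X -> tree) :=
  exists c K d, forall s x, s 0 = code (e x) ->
    (forall i, 0 < i < K -> s i = [::]) ->
    runs c s (upd s 0 (code (f x))) ((treesz (e x) + 2) ^ d).

Lemma PTg_intro X (e f : X -> tree) c K b : PB (fun x => treesz (e x)) b ->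
  (forall s x, s 0 = code (e x) -> (forall i, 0 < i < K -> s i = [::]) ->
    runs c s (upd s 0 (code (f x))) (b x)) -> PTg e f.
Proof.
case=> d Hd H; exists c, K, d => s x hx hs.
by apply: runs_le (Hd x); exact: H.
Qed.

Lemma PB_pow X (m : X -> nat) d : PB m (fun x => (m x + 2) ^ d).
Proof. by exists d. Qed.

Lemma PTg_size X (e f : X -> tree) : PTg e f ->
  PB (fun x => treesz (e x)) (fun x => treesz (f x)).
Proof.
case=> c [K [d H]].
apply: PB_le; first exact: (PB_add (PB_id _) (PB_pow _ d)).
move=> x; have [||t ht ex] := H (upd (fun=> [::]) 0 (code (e x))) x; first by [].
  by case.
by have := exec_size 0 ex; rewrite /upd /= /treesz in ht *; lia.
Qed.

Lemma PTg_ext X (e f g : X -> tree) : PTg e f -> f =1 g -> PTg e g.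
Proof. by move=> H /functional_extensionality <-. Qed.

Lemma PTg_id X (e : X -> tree) : PTg e e.
Proof.
apply: (@PTg_intro _ _ _ Skip 0 (fun=> 0)) => [|s x h _]; first exact: PB_const.
by apply: runs_ext; [exact: runs_skip | store_eq].
Qed.

Lemma PTg_const X (e : X -> tree) k : PTg e (fun=> k).
Proof.
apply: (@PTg_intro _ _ _ (Seq (clear 0) (push_all 0 (code k))) 0
  (fun x => 3 * treesz (e x) + 1 + treesz k)) => [|s x h _]; first by pb.
apply: runs_le.
  apply: runs_ext; first by
    apply: runs_seq; [exact: runs_clear | exact: runs_push_all].
  by store_eq; rewrite cats0.
by rewrite h.
Qed.

(** The second function has to be correct only on codes of some [y : Y]. This covers both the
    restriction to a subtype and the decoding of a matched constructor. *)
Lemma PTg_comp X Y (e f g : X -> tree) (e' f' : Y -> tree) :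
  PTg e g -> PTg e' f' -> (forall x, exists2 y, e' y = g x & f' y = f x) ->
  PTg e f.
Proof.
move=> Pg [cf [Kf [df Hf]]] Hy; have sg := PTg_size Pg.
case: Pg => [cg [Kg [dg Hg]]].
apply: (@PTg_intro _ _ _ (Seq cg cf) (maxn Kf Kg)
  (fun x => (treesz (e x) + 2) ^ dg + (treesz (g x) + 2) ^ df)).
  by apply: PB_add; pb.
move=> s x h hs; have [y ey fy] := Hy x; apply: runs_ext.
  apply: runs_seq; first by apply: Hg => // i hi; apply: hs; lia.
  by rewrite -ey; apply: Hf => [|i hi]; upd_cases; rewrite ?ey //; apply: hs; lia.
by rewrite fy; store_eq.
Qed.

(** Registers from [k] on lie beyond the scratch space of both programs: [k] keeps the input, [k.+1]
    the first result, and [k.+2] helps to move stacks. *)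
Definition both cf cg k := Seq (copy 0 k k.+1) (Seq cf (Seq (mvo 0 k.+1 k.+2)
  (Seq (mvo k 0 k.+2) cg))).

Lemma runs_both cf cg Kf Kg fx gx bf bg k s x : maxn Kf Kg < k ->
  s 0 = code x -> (forall i, 0 < i < k.+3 -> s i = [::]) ->
  (forall s, s 0 = code x -> (forall i, 0 < i < Kf -> s i = [::]) ->
    runs cf s (upd s 0 (code fx)) bf) ->
  (forall s, s 0 = code x -> (forall i, 0 < i < Kg -> s i = [::]) ->
    runs cg s (upd s 0 (code gx)) bg) ->
  runs (both cf cg k) s (upd (upd s k.+1 (code fx)) 0 (code gx))
    (25 * treesz x + 6 + bf + bg + 12 * treesz fx).
Proof.
move=> hk h hs Hf Hg; apply: runs_le.
  apply: runs_ext.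
    apply: runs_seq; first by apply: runs_copy; rewrite ?hs //; lia.
    apply: runs_seq; first by apply: Hf => [|i hi]; upd_cases => //; apply: hs; lia.
    apply: (@runs_seq _ _ _ (upd (upd (upd s k (code x)) k.+1 (code fx)) 0 [::])).
      apply: runs_ext; first by apply: runs_mvo; upd_cases => //; rewrite ?hs //; lia.
      by store_eq; rewrite ?hs ?cats0 //; lia.
    apply: (@runs_seq _ _ _ (upd (upd s k.+1 (code fx)) 0 (code x))).
      apply: runs_ext; first by apply: runs_mvo; upd_cases => //; rewrite ?hs //; lia.
      by store_eq; rewrite ?hs ?cats0 //; lia.
    by apply: Hg => [|i hi]; upd_cases => //; apply: hs; lia.
  by store_eq.
rewrite /upd !eqxx /= h.
have -> : (k == k.+1) = false by lia.
have -> : (k == 0) = false by lia.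
by rewrite /= -/(treesz x) -/(treesz fx); lia.
Qed.

Lemma PTg_pair X (e f g : X -> tree) :
  PTg e f -> PTg e g -> PTg e (fun x => Node (f x) (g x)).
Proof.
move=> Pf Pg; have sf := PTg_size Pf.
case: Pf Pg => [cf [Kf [bf Hf]]] [cg [Kg [bg Hg]]].
pose k := (Kf + Kg).+1.
apply: (@PTg_intro _ _ _ (Seq (both cf cg k) (Seq (mvo k.+1 0 k.+2) (Push 0 true)))
  (k + 3) (fun x => 25 * treesz (e x) + 10 + (treesz (e x) + 2) ^ bf
    + (treesz (e x) + 2) ^ bg + 24 * treesz (f x))); first by pb.
move=> s x h hs; apply: runs_le.
  apply: runs_ext.
    apply: runs_seq.
      apply: (@runs_both cf cg Kf Kg (f x) (g x) ((treesz (e x) + 2) ^ bf)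
        ((treesz (e x) + 2) ^ bg) k s (e x)) => //; first by lia.
      - by move=> i hi; apply: hs; lia.
      - by move=> s1 *; exact: Hf.
      - by move=> s1 *; exact: Hg.
    apply: (@runs_seq _ _ _ (upd s 0 (code (f x) ++ code (g x)))).
      apply: runs_ext; first by apply: runs_mvo; upd_cases => //; rewrite ?hs //; lia.
      by store_eq; rewrite ?hs //; lia.
    exact: runs_push.
  by store_eq.
rewrite /upd !eqxx /= -/(treesz (f x)); lia.
Qed.

(** Each branch is assumed only on the inputs that reach it, because a match takes a value apart
    only where its constructor is known. *)
Lemma PTg_if X (e h f g : X -> tree) : PTg e h ->
  PTg (fun y : {x | h x = Leaf} => e (sval y)) (fun y => f (sval y)) ->
  PTg (fun y : {x | h x <> Leaf} => e (sval y)) (fun y => g (sval y)) ->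
  PTg e (fun x => if h x is Leaf then f x else g x).
Proof.
move=> Ph; have sh := PTg_size Ph.
case: Ph => [ch [Kh [dh Hh]]] [cf [Kf [df Hf]]] [cg [Kg [dg Hg]]].
pose k := (Kh + Kf + Kg).+1.
pose back := Seq (clear 0) (mvo k 0 k.+1).
pose p x d := (treesz (e x) + 2) ^ d.
apply: (@PTg_intro _ _ _
  (Seq (copy 0 k k.+1) (Seq ch (If 0 (Seq back cg) (Seq back cf) Skip))) (k + 2)
  (fun x => 25 * treesz (e x) + 10 + p x dh + (p x df + p x dg) + 3 * treesz (h x))).
  by rewrite /p; pb.
move=> s x ex hs.
have Hback s1 : s1 0 = code (h x) -> s1 k = s 0 -> s1 k.+1 = [::] ->
  runs back s1 (upd (upd s1 k [::]) 0 (s 0)) (3 * treesz (h x) + 1 + (12 * treesz (e x) + 2)).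
  move=> h0 hk hk1; apply: runs_le.
    apply: runs_ext.
      apply: runs_seq; first exact: runs_clear.
      by apply: runs_mvo; upd_cases => //; lia.
    by store_eq; rewrite ?cats0.
  by rewrite h0 /upd (_ : (k == 0) = false) ?hk ?ex //; lia.
have Hf' s1 : h x = Leaf -> s1 0 = code (e x) -> (forall i, 0 < i < Kf -> s1 i = [::]) ->
    runs cf s1 (upd s1 0 (code (f x))) (p x df).
  by move=> hx; exact: (Hf s1 (exist _ x hx)).
have Hg' s1 : h x <> Leaf -> s1 0 = code (e x) -> (forall i, 0 < i < Kg -> s1 i = [::]) ->
    runs cg s1 (upd s1 0 (code (g x))) (p x dg).
  by move=> hx; exact: (Hg s1 (exist _ x hx)).
apply: runs_le.
  apply: runs_ext.
    apply: runs_seq; first by apply: runs_copy; rewrite ?hs //; lia.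
    apply: runs_seq; first by apply: (Hh _ x) => [|i hi]; upd_cases => //; apply: hs; lia.
    apply: runs_if.
    instantiate (1 := p x df + p x dg + (3 * treesz (h x) + 1 + (12 * treesz (e x) + 2))).
    instantiate (1 := upd s 0 (code (if h x is Leaf then f x else g x))).
    rewrite {1}/upd /=; case: (h x) Hback Hf' Hg' => [|a b] Hback Hf' Hg' /=.
      apply: runs_le.
        apply: runs_ext.
          apply: runs_seq; first by apply: Hback; upd_cases => //; apply: hs; lia.
          apply: Hf' => [//||i hi]; upd_cases => //; apply: hs; lia.
        by store_eq; rewrite hs //; lia.
      lia.
    apply: runs_le.
      apply: runs_ext.
        apply: runs_seq; first by apply: Hback; upd_cases => //; apply: hs; lia.
        apply: Hg' => [//||i hi]; upd_cases => //; apply: hs; lia.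
      by store_eq; rewrite hs //; lia.
    lia.
  by [].
by rewrite ex -/(treesz (e x)) /p; lia.
Qed.

(* Moves the code of one tree from the front of register 0 to register 1
   (reversed); register 2 counts the subtrees still to be read. *)
Definition split_loop := While 2 (If 0
  (Seq (Pop 0) (Seq (Push 1 true) (Push 2 true)))
  (Seq (Pop 0) (Seq (Push 1 false) (Pop 2))) Skip).

(** The loop does not stop after a subtree, so the claim is put in continuation form: reading the
    code of [x] is a prefix of a longer run. An inner vertex replaces one pending subtree by two, a
    leaf removes one. *)
Lemma runs_split x s w v s' n : s 0 = code x ++ w -> s 2 = true :: v ->
  runs split_loop (upd (upd (upd s 0 w) 1 (catrev (code x) (s 1))) 2 v) s' n ->
  runs split_loop s s' (7 * treesz x + n).
Proof.
elim: x s w v n => [|a IHa b IHb] s w v n E0 E2 H.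
  apply: runs_le.
    apply: runs_whileS H; first by rewrite E2.
    apply: runs_if; rewrite E0 /=; apply: runs_ext.
      apply: runs_seq; first exact: runs_pop.
      by apply: runs_seq; [exact: runs_push | exact: runs_pop].
    by store_eq; rewrite /= ?E0 ?E2.
  by rewrite /treesz /=; lia.
rewrite treesz_node; apply: runs_le.
  apply: runs_whileS; first by rewrite E2.
    apply: runs_if; rewrite E0 /=.
    apply: runs_seq; first exact: runs_pop.
    by apply: runs_seq; exact: runs_push.
  apply: (IHa _ (code b ++ w) (true :: v)).
  - by rewrite /upd /= E0 /= catA.
  - by rewrite /upd /= E2.
  apply: (IHb _ w v) => //.
  move: H; congr runs; apply: functional_extensionality; store_eq => //.
  by rewrite /= !catrevE rev_cat catA.
lia.
Qed.

Definition split_first := Seq (Pop 0) (Seq (Push 2 true) split_loop).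

Lemma runs_split_first a b s : s 0 = code (Node a b) -> s 1 = [::] -> s 2 = [::] ->
  runs split_first s (upd (upd s 0 (code b)) 1 (rev (code a))) (7 * treesz a + 5).
Proof.
move=> E0 E1 E2; apply: runs_le.
  apply: runs_seq; first exact: runs_pop.
  apply: runs_seq; first exact: runs_push.
  apply: (@runs_split a _ (code b) [::]).
  - by rewrite /upd /= E0.
  - by rewrite /upd /= E2.
  apply: runs_ext; first by apply: runs_while0.
  by store_eq; rewrite /= ?E1 ?catrevE ?cats0.
lia.
Qed.

Definition tfst x := if x is Node a _ then a else Leaf.
Definition tsnd x := if x is Node _ b then b else Leaf.

Lemma PTg_fst_id : PTg id tfst.
Proof.
apply: (@PTg_intro _ _ _ (If 0 (Seq split_first (Seq (clear 0) (mv 1 0))) Skip Skip) 3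
  (fun x => 20 * treesz x + 20)); first by pb.
move=> s x e hs; case: x e => [|a b] e.
  apply: runs_le.
    apply: runs_ext; first by apply: runs_if; rewrite e /=; exact: runs_skip.
    by store_eq.
  by [].
apply: runs_le.
  apply: runs_ext.
    apply: runs_if; rewrite e /=.
    apply: runs_seq; first by apply: (runs_split_first e); apply: hs.
    by apply: runs_seq; [exact: runs_clear | apply: runs_mv].
  by store_eq => //=; rewrite ?catrevE ?revK ?cats0 ?hs.
by rewrite /upd /= size_rev treesz_node -!/(treesz _); lia.
Qed.

Lemma PTg_fst X (e f : X -> tree) : PTg e f -> PTg e (fun x => tfst (f x)).
Proof. by move=> H; apply: (PTg_comp H PTg_fst_id) => x; exists (f x). Qed.

Lemma PTg_snd_id : PTg id tsnd.
Proof.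
apply: (@PTg_intro _ _ _ (If 0 (Seq split_first (clear 1)) Skip Skip) 3
  (fun x => 20 * treesz x + 20)); first by pb.
move=> s x e hs; case: x e => [|a b] e.
  apply: runs_le.
    apply: runs_ext; first by apply: runs_if; rewrite e /=; exact: runs_skip.
    by store_eq.
  by [].
apply: runs_le.
  apply: runs_ext.
    apply: runs_if; rewrite e /=.
    apply: runs_seq; first by apply: (runs_split_first e); apply: hs.
    exact: runs_clear.
  by store_eq => //=; rewrite ?hs.
by rewrite /upd /= size_rev treesz_node -!/(treesz _); lia.
Qed.

Lemma PTg_snd X (e f : X -> tree) : PTg e f -> PTg e (fun x => tsnd (f x)).
Proof. by move=> H; apply: (PTg_comp H PTg_snd_id) => x; exists (f x). Qed.

Definition tbool (b : bool) := if b then Node Leaf Leaf else Leaf.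

Definition compare a b fl := While a (Seq (If a
  (If b (Pop b) (Seq (Pop b) (Push fl true)) (Push fl true))
  (If b (Seq (Pop b) (Push fl true)) (Pop b) (Push fl true)) Skip) (Pop a)).

(** Every mismatch leaves a mark on [fl], a longer [b] leaves a remainder. The exact leftovers do
    not matter: the stacks were equal when [fl] started empty and both end up empty. *)
Lemma runs_compare a b fl s : a <> b -> a <> fl -> b <> fl ->
  exists v f, [/\ runs (compare a b fl) s (upd (upd (upd s a [::]) b v) fl f)
      (9 * size (s a) + 1), size v <= size (s b), size f <= size (s fl) + size (s a) &
    (f == [::]) && (v == [::]) = (s fl == [::]) && (s a == s b)].
Proof.
move=> ab af bf; move E: (s a) => u; elim: u s E => [|x u IH] s E.
  exists (s b), (s fl); split=> //; rewrite ?addn0 // 1?[s b == _]eq_sym //.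
  by apply: runs_ext; [exact: runs_while0 | store_eq].
pose v1 := behead (s b).
pose f1 := if s b is y :: _ then if x == y then s fl else true :: s fl else true :: s fl.
pose s1 := upd (upd (upd s b v1) fl f1) a u.
have [|v [f [H h1 h2 h3]]] := IH s1; first by rewrite /s1 /upd eqxx.
exists v, f; split.
- apply: runs_le.
    apply: runs_ext.
      apply: runs_whileS H; first by rewrite E.
      instantiate (1 := 7); rewrite -(addn1 6); apply: (@runs_seq _ _ _ (upd (upd s b v1) fl f1)).
        apply: runs_if; rewrite E /= /v1 /f1.
        case: x {E h1 h2 h3 s1 f1 v1} => /=; apply: runs_if; case Eb: (s b) => [|[] w] /=;
        try (apply: (@runs_le _ _ _ 1); [|by []]; apply: runs_ext; [exact: runs_push |
          by store_eq; rewrite ?Eb]);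
        try (apply: (@runs_le _ _ _ 1); [|by []]; apply: runs_ext; [exact: runs_pop |
          by store_eq; rewrite ?Eb]);
        try (apply: (@runs_le _ _ _ 2); [|by []]; apply: runs_ext; [
          apply: (@runs_seq _ _ _ _ _ 1 1); [exact: runs_pop | exact: runs_push] |
          by store_eq; rewrite ?Eb]).
      by apply: runs_ext; [exact: runs_pop | rewrite /s1; store_eq; rewrite E].
    by rewrite /s1; store_eq.
  by rewrite /=; lia.
- move: h1; rewrite /s1 /upd; case: eqP => [/esym//|_]; case: eqP => // _; rewrite eqxx /v1 size_behead; lia.
- move: h2; rewrite /s1 /upd; case: eqP => [/esym//|_]; rewrite eqxx /f1; case: (s b) => [|y w] /=; first lia.
  by case: eqP => _ /=; lia.
- have e1 : s1 fl = f1 by rewrite /s1; upd_cases.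
  have e2 : s1 b = v1 by rewrite /s1; upd_cases.
  rewrite h3 e1 e2 /f1 /v1; case: (s b) => [|y w] /=; first by rewrite andbF.
  by rewrite eqseq_cons; case: (x == y) => //=; rewrite andbF.
Qed.

Fixpoint tree_eqb x y :=
  match x, y with
  | Leaf, Leaf => true
  | Node a b, Node c d => tree_eqb a c && tree_eqb b d
  | _, _ => false
  end.

Lemma tree_eqP : Equality.axiom tree_eqb.
Proof.
elim=> [|a IHa b IHb] [|c d] /=; try by constructor.
by apply: (iffP andP) => [[/IHa -> /IHb ->]|[<- <-]] //; split; [apply/IHa|apply/IHb].
Qed.
HB.instance Definition _ := hasDecEq.Build tree tree_eqP.

Lemma PTg_eqb X (e f g : X -> tree) :
  PTg e f -> PTg e g -> PTg e (fun x => tbool (f x == g x)).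
Proof.
move=> Pf Pg; have sf := PTg_size Pf; have sg := PTg_size Pg.
case: Pf Pg => [cf [Kf [bf Hf]]] [cg [Kg [bg Hg]]].
pose k := (Kf + Kg).+1.
pose fin r1 := Seq (clear k.+2) (push_all 0 (code (tbool r1))).
apply: (@PTg_intro _ _ _ (Seq (both cf cg k) (Seq (compare 0 k.+1 k.+2)
    (Seq (If k.+1 (Seq (clear k.+1) (Push k.+2 true)) (Seq (clear k.+1) (Push k.+2 true)) Skip)
      (If k.+2 (fin false) (fin false) (fin true))))) (k + 3)
  (fun x => 25 * treesz (e x) + 30 + (treesz (e x) + 2) ^ bf + (treesz (e x) + 2) ^ bg
    + 24 * treesz (f x) + 20 * treesz (g x))); first by pb.
move=> s x h hs.
have hk1 : s k.+1 = [::] by apply: hs; lia.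
have hk2 : s k.+2 = [::] by apply: hs; lia.
have hk : s k = [::] by apply: hs; lia.
pose s5 := upd (upd s k.+1 (code (f x))) 0 (code (g x)).
have [||| v [fl [H5 h1 h2 h3]]] := @runs_compare 0 k.+1 k.+2 s5; try lia.
have S0 : s5 0 = code (g x) by [].
have S1 : s5 k.+1 = code (f x) by rewrite /s5; upd_cases.
have S2 : s5 k.+2 = [::] by rewrite /s5; upd_cases.
rewrite S0 S1 S2 /= in H5 h1 h2 h3.
have E3 : (fl == [::]) && (v == [::]) = (f x == g x).
  rewrite h3; apply/eqP/eqP => [E|-> //].
  by have [] := @code_inj (g x) (f x) [::] [::]; rewrite ?cats0.
pose s6 := upd (upd (upd s5 0 [::]) k.+1 [::]) k.+2 (if v is [::] then fl else true :: fl).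
apply: runs_le.
  apply: runs_ext.
    apply: runs_seq.
      apply: (@runs_both cf cg Kf Kg (f x) (g x) ((treesz (e x) + 2) ^ bf)
        ((treesz (e x) + 2) ^ bg) k s (e x)) => //; first by lia.
      - by move=> i hi; apply: hs; lia.
      - by move=> s1 *; exact: Hf.
      - by move=> s1 *; exact: Hg.
    apply: runs_seq; first exact: H5.
    apply: (@runs_seq _ _ _ s6).
      apply: runs_if; instantiate (1 := 3 * size v + 2).
      have Ev : upd (upd (upd s5 0 [::]) k.+1 v) k.+2 fl k.+1 = v by upd_cases.
      rewrite Ev.
      have Hc : v <> [::] -> runs (Seq (clear k.+1) (Push k.+2 true))
          (upd (upd (upd s5 0 [::]) k.+1 v) k.+2 fl) s6 (3 * size v + 2).
        move=> nv; apply: runs_le.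
          apply: runs_ext; first by apply: runs_seq; [exact: runs_clear | exact: runs_push].
          by rewrite /s6; store_eq; case: v {H5 h1 h2 h3 E3 s6 Ev} nv.
        by rewrite Ev; lia.
      have [vn|vn] := eqVneq v [::]; last first.
        by case: (v) (vn) (Hc (elimN eqP vn)) => [|[] v'].
      rewrite vn /=; apply: runs_le; [apply: runs_ext; first exact: runs_skip | by []].
      by rewrite /s6 vn.
    apply: runs_if; instantiate (1 := 3 * (size fl).+1 + 4).
    instantiate (1 := upd s 0 (code (tbool (f x == g x)))).
    have F b : runs (fin b) s6 (upd s 0 (code (tbool b))) (3 * (size fl).+1 + 4).
      apply: runs_le.
        apply: runs_ext; first by apply: runs_seq; [exact: runs_clear | exact: runs_push_all].
        by rewrite /s6 /s5; store_eq; rewrite ?cats0.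
      rewrite /s6 {1}/upd eqxx; case: (v) => [|? ?] /=; case: b => /=; lia.
    have -> : s6 k.+2 = if v is [::] then fl else true :: fl by rewrite /s6 /upd eqxx.
    rewrite -E3; case: (v) => [|y v'] /=; last by rewrite andbF.
    by rewrite andbT; case: (fl) F => [|[] fl'] F.
  by [].
have B1 : size v <= treesz (f x) by exact: h1.
have B2 : size fl <= treesz (g x) by exact: h2.
by rewrite -!/(treesz _); lia.
Qed.

(** A copy of the code of the initial state is the clock: one round per bit. The bound [q], uniform
    in the number of rounds, prevents the growth that iterating a polynomial-time step could
    cause. *)
Lemma PTg_iter X S (e : X -> tree) (e' : S -> tree) (f : S -> S) (h : X -> S) q :
  PTg e' (fun s => e' (f s)) -> PTg e (fun x => e' (h x)) ->
  PB (fun x => treesz (e x)) q ->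
  (forall x j, treesz (e' (iter j f (h x))) <= q x) ->
  PTg e (fun x => e' (iter (treesz (e' (h x))) f (h x))).
Proof.
move=> [cf [Kf [d Hf]]] Ph pq Hq.
have sh := PTg_size Ph; case: Ph => [ch [Kh [bh Hh]]].
pose k := (Kf + Kh).+1.
apply: (@PTg_intro _ _ _ (Seq ch (Seq (copy 0 k k.+1) (While k (Seq (Pop k) cf)))) (k + 2)
 (fun x => (treesz (e x) + 2) ^ bh + (13 * treesz (e' (h x)) + 3 +
    treesz (e' (h x)) * ((q x + 2) ^ d + 3)))); first by pb.
move=> s x ex hs; set y := h x.
have L u : forall j s1, size u + j = treesz (e' y) -> s1 0 = code (e' (iter j f y)) -> s1 k = u ->
    (forall i, 0 < i < k -> s1 i = [::]) ->
    runs (While k (Seq (Pop k) cf)) s1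
      (upd (upd s1 k [::]) 0 (code (e' (iter (treesz (e' y)) f y))))
      (size u * ((q x + 2) ^ d + 3) + 1).
  elim: u => [|b u IH] j s1 hj h0 hk hi.
    apply: runs_ext; first exact: runs_while0.
    by store_eq; rewrite h0 -hj.
  apply: runs_le.
    apply: runs_ext.
      apply: runs_whileS; first by rewrite hk.
        apply: runs_seq; first exact: runs_pop.
        by apply: (Hf _ (iter j f y)) => [|i hi']; upd_cases => //; apply: hi; lia.
      apply: (IH j.+1); first by rewrite /= in hj; lia.
      - by [].
      - by upd_cases; rewrite hk.
      - by move=> i hi'; upd_cases; apply: hi; lia.
    by store_eq.
  have hb : (treesz (e' (iter j f y)) + 2) ^ d <= (q x + 2) ^ d.
    case: (posnP d) => [->|d0]; first by rewrite !expn0.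
    by rewrite leq_exp2r // leq_add2r Hq.
  by rewrite [size (_ :: _)]/= mulSn; lia.
apply: runs_le.
  apply: runs_seq; first by apply: (Hh _ x) => // i hi; apply: hs; lia.
  apply: runs_ext.
    apply: runs_seq; first by apply: runs_copy; upd_cases => //; rewrite ?hs //; lia.
    apply: (L (code (e' y)) 0); rewrite ?addn0 //.
      by upd_cases.
    by move=> i hi; upd_cases; apply: hs; lia.
  by store_eq; rewrite hs //; lia.
by rewrite /upd eqxx -/(treesz (e' y)); lia.
Qed.

(** * Translation between bit strings and trees *)

Fixpoint tbits (w : seq bool) :=
  if w is b :: w' then Node (tbool b) (tbits w') else Leaf.

(** The tree of the list is built from its end: a cell with bit true starts with the code 1100, one
    with bit false with 10. *)
Definition load := Seq (mv 0 1) (Seq (Push 0 false)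
  (While 1 (If 1 (Seq (Pop 1) (push_all 0 [:: true; true; false; false]))
                 (Seq (Pop 1) (push_all 0 [:: true; false])) Skip))).

Lemma runs_load w : runs load (upd (fun=> [::]) 0 w)
  (upd (fun=> [::]) 0 (code (tbits w))) (20 * size w + 10).
Proof.
pose W := While 1 (If 1 (Seq (Pop 1) (push_all 0 [:: true; true; false; false]))
                 (Seq (Pop 1) (push_all 0 [:: true; false])) Skip).
have L u v s : s 1 = u -> s 0 = code (tbits v) ->
    runs W s (upd (upd s 1 [::]) 0 (code (tbits (catrev u v)))) (9 * size u + 1).
  elim: u v s => [|b u IH] v s h1 h0.
    by apply: runs_ext; [exact: runs_while0 | store_eq].
  apply: runs_le.
    apply: runs_ext.
      apply: runs_whileS; first by rewrite h1.
        apply: runs_if; rewrite h1 /=.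
        instantiate (2 := upd (upd s 1 u) 0 (code (tbits (b :: v)))).
        instantiate (1 := 5); case: b {h1} (h1) => h1; apply: runs_le.
        - apply: runs_ext.
            by apply: runs_seq; [exact: runs_pop | exact: (runs_push_all 0 [:: _; _; _; _])].
          by store_eq; rewrite /= ?h0 ?h1.
        - by [].
        - apply: runs_ext.
            by apply: runs_seq; [exact: runs_pop | exact: (runs_push_all 0 [:: _; _])].
          by store_eq; rewrite /= ?h0 ?h1.
        by [].
      by apply: (IH (b :: v)).
    by store_eq.
  by rewrite /=; lia.
apply: runs_le.
  apply: runs_ext.
    apply: runs_seq; first by apply: runs_mv.
    apply: runs_seq; first exact: runs_push.
    by apply: (L (rev w) [::]); rewrite /upd /= ?catrevE ?cats0.
  by store_eq; rewrite catrevE cats0 revK.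
by rewrite /upd /= size_rev; lia.
Qed.

Definition unload := Seq (While 0 (If 0
  (Seq (Pop 0) (If 0 (Seq (Pop 0) (Seq (Pop 0) (Seq (Pop 0) (Push 1 true))))
                     (Seq (Pop 0) (Push 1 false)) Skip)) (Pop 0) Skip)) (mv 1 0).

Lemma runs_unload w : runs unload (upd (fun=> [::]) 0 (code (tbits w)))
  (upd (fun=> [::]) 0 w) (30 * size w + 10).
Proof.
pose W := While 0 (If 0
  (Seq (Pop 0) (If 0 (Seq (Pop 0) (Seq (Pop 0) (Seq (Pop 0) (Push 1 true))))
                     (Seq (Pop 0) (Push 1 false)) Skip)) (Pop 0) Skip).
have L u s : s 0 = code (tbits u) ->
    runs W s (upd (upd s 0 [::]) 1 (catrev u (s 1))) (12 * size u + 6).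
  elim: u s => [|b u IH] s h0.
    apply: runs_le.
      apply: runs_ext.
        apply: runs_whileS; first by rewrite h0.
          by apply: runs_if; rewrite h0 /=; exact: runs_pop.
        by apply: runs_while0; rewrite /upd /= h0.
      by store_eq; rewrite /= ?h0.
    by [].
  apply: runs_le.
    apply: runs_ext.
      apply: runs_whileS; first by rewrite h0.
        apply: runs_if; rewrite h0 /=.
        instantiate (2 := upd (upd s 0 (code (tbits u))) 1 (b :: s 1)).
        instantiate (1 := 7); apply: (@runs_seq _ _ _ _ _ 1 6); first exact: runs_pop.
        apply: runs_if; rewrite /upd /= h0 /=.
        case: b {h0} (h0) => h0 /=; last first.
          apply: (@runs_le _ _ _ 2) => //; apply: runs_ext.
            by apply: (@runs_seq _ _ _ _ _ 1 1); [exact: runs_pop | exact: runs_push].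
          by store_eq; rewrite /= ?h0.
        apply: runs_ext.
          apply: (@runs_seq _ _ _ _ _ 1 3); first exact: runs_pop.
          apply: (@runs_seq _ _ _ _ _ 1 2); first exact: runs_pop.
          by apply: (@runs_seq _ _ _ _ _ 1 1); [exact: runs_pop | exact: runs_push].
        by store_eq; rewrite /= ?h0.
      by apply: IH.
    by store_eq.
  by rewrite /=; lia.
apply: runs_le.
  apply: runs_ext.
    by apply: runs_seq; [exact: (L w) | apply: runs_mv].
  by store_eq; rewrite !catrevE ?cats0 ?revK.
by rewrite /upd /= catrevE size_cat size_rev /=; lia.
Qed.

Lemma treesz_tbits w : treesz (tbits w) <= 4 * size w + 1.
Proof. by elim: w => //= b w; rewrite treesz_node; case: b; rewrite /treesz /=; lia. Qed.

Lemma polytime_of_PTg (f : seq bool -> seq bool) :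
  PTg tbits (fun w => tbits (f w)) -> polytime f.
Proof.
move=> PF; have := PTg_size PF; case: PF => c [K [b H]] sF.
have sb : PB size (fun w => treesz (tbits w)).
  by apply: PB_le; [| exact: treesz_tbits]; pb.
have sf w : size (f w) <= treesz (tbits (f w)).
  by elim: (f w) => //= x u; rewrite treesz_node; lia.
have sF' : PB size (fun w => treesz (tbits (f w))).
  case: sF => d Hd; apply: PB_le Hd; pb.
have [d Hd] : PB size (fun w => 20 * size w + 10 + ((treesz (tbits w) + 2) ^ b +
    (30 * treesz (tbits (f w)) + 10))) by pb.
apply: (@polytime_of_cmd (Seq load (Seq c unload)) f d) => w.
have [t ht e] : runs (Seq load (Seq c unload)) (upd (fun=> [::]) 0 w)
   (upd (fun=> [::]) 0 (f w)) (20 * size w + 10 + ((treesz (tbits w) + 2) ^ b + (30 * size (f w) + 10))).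
  apply: runs_seq; first exact: runs_load.
  apply: runs_seq; first by apply: (H _ w) => // i; case: i.
  have := runs_unload (f w); congr runs.
  by apply: functional_extensionality; store_eq.
exists (upd (fun=> [::]) 0 (f w)), t; split=> //.
apply: leq_trans ht _; apply: leq_trans (Hd w).
by rewrite !leq_add // leq_mul.
Qed.

(** * Polynomial-time functions on encoded data *)

(** Injectivity allows equality to be decided by comparing codes. *)
Class Enc (A : Type) := { enc : A -> tree; enc_inj : injective enc }.

Definition sz {A} {EA : Enc A} (x : A) := treesz (enc x).

Lemma tbool_inj : injective tbool.
Proof. by do 2 case. Qed.
#[export] Instance Enc_bool : Enc bool := {| enc_inj := tbool_inj |}.

Lemma unit_enc_inj : injective (fun _ : unit => Leaf).
Proof. by do 2 case. Qed.
#[export] Instance Enc_unit : Enc unit := {| enc_inj := unit_enc_inj |}.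

Definition prod_enc A B (EA : Enc A) (EB : Enc B) (p : A * B) :=
  Node (enc p.1) (enc p.2).
Lemma prod_enc_inj A B (EA : Enc A) (EB : Enc B) : injective (prod_enc EA EB).
Proof. by move=> [a b] [c d] [h1 h2]; rewrite (enc_inj h1) (enc_inj h2). Qed.
#[export] Instance Enc_prod A B (EA : Enc A) (EB : Enc B) : Enc (A * B) :=
  {| enc_inj := @prod_enc_inj A B EA EB |}.

Fixpoint seq_enc A (EA : Enc A) (l : seq A) :=
  if l is a :: l' then Node (enc a) (seq_enc EA l') else Leaf.
Lemma seq_enc_inj A (EA : Enc A) : injective (seq_enc EA).
Proof. by elim=> [|a l IH] [|b m] //= [h1 h2]; rewrite (enc_inj h1) (IH _ h2). Qed.
#[export] Instance Enc_seq A (EA : Enc A) : Enc (seq A) := {| enc_inj := @seq_enc_inj A EA |}.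

Definition option_enc A (EA : Enc A) (o : option A) :=
  if o is Some a then Node (enc a) Leaf else Leaf.
Lemma option_enc_inj A (EA : Enc A) : injective (option_enc EA).
Proof. by move=> [a|] [b|] //= [h]; rewrite (enc_inj h). Qed.
#[export] Instance Enc_option A (EA : Enc A) : Enc (option A) :=
  {| enc_inj := @option_enc_inj A EA |}.

Definition PT {A B} {EA : Enc A} {EB : Enc B} (f : A -> B) :=
  PTg (@enc A EA) (fun x => enc (f x)).

Lemma PT_polytime (f : seq bool -> seq bool) : PT f -> polytime f.
Proof.
have E : @enc (seq bool) _ = tbits.
  by apply: functional_extensionality; elim=> //= b w ->.
by move=> H; apply: polytime_of_PTg; move: H; rewrite /PT E.
Qed.

Section Combinators.
Context {A B C D : Type} {EA : Enc A} {EB : Enc B} {EC : Enc C} {ED : Enc D}.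

Lemma PT_ext (f g : A -> B) : PT f -> f =1 g -> PT g.
Proof. by move=> H e; apply: PTg_ext H _ => x; rewrite e. Qed.

Lemma PT_id : PT (fun x : A => x).
Proof. exact: PTg_id. Qed.

Lemma PT_const (b : B) : PT (fun _ : A => b).
Proof. exact: PTg_const. Qed.

Lemma PT_comp (f : B -> C) (g : A -> B) : PT f -> PT g -> PT (fun x => f (g x)).
Proof. by move=> Pf Pg; apply: (PTg_comp Pg Pf) => x; exists (g x). Qed.

Lemma PT_pair (f : A -> B) (g : A -> C) : PT f -> PT g -> PT (fun x => (f x, g x)).
Proof. exact: PTg_pair. Qed.

Lemma PT_fst (f : A -> B * C) : PT f -> PT (fun x => (f x).1).
Proof. exact: PTg_fst. Qed.

Lemma PT_snd (f : A -> B * C) : PT f -> PT (fun x => (f x).2).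
Proof. exact: PTg_snd. Qed.

Lemma PTg_sub (X : Type) (P : X -> Prop) (e f : X -> tree) :
  PTg e f -> PTg (fun y : {x | P x} => e (sval y)) (fun y => f (sval y)).
Proof. by move=> H; apply: (PTg_comp (PTg_id _) H) => y; exists (sval y). Qed.

Lemma PT_if (b : A -> bool) (f g : A -> B) : PT b -> PT f -> PT g ->
  PT (fun x => if b x then f x else g x).
Proof.
move=> Pb Pf Pg; apply: PTg_ext.
  by apply: (PTg_if Pb); apply: PTg_sub; [exact: Pg | exact: Pf].
by move=> x /=; case: (b x).
Qed.

Lemma PT_cons (f : A -> B) (g : A -> seq B) : PT f -> PT g -> PT (fun x => f x :: g x).
Proof. exact: PTg_pair. Qed.

Lemma PT_Some (f : A -> B) : PT f -> PT (fun x => Some (f x)).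
Proof. by move=> Pf; apply: PTg_pair => //; exact: PTg_const. Qed.

(** The empty list is coded by [Leaf], so the match is the test of [PTg_if]; in the other branch
    head and tail are the two subtrees of the code. *)
Lemma PT_case (l : A -> seq B) (f : A -> C) (g : A -> B -> seq B -> C) :
  PT l -> PT f -> PT (fun p : A * B * seq B => g p.1.1 p.1.2 p.2) ->
  PT (fun x => if l x is b :: l' then g x b l' else f x).
Proof.
move=> Pl Pf Pg; apply: (@PTg_ext _ _ (fun x => if enc (l x) is Leaf then enc (f x)
  else enc (if l x is b :: l' then g x b l' else f x))); last first.
  by move=> x; case: (l x).
apply: (PTg_if Pl); first exact: (PTg_sub (fun x => enc (l x) = Leaf) Pf).
apply: (PTg_comp (g := fun y : {x : A | enc (l x) <> Leaf} => Node
   (Node (enc (sval y)) (tfst (enc (l (sval y))))) (tsnd (enc (l (sval y))))) _ Pg).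
  have Pl' := PTg_sub (fun x => enc (l x) <> Leaf) Pl.
  by apply: PTg_pair; [apply: PTg_pair; [exact: PTg_id | exact: PTg_fst] | exact: PTg_snd].
by case=> x /=; case: (l x) => [//|b m] _; exists (x, b, m).
Qed.

Lemma PT_omatch (o : A -> option B) (f : A -> C) (g : A -> B -> C) :
  PT o -> PT f -> PT (fun p : A * B => g p.1 p.2) ->
  PT (fun x => if o x is Some b then g x b else f x).
Proof.
move=> Pl Pf Pg; apply: (@PTg_ext _ _ (fun x => if enc (o x) is Leaf then enc (f x)
  else enc (if o x is Some b then g x b else f x))); last first.
  by move=> x; case: (o x).
apply: (PTg_if Pl); first exact: (PTg_sub (fun x => enc (o x) = Leaf) Pf).
apply: (PTg_comp (g := fun y : {x : A | enc (o x) <> Leaf} => Node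
   (enc (sval y)) (tfst (enc (o (sval y))))) _ Pg).
  have Pl' := PTg_sub (fun x => enc (o x) <> Leaf) Pl.
  by apply: PTg_pair; [exact: PTg_id | exact: PTg_fst].
by case=> x /=; case: (o x) => [b|//] _; exists (x, b).
Qed.

Lemma PT_PB (f : A -> B) : PT f -> PB sz (fun x => sz (f x)).
Proof. exact: PTg_size. Qed.

Lemma sz_pair (a : A) (b : B) : sz (a, b) = (sz a + sz b).+1.
Proof. exact: treesz_node. Qed.

Lemma sz_cons (a : A) l : sz (a :: l) = (sz a + sz l).+1.
Proof. exact: treesz_node. Qed.

Lemma sz_nil : sz ([::] : seq A) = 1.
Proof. by []. Qed.

Lemma sz_gt0 (a : A) : 0 < sz a.
Proof. exact: treesz_gt0. Qed.

Lemma size_sz (l : seq A) : size l <= sz l.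
Proof. by elim: l => // a l IH; rewrite sz_cons /=; lia. Qed.

Lemma sz_cat (l m : seq A) : (sz (l ++ m)).+1 = sz l + sz m.
Proof. by elim: l => [|a l IH] //=; rewrite !sz_cons; lia. Qed.

Lemma sz_rev (l : seq A) : sz (rev l) = sz l.
Proof.
elim: l => [|a l IH] //; have := sz_cat (rev l) [:: a].
by rewrite rev_cons -cats1 IH !sz_cons sz_nil; lia.
Qed.

Lemma sz_drop m (u : seq A) : sz (drop m u) <= sz u.
Proof. by elim: u m => [|a u IH] [|m] //; rewrite drop_cons sz_cons; have := IH m; lia. Qed.

Lemma sz_take m (u : seq A) : sz (take m u) <= sz u.
Proof.
elim: u m => [|a u IH] [|m] //; rewrite take_cons ?sz_cons ?sz_nil //.
by have := IH m; lia.
Qed.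

Lemma PT_iter (f : B -> B) (h : A -> B) q : PT f -> PT h -> PB sz q ->
  (forall x j, sz (iter j f (h x)) <= q x) ->
  PT (fun x => iter (sz (h x)) f (h x)).
Proof. exact: PTg_iter. Qed.

End Combinators.

Lemma sz_mem (A : eqType) {EA : Enc A} (a : A) (l : seq A) : a \in l -> sz a < sz l.
Proof. by elim: l => // b l IH; rewrite inE sz_cons => /predU1P[->|/IH]; lia. Qed.

Lemma PT_eq (A : Type) (B : eqType) (EA : Enc A) (EB : Enc B) (f g : A -> B) :
  PT f -> PT g -> PT (fun x => f x == g x).
Proof.
move=> Pf Pg; apply: PTg_ext (PTg_eqb Pf Pg) _ => x /=.
by rewrite (inj_eq enc_inj).
Qed.

Lemma PT_andb A (EA : Enc A) (f g : A -> bool) : PT f -> PT g -> PT (fun x => f x && g x).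
Proof. by move=> Pf Pg; apply: (PT_if Pf Pg); exact: PT_const. Qed.

Lemma PT_orb A (EA : Enc A) (f g : A -> bool) : PT f -> PT g -> PT (fun x => f x || g x).
Proof. by move=> Pf Pg; apply: (PT_if Pf _ Pg); exact: PT_const. Qed.

Lemma PT_negb A (EA : Enc A) (f : A -> bool) : PT f -> PT (fun x => ~~ f x).
Proof. by move=> Pf; apply: (PT_if Pf); exact: PT_const. Qed.

(** A hook, redefined whenever new closure lemmas become available. *)
Ltac pt_user := fail.

Ltac pt_step := match goal with
  | H : PT ?f |- PT ?f => exact H
  | |- PT (fun x => x) => apply: PT_id
  | |- PT fst => apply: (PT_fst PT_id)
  | |- PT snd => apply: (PT_snd PT_id)
  | |- PT (fun _ => ?c) => apply: PT_const
  | |- PT (fun x => (@?f x).1) => apply: PT_fst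
  | |- PT (fun x => (@?f x).2) => apply: PT_snd
  | |- PT (fun x => (@?f x, @?g x)) => apply: PT_pair
  | |- PT (fun x => @?f x :: @?g x) => apply: PT_cons
  | |- PT (fun x => Some (@?f x)) => apply: PT_Some
  | |- PT (fun x => @?f x == @?g x) => apply: PT_eq
  | |- PT (fun x => @?f x && @?g x) => apply: PT_andb
  | |- PT (fun x => @?f x || @?g x) => apply: PT_orb
  | |- PT (fun x => ~~ @?f x) => apply: PT_negb
  | |- PT (fun x => if @?f x then _ else _) => apply: PT_if
  | |- PT (fun x => match @?f x with [::] => _ | _ :: _ => _ end) => apply: PT_case
  | |- PT (fun x => match @?f x with Some _ => _ | None => _ end) => apply: PT_omatch
  | |- PT _ => pt_user
  end; cbv beta.
Ltac pt := repeat pt_step.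

(** * Folds and list functions *)

Section Fold.
Context {X A B : Type} {EX : Enc X} {EA : Enc A} {EB : Enc B}.

(** Once the list is used up the state is fixed, so the surplus rounds of [PT_iter] are harmless. *)
Definition fold_step (g : X -> B -> A -> B) (s : X * (seq A * B)) :=
  if s.2.1 is a :: l then (s.1, (l, g s.1 s.2.2 a)) else s.

Lemma iter_fold_step g n x l b : iter n (fold_step g) (x, (l, b)) =
  (x, (drop n l, foldl (g x) b (take n l))).
Proof.
elim: n l b => [|n IH] l b; first by rewrite drop0 take0.
by rewrite iterSr; case: l => [|a l] /=; rewrite IH.
Qed.

Lemma PT_comp3 (C D : Type) (EC : Enc C) (ED : Enc D) (g : X -> B -> A -> C)
    (f1 : D -> X) (f2 : D -> B) (f3 : D -> A) :
  PT (fun p : X * B * A => g p.1.1 p.1.2 p.2) ->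
  PT f1 -> PT f2 -> PT f3 -> PT (fun x => g (f1 x) (f2 x) (f3 x)).
Proof.
move=> Pg P1 P2 P3; apply: (PT_comp Pg (g := fun x => (f1 x, f2 x, f3 x))); pt.
Qed.

(** The main source of algorithms. The accumulator has to be bounded after every prefix of the list,
    not only at the end. *)
Lemma PT_foldl (g : X -> B -> A -> B) (h : X -> B) (l : X -> seq A) q :
  PT (fun p : X * B * A => g p.1.1 p.1.2 p.2) -> PT h -> PT l -> PB sz q ->
  (forall x n, sz (foldl (g x) (h x) (take n (l x))) <= q x) ->
  PT (fun x => foldl (g x) (h x) (l x)).
Proof.
move=> Pg Ph Pl Pq Hq; have sl := PT_PB Pl.
have PS : PT (fold_step g).
  rewrite /fold_step; pt; apply: (PT_comp3 Pg); pt.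
have PH : PT (fun x => (x, (l x, h x))) by pt.
have Pi : PT (fun x => iter (sz (x, (l x, h x))) (fold_step g) (x, (l x, h x))).
  apply: (PT_iter (q := fun x => sz x + (sz (l x) + q x) + 2)) => //; first by pb.
  move=> x j; rewrite iter_fold_step !sz_pair.
  by pose proof (sz_drop j (l x)); pose proof (Hq x j); lia.
apply: PT_ext (PT_snd (PT_snd Pi)) _ => x.
rewrite iter_fold_step /= take_oversize //.
by rewrite !sz_pair; pose proof (size_sz (l x)); lia.
Qed.

End Fold.

Lemma PT_comp2 (X A C D : Type) (EX : Enc X) (EA : Enc A) (EC : Enc C) (ED : Enc D)
  (g : X -> A -> C) (f1 : D -> X) (f2 : D -> A) :
  PT (fun p : X * A => g p.1 p.2) ->
  PT f1 -> PT f2 -> PT (fun x => g (f1 x) (f2 x)).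
Proof.
move=> Pg P1 P2; apply: (PT_comp Pg (g := fun x => (f1 x, f2 x))); pt.
Qed.

Lemma foldl_consE (C D : Type) (f : D -> C) (l : seq D) m :
  foldl (fun acc a => f a :: acc) m l = catrev (map f l) m.
Proof. by elim: l m => //= a l IH m; rewrite IH. Qed.

Lemma PT_catrev {X A} {EX : Enc X} {EA : Enc A} (l m : X -> seq A) : PT l -> PT m -> PT (fun x => catrev (l x) (m x)).
Proof.
move=> Pl Pm; have sl := PT_PB Pl; have sm := PT_PB Pm.
apply: (@PT_ext _ _ _ _ (fun x => foldl (fun acc a => a :: acc) (m x) (l x))); last first.
  by move=> x; rewrite (foldl_consE id) map_id.
apply: (PT_foldl (q := fun x => sz (l x) + sz (m x))); try pt; first by pb.
move=> x n; rewrite (foldl_consE id) map_id catrevE.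
by pose proof (sz_cat (rev (take n (l x))) (m x)) as H; pose proof (sz_take n (l x)); rewrite sz_rev in H; lia.
Qed.

Lemma PT_rev {X A} {EX : Enc X} {EA : Enc A} (l : X -> seq A) : PT l -> PT (fun x => rev (l x)).
Proof. by move=> Pl; apply: PT_catrev => //; pt. Qed.

Lemma PT_cat {X A} {EX : Enc X} {EA : Enc A} (l m : X -> seq A) : PT l -> PT m -> PT (fun x => l x ++ m x).
Proof.
move=> Pl Pm; apply: (@PT_ext _ _ _ _ (fun x => catrev (rev (l x)) (m x))).
  by apply: PT_catrev => //; exact: PT_rev.
by move=> x; rewrite catrevE revK.
Qed.

Lemma sz_map_le {A B} {EA : Enc A} {EB : Enc B} (f : A -> B) l c N : sz l <= N ->
  (forall a, sz a <= N -> sz (f a) < c) -> sz (map f l) <= size l * c + 1.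
Proof.
move=> hN H; elim: l hN => [|a l IH] //; rewrite /= !sz_cons => h.
have h1 : sz l <= N by lia.
by have := IH h1; have := H a; nia.
Qed.

Lemma PT_map {X A B} {EX : Enc X} {EA : Enc A} {EB : Enc B} (f : X -> A -> B) (l : X -> seq A) :
  PT (fun p : X * A => f p.1 p.2) -> PT l -> PT (fun x => map (f x) (l x)).
Proof.
move=> Pf Pl; have sl := PT_PB Pl; have [d Hd] := PT_PB Pf.
apply: (@PT_ext _ _ _ _ (fun x => rev (foldl (fun acc a => f x a :: acc) [::] (l x)))); last first.
  by move=> x; rewrite foldl_consE catrevE cats0 revK.
apply: PT_rev.
apply: (PT_foldl (q := fun x => sz (l x) * ((sz x + sz (l x) + 1 + 2) ^ d + 1) + 1)); try pt.
- by apply: (PT_comp2 Pf); pt.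
- by pb.
move=> x n; rewrite foldl_consE catrevE cats0 sz_rev.
pose proof (sz_take n (l x)) as h.
apply: (@leq_trans (size (take n (l x)) * ((sz x + sz (l x) + 1 + 2) ^ d + 1) + 1)); last first.
  by pose proof (size_sz (take n (l x))) as h'; rewrite leq_add2r leq_mul2r (leq_trans h' h) orbT.
apply: (sz_map_le h) => a ha; have := Hd (x, a); rewrite sz_pair /=.
have : ((sz x + sz a).+1 + 2) ^ d <= (sz x + sz (l x) + 1 + 2) ^ d; last by lia.
case: (posnP d) => [->|d0]; first by rewrite !expn0.
by rewrite leq_exp2r //; lia.
Qed.

Lemma PT_flatten {X A} {EX : Enc X} {EA : Enc A} (l : X -> seq (seq A)) : PT l -> PT (fun x => flatten (l x)).
Proof.
move=> Pl; have sl := PT_PB Pl.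
have E (m : seq (seq A)) acc : foldl (fun acc s => catrev s acc) acc m = catrev (flatten m) acc.
  elim: m acc => //= s m IH acc; rewrite IH; move: (flatten m) => u.
  by rewrite !catrevE rev_cat catA.
apply: (@PT_ext _ _ _ _ (fun x => rev (foldl (fun acc s => catrev s acc) [::] (l x)))); last first.
  by move=> x; rewrite E catrevE cats0 revK.
apply: PT_rev; apply: (PT_foldl (q := fun x => sz (l x))); try pt.
- by apply: PT_catrev; pt.
- by [].
move=> x n; rewrite E catrevE cats0 sz_rev; apply: leq_trans (sz_take n _).
by elim: (take n _) => //= s m IH; pose proof (sz_cat s (flatten m)); rewrite sz_cons; lia.
Qed.

Lemma PT_filter {X A} {EX : Enc X} {EA : Enc A} (p : X -> A -> bool) (l : X -> seq A) :
  PT (fun z : X * A => p z.1 z.2) -> PT l -> PT (fun x => filter (p x) (l x)).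
Proof.
move=> Pp Pl.
apply: (@PT_ext _ _ _ _ (fun x => flatten [seq if p x a then [:: a] else [::] | a <- l x])); last first.
  by move=> x; elim: (l x) => //= a m ->; case: (p x a).
apply: PT_flatten; apply: PT_map => //; pt.
Qed.

Lemma PT_isnil {X A} {EX : Enc X} {EA : Enc A} (l : X -> seq A) : PT l -> PT (fun x => nilp (l x)).
Proof.
move=> Pl; apply: (@PT_ext _ _ _ _ (fun x => if l x is _ :: _ then false else true)); first by pt.
by move=> x; case: (l x).
Qed.

Lemma PT_has {X A} {EX : Enc X} {EA : Enc A} (p : X -> A -> bool) (l : X -> seq A) :
  PT (fun z : X * A => p z.1 z.2) -> PT l -> PT (fun x => has (p x) (l x)).
Proof.
move=> Pp Pl; apply: (@PT_ext _ _ _ _ (fun x => ~~ nilp (filter (p x) (l x)))).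
  by apply: PT_negb; apply: PT_isnil; exact: PT_filter.
by move=> x; rewrite has_count -size_filter lt0n.
Qed.

Lemma PT_all {X A} {EX : Enc X} {EA : Enc A} (p : X -> A -> bool) (l : X -> seq A) :
  PT (fun z : X * A => p z.1 z.2) -> PT l -> PT (fun x => all (p x) (l x)).
Proof.
move=> Pp Pl; apply: (@PT_ext _ _ _ _ (fun x => ~~ has (fun a => ~~ p x a) (l x))).
  by apply: PT_negb; apply: PT_has => //; exact: PT_negb.
by move=> x; rewrite -all_predC; apply: eq_all => a /=; rewrite negbK.
Qed.

Lemma PT_head {X A} {EX : Enc X} {EA : Enc A} (l : X -> seq A) (d : X -> A) : PT l -> PT d -> PT (fun x => head (d x) (l x)).
Proof.
move=> Pl Pd; apply: (@PT_ext _ _ _ _ (fun x => if l x is a :: _ then a else d x)) => //; pt.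
Qed.

Lemma PT_behead {X A} {EX : Enc X} {EA : Enc A} (l : X -> seq A) : PT l -> PT (fun x => behead (l x)).
Proof.
move=> Pl; apply: (@PT_ext _ _ _ _ (fun x => if l x is _ :: m then m else [::])) => //; pt.
Qed.

Lemma PT_allpairs (X A B C : Type) (EX : Enc X) (EA : Enc A) (EB : Enc B) (EC : Enc C)
    (f : X -> A -> B -> C) (l : X -> seq A) (m : X -> A -> seq B) :
  PT (fun p : X * A * B => f p.1.1 p.1.2 p.2) -> PT l ->
  PT (fun p : X * A => m p.1 p.2) ->
  PT (fun x => [seq f x a b | a <- l x, b <- m x a]).
Proof.
move=> Pf Pl Pm; apply: PT_flatten; apply: PT_map => //.
by apply: (PT_map (f := fun p b => f p.1 p.2 b)).
Qed.

Lemma PT_mem (X : Type) (A : eqType) (EX : Enc X) (EA : Enc A) (a : X -> A) (l : X -> seq A) :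
  PT a -> PT l -> PT (fun x => a x \in l x).
Proof.
move=> Pa Pl; apply: (@PT_ext _ _ _ _ (fun x => has (fun b => b == a x) (l x))); last first.
  by move=> x; rewrite has_pred1.
apply: PT_has => //; pt; exact: (PT_comp Pa (PT_fst (PT_id))).
Qed.

(** * Binary arithmetic *)

Lemma PT_foldl_grow {X A B} {EX : Enc X} {EA : Enc A} {EB : Enc B}
    (g : X -> B -> A -> B) (h : X -> B) (l : X -> seq A) c :
  PT (fun p : X * B * A => g p.1.1 p.1.2 p.2) -> PT h -> PT l ->
  (forall x b a, sz (g x b a) <= sz b + c) ->
  PT (fun x => foldl (g x) (h x) (l x)).
Proof.
move=> Pg Ph Pl H; have sl := PT_PB Pl; have sh := PT_PB Ph.
apply: (PT_foldl (q := fun x => sz (h x) + sz (l x) * c)) => //; first by pb.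
move=> x n; apply: (@leq_trans (sz (h x) + size (take n (l x)) * c)).
  elim: (take n _) (h x) => [|a m IH] b /=; first by lia.
  by have := IH (g x b a); have := H x b a; rewrite mulSn; lia.
pose proof (size_sz (take n (l x))); pose proof (sz_take n (l x)).
by rewrite leq_add2l leq_mul2r (leq_trans _ H1) // orbT.
Qed.

Lemma PT_zip {X A B} {EX : Enc X} {EA : Enc A} {EB : Enc B} (l : X -> seq A) (m : X -> seq B) :
  PT l -> PT m -> PT (fun x => zip (l x) (m x)).
Proof.
move=> Pl Pm; have sl := PT_PB Pl; have sm := PT_PB Pm.
pose g (s : seq B * seq (A * B)) a := if s.1 is b :: m' then (m', (a, b) :: s.2) else s.
have E u v acc : foldl g (v, acc) u = (drop (size u) v, catrev (zip u v) acc).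
  elim: u v acc => [|a u IH] [|b v] acc //=; rewrite ?drop0 ?IH //=.
  by case: u {IH}.
apply: (@PT_ext _ _ _ _ (fun x => rev (foldl g (m x, [::]) (l x)).2)); last first.
  by move=> x; rewrite E catrevE cats0 revK.
apply: PT_rev; apply: PT_snd.
apply: (PT_foldl (q := fun x => sz (m x) + (sz (l x) + sz (m x)) + 1)); rewrite /g; try pt; first by pb.
move=> x n; rewrite -/g E catrevE cats0 sz_pair sz_rev.
have Z (u : seq A) (v : seq B) : sz (zip u v) <= sz u + sz v.
  elim: u v => [|a u IH] [|b v] //=; try by rewrite sz_nil; lia.
  by rewrite !sz_cons sz_pair; have := IH v; lia.
pose proof (sz_drop (size (take n (l x))) (m x)).
pose proof (sz_take n (l x)); have := Z (take n (l x)) (m x); lia.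
Qed.

Fixpoint bits_rec k n :=
  if k is k'.+1 then if n is 0 then [::] else odd n :: bits_rec k' n./2 else [::].

Definition bits n := bits_rec n n.

Definition bval (l : seq bool) := foldr (fun (b : bool) v => b + v.*2) 0 l.

Lemma bits_recE k n : n <= k -> bits_rec k n = bits n.
Proof.
suff H m : n <= k -> n <= m -> bits_rec k n = bits_rec m n by move=> h; exact: H.
elim/ltn_ind: n k m => -[|n] IH [|k] [|m] //= hk hm; congr cons.
by apply: IH; lia.
Qed.

Lemma bitsS n : 0 < n -> bits n = odd n :: bits n./2.
Proof.
case: n => // n _; rewrite {1}/bits /= -[uphalf n]/(n.+1./2).
by rewrite bits_recE //; lia.
Qed.

Lemma bitsK n : bval (bits n) = n.
Proof.
elim/ltn_ind: n => -[|n] IH //; rewrite bitsS //= IH ?odd_double_half //; lia.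
Qed.

Lemma bval_gt0 l : l <> [::] -> last true l -> 0 < bval l.
Proof.
elim: l => // b l IH _ /=; case: l IH => [|c l] IH; first by case: b.
by move=> h; have := IH ltac:(done) h; lia.
Qed.

Lemma bvalK l : last true l -> bits (bval l) = l.
Proof.
elim: l => // b l IH h; rewrite bitsS; last exact: bval_gt0.
rewrite /= oddD odd_double addbF oddb halfD odd_double andbF doubleK add0n.
case: l IH h => [|c l] IH h; first by case: b h.
by have -> : b./2 = 0 by [case: (b)]; rewrite add0n IH.
Qed.

Lemma bval_lt l : bval l < 2 ^ size l.
Proof. by elim: l => //= b l IH; rewrite expnS; case: b; lia. Qed.

Lemma size_bits_le n k : n < 2 ^ k -> size (bits n) <= k.
Proof.
elim: k n => [|k IH] n; first by case: n.
case: n => // n h; rewrite bitsS //= ltnS; apply: IH.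
by move: h; rewrite expnS; lia.
Qed.

Lemma bits_inj : injective bits.
Proof. exact: can_inj bitsK. Qed.

Lemma nat_enc_inj : injective (fun n => enc (bits n)).
Proof. by move=> n m h; apply: bits_inj; exact: enc_inj h. Qed.
#[export] Instance Enc_nat : Enc nat := {| enc_inj := nat_enc_inj |}.

Lemma sz_nat n : sz n = sz (bits n).
Proof. by []. Qed.

Lemma sz_bits_le (l : seq bool) : sz l <= 4 * size l + 1.
Proof. by elim: l => // b l; rewrite sz_cons /=; case: b; rewrite /sz /treesz /=; lia. Qed.

Lemma sz_nat_le n k : n < 2 ^ k -> sz n <= 4 * k + 1.
Proof. by move=> /size_bits_le h; rewrite sz_nat; have := sz_bits_le (bits n); lia. Qed.

Lemma ltn_sz n : n < 2 ^ sz n.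
Proof.
rewrite -{1}(bitsK n); apply: leq_trans (bval_lt _) _.
by rewrite leq_exp2l // sz_nat; exact: size_sz.
Qed.

Lemma PT_bits {X} {EX : Enc X} (f : X -> nat) : PT f -> PT (fun x => bits (f x)).
Proof. by []. Qed.

(** Digitwise arithmetic leaves zeros at the most significant end, which comes first in [acc]; the
    code of a number must be free of them. *)
Definition strip (acc : seq bool) : seq bool :=
  foldl (fun r b => if r is [::] then if b then [:: true] else [::] else b :: r) [::] acc.

Lemma bval_cat l m : bval (l ++ m) = bval l + 2 ^ size l * bval m.
Proof.
elim: l => [|b l IH] /=; first by rewrite expn0; lia.
by rewrite IH expnS; lia.
Qed.

Lemma stripE acc : strip acc = bits (bval (rev acc)).
Proof.
pose g (r : seq bool) (b : bool) := if r is [::] then if b then [:: true] else [::] else b :: r.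
have H u : forall r, last true r -> last true (foldl g r u) /\
    bval (foldl g r u) = bval (catrev u r).
  elim: u => [|b u IH] r hr //=.
  have h1 : last true (g r b) by case: r hr => [|c r] /=; case: b.
  have [h2 ->] := IH _ h1; split=> //.
  rewrite !catrevE !bval_cat; congr (_ + _ * _).
  by case: r {hr h1 h2} => [|c r] //=; case: b.
have [h1 h2] := H acc [::] isT.
by rewrite -[LHS]/(foldl g [::] acc) -[LHS](bvalK h1) h2 catrevE cats0.
Qed.

Lemma PT_strip {X} {EX : Enc X} (f : X -> seq bool) : PT f ->
  PT (fun x => bval (rev (f x))).
Proof.
move=> Pf; apply: (@PTg_ext _ _ (fun x => enc (strip (f x)))); last by move=> x; rewrite stripE.
apply: (PT_foldl_grow (g := fun _ r b => if r is [::] then if b then [:: true] else [::] else b :: r) (h := fun=> [::]) (c := 4)) => //; try pt.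
move=> x b a; case: b => [|c b]; last by rewrite !sz_cons; case: a; rewrite /sz /treesz /=; lia.
by case: a.
Qed.

Definition sstate := (seq bool * seq bool * bool * seq bool)%type.

Definition serial_step (op : bool * bool * bool -> bool * bool) (s : sstate) : sstate :=
  let o := op (head false s.1.1.1, head false s.1.1.2, s.1.2) in
  (behead s.1.1.1, behead s.1.1.2, o.2, o.1 :: s.2).

(** The list [l ++ m] only counts rounds. Missing digits are read as zeros, and [size l + size m]
    rounds are enough to use up both numbers. *)
Definition serial op (l m : seq bool) : sstate :=
  foldl (fun s _ => serial_step op s) (l, m, false, [::]) (l ++ m).

Lemma PT_serial {X} {EX : Enc X} op (l m : X -> seq bool) : PT op -> PT l -> PT m ->
  PT (fun x => serial op (l x) (m x)).
Proof.
move=> Po Pl Pm; apply: (PT_foldl_grow (c := 12)); try pt; last 1 first.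
- move=> x [[[r1 r2] c] acc] a; rewrite /serial_step /= !sz_pair !sz_cons.
  have B (b : bool) : sz b <= 3 by case: b.
  have BH (u : seq bool) : sz (behead u) <= sz u by case: u => // b u; rewrite sz_cons /=; lia.
  have := BH r1; have := BH r2; have := B (op (head false r1, head false r2, c)).1.
  by have := B (op (head false r1, head false r2, c)).2; have := sz_gt0 c; lia.
- rewrite /serial_step; have P (f : X * sstate * bool -> bool * bool * bool) :
    PT f -> PT (fun x => op (f x)) by move=> Pf; exact: (PT_comp Po Pf).
  by pt; repeat first [apply: PT_behead | apply: P | apply: PT_head | pt_step].
- exact: PT_cat.
Qed.

Definition adder (p : bool * bool * bool) : bool * bool :=
  let: (a, b, c) := p in (a (+) b (+) c, (a && b) || (c && (a || b))).
Definition subtracter (p : bool * bool * bool) : bool * bool :=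
  let: (a, b, c) := p in (a (+) b (+) c, (~~ a && (b || c)) || (b && c)).

Lemma PT_addb {X} {EX : Enc X} (f g : X -> bool) : PT f -> PT g -> PT (fun x => f x (+) g x).
Proof.
move=> Pf Pg; apply: (@PT_ext _ _ _ _ (fun x => if f x then ~~ g x else g x)); first by pt.
by move=> x; case: (f x).
Qed.

Lemma PT_adder : PT adder.
Proof.
apply: (@PT_ext _ _ _ _ (fun p : bool * bool * bool => (p.1.1 (+) p.1.2 (+) p.2,
  (p.1.1 && p.1.2) || (p.2 && (p.1.1 || p.1.2))))); last by move=> [[a b] c].
by pt; do 2 (apply: PT_addb; pt).
Qed.

Lemma PT_subtracter : PT subtracter.
Proof.
apply: (@PT_ext _ _ _ _ (fun p : bool * bool * bool => (p.1.1 (+) p.1.2 (+) p.2,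
  (~~ p.1.1 && (p.1.2 || p.2)) || (p.1.2 && p.2)))); last by move=> [[a b] c].
by pt; do 2 (apply: PT_addb; pt).
Qed.

Lemma bval_head (l : seq bool) : bval l = head false l + (bval (behead l)).*2.
Proof. by case: l. Qed.

Lemma bval_rev_cons (b : bool) acc : bval (rev (b :: acc)) = bval (rev acc) + 2 ^ size acc * b.
Proof. by rewrite rev_cons -cats1 bval_cat size_rev /= addn0. Qed.

Definition sinv (P : seq bool -> seq bool -> bool -> seq bool -> Prop) (s : sstate) :=
  let: (r1, r2, c, acc) := s in P r1 r2 c acc.

Lemma serial_inv op P l m :
  P l m false [::] ->
  (forall r1 r2 c acc, P r1 r2 c acc -> sinv P (serial_step op (r1, r2, c, acc))) ->
  exists c acc, [/\ serial op l m = ([::], [::], c, acc),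
    size acc = size l + size m & P [::] [::] c acc].
Proof.
move=> P0 PS; rewrite /serial.
have H (u : seq bool) : forall r1 r2 c acc, P r1 r2 c acc ->
    exists c' acc', [/\ foldl (fun s _ => serial_step op s) (r1, r2, c, acc) u =
      (drop (size u) r1, drop (size u) r2, c', acc'), size acc' = size acc + size u &
      P (drop (size u) r1) (drop (size u) r2) c' acc'].
  elim: u => [|a u IH] r1 r2 c acc h /=; first by exists c, acc; rewrite !drop0 addn0.
  have h' := PS _ _ _ _ h; rewrite /serial_step /= in h'.
  have [c' [acc' [e1 e2 e3]]] := IH _ _ _ _ h'.
  exists c', acc'; rewrite /serial_step /= e1 -!drop1 !drop_drop !addn1 in e3 *.
  by split=> //; rewrite e2 /=; lia.
have [c [acc [e1 e2 e3]]] := H (l ++ m) _ _ _ _ P0.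
rewrite !size_cat !drop_oversize in e1 e2 e3; try lia.
by exists c, acc.
Qed.

Lemma serial_add l m : bval (rev (serial adder l m).2) = bval l + bval m.
Proof.
pose P r1 r2 (c : bool) acc := bval (rev acc) + 2 ^ size acc * (bval r1 + bval r2 + c) =
  bval l + bval m.
have [||c [acc [-> sa]]] := @serial_inv adder P l m; rewrite /P.
- by rewrite expn0 /= !addn0 mul1n.
- move=> r1 r2 c acc; rewrite (bval_head r1) (bval_head r2) /= bval_rev_cons expnS.
  by case: (head false r1); case: (head false r2); case: c => /=; lia.
(* A carry out of the last round would make the sum at least 2 to the power [size l + size m]. *)
case: c => [/= h|/=]; last by rewrite muln0 addn0.
have := bval_lt l; have := bval_lt m; rewrite sa expnD in h.
have p1 : 0 < 2 ^ size l by rewrite expn_gt0.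
have p2 : 0 < 2 ^ size m by rewrite expn_gt0.
move=> h1 h2.
case: (posnP (bval m)) => [e|p]; first by nia.
have q2 : 1 < 2 ^ size m by lia.
case: (posnP (bval l)) => [e|p']; first by nia.
have q1 : 1 < 2 ^ size l by lia.
by nia.
Qed.

(** The last borrow decides the order, so one circuit yields both the comparison and the
    difference. *)
Lemma serial_sub l m : let s := serial subtracter l m in
  s.1.2 = (bval l < bval m) /\ (bval m <= bval l -> bval (rev s.2) = bval l - bval m).
Proof.
pose P r1 r2 (c : bool) acc := bval (rev acc) + 2 ^ size acc * bval r1 + bval m =
  bval l + 2 ^ size acc * (bval r2 + c).
have [||c [acc [-> sa]]] := @serial_inv subtracter P l m; rewrite /P.
- by rewrite expn0 /= !addn0 !mul1n.
- move=> r1 r2 c acc; rewrite (bval_head r1) (bval_head r2) /= bval_rev_cons expnS.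
  by case: (head false r1); case: (head false r2); case: c => /=; lia.
rewrite /= !muln0 !addn0; have := bval_lt (rev acc); rewrite size_rev.
by case: c => /=; lia.
Qed.

Lemma PT_addn {X} {EX : Enc X} (f g : X -> nat) : PT f -> PT g -> PT (fun x => f x + g x).
Proof.
move=> Pf Pg.
apply: (@PT_ext _ _ _ _ (fun x => bval (rev (serial adder (bits (f x)) (bits (g x))).2))).
  by apply: PT_strip; apply: PT_snd; apply: PT_serial => //; exact: PT_adder.
by move=> x; rewrite serial_add !bitsK.
Qed.

Lemma PT_ltn {X} {EX : Enc X} (f g : X -> nat) : PT f -> PT g -> PT (fun x => f x < g x).
Proof.
move=> Pf Pg.
apply: (@PT_ext _ _ _ _ (fun x => (serial subtracter (bits (f x)) (bits (g x))).1.2)).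
  apply: PT_snd; apply: PT_fst; apply: PT_serial => //; exact: PT_subtracter.
by move=> x; have [-> _] := serial_sub (bits (f x)) (bits (g x)); rewrite !bitsK.
Qed.

Lemma PT_leq {X} {EX : Enc X} (f g : X -> nat) : PT f -> PT g -> PT (fun x => f x <= g x).
Proof.
move=> Pf Pg; apply: (@PT_ext _ _ _ _ (fun x => ~~ (g x < f x))).
  by apply: PT_negb; exact: PT_ltn.
by move=> x; rewrite -leqNgt.
Qed.

Lemma PT_subn {X} {EX : Enc X} (f g : X -> nat) : PT f -> PT g -> PT (fun x => f x - g x).
Proof.
move=> Pf Pg.
apply: (@PT_ext _ _ _ _ (fun x => if f x < g x then 0 else
   bval (rev (serial subtracter (bits (f x)) (bits (g x))).2))).
  apply: PT_if; [exact: PT_ltn | exact: PT_const |].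
  by apply: PT_strip; apply: PT_snd; apply: PT_serial => //; exact: PT_subtracter.
move=> x; have [_] := serial_sub (bits (f x)) (bits (g x)); rewrite !bitsK.
by case: ltnP => [h _|h ->] //; lia.
Qed.

Lemma PT_muln {X} {EX : Enc X} (f g : X -> nat) : PT f -> PT g -> PT (fun x => f x * g x).
Proof.
move=> Pf Pg; have sf := PT_PB Pf; have sg := PT_PB Pg.
(* Doubling and adding, from the most significant digit of [f x] on. *)
pose h x acc (b : bool) := if b then acc + acc + g x else acc + acc.
have E x u acc : foldl (h x) acc u = acc * 2 ^ size u + bval (rev u) * g x.
  elim: u acc => [|b u IH] acc /=; first by rewrite muln1 mul0n addn0.
  rewrite IH bval_rev_cons expnS /h; case: b => /=; lia.
apply: (@PT_ext _ _ _ _ (fun x => foldl (h x) 0 (rev (bits (f x))))); last first.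
  by move=> x; rewrite E mul0n revK bitsK.
apply: (PT_foldl (q := fun x => 4 * (sz (f x) + sz (g x)) + 1)); rewrite /h; try pt.
- by apply: PT_addn; [apply: PT_addn; pt | apply: (PT_comp Pg); pt].
- by apply: PT_addn; pt.
- by apply: PT_rev; exact: PT_bits.
- by pb.
move=> x n; rewrite -/(h x) E mul0n add0n; apply: sz_nat_le; rewrite expnD.
apply: ltn_mul; last exact: ltn_sz.
apply: leq_trans (bval_lt _) _; rewrite leq_exp2l // size_rev sz_nat.
have h1 := size_take_min n (rev (bits (f x))).
by pose proof (size_sz (bits (f x))); rewrite size_rev in h1; lia.
Qed.

Lemma PT_size {X A} {EX : Enc X} {EA : Enc A} (l : X -> seq A) : PT l -> PT (fun x => size (l x)).
Proof.
move=> Pl; have sl := PT_PB Pl.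
have E u k : foldl (fun n (_ : A) => n + 1) k u = k + size u.
  by elim: u k => [|a u IH] k /=; rewrite ?IH; lia.
apply: (@PT_ext _ _ _ _ (fun x => foldl (fun n _ => n + 1) 0 (l x))); last by move=> x; rewrite E.
apply: (PT_foldl (q := fun x => 4 * sz (l x) + 1)); try pt; [apply: PT_addn; pt | by pb |].
move=> x n; rewrite E add0n; apply: sz_nat_le.
pose proof (size_sz (take n (l x))); pose proof (sz_take n (l x)).
by apply: leq_ltn_trans (ltn_expl _ (isT : 1 < 2)); lia.
Qed.

(** The length is given in unary, as the length of a list: for a binary number [n] the list
    [iota 0 n] would be exponentially long. *)
Lemma PT_iota {X A} {EX : Enc X} {EA : Enc A} (l : X -> seq A) : PT l ->
  PT (fun x => iota 0 (size (l x))).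
Proof.
move=> Pl; have sl := PT_PB Pl.
pose g (s : seq nat) (_ : A) := size s :: s.
have E u : foldl g [::] u = rev (iota 0 (size u)).
  elim/last_ind: u => // u a IH; rewrite foldl_rcons IH /g size_rev size_iota size_rcons.
  by rewrite -addn1 iotaD rev_cat.
apply: (@PT_ext _ _ _ _ (fun x => rev (foldl g [::] (l x)))); last by move=> x; rewrite E revK.
apply: PT_rev; apply: (PT_foldl (q := fun x => sz (l x) * (4 * sz (l x) + 2) + 1)); try pt.
- by rewrite /g; pt; apply: PT_size; pt.
- by pb.
move=> x n; rewrite E sz_rev.
pose proof (size_sz (take n (l x))); pose proof (sz_take n (l x)).
have H3 : size (take n (l x)) <= sz (l x) by lia.
move: (size _) H3 => k hk {H H0}.
have L m : m <= k -> sz (iota 0 m) <= m * (4 * sz (l x) + 2) + 1.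
  elim: m => // m IH hm; rewrite -addn1 iotaD add0n /=.
  pose proof (sz_cat (iota 0 m) [:: m]); rewrite sz_cons sz_nil in H.
  have := IH (ltnW hm); pose proof (@sz_nat_le m (sz (l x))); rewrite mulnDl mul1n.
  have : m < 2 ^ sz (l x) by apply: leq_ltn_trans (ltn_expl _ (isT : 1 < 2)); lia.
  by lia.
by apply: leq_trans (L k (leqnn k)) _; nia.
Qed.

Lemma PT_nth {X A} {EX : Enc X} {EA : Enc A} (d : X -> A) (l : X -> seq A) (i : X -> nat) :
  PT d -> PT l -> PT i -> PT (fun x => nth (d x) (l x) (i x)).
Proof.
move=> Pd Pl Pi.
apply: (@PT_ext _ _ _ _ (fun x => head (d x) (map snd
  (filter (fun p => p.1 == i x) (zip (iota 0 (size (l x))) (l x)))))).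
  apply: PT_head => //; apply: (PT_map (f := fun _ => snd)); first by pt.
  apply: PT_filter; last by apply: PT_zip => //; exact: PT_iota.
  by pt; apply: (PT_comp Pi); pt.
move=> x; have E u k j : k <= j -> head (d x) (map snd (filter (fun p : nat * A => p.1 == j)
    (zip (iota k (size u)) u))) = nth (d x) u (j - k).
  elim: u k => [|a u IH] k h /=; first by rewrite nth_nil.
  case: (eqVneq k j) => [<-|ne]; first by rewrite subnn.
  rewrite IH; last by lia.
  by rewrite -[j - k]prednK ?subnS //; lia.
by rewrite E // subn0.
Qed.

(** The exponent is in unary for the same reason: otherwise the power could have exponentially many
    digits. *)
Lemma PT_expn {X A} {EX : Enc X} {EA : Enc A} (f : X -> nat) (l : X -> seq A) :
  PT f -> PT l -> PT (fun x => f x ^ size (l x)).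
Proof.
move=> Pf Pl; have sl := PT_PB Pl; have sf := PT_PB Pf.
have E c u k : foldl (fun n (_ : A) => n * c) k u = k * c ^ size u.
  by elim: u k => [|a u IH] k /=; rewrite ?muln1 // IH expnS mulnA.
apply: (@PT_ext _ _ _ _ (fun x => foldl (fun n _ => n * f x) 1 (l x))).
  apply: (PT_foldl (q := fun x => 4 * (sz (l x) * sz (f x) + 1) + 1)); try pt.
  - by apply: PT_muln; pt; apply: (PT_comp Pf); pt.
  - by pb.
  move=> x n; rewrite E mul1n; apply: sz_nat_le.
  pose proof (size_sz (take n (l x))); pose proof (sz_take n (l x)).
  apply: (@leq_ltn_trans ((2 ^ sz (f x)) ^ size (take n (l x)))).
    by case: (size _) => // k; rewrite leq_exp2r // ltnW // ltn_sz.
  by rewrite -expnM ltn_exp2l //; nia.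
by move=> x; rewrite E mul1n.
Qed.

(** * Integers *)

Definition mkint (b : bool) (n : nat) : int := if b then (- Posz n)%R else Posz n.

Definition int_enc (z : int) := enc ((z < 0)%R, `|z|%N).

Lemma int_enc_inj : injective int_enc.
Proof.
move=> x y h; have [h1 h2] := enc_inj h.
lia.
Qed.
#[export] Instance Enc_int : Enc int := {| enc_inj := int_enc_inj |}.

Lemma PT_mkint {X} {EX : Enc X} (b : X -> bool) (n : X -> nat) : PT b -> PT n ->
  PT (fun x => mkint (b x) (n x)).
Proof.
move=> Pb Pn; have P : PT (fun x => (b x && (n x != 0), n x)) by pt.
apply: PTg_ext P _ => x; rewrite -[RHS]/(enc ((mkint (b x) (n x) < 0)%R, `|mkint (b x) (n x)|%N)); congr (enc (_, _)).
  by rewrite /mkint; case: (b x); lia.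
by rewrite /mkint; case: (b x); lia.
Qed.

Lemma PT_neg {X} {EX : Enc X} (f : X -> int) : PT f -> PT (fun x => (f x < 0)%R).
Proof. by move=> Pf; exact: (PTg_fst Pf). Qed.

Lemma PT_absz {X} {EX : Enc X} (f : X -> int) : PT f -> PT (fun x => `|f x|%N).
Proof. by move=> Pf; exact: (PTg_snd Pf). Qed.

Ltac pt_user ::= first
  [ apply: PT_cat | apply: PT_rev | apply: PT_flatten | apply: PT_allpairs
  | apply: PT_map | apply: PT_filter | apply: PT_has | apply: PT_all | apply: PT_mem
  | apply: PT_behead | apply: PT_head | apply: PT_nth | apply: PT_size | apply: PT_iota
  | apply: PT_zip | apply: PT_addn | apply: PT_ltn | apply: PT_leq | apply: PT_subn
  | apply: PT_muln | apply: PT_isnil | apply: PT_mkint | apply: PT_neg | apply: PT_absz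
  | apply: PT_addb ].

Lemma PT_addz {X} {EX : Enc X} (f g : X -> int) : PT f -> PT g -> PT (fun x => (f x + g x)%R).
Proof.
move=> Pf Pg.
apply: (@PT_ext _ _ _ _ (fun x => if (f x < 0)%R == (g x < 0)%R then
    mkint (f x < 0)%R (`|f x|%N + `|g x|%N)
  else if `|g x|%N <= `|f x|%N then mkint (f x < 0)%R (`|f x|%N - `|g x|%N)
  else mkint (g x < 0)%R (`|g x|%N - `|f x|%N))); first by pt.
by move=> x; rewrite /mkint; repeat case: ifP; lia.
Qed.

Lemma PT_oppz {X} {EX : Enc X} (f : X -> int) : PT f -> PT (fun x => (- f x)%R).
Proof.
move=> Pf; apply: (@PT_ext _ _ _ _ (fun x => mkint (~~ (f x < 0)%R) `|f x|%N)); first by pt.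
by move=> x; rewrite /mkint; repeat case: ifP; lia.
Qed.

Lemma PT_lez {X} {EX : Enc X} (f g : X -> int) : PT f -> PT g -> PT (fun x => (f x <= g x)%R).
Proof.
move=> Pf Pg; apply: (@PT_ext _ _ _ _ (fun x => ~~ ((g x + - f x)%R < 0)%R)).
  by pt; apply: PT_addz => //; exact: PT_oppz.
by move=> x; lia.
Qed.

Lemma PT_ltz {X} {EX : Enc X} (f g : X -> int) : PT f -> PT g -> PT (fun x => (f x < g x)%R).
Proof.
move=> Pf Pg; apply: (@PT_ext _ _ _ _ (fun x => ((f x + - g x)%R < 0)%R)).
  by pt; apply: PT_addz => //; exact: PT_oppz.
by move=> x; lia.
Qed.

Lemma PT_mulz {X} {EX : Enc X} (f g : X -> int) : PT f -> PT g -> PT (fun x => (f x * g x)%R).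
Proof.
move=> Pf Pg; apply: (@PT_ext _ _ _ _ (fun x =>
  mkint ((f x < 0)%R (+) (g x < 0)%R) (`|f x|%N * `|g x|%N))); first by pt.
by move=> x; rewrite /mkint -abszM; case: ltrP => ha; case: ltrP => hb /=; nia.
Qed.

Lemma PT_Posz {X} {EX : Enc X} (f : X -> nat) : PT f -> PT (fun x => Posz (f x)).
Proof.
by move=> Pf; apply: (@PT_ext _ _ _ _ (fun x => mkint false (f x))) => //; pt.
Qed.

Lemma sz_int (z : int) k : `|z|%N < 2 ^ k -> sz z <= 4 * k + 5.
Proof.
move=> /sz_nat_le h; have -> : sz z = sz ((z < 0)%R, `|z|%N) by [].
rewrite sz_pair.
have B (b : bool) : sz b <= 3 by case: b.
by have := B (z < 0)%R; lia.
Qed.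

Lemma absz_lt_sz (z : int) : `|z|%N < 2 ^ sz z.
Proof.
apply: leq_trans (ltn_sz _) _; rewrite leq_exp2l //.
by have -> : sz z = sz ((z < 0)%R, `|z|%N) by []; rewrite sz_pair; lia.
Qed.

Definition sumz (l : seq int) : int := foldl (fun a b => (a + b)%R) 0%R l.

Lemma sumzE l : sumz l = (\sum_(i <- l) i)%R.
Proof.
rewrite /sumz; have E k : foldl (fun a b : int => (a + b)%R) k l = (k + \sum_(i <- l) i)%R.
  elim: l k => [|a l IH] k; first by rewrite big_nil addr0.
  by rewrite /= IH big_cons addrA.
by rewrite E add0r.
Qed.

Lemma abs_sumz_lt (l : seq int) : `|sumz l|%N < 2 ^ sz l.
Proof.
rewrite sumzE; elim: l => [|a l IH]; first by rewrite big_nil.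
rewrite big_cons sz_cons expnS expnD; pose proof (absz_lt_sz a).
move: (\sum_(j <- l) j)%R IH H => s; move: (2 ^ sz a) (2 ^ sz l) => u v h1 h2.
by have : `|(a + s)%R|%N <= `|a|%N + `|s|%N by [lia]; nia.
Qed.

Lemma PT_sumz {X} {EX : Enc X} (l : X -> seq int) : PT l -> PT (fun x => sumz (l x)).
Proof.
move=> Pl; have sl := PT_PB Pl.
apply: (PT_foldl (q := fun x => 4 * sz (l x) + 5)); try pt; first by apply: PT_addz; pt.
  by pb.
move=> x n; apply: sz_int; apply: leq_trans (abs_sumz_lt _) _.
by rewrite leq_exp2l //; exact: sz_take.
Qed.

Definition minz (a b : int) : int := if (a <= b)%R then a else b.

Definition minl (d : int) (l : seq int) := foldl minz d l.

Lemma minl_mem d l : minl d l \in d :: l.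
Proof.
elim: l d => [|a l IH] d; first by rewrite inE.
have := IH (minz d a); rewrite /minl /= !inE.
have : (minz d a == d) || (minz d a == a) by rewrite /minz; case: ifP; rewrite eqxx ?orbT.
by case/orP=> /eqP-> /orP[->|->]; rewrite ?orbT.
Qed.

Lemma minl_le (d : int) (l : seq int) (z : int) : z \in d :: l -> (minl d l <= z)%R.
Proof.
elim: l d z => [|a l IH] d z; first by rewrite inE => /eqP ->.
have [m1 m2] : (minz d a <= d)%R /\ (minz d a <= a)%R.
  by rewrite /minz; case: (lerP d a) => h; split=> //; exact: ltW.
rewrite !inE => h; rewrite -[minl d _]/(minl (minz d a) l).
case/or3P: h => [/eqP->|/eqP->|h].
- by apply: le_trans (IH _ _ (mem_head _ _)) _.
- by apply: le_trans (IH _ _ (mem_head _ _)) _.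
- by apply: IH; rewrite inE h orbT.
Qed.

Lemma PT_minl {X} {EX : Enc X} (d : X -> int) (l : X -> seq int) : PT d -> PT l ->
  PT (fun x => minl (d x) (l x)).
Proof.
move=> Pd Pl; have sl := PT_PB Pl; have sd := PT_PB Pd.
apply: (PT_foldl (q := fun x => (sz (d x) + sz (l x)).+1)); rewrite /minz; try pt; first by apply: PT_lez; pt.
  by apply: PB_le; [exact: (PB_add (PB_add sd sl) (PB_const _ 1)) | move=> x; lia].
move=> x n; pose proof (sz_take n (l x)).
pose proof (sz_mem (minl_mem (d x) (take n (l x)))) as h; rewrite sz_cons in h.
by apply: leq_trans (ltnW h) _; rewrite ltnS leq_add2l.
Qed.

Ltac pt_base := first
  [ apply: PT_cat | apply: PT_rev | apply: PT_flatten | apply: PT_allpairs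
  | apply: PT_map | apply: PT_filter | apply: PT_has | apply: PT_all | apply: PT_mem
  | apply: PT_behead | apply: PT_head | apply: PT_nth | apply: PT_size | apply: PT_iota
  | apply: PT_zip | apply: PT_addn | apply: PT_ltn | apply: PT_leq | apply: PT_subn
  | apply: PT_muln | apply: PT_isnil | apply: PT_mkint | apply: PT_neg | apply: PT_absz
  | apply: PT_addb | apply: PT_addz | apply: PT_oppz | apply: PT_lez | apply: PT_ltz
  | apply: PT_mulz | apply: PT_Posz | apply: PT_sumz | apply: PT_minl ].

Ltac pt_user ::= pt_base.

(** * Tables of PLH functions *)

Local Open Scope ring_scope.

Definition ext (a : seq rat) (i : nat) : rat := nth 0 (1 :: a) i.

(** The equivalence of a back-and-forth argument, which takes the place of a syntactic quantifier
    elimination. *)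
Definition same (C : seq rat) n (a b : seq rat) :=
  forall c d i j, c \in C -> d \in C -> (i <= n)%N -> (j <= n)%N ->
  (c * ext a i < d * ext a j) = (c * ext b i < d * ext b j).

Lemma same_sym C n a b : same C n a b -> same C n b a.
Proof. by move=> h c d i j *; rewrite h. Qed.

Lemma same_sub C C' n a b : {subset C <= C'} -> same C' n a b -> same C n a b.
Proof. by move=> s h c d i j hc hd; apply: h; exact: s. Qed.

Lemma term_valueE n (t : term n) :
  exists c i, (i <= n)%N /\ forall e : n.-tuple rat, term_value e t = c * ext e i.
Proof.
elim: t => [i||c t [c' [i [hi H]]]] /=.
- exists 1, i.+1; split=> [|e]; first exact: ltn_ord.
  by rewrite mul1r (tnth_nth 0).
- by exists 1, 0%N; split=> // e; rewrite mul1r.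
- by exists (c * c'), i; split=> // e; rewrite H mulrA.
Qed.

(** Density of the order without end points, for finite sets that may be empty. *)
Lemma exists_between (A B : seq rat) : (forall a b, a \in A -> b \in B -> a < b) ->
  exists y, (forall a, a \in A -> a < y) /\ (forall b, b \in B -> y < b).
Proof.
have L (a : rat) (D : seq rat) : (forall b, b \in D -> a < b) ->
    exists2 y, a < y & forall b, b \in D -> y < b.
  elim: D => [|b D IH] h; first by exists (a + 1) => //; lra.
  have [|y ay hy] := IH; first by move=> c hc; apply: h; rewrite inE hc orbT.
  have hb := h b (mem_head _ _).
  exists (Num.min y ((a + b) / 2)); first by rewrite lt_min ay /=; lra.
  move=> c; rewrite inE gt_min => /predU1P[->|/hy -> //].
  by apply/orP; right; lra.
elim: A => [|a A IH] h.
  have : exists y, forall b, b \in B -> y < b; last by case=> y hy; exists y.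
  elim: B {h} => [|b B [y hy]]; first by exists 0.
  exists (Num.min y (b - 1)) => c; rewrite inE gt_min => /predU1P[->|/hy -> //].
  by apply/orP; right; lra.
have [|y [y1 y2]] := IH; first by move=> c d hc; apply: h; rewrite inE hc orbT.
have [ay|ay] := ltP a y.
  by exists y; split=> // c; rewrite inE => /predU1P[->|/y1].
have [|z az hz] := L a B; first by move=> b hb; apply: h; rewrite // mem_head.
exists z; split=> // c; rewrite inE => /predU1P[->//|/y1 cy].
exact: lt_trans cy (le_lt_trans ay az).
Qed.

(** One extension step between two finite chains: a listed [x] goes to its partner, any other [x]
    into the corresponding gap. *)
Lemma transfer_point (L : seq (rat * rat)) (x : rat) :
  (forall p q, p \in L -> q \in L -> (p.1 < q.1) = (p.2 < q.2)) ->
  exists y, forall p, p \in L -> (x < p.1) = (y < p.2) /\ (p.1 < x) = (p.2 < y).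
Proof.
move=> H; case: (boolP (has (fun p => p.1 == x) L)) => [/hasP[p hp /eqP <-]|/hasPn nx].
  by exists p.2 => q hq; rewrite !H.
pose A := [seq p.2 | p <- L & p.1 < x]; pose B := [seq p.2 | p <- L & x < p.1].
have [|y [y1 y2]] := @exists_between A B.
  move=> a b /mapP[p]; rewrite mem_filter => /andP[px hp] ->.
  move=> /mapP[q]; rewrite mem_filter => /andP[qx hq] ->.
  by rewrite -H //; exact: lt_trans px qx.
exists y => p hp; have := nx p hp; case: (ltgtP p.1 x) => // h _.
  have : p.2 < y by apply: y1; apply/mapP; exists p; rewrite // mem_filter h.
  by move=> h'; rewrite h' ltNge (ltW h').
have : y < p.2 by apply: y2; apply/mapP; exists p; rewrite // mem_filter h.
by move=> h'; rewrite h' ltNge (ltW h').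
Qed.

Definition ratios (C : seq rat) := 0 :: [seq d / c | c <- C, d <- C].

(** For [c != 0], comparing [c x] with [d x_j] asks on which side of [(d / c) x_j] the number [x]
    lies, so these points must be ordered alike in both tuples. The ratio 0 records the sign of [x],
    which decides between [c x] and [d x]. *)
Definition qclose (C : seq rat) := 1 :: C ++ ratios C.

Lemma ratiosP C c d : c \in C -> d \in C -> d / c \in ratios C.
Proof.
by move=> hc hd; rewrite inE; apply/orP; right; apply/allpairsP; exists (c, d).
Qed.

(* Adding a coordinate [x] only asks how [x] compares to the points [r * ext a j]. *)
Lemma same_cons C n (a b : seq rat) x y : same (qclose C) n a b ->
  (forall r j, r \in ratios C -> (j <= n)%N ->
     (x < r * ext a j) = (y < r * ext b j) /\ (r * ext a j < x) = (r * ext b j < y)) ->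
  same C n.+1 (x :: a) (y :: b).
Proof.
move=> hab hxy.
have sC : {subset C <= qclose C} by move=> c hc; rewrite inE mem_cat hc /= orbT.
have z0 : 0 \in ratios C by rewrite mem_head.
have s0 : 0 \in qclose C by rewrite inE mem_cat z0 !orbT.
have one1 : 1 \in qclose C by rewrite mem_head.
have [X0 X1] := hxy 0 0%N z0 isT; rewrite !mul0r in X0 X1.
pose e0 (i : nat) := if i is i'.+1 then i' else 0%N.
have sg0 c j : c \in qclose C -> (j <= n)%N ->
    (0 < c * ext a j) = (0 < c * ext b j) /\ (c * ext a j < 0) = (c * ext b j < 0).
  move=> hc hj; have := hab 0 c 0%N j s0 hc isT hj; have := hab c 0 j 0%N hc s0 hj isT.
  by rewrite !mul0r => -> ->.
have K c d j : c \in C -> d \in C -> (j <= n)%N ->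
    (c * x < d * ext a j) = (c * y < d * ext b j) /\
    (d * ext a j < c * x) = (d * ext b j < c * y).
  move=> hc hd hj; have [E1 E2] := hxy _ j (ratiosP hc hd) hj.
  case: (ltgtP c 0) => [c0|c0|->]; last by rewrite !mul0r; have [] := sg0 d j (sC _ hd) hj.
  - have [R1 R2] : (forall u v, (c * u < d * v) = (d / c * v < u)) /\
       (forall u v, (d * v < c * u) = (u < d / c * v)).
      have E v : d * v = c * (d / c * v) by field; rewrite lt_eqF.
      by split=> u v; rewrite E ltr_nM2l.
    by rewrite !R1 !R2 E1 E2.
  - have [R1 R2] : (forall u v, (c * u < d * v) = (u < d / c * v)) /\
       (forall u v, (d * v < c * u) = (d / c * v < u)).
      have E v : d * v = c * (d / c * v) by field; rewrite gt_eqF.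
      by split=> u v; rewrite E ltr_pM2l.
    by rewrite !R1 !R2 E1 E2.
have S c d : (c * x < d * x) = (c * y < d * y).
  rewrite -![_ * x < _]subr_lt0 -![_ * y < _]subr_lt0 -!mulrBl.
  case: (ltgtP x 0) X0 X1 => [hx|hx|hx] X0 X1.
  - by rewrite !nmulr_llt0 // -X1.
  - by rewrite !pmulr_llt0 // -X0.
  - have -> : y = 0 by case: (ltgtP y 0) X0 X1.
    by rewrite hx !mulr0.
have cases i : (i <= n.+1)%N -> i = 1%N \/ exists2 j, (j <= n)%N &
    forall z u, ext (z :: u) i = ext u j.
  case: i => [|[|i]] hi; [by right; exists 0%N | by left |].
  by right; exists i.+1.
move=> c d i j hc hd hi hj.
case: (cases i hi) => [->|[i' hi' Ei]]; case: (cases j hj) => [->|[j' hj' Ej]].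
- exact: S.
- by rewrite !Ej; have [] := K c d j' hc hd hj'.
- by rewrite !Ei; have [] := K d c i' hd hc hi'.
- by rewrite !Ei !Ej; apply: hab => //; exact: sC.
Qed.

Definition idx n := iota 0 n.+1.
Arguments idx : simpl never.

Lemma mem_idx n j : (j \in idx n) = (j <= n)%N.
Proof. by rewrite mem_iota. Qed.

Lemma same_extend C n (a b : seq rat) x : same (qclose C) n a b ->
  exists y, same C n.+1 (x :: a) (y :: b).
Proof.
move=> hab; pose L := [seq (r * ext a j, r * ext b j) | r <- ratios C, j <- idx n].
have sub : {subset ratios C <= qclose C}.
  by move=> c hc; rewrite inE mem_cat hc !orbT.
have [|y Hy] := @transfer_point L x.
  move=> p q /allpairsP[[r j] /= [hr hj ->]] /allpairsP[[r' j'] /= [hr' hj' ->]] /=.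
  by rewrite !mem_idx in hj hj'; apply: hab; rewrite ?sub.
exists y; apply: same_cons => // r j hr hj.
have := Hy (r * ext a j, r * ext b j); apply.
by apply/allpairsP; exists (r, j); rewrite mem_idx.
Qed.

Lemma mem2b (T : eqType) (c d : T) : d \in [:: c; d].
Proof. by rewrite !inE eqxx orbT. Qed.

(** Quantifier elimination in semantic form. A quantifier costs one application of [qclose]; its
    witness is transferred by [same_extend], in either direction by symmetry. *)
Lemma holds_same n (phi : formula n) : exists C, forall a b : n.-tuple rat,
  same C n a b -> (holds phi a <-> holds phi b).
Proof.
elim: phi => {n} /=.
- move=> n s t; have [c [i [hi Hs]]] := term_valueE s; have [d [j [hj Ht]]] := term_valueE t.
  exists [:: c; d] => a b h; rewrite !Hs !Ht.
  have h1 := h c d i j (mem_head _ _) (mem2b c d) hi hj.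
  have h2 := h d c j i (mem2b c d) (mem_head _ _) hj hi.
  by split=> e; move: h1 h2; rewrite e !ltxx; case: ltgtP.
- move=> n s t; have [c [i [hi Hs]]] := term_valueE s; have [d [j [hj Ht]]] := term_valueE t.
  exists [:: c; d] => a b h; rewrite !Hs !Ht.
  by rewrite (h c d i j (mem_head _ _) (mem2b c d) hi hj).
- by move=> n f [C H]; exists C => a b /H ->.
- move=> n f [C H] g [D H']; exists (C ++ D) => a b h.
  rewrite (H a b) ?(H' a b) //; apply: same_sub h => c hc; by rewrite mem_cat hc ?orbT.
- move=> n f [C H] g [D H']; exists (C ++ D) => a b h.
  rewrite (H a b) ?(H' a b) //; apply: same_sub h => c hc; by rewrite mem_cat hc ?orbT.
- move=> n f [C H]; exists (qclose C) => a b h.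
  split=> -[x hx].
    have [y hy] := same_extend x h; exists y.
    exact: (proj1 (H (cons_tuple x a) (cons_tuple y b) hy) hx).
  have [y hy] := same_extend x (same_sym h); exists y.
  exact: (proj1 (H (cons_tuple x b) (cons_tuple y a) hy) hx).
- move=> n f [C H]; exists (qclose C) => a b h.
  split=> hx x.
    have [y hy] := same_extend x (same_sym h).
    exact: (proj2 (H (cons_tuple x b) (cons_tuple y a) hy) (hx y)).
  have [y hy] := same_extend x h.
  exact: (proj2 (H (cons_tuple x a) (cons_tuple y b) hy) (hx y)).
Qed.

Definition signature (C : seq rat) n (a : seq rat) : seq bool :=
  [seq q.1.1 * ext a q.2.1 < q.1.2 * ext a q.2.2 | q <-
    [seq (p, r) | p <- [seq (c, d) | c <- C, d <- C],
                  r <- [seq (i, j) | i <- idx n, j <- idx n]]].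

Lemma signature_same C n a b : signature C n a = signature C n b <-> same C n a b.
Proof.
split=> [/eq_in_map h c d i j hc hd hi hj|h].
  apply: (h ((c, d), (i, j))); apply/allpairsP; exists ((c, d), (i, j)); split=> //.
    by apply/allpairsP; exists (c, d).
  by apply/allpairsP; exists (i, j); rewrite !mem_idx.
apply/eq_in_map => q /allpairsP[[p r] [hp hr ->]].
move: hp hr => /allpairsP[[c d] [hc hd ->]] /allpairsP[[i j] [hi hj ->]].
by rewrite !mem_idx in hi hj; exact: h.
Qed.

(** A pattern that is absent and a pattern with entry [None] both mean infinite cost. *)
Definition lookup (T : Type) (s : seq bool) (tbl : seq (seq bool * option T)) : option T :=
  head None [seq p.2 | p <- tbl & p.1 == s].

Definition desc_value (a : seq rat) (o : option (rat * nat)) : cost :=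
  omap (fun p => p.1 * ext a p.2) o.

(** The value of [F] is definable from the arguments, so it has to be one of the finitely many
    points [r x_j]; which one depends only on the sign pattern. *)
Lemma PLH_desc (F : cost_fun rat) : PLH F -> exists C, forall a : (arity F).-tuple rat,
  exists2 o, (if o is Some p then p.2 <= arity F else true)%N &
    forall b : (arity F).-tuple rat, same C (arity F) a b -> F b = desc_value b o.
Proof.
set n := arity F; case=> phi Hphi; have [C HC] := holds_same phi.
pose C' := qclose C; pose C2 := C' ++ [seq c * r | c <- qclose C', r <- ratios C].
exists (qclose C ++ qclose C2 ++ C2).
(* A value different from all points [r x_j] could be moved to a larger [y] in the same gap without
   changing the truth of [phi], and [F] would have two values at [a]. *)
have pt (a : n.-tuple rat) v : F a = Some v ->
    exists r j, [/\ r \in ratios C, (j <= n)%N & v = r * ext a j].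
  move=> Fa; apply: NNPP => no.
  pose P := [seq r * ext a j | r <- ratios C, j <- idx n].
  have vP p : p \in P -> p != v.
    move=> /allpairsP[[r j] /= [hr hj ->]]; apply/eqP => e; apply: no.
    by exists r, j; rewrite mem_idx in hj.
  have [|y [y1 y2]] := @exists_between (v :: [seq p <- P | p < v]) [seq p <- P | v < p].
    move=> p q; rewrite inE !mem_filter => /predU1P[->|/andP[h _]] /andP[h' _] //.
    exact: lt_trans h h'.
  have vy : v < y by apply: y1; rewrite mem_head.
  have /HC : same C n.+1 (cons_tuple v a) (cons_tuple y a).
    apply: same_cons => [c d i j *|r j hr hj] //.
    have hp : r * ext a j \in P by apply/allpairsP; exists (r, j); rewrite mem_idx.
    case: (ltgtP v (r * ext a j)) (vP _ hp) => // h _.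
    - have yp : y < r * ext a j by apply: y2; rewrite mem_filter h.
      by rewrite yp !ltNge (ltW yp).
    - have yp := lt_trans h vy; rewrite yp !ltNge (ltW yp); split=> //.
  rewrite Hphi Hphi Fa => -[/(_ erefl) [e] _]; by rewrite e ltxx in vy.
(* With the point [r x_j] as value coordinate, both extended tuples are again equivalent, so [phi]
   carries the same description over from [a] to [b]. *)
have tr (a b : n.-tuple rat) r j : same (qclose C ++ qclose C2 ++ C2) n a b ->
    r \in ratios C -> (j <= n)%N -> F a = Some (r * ext a j) -> F b = Some (r * ext b j).
  move=> h hr hj /Hphi hp; apply/Hphi; apply: (proj1 (HC (cons_tuple (r * ext a j) a) (cons_tuple (r * ext b j) b) _) hp).
  apply: same_cons; first by apply: same_sub h => c hc; rewrite mem_cat hc.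
  have hC2 s : s \in ratios C -> s \in qclose C ++ qclose C2 ++ C2.
    by move=> hs; rewrite mem_cat inE mem_cat hs !orbT.
  by move=> s k hs hk; split; apply: h => //; apply: hC2.
move=> a; case E: (F a) => [v|].
  have [r [j [hr hj ev]]] := pt a v E.
  exists (Some (r, j)) => // b h.
  by apply: (tr a b) => //; rewrite E ev.
exists None => // b h; case E' : (F b) => [v|] //.
have [r [j [hr hj ev]]] := pt b v E'; rewrite ev in E'.
by have := tr b a r j (same_sym h) hr hj E'; rewrite E.
Qed.

Fixpoint all_bits k : seq (seq bool) :=
  if k is k'.+1 then map (cons true) (all_bits k') ++ map (cons false) (all_bits k')
  else [:: [::]].

Lemma mem_all_bits s : s \in all_bits (size s).
Proof. by elim: s => //= -[] s IH; rewrite mem_cat map_f ?orbT. Qed.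

(** There are finitely many sign vectors; for each one that is realized by some tuple, a description
    at that tuple is entered. *)
Lemma PLH_table (F : cost_fun rat) : PLH F -> exists C tbl,
  (forall p o, (p, o) \in tbl -> if o is Some q then q.2 <= arity F else true)%N /\
  forall a : (arity F).-tuple rat,
    F a = desc_value a (lookup (signature C (arity F) a) tbl).
Proof.
move=> /PLH_desc[C HC]; set n := arity F in HC *.
have size_sig a : size (signature C n a) = (size C * size C * (n.+1 * n.+1))%N.
  by rewrite size_map !size_allpairs !size_iota.
suff [tbl [ht Ht]] : exists tbl,
   (forall p o, (p, o) \in tbl -> if o is Some q then q.2 <= n else true)%N /\
   forall a : n.-tuple rat, signature C n a \in all_bits (size C * size C * (n.+1 * n.+1)) ->
    F a = desc_value a (lookup (signature C n a) tbl).
  exists C, tbl; split=> // a; apply: Ht; rewrite -(size_sig a); exact: mem_all_bits.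
elim: (all_bits _) => [|s S [tbl [ht IH]]]; first by exists [::].
have [[a ea]|no] := classic (exists a : n.-tuple rat, signature C n a = s).
  have [o ho Ho] := HC a; exists ((s, o) :: tbl); split.
    move=> p o'; rewrite inE => /orP[|]; last exact: ht.
    by rewrite xpair_eqE => /andP[_ /eqP e]; rewrite e; case: (o) ho.
  move=> b; rewrite inE /lookup /=; case: (eqVneq s) => [e _|ne] /=.
    by apply: Ho; apply/signature_same; rewrite ea.
  by move=> /IH.
exists tbl; split=> // b; rewrite inE => /predU1P[e|/IH //].
by case: no; exists b.
Qed.

Local Close Scope ring_scope.

(** * Sampling *)

Local Open Scope ring_scope.

Lemma exists_argmin (T : eqType) (f : T -> rat) (l : seq T) : l != [::] ->
  exists2 x, x \in l & forall y, y \in l -> f x <= f y.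
Proof.
elim: l => // a l IH _; have [->|ne] := eqVneq l [::].
  by exists a; rewrite ?mem_head // => y; rewrite inE => /eqP ->.
have [x xl hx] := IH ne; have [h|h] := leP (f a) (f x).
  exists a; rewrite ?mem_head // => y; rewrite inE => /predU1P[->//|/hx].
  exact: le_trans h.
exists x; first by rewrite inE xl orbT.
by move=> y; rewrite inE => /predU1P[->|/hx //]; exact: ltW.
Qed.

(** * Vertices of systems of homogeneous constraints in two variables *)

Section Tightening.

Variables (J : finType) (star : J) (G : seq (J * J * rat)) (w : J -> rat).

Hypothesis Gpos : forall i j g, (i, j, g) \in G -> 0 < g.
Hypothesis Gup : forall i, exists g, (i, star, g) \in G.
Hypothesis Gdn : forall i, exists g, (star, i, g) \in G.

(** An entry [(i, j, g)] is the constraint [b i <= g * b j]. For positive values, logarithms turn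
    such constraints into difference constraints, and scaling a component corresponds to a shift. *)
Definition feasible (b : J -> rat) :=
  [/\ b star = 1, forall i, 0 < b i & forall i j g, (i, j, g) \in G -> b i <= g * b j].

Definition tight (b : J -> rat) : rel J := fun i j =>
  has (fun c => (c.1 == (i, j)) && (b i == c.2 * b j)) G ||
  has (fun c => (c.1 == (j, i)) && (b j == c.2 * b i)) G.

Lemma tight_sym b : symmetric (tight b).
Proof. by move=> i j; rewrite /tight orbC. Qed.

Lemma tightP b i j : reflect (exists g, ((i, j, g) \in G /\ b i = g * b j) \/
    ((j, i, g) \in G /\ b j = g * b i)) (tight b i j).
Proof.
apply: (iffP orP) => [[]/hasP[[[x y] g] hg /= /andP[/eqP[ex ey] /eqP e]]|[g [[hg e]|[hg e]]]].
- by exists g; left; rewrite -ex -ey; split=> //; rewrite ex ey.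
- by exists g; right; rewrite -ex -ey; split=> //; rewrite ex ey.
- by left; apply/hasP; exists (i, j, g) => //=; rewrite e !eqxx.
- by right; apply/hasP; exists (j, i, g) => //=; rewrite e !eqxx.
Qed.

Definition lcost (b : J -> rat) := \sum_i w i * b i.

Definition stretch (K : {set J}) t (b : J -> rat) i := if i \in K then t * b i else b i.

Lemma lcost_scale K t b :
  lcost (stretch K t b) = lcost b + (t - 1) * \sum_(i in K) w i * b i.
Proof.
rewrite /lcost (bigID (mem K)) /= [in RHS](bigID (mem K)) /= mulrBl mul1r mulr_sumr.
under [X in X + _ = _]eq_bigr => i hi do rewrite /stretch hi mulrCA.
under [X in _ + X = _]eq_bigr => i hi do rewrite /stretch (negbTE hi).
ring.
Qed.

(** The measure that makes [tighten] terminate. *)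
Definition nconn b := #|[set p : J * J | connect (tight b) p.1 p.2]|.

(* Scale a component of tight constraints that avoids [star], in the direction that does
   not increase the cost, until some constraint leaving the component becomes tight. *)
Lemma tighten_step b i0 : feasible b -> ~~ connect (tight b) star i0 ->
  exists b', [/\ feasible b', lcost b' <= lcost b & (nconn b < nconn b')%N].
Proof.
move=> [b1 bp bG] ni; pose K := [set j | connect (tight b) i0 j].
have csym := sym_connect_sym (@tight_sym b).
have sK : star \notin K by rewrite inE csym.
have iK : i0 \in K by rewrite inE connect0.
have cl x y : tight b x y -> (x \in K) = (y \in K).
  move=> h; rewrite !inE; apply/idP/idP => h'; apply: connect_trans h' _; apply: connect1 => //.
  by rewrite tight_sym.
(* No tight constraint crosses the border of [K], so all of them survive the scaling of [K]; a new
   tight one across the border connects further pairs. *)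
have fin t x y : 0 < t -> feasible (stretch K t b) -> tight (stretch K t b) x y ->
    (x \in K) != (y \in K) -> (t - 1) * \sum_(i in K) w i * b i <= 0 ->
    exists b', [/\ feasible b', lcost b' <= lcost b & (nconn b < nconn b')%N].
  move=> t0 fs txy nK le0; exists (stretch K t b); split=> //.
    by rewrite lcost_scale; lra.
  apply: proper_card; apply/properP; split.
    apply/subsetP => -[u v]; rewrite !inE /=; apply: connect_sub u v => u v uv.
    apply: connect1; apply/tightP; have e := cl _ _ uv.
    case/tightP: uv => g [[hg E]|[hg E]]; exists g; [left|right]; split=> //;
      rewrite /stretch e; case: ifP => // _; rewrite E; ring.
  exists (x, y); rewrite !inE /=; first exact: connect1.
  apply/negP => cxy; move: nK; rewrite !inE.
  by rewrite (same_connect_r csym cxy) eqxx.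
(* The cost grows with the scale of [K], so [K] is shrunk. The constraints entering [K] bound the
   factor from below, and the largest bound becomes tight first; [Gdn] provides one. *)
have [s0|s0] := leP 0 (\sum_(i in K) w i * b i).
  pose L := [seq c <- G | (c.1.1 \notin K) && (c.1.2 \in K)].
  pose rho (c : J * J * rat) := b c.1.1 / (c.2 * b c.1.2).
  have [|[[x y] g] cL hc] := @exists_argmin _ (fun c => - rho c) L.
    have [g hg] := Gdn i0; apply/eqP => e0.
    have : (star, i0, g) \in L by rewrite mem_filter /= sK iK.
    by rewrite e0.
  move: (cL); rewrite mem_filter /= => /andP[/andP[xK yK] hg].
  have gp := Gpos hg; have xp := bp x; have yp := bp y.
  have gy : 0 < g * b y by rewrite mulr_gt0.
  pose t := rho (x, y, g).
  have et : t * (g * b y) = b x by rewrite /t /rho /= mulfVK // gt_eqF.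
  have t0 : 0 < t by rewrite divr_gt0.
  have t1 : t < 1.
    rewrite /t /rho /= ltr_pdivrMr // mul1r lt_neqAle bG // andbT; apply/eqP => e.
    have : tight b x y by apply/tightP; exists g; left.
    by move/cl; rewrite yK (negbTE xK).
  apply: (fin t x y) => //.
  - split; first by rewrite /stretch (negbTE sK).
      by move=> i; rewrite /stretch; case: ifP => _; [apply: mulr_gt0 => //; exact: bp | exact: bp].
    move=> i j h hh; have hp := Gpos hh; have ip := bp i; have jp := bp j; have le := bG _ _ _ hh.
    rewrite /stretch; case: ifP => iK'; case: ifP => jK' //.
    + by rewrite mulrCA ler_pM2l.
    + by apply: le_trans le; rewrite ler_piMl // ltW.
    + have : (i, j, h) \in L by rewrite mem_filter /= iK' jK'.
      move/hc; rewrite lerN2 -/t /rho /= ler_pdivrMr ?mulr_gt0 //.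
      by move=> hle; apply: le_trans hle _; rewrite mulrCA.
  - apply/tightP; exists g; left; split=> //; rewrite /stretch yK (negbTE xK) -et; ring.
  - by rewrite yK (negbTE xK).
  - by rewrite nmulr_rle0 // subr_lt0.
(* Here [K] is enlarged. The constraints leaving [K] bound the factor from above, and the smallest
   bound becomes tight first; [Gup] provides one. *)
pose L := [seq c <- G | (c.1.1 \in K) && (c.1.2 \notin K)].
pose rho (c : J * J * rat) := c.2 * b c.1.2 / b c.1.1.
have [|[[x y] g] cL hc] := @exists_argmin _ rho L.
  have [g hg] := Gup i0; apply/eqP => e0.
  have : (i0, star, g) \in L by rewrite mem_filter /= sK iK.
  by rewrite e0.
move: (cL); rewrite mem_filter /= => /andP[/andP[xK yK] hg].
have gp := Gpos hg; have xp := bp x; have yp := bp y.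
pose t := rho (x, y, g).
have et : t * b x = g * b y by rewrite /t /rho /= mulfVK // gt_eqF.
have t1 : 1 < t.
  rewrite /t /rho /= ltr_pdivlMr // mul1r lt_neqAle bG // andbT; apply/eqP => e.
  have : tight b x y by apply/tightP; exists g; left.
  by move/cl; rewrite xK (negbTE yK).
have t0 : 0 < t by lra.
apply: (fin t x y) => //.
- split; first by rewrite /stretch (negbTE sK).
    by move=> i; rewrite /stretch; case: ifP => _; [apply: mulr_gt0 => //; exact: bp | exact: bp].
  move=> i j h hh; have hp := Gpos hh; have ip := bp i; have jp := bp j; have le := bG _ _ _ hh.
  rewrite /stretch; case: ifP => iK'; case: ifP => jK' //.
  + by rewrite mulrCA ler_pM2l.
  + have : (i, j, h) \in L by rewrite mem_filter /= iK' jK'.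
    by move/hc; rewrite -/t /rho /= ler_pdivlMr.
  + apply: le_trans le _; rewrite mulrCA ler_peMl ?mulr_ge0 ?ltW //.
- apply/tightP; exists g; left; split=> //; rewrite /stretch xK (negbTE yK) -et; ring.
- by rewrite xK (negbTE yK).
- by rewrite pmulr_rle0 ?subr_gt0 // ltW.
Qed.

Lemma tighten b : feasible b -> exists b', [/\ feasible b', lcost b' <= lcost b &
  forall i, connect (tight b') star i].
Proof.
move: {2}(#|{: J * J}| - nconn b)%N (leqnn (#|{: J * J}| - nconn b)) => k.
elim: k b => [|k IH] b hk fb.
all: have [/forallP all|] := boolP [forall i, connect (tight b) star i]; first by exists b.
all: rewrite negb_forall => /existsP[i0 ni].
all: have [b' [f1 c1 n1]] := tighten_step fb ni.
all: have mc : (nconn b' <= #|{: J * J}|)%N := max_card _.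
  by lia.
have [|b2 [f2 c2 a2]] := IH b' _ f1; first by lia.
by exists b2; split=> //; exact: le_trans c1.
Qed.

(** Along a tight edge the value is multiplied by [g] or by its inverse. A path without repetition
    has fewer edges than there are variables. *)
Lemma connect_product b i : feasible b -> connect (tight b) star i ->
  exists fs : seq rat, [/\ (size fs < #|J|)%N, b i = \prod_(f <- fs) f &
    forall f, f \in fs -> exists x y g, (x, y, g) \in G /\ (f = g \/ f = g^-1)].
Proof.
move=> [b1 bp bG] /connectP[p pp ->]; case/shortenP: pp => q pq uq _ {p}.
have sq : (size q < #|J|)%N.
  by have := max_card (mem (star :: q)); rewrite (card_uniqP uq).
have H x : path (tight b) x q -> exists fs : seq rat, [/\ size fs = size q,
    b (last x q) = b x * \prod_(f <- fs) f &
    forall f, f \in fs -> exists x y g, (x, y, g) \in G /\ (f = g \/ f = g^-1)].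
  elim: q {pq uq sq} x => [|y q IH] x /=; first by exists [::]; rewrite big_nil mulr1.
  move=> /andP[txy /IH[fs [s1 e1 a1]]].
  have [f ef [u [v [g [hg hf]]]]] : exists2 f, b y = b x * f &
      exists x y g, (x, y, g) \in G /\ (f = g \/ f = g^-1).
    case/tightP: txy => g [[hg e]|[hg e]].
      exists g^-1; last by exists x, y, g; split=> //; right.
      by rewrite e mulrAC mulfV ?mul1r // gt_eqF //; exact: Gpos hg.
    by exists g; [rewrite e mulrC | exists y, x, g; split=> //; left].
  exists (f :: fs); rewrite /= s1 big_cons e1 ef mulrA; split=> // f'.
  by rewrite inE => /predU1P[->|/a1 //]; exists u, v, g.
have [fs [s1 e1 a1]] := H star pq.
by exists fs; rewrite s1 e1 b1 mul1r.
Qed.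

End Tightening.

(** * Signs of integer polynomials at large arguments *)

Section IntegerPolynomials.

(** Used through [P.[1]], which then bounds the sum of the absolute values of the coefficients of
    [p] and is easily computed for sums and products. *)
Definition majorizes (P p : {poly int}) := forall i, `|p`_i| <= P`_i.

Lemma majorizesD P Q p q : majorizes P p -> majorizes Q q -> majorizes (P + Q) (p + q).
Proof. by move=> h1 h2 i; rewrite !coefD; apply: le_trans (ler_normD _ _) (lerD (h1 i) (h2 i)). Qed.

Lemma majorizesM P Q p q : majorizes P p -> majorizes Q q -> majorizes (P * Q) (p * q).
Proof.
move=> h1 h2 i; rewrite !coefM; apply: le_trans (ler_norm_sum _ _ _) _.
by apply: ler_sum => j _; rewrite normrM; apply: ler_pM.
Qed.

Lemma majorizesC c : majorizes `|c|%:P c%:P.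
Proof. by move=> i; rewrite !coefC; case: ifP => // _; rewrite normr0. Qed.

Lemma majorizesX k : majorizes 'X^k 'X^k.
Proof. by move=> i; rewrite coefXn; case: (i == k). Qed.

Lemma majorizesXn P p k : majorizes P p -> majorizes (P ^+ k) (p ^+ k).
Proof.
move=> h; elim: k => [|k IH]; last by rewrite !exprS; exact: majorizesM.
by rewrite !expr0; have := @majorizesC 1; rewrite normr1.
Qed.

Lemma majorizes_sum (I : Type) (r : seq I) (P p : I -> {poly int}) :
  (forall i, majorizes (P i) (p i)) ->
  majorizes (\sum_(i <- r) P i) (\sum_(i <- r) p i).
Proof.
move=> h; elim: r => [|a r IH]; first by rewrite !big_nil => i; rewrite coef0 normr0.
by rewrite !big_cons; exact: majorizesD.
Qed.

(** Beyond the sum of the absolute values of all coefficients the leading term dominates, since a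
    nonzero integer leading coefficient is at least 1 in absolute value. Hence all larger [R] agree
    on the sign. *)
Lemma sgz_horner (P p : {poly int}) (R : int) : majorizes P p -> P.[1] < R ->
  sgz p.[R] = sgz (lead_coef p).
Proof.
move=> h hR; have P0 i : 0 <= P`_i by apply: le_trans (h i).
have hN : \sum_(i < size p) `|p`_i| <= P.[1].
  rewrite horner_coef; under [X in _ <= X]eq_bigr => i _ do rewrite expr1n mulr1.
  rewrite (big_ord_widen (maxn (size p) (size P)) (fun i => `|p`_i|)) ?leq_maxl //.
  rewrite (big_ord_widen (maxn (size p) (size P)) (fun i => P`_i)) ?leq_maxr //.
  rewrite [X in X <= _]big_mkcond [X in _ <= X]big_mkcond /=; apply: ler_sum => i _.
  case: ifP => // hi; case: ifP => // hi'.
  by apply: le_trans (h i) _; rewrite nth_default // leqNgt hi'.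
have R0 : 0 < R by apply: le_lt_trans hR; apply: le_trans hN; apply: sumr_ge0.
have {hN} hN := le_lt_trans hN hR.
rewrite horner_coef lead_coefE; case: (posnP (size p)) => [s0|].
  by rewrite s0 big_ord0 nth_default ?s0.
have : (size p != 0)%N -> p`_(size p).-1 != 0.
  by move=> s0; rewrite -lead_coefE lead_coef_eq0 -size_poly_eq0.
case: (size p) hN => // d; rewrite !big_ord_recr /= => hN /(_ isT) l0 _.
set l := p`_d in hN l0 *.
have l1 : 1 <= `|l| by rewrite -gtz0_ge1 normr_gt0.
have Rd k : 0 < R ^+ k by rewrite exprn_gt0.
have sR : sgz (l * R ^+ d) = sgz l by rewrite sgzM [sgz (R ^+ d)]gtr0_sgz // mulr1.
rewrite -[RHS]sR; set s := \sum_(i < d) _.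
suff : `|s| < `|l * R ^+ d| by move: (l * R ^+ d) s => {}b {}s; lia.
rewrite normrM (gtr0_norm (Rd d)); case: d @s l hN l0 l1 sR => [|k] s l hN l0 l1 sR.
  by rewrite /s big_ord0 normr0 expr0 mulr1 normr_gt0.
have hs : `|s| <= (\sum_(i < k.+1) `|p`_i|) * R ^+ k.
  rewrite mulr_suml; apply: le_trans (ler_norm_sum _ _ _) _; apply: ler_sum => i _.
  rewrite normrM; apply: ler_wpM2l => //; rewrite (gtr0_norm (Rd i)).
  by apply: ler_weXn2l; [lia | exact: leq_ord].
apply: le_lt_trans hs _; rewrite exprS mulrA ltr_pM2r //.
by move: (\sum_(i < k.+1) _) `|l| hN l1 => S L; nia.
Qed.

End IntegerPolynomials.

(** * The sample of polynomially many values *)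

Section Sample.

Variable CZ : seq int.
Variable n : nat.

Definition nzabs := [seq `|c|%N | c <- CZ & c != 0].

(* The pair (p, q) stands for the ratio p / q. *)
Definition ratio_list : seq (nat * nat) := [seq (p, q) | p <- nzabs, q <- nzabs].

Definition rho (p : nat * nat) : rat := p.1%:R / p.2%:R.

Fixpoint monomials k (l : seq (nat * nat)) : seq rat :=
  if l is p :: l' then [seq rho p ^+ m * x | m <- iota 0 k.+1, x <- monomials k l'] else [:: 1].

Fixpoint int_monomials (l : seq (nat * nat)) : seq nat :=
  if l is p :: l' then
    [seq (p.1 ^ m * p.2 ^ (n - m) * x)%N | m <- iota 0 n.+1, x <- int_monomials l'] else [:: 1%N].

Fixpoint denominator (l : seq (nat * nat)) : nat :=
  if l is p :: l' then (p.2 ^ n * denominator l')%N else 1%N.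

Fixpoint monomial_bound (l : seq (nat * nat)) : nat :=
  if l is p :: l' then ((p.1 * p.2) ^ n * monomial_bound l')%N else 1%N.

(** The scaled image of the constant 1. A coordinate is a monomial in the ratios times powers of
    [(R - 1) / R] and of [R], with exponents between [- n] and [n]. The factors clear the
    denominators of the monomial, the powers of [R - 1], and those of [R], to which both kinds of
    powers contribute. *)
Definition unit_value (R : nat) : int :=
  (denominator ratio_list * (R.-1 ^ n * R ^ (2 * n)))%N.

Definition sample_abs (R : nat) : seq nat :=
  [seq (K * (R.-1 ^ ab.1 * R ^ ab.2))%N | K <- int_monomials ratio_list,
     ab <- [seq (a, b) | a <- iota 0 (2 * n).+1, b <- iota 0 (4 * n).+1]].

Definition sample (R : nat) : seq int :=
  0 :: map Posz (sample_abs R) ++ map (fun v => - Posz v) (sample_abs R).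

Definition pos_list (l : seq (nat * nat)) := all (fun p => (0 < p.1) && (0 < p.2))%N l.

Lemma ratio_list_pos : pos_list ratio_list.
Proof.
have h x : x \in nzabs -> (0 < x)%N.
  by case/mapP=> c; rewrite mem_filter => /andP[c0 _] ->; rewrite absz_gt0.
by apply/allP => -[p q] /allpairsP[[u v] /= [/h hu /h hv [-> ->]]]; rewrite hu hv.
Qed.

Lemma ratio_list_sym p : p \in ratio_list -> (p.2, p.1) \in ratio_list.
Proof. by case/allpairsP=> -[u v] /= [hu hv ->]; apply/allpairsP; exists (v, u). Qed.

Lemma rho_inv p : (rho p)^-1 = rho (p.2, p.1).
Proof. by rewrite /rho invf_div. Qed.

Lemma monomials_mono k l : {subset monomials k l <= monomials k.+1 l}.
Proof.
elim: l => // p l IH x /allpairsP[[m y] [hm hy ->]].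
rewrite mem_iota in hm; apply/allpairsP; exists (m, y); split=> //; last exact: IH.
by rewrite mem_iota /=; exact: leqW.
Qed.

Lemma monomials1 k l : 1 \in monomials k l.
Proof.
elim: l => // p l IH; apply/allpairsP.
by exists (0%N, 1); rewrite mem_iota expr0 mul1r.
Qed.

Lemma monomials_mul k l p x : p \in l -> x \in monomials k l -> rho p * x \in monomials k.+1 l.
Proof.
elim: l x => // q l IH x; rewrite inE => hp /allpairsP[[m y] [hm hy ->]].
rewrite mem_iota in hm.
have /orP[/eqP ->|pl] := hp.
  apply/allpairsP; exists (m.+1, y); rewrite mem_iota; split=> //; first exact: monomials_mono.
  by rewrite /= exprS mulrA.
apply/allpairsP; exists (m, rho p * y); split; last by rewrite /= mulrCA.
  by rewrite mem_iota /=; exact: leqW.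
exact: IH.
Qed.

Lemma monomials_int k l x : pos_list l -> (k <= n)%N -> x \in monomials k l ->
  exists2 K, K \in int_monomials l & K%:R = x * (denominator l)%:R.
Proof.
move=> + kn; elim: l x => [|p l IH] x.
  by move=> _; rewrite inE => /eqP ->; exists 1%N; rewrite ?inE // mulr1.
move=> /andP[/andP[p1 p2] hl] /allpairsP[[m y] [hm hy ->]].
have [K hK eK] := IH y hl hy; rewrite mem_iota in hm.
have mn : (m <= n)%N by case/andP: hm => _; rewrite add0n ltnS => h; exact: leq_trans h kn.
exists (p.1 ^ m * p.2 ^ (n - m) * K)%N.
  by apply/allpairsP; exists (m, K); rewrite mem_iota; split=> //; lia.
rewrite [denominator _]/= !natrM eK /rho expr_div_n !natrX.
have -> : (p.2%:R : rat) ^+ n = p.2%:R ^+ m * p.2%:R ^+ (n - m) by rewrite -exprD subnKC.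
rewrite [(m, y).1]/= [(m, y).2]/=; field; rewrite expf_neq0 // pnatr_eq0; lia.
Qed.

Lemma int_monomials_bound l K : pos_list l -> K \in int_monomials l ->
  (0 < K <= monomial_bound l)%N.
Proof.
elim: l K => [|p l IH] K; first by move=> _; rewrite inE => /eqP ->.
move=> /andP[/andP[p1 p2] hl] /allpairsP[[m y] [hm hy ->]].
have /andP[y0 hK] := IH y hl hy; rewrite mem_iota in hm; rewrite [monomial_bound _]/= [(m, y).1]/= [(m, y).2]/=.
rewrite !muln_gt0 !expn_gt0 p1 p2 y0 /=; apply: leq_mul => //.
by rewrite expnMn; apply: leq_mul; rewrite leq_pexp2l //; lia.
Qed.

Lemma denominator_mem l : denominator l \in int_monomials l.
Proof.
elim: l => // p l IH; apply/allpairsP.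
by exists (0%N, denominator l); rewrite mem_iota expn0 mul1n subn0.
Qed.

Definition factor (eta R f : rat) := exists2 p, p \in ratio_list &
  [\/ f = rho p, f = eta * rho p | f = rho p / eta] \/ f = R \/ f = R^-1.

(** Positive and negative powers are counted separately to keep the exponents natural numbers. *)
Lemma factor_product (eta R : rat) fs : eta != 0 -> R != 0 ->
  (forall f, f \in fs -> factor eta R f) ->
  exists x e1 e2 d1 d2, [/\ x \in monomials (size fs) ratio_list,
    [/\ (e1 <= size fs)%N, (e2 <= size fs)%N, (d1 <= size fs)%N & (d2 <= size fs)%N] &
    \prod_(f <- fs) f = x * (eta ^+ e1 / eta ^+ e2) * (R ^+ d1 / R ^+ d2)].
Proof.
move=> h0 R0; elim: fs => [|f fs IH] hf.
  exists 1, 0%N, 0%N, 0%N, 0%N; rewrite big_nil; split=> //.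
  exact: monomials1.
have [|x [e1 [e2 [d1 [d2 [hx [l1 l2 l3 l4] E]]]]]] := IH.
  by move=> g hg; apply: hf; rewrite inE hg orbT.
have hx' := monomials_mono hx.
have [p hp hf'] := hf f (mem_head _ _); rewrite big_cons E.
have hpx := monomials_mul hp hx.
have en k : eta ^+ k != 0 by rewrite expf_neq0.
have rn k : R ^+ k != 0 by rewrite expf_neq0.
case: hf' => [[]|[]] ->.
- exists (rho p * x), e1, e2, d1, d2; split=> //; first by split; exact: leqW.
  by rewrite !mulrA.
- exists (rho p * x), e1.+1, e2, d1, d2; split=> //; first by split=> //; exact: leqW.
  by rewrite exprS; field; rewrite en rn.
- exists (rho p * x), e1, e2.+1, d1, d2; split=> //; first by split=> //; exact: leqW.
  by rewrite exprS; field; rewrite en rn h0.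
- exists x, e1, e2, d1.+1, d2; split=> //; first by split=> //; exact: leqW.
  by rewrite exprS; field; rewrite en rn.
- exists x, e1, e2, d1, d2.+1; split=> //; first by split=> //; exact: leqW.
  by rewrite exprS; field; rewrite en rn R0.
Qed.

Lemma monomial_value (R : nat) x e1 e2 d1 d2 k : (1 < R)%N -> (k <= n)%N ->
  x \in monomials k ratio_list -> [/\ (e1 <= k)%N, (e2 <= k)%N, (d1 <= k)%N & (d2 <= k)%N] ->
  exists K a b, [/\ K \in int_monomials ratio_list, (a <= 2 * n)%N, (b <= 4 * n)%N &
   x * ((R.-1%:R / R%:R) ^+ e1 / (R.-1%:R / R%:R) ^+ e2) * (R%:R ^+ d1 / R%:R ^+ d2) *
     (unit_value R)%:~R = (K * (R.-1 ^ a * R ^ b))%:R :> rat].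
Proof.
move=> R1 kn hx [l1 l2 l3 l4].
have [K hK eK] := monomials_int ratio_list_pos kn hx.
exists K, (n + e1 - e2)%N, (2 * n + d1 + e2 - (d2 + e1))%N; split=> //; try lia.
rewrite /unit_value -pmulrn !natrM !natrX eK.
have P0 : (R.-1%:R : rat) != 0 by rewrite pnatr_eq0; lia.
have R0 : (R%:R : rat) != 0 by rewrite pnatr_eq0; lia.
have B (y : rat) u v : y != 0 -> (v <= u)%N -> y ^+ (u - v) = y ^+ u / y ^+ v.
  by move=> y0 vu; rewrite -[in RHS](subnK vu) exprD mulfK // expf_neq0.
rewrite !B //; try lia.
rewrite !expr_div_n !exprD.
have Pk j : (R.-1%:R : rat) ^+ j != 0 by rewrite expf_neq0.
have Rk j : (R%:R : rat) ^+ j != 0 by rewrite expf_neq0.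
by field; rewrite !Pk !Rk.
Qed.

Lemma exists_nat_ge (l : seq rat) : exists N : nat, forall x, x \in l -> x <= N%:R.
Proof.
elim: l => [|a l [N hN]]; first by exists 0%N.
exists (N + Num.bound `|a|)%N => x; rewrite inE natrD => /predU1P[->|/hN h].
  apply: le_trans (ler_norm a) _; apply: le_trans (ltW (archi_boundP (normr_ge0 a))) _.
  by rewrite lerDr.
by apply: le_trans h _; rewrite lerDl.
Qed.

(** If [c] and [d] differ in sign or one of them vanishes, the signs alone decide; otherwise [x] is
    compared with a positive multiple of [y]. *)
Lemma cmp_transfer (c d x y x' y' : rat) : 0 < x -> 0 < y -> 0 < x' -> 0 < y' ->
  (c != 0 -> d != 0 -> (x < `|d| / `|c| * y) = (x' < `|d| / `|c| * y') /\
     (`|d| / `|c| * y < x) = (`|d| / `|c| * y' < x')) ->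
  (c * x < d * y) = (c * x' < d * y').
Proof.
move=> x0 y0 x'0 y'0 H.
have cn u v : c < 0 -> d < 0 -> (c * u < d * v) = (`|d| / `|c| * v < u).
  move=> c0 d0; rewrite -[RHS](ltr_nM2l c0) !ltr0_norm //.
  by congr (_ < _); field; rewrite lt_eqF.
have cp u v : 0 < c -> 0 < d -> (c * u < d * v) = (u < `|d| / `|c| * v).
  move=> c0 d0; rewrite -[RHS](ltr_pM2l c0) !gtr0_norm //.
  by congr (_ < _); field; rewrite gt_eqF.
have [c0|c0|->] := ltgtP c 0; have [d0|d0|->] := ltgtP d 0; rewrite ?mul0r ?ltxx //.
- by rewrite !cn //; have [] := H (ltr0_neq0 c0) (ltr0_neq0 d0).
- have t u v : 0 < u -> 0 < v -> c * u < d * v.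
    by move=> u0 v0; apply: (@lt_trans _ _ 0); rewrite ?nmulr_rlt0 ?mulr_gt0.
  by rewrite !t.
- by rewrite !nmulr_rlt0 // x0 x'0.
- have t u v : 0 < u -> 0 < v -> (c * u < d * v) = false.
    move=> u0 v0; apply/negbTE; rewrite -leNgt ltW //.
    by apply: (@lt_trans _ _ 0); rewrite ?nmulr_rlt0 ?mulr_gt0.
  by rewrite !t.
- by rewrite !cp //; have [] := H (lt0r_neq0 c0) (lt0r_neq0 d0).
- by rewrite !pmulr_rlt0 // !ltNge !ltW.
- by rewrite !nmulr_rgt0 // !ltNge !ltW.
- by rewrite !pmulr_rgt0 // y0 y'0.
Qed.

Hypothesis CZ1 : 1 \in CZ.

Lemma ratio_list11 : (1%N, 1%N) \in ratio_list.
Proof.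
have h : 1%N \in nzabs by apply/mapP; exists 1 => //; rewrite mem_filter.
by apply/allpairsP; exists (1%N, 1%N).
Qed.

Lemma ratio_listP c d : c \in CZ -> d \in CZ -> c != 0 -> d != 0 ->
  (`|d|%N, `|c|%N) \in ratio_list.
Proof.
move=> hc hd c0 d0; apply/allpairsP; exists (`|d|%N, `|c|%N).
by split=> //; apply/mapP; [exists d | exists c]; rewrite ?mem_filter ?c0 ?d0.
Qed.

Section RationalSolution.

Variables (beta : 'I_n.+1 -> rat) (wr : 'I_n.+1 -> rat).
Hypotheses (beta0 : beta ord0 = 1) (beta_gt0 : forall i, 0 < beta i).

(* Strict inequalities are tightened by the factor 1 - 1/R, and 1/R and R bound all
   variables; every large R leaves [beta] feasible. *)
Lemma symbolic_solution : exists N : nat, forall R : nat, (N < R)%N ->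
  exists b : 'I_n.+1 -> rat,
  [/\ b ord0 = 1, forall i, 0 < b i,
    \sum_i wr i * b i <= \sum_i wr i * beta i,
    (forall i j p, p \in ratio_list -> (beta i < rho p * beta j) = (b i < rho p * b j) /\
       (rho p * beta j < beta i) = (rho p * b j < b i)) &
    forall i, exists K ab, [/\ K \in int_monomials ratio_list, (ab.1 <= 2 * n)%N,
      (ab.2 <= 4 * n)%N &
      b i * (unit_value R)%:~R = (K * (R.-1 ^ ab.1 * R ^ ab.2))%:R]].
Proof.
pose J := 'I_n.+1.
pose T := [seq (x, p) | x <- enum {: J * J}, p <- ratio_list].
have rp p : p \in ratio_list -> 0 < rho p.
  by move=> hp; have /allP/(_ p hp)/andP[p1 p2] := ratio_list_pos; rewrite divr_gt0 ?ltr0n.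
have TP i j p : ((i, j), p) \in T = (p \in ratio_list).
  apply/allpairsP/idP => [[[x q] /= [_ hq [_ ->]]] //|hp].
  by exists ((i, j), p); rewrite mem_enum.
(* For [y = rho p * beta j], the tightened constraint [beta i <= (1 - 1/R) y] holds as soon as
   [R >= y / (y - beta i)]. *)
pose gap (x : J * J * (nat * nat)) :=
  rho x.2 * beta x.1.2 / (rho x.2 * beta x.1.2 - beta x.1.1).
have [N hN] := exists_nat_ge ([seq beta i | i <- enum J] ++ [seq (beta i)^-1 | i <- enum J]
  ++ [seq gap x | x <- T]).
exists N.+2 => R1 hR.
have R1p : 0 < R1%:R :> rat by rewrite ltr0n; lia.
have NR : N%:R <= R1%:R :> rat by rewrite ler_nat; lia.
pose eta : rat := R1.-1%:R / R1%:R.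
have eta1 : eta = 1 - R1%:R^-1.
  rewrite /eta -subn1 natrB; last by lia.
  by rewrite mulrBl divff ?gt_eqF // div1r.
have eta0 : 0 < eta by rewrite divr_gt0 // ltr0n; lia.
have etalt : eta < 1 by rewrite eta1 ltrBlDr ltrDl invr_gt0.
(* Strict comparisons are tightened by [eta], equalities appear as they are. The last two groups
   link every variable to coordinate 0 in both directions, as [tighten] requires. *)
pose G : seq (J * J * rat) :=
  [seq (x.1, eta * rho x.2) | x <- T & beta x.1.1 < rho x.2 * beta x.1.2] ++
  [seq (x.1, rho x.2) | x <- T & beta x.1.1 == rho x.2 * beta x.1.2] ++
  [seq (i, ord0, R1%:R) | i <- enum J] ++ [seq (ord0, i, R1%:R) | i <- enum J].
have GP i j g : (i, j, g) \in G -> [\/ exists2 p, p \in ratio_list &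
     g = eta * rho p /\ beta i < rho p * beta j,
     exists2 p, p \in ratio_list & g = rho p /\ beta i = rho p * beta j |
     g = R1%:R /\ (j = ord0 \/ i = ord0)].
  rewrite !mem_cat => /or4P[] /mapP[].
  - move=> [[u v] p]; rewrite mem_filter TP /= => /andP[h hp] [-> -> ->].
    by constructor 1; exists p.
  - move=> [[u v] p]; rewrite mem_filter TP /= => /andP[/eqP h hp] [-> -> ->].
    by constructor 2; exists p.
  - by move=> x _ [_ -> ->]; constructor 3; split=> //; left.
  - by move=> x _ [-> _ ->]; constructor 3; split=> //; right.
have G1 i j p : p \in ratio_list -> beta i < rho p * beta j -> (i, j, eta * rho p) \in G.
  move=> hp h; rewrite mem_cat; apply/orP; left; apply/mapP; exists ((i, j), p) => //.
  by rewrite mem_filter /= h TP.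
have G2 i j p : p \in ratio_list -> beta i = rho p * beta j -> (i, j, rho p) \in G.
  move=> hp h; rewrite !mem_cat; apply/or3P; constructor 2; apply/mapP; exists ((i, j), p) => //.
  by rewrite mem_filter /= -h eqxx TP.
have G3 i : (i, ord0, R1%:R) \in G.
  rewrite !mem_cat; apply/or4P; constructor 3; apply/mapP; exists i; by rewrite ?mem_enum.
have G4 i : (ord0, i, R1%:R) \in G.
  rewrite !mem_cat; apply/or4P; constructor 4; apply/mapP; exists i; by rewrite ?mem_enum.
have Gpos i j g : (i, j, g) \in G -> 0 < g.
  by case/GP => [[p /rp hp [-> _]]|[p /rp hp [-> _]]|[-> _]] //; rewrite mulr_gt0.
have fb : feasible ord0 G beta.
  split=> // i j g /GP[[p hp [-> h]]|[p hp [-> h]]|[-> h]].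
  - have r0 : 0 < rho p * beta j by rewrite mulr_gt0 ?rp.
    have dp : 0 < rho p * beta j - beta i by rewrite subr_gt0.
    have : gap ((i, j), p) <= R1%:R.
      apply: le_trans NR; apply: hN; rewrite !mem_cat; apply/or3P; constructor 3.
      by apply/mapP; exists ((i, j), p); rewrite ?TP.
    rewrite /gap /= ler_pdivrMr // => hg.
    rewrite -mulrA eta1; set y := rho p * beta j in hg *.
    have hy : y / R1%:R <= y - beta i by rewrite ler_pdivrMr // mulrC.
    have -> : (1 - R1%:R^-1) * y = y - y / R1%:R by ring.
    by lra.
  - by rewrite h.
  - have bi k : beta k <= R1%:R.
      apply: le_trans NR; apply: hN; rewrite !mem_cat; apply/or3P; constructor 1.
      by apply/mapP; exists k; rewrite ?mem_enum.
    have bv k : (beta k)^-1 <= R1%:R.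
      apply: le_trans NR; apply: hN; rewrite !mem_cat; apply/or3P; constructor 2.
      by apply/mapP; exists k; rewrite ?mem_enum.
    case: h => ->; rewrite beta0 ?mulr1 //.
    by have := bv j; rewrite -div1r ler_pdivrMr.
have Gup i : exists g, (i, ord0, g) \in G by exists R1%:R.
have Gdn i : exists g, (ord0, i, g) \in G by exists R1%:R.
have [b [[b0 bp bG] bc bcon]] := @tighten J ord0 G wr Gpos Gup Gdn beta fb.
have fb' : feasible ord0 G b by [].
have lt1 i j p : p \in ratio_list -> beta i < rho p * beta j -> b i < rho p * b j.
  move=> hp h; apply: le_lt_trans (bG _ _ _ (G1 _ _ _ hp h)) _.
  by rewrite -mulrA gtr_pMl // mulr_gt0 ?rp.
have sw p : p \in ratio_list -> rho (p.2, p.1) = (rho p)^-1 by rewrite rho_inv.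
have swl p x y : p \in ratio_list -> (rho p * y < x) = (y < rho (p.2, p.1) * x).
  by move=> hp; rewrite sw // mulrC -[in RHS](mulrC x) ltr_pdivlMr ?rp.
have le1 i j p : p \in ratio_list -> beta i = rho p * beta j -> b i <= rho p * b j.
  by move=> hp h; apply: bG; exact: G2.
have eq1 i j p : p \in ratio_list -> beta i = rho p * beta j -> b i = rho p * b j.
  move=> hp h; apply/eqP; rewrite eq_le le1 //=.
  have hp' := ratio_list_sym hp.
  have : b j <= rho (p.2, p.1) * b i.
    by apply: le1 => //; rewrite h sw // mulKf // gt_eqF // rp.
  by rewrite sw // mulrC ler_pdivlMr ?rp // mulrC.
exists b; split=> //.
  move=> i j p hp; have hp' := ratio_list_sym hp.
  have [h|h|h] := ltgtP (beta i) (rho p * beta j).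
  - by have h' := lt1 _ _ _ hp h; rewrite h' ltNge (ltW h').
  - have h' : rho p * b j < b i by rewrite swl //; apply: lt1 => //; rewrite -swl.
    by rewrite h' ltNge (ltW h').
  - by rewrite (eq1 _ _ _ hp h) ltxx.
move=> i; have [fs [sf ef hf]] := connect_product Gpos fb' (bcon i).
rewrite card_ord ltnS in sf.
have [||| x [e1 [e2 [d1 [d2 [hx hl E]]]]]] := @factor_product eta R1%:R fs.
- by rewrite gt_eqF.
- by rewrite gt_eqF.
- move=> f /hf[u [v [g [/GP hg hfg]]]].
  case: hg => [[p hp [eg _]]|[p hp [eg _]]|[eg _]]; rewrite eg in hfg.
  + case: hfg => ->; first by exists p => //; left; constructor 2.
    exists (p.2, p.1); first exact: ratio_list_sym.
    by left; constructor 3; rewrite sw // invfM mulrC.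
  + case: hfg => ->; first by exists p => //; left; constructor 1.
    exists (p.2, p.1); first exact: ratio_list_sym.
    by left; constructor 1; rewrite sw.
  + by exists (1%N, 1%N); [exact: ratio_list11 | right].
have R2 : (1 < R1)%N by lia.
have [K [a [c [hK ha hb E2]]]] := monomial_value R2 sf hx hl.
by exists K, (a, c); rewrite /= ef E.
Qed.

End RationalSolution.

(** Bounds the majorants at 1 of all polynomials whose sign matters: the cost, with weights [w], and
    the comparisons, with two coefficients from [CZ]. One coordinate contributes at most
    [monomial_bound] times [4 ^ n], as [X + 1] occurs in its majorant with exponent at most
    [2 * n]. *)
Definition sample_bound (w : 'I_n.+1 -> int) : nat :=
  ((\sum_i `|w i| + 2 * \sum_(c <- CZ) `|c|) * (monomial_bound ratio_list * 4 ^ n))%N.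

(** A solution is taken at an unknown huge [S] and read as a vector of polynomials. Comparisons and
    the sign of the cost then carry over to the given [R]. The threshold is part of [w], as the
    weight of coordinate 0. *)
Theorem sample_exists (alpha : 'I_n.+1 -> rat) (w : 'I_n.+1 -> int) (R : nat) :
  alpha ord0 = 1 -> \sum_i (w i)%:~R * alpha i <= 0 ->
  (1 < R)%N -> (sample_bound w < R)%N ->
  exists A : 'I_n.+1 -> int, [/\ A ord0 = unit_value R, forall i, A i \in sample R,
    (forall c d i j, c \in CZ -> d \in CZ ->
      (c%:~R * alpha i < d%:~R * alpha j) = (c * A i < d * A j)) &
    \sum_i w i * A i <= 0].
Proof.
move=> a0 hw R1 hB.
(* The vertex argument concerns absolute values. Signs are put back later, and a vanishing
   coordinate gets the dummy value 1 with sign 0. *)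
pose beta i := if alpha i == 0 then 1 else `|alpha i|.
have beta_gt0 i : 0 < beta i by rewrite /beta; case: eqP => // /eqP h; rewrite normr_gt0.
have beta0 : beta ord0 = 1 by rewrite /beta a0 oner_eq0 normr1.
pose sg i : rat := Num.sg (alpha i).
have ab i : alpha i = sg i * beta i.
  rewrite /sg /beta; case: eqP => [->|_]; first by rewrite sgr0 mul0r.
  exact: numEsg.
pose wr i := (w i)%:~R * sg i.
have [N HN] := symbolic_solution wr beta0 beta_gt0.
(* Above [N] for feasibility, and above [R] so that signs at [R] and at [S] agree. *)
pose S := (R + N).+1; have [|b [b0 bp bc bcmp bform]] := HN S; first by lia.
pose P i (x : nat * (nat * nat)) :=
   [/\ x.1 \in int_monomials ratio_list, (x.2.1 <= 2 * n)%N, (x.2.2 <= 4 * n)%N,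
     b i * (unit_value S)%:~R = (x.1 * (S.-1 ^ x.2.1 * S ^ x.2.2))%:R &
     i = ord0 -> x = (denominator ratio_list, (n, 2 * n)%N)].
(* The exponents found at [S] are frozen; from here on [S] may be replaced by an indeterminate.
   Those of coordinate 0 are prescribed, so that it becomes [unit_value]. *)
have [x hx] : exists x : 'I_n.+1 -> nat * (nat * nat), forall i, P i (x i).
  apply: (@fin_all_exists _ _ P) => i; rewrite /P; have [->|ni] := eqVneq i ord0.
    exists (denominator ratio_list, (n, 2 * n)%N); split=> //=; try lia.
      exact: denominator_mem.
    by rewrite b0 mul1r /unit_value -pmulrn.
  have [K [y [h1 h2 h3 h4]]] := bform i; exists (K, y); split=> //= e.
  by rewrite e eqxx in ni.
pose s i : int := sgz (alpha i).
pose A (r : nat) i : int := s i * Posz ((x i).1 * (r.-1 ^ (x i).2.1 * r ^ (x i).2.2)).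
pose pA i : {poly int} := (s i * Posz (x i).1)%:P * (('X - 1) ^+ (x i).2.1 * 'X^((x i).2.2)).
pose PA i : {poly int} := `|s i * Posz (x i).1|%:P * (('X + 1) ^+ (x i).2.1 * 'X^((x i).2.2)).
have PX u k : Posz (u ^ k) = Posz u ^+ k.
  by elim: k => // k IH; rewrite expnS PoszM IH exprS.
have pAE r i : (0 < r)%N -> (pA i).[Posz r] = A r i.
  move=> r0; rewrite /pA /A hornerM hornerC hornerM horner_exp hornerXn.
  rewrite (_ : ('X - 1).[Posz r] = Posz r.-1); last by rewrite !hornerE; lia.
  by rewrite !PoszM !PX !mulrA.
have maj i : majorizes (PA i) (pA i).
  apply: majorizesM; first exact: majorizesC.
  apply: majorizesM; last exact: majorizesX.
  apply: majorizesXn; apply: majorizesD; first exact: (majorizesX 1).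
  by have := majorizesC (-1); rewrite normrN1 polyCN.
pose M := (monomial_bound ratio_list * 4 ^ n)%N.
have PA1 i : (PA i).[1] <= Posz M.
  rewrite /PA hornerM hornerC hornerM horner_exp hornerXn expr1n mulr1.
  rewrite (_ : ('X + 1).[1] = 2%:R); last by rewrite !hornerE.
  have [hK ha _ _ _] := hx i; have /andP[K0 KB] := int_monomials_bound ratio_list_pos hK.
  rewrite normrM /M PoszM; apply: ler_pM => //; rewrite ?exprn_ge0 //.
    have s1 : `|s i| <= 1 by rewrite /s; case: (sgzP (alpha i)).
    have K1 : `|Posz (x i).1| <= Posz (monomial_bound ratio_list) by rewrite ger0_norm.
    by rewrite -[X in _ <= X]mul1r; apply: ler_pM.
  rewrite (_ : 4 = 2 ^ 2)%N // -expnM -natrX natz lez_nat.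
  by rewrite leq_exp2l.
have transfer (p Q : {poly int}) : majorizes Q p -> Q.[1] < Posz R ->
    sgz p.[Posz R] = sgz p.[Posz S].
  move=> h hR; rewrite !(sgz_horner h) //; apply: lt_trans hR _; rewrite ltz_nat /S; lia.
have U0 : 0 < (unit_value S)%:~R :> rat.
  rewrite ltr0z /unit_value ltz_nat !muln_gt0 !expn_gt0.
  have /andP[-> _] := int_monomials_bound ratio_list_pos (denominator_mem ratio_list).
  by rewrite andTb; apply/andP; split; apply/orP; left; rewrite /S /=; lia.
have AS i : (A S i)%:~R = sg i * b i * (unit_value S)%:~R :> rat.
  by have [_ _ _ E _] := hx i; rewrite -mulrA E /A intrM /s /sg sgrEz -pmulrn.
exists (A R); split.
- have [_ _ _ _ /(_ erefl) e] := hx ord0.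
  by rewrite /A e /s a0 sgz1 mul1r.
- move=> i; have [hK ha hb _ _] := hx i; rewrite /A /s /sample.
  have hm : ((x i).1 * (R.-1 ^ (x i).2.1 * R ^ (x i).2.2))%N \in sample_abs R.
    apply/allpairsP; exists ((x i).1, (x i).2); split=> //.
    apply/allpairsP; exists ((x i).2.1, (x i).2.2); rewrite !mem_iota /=; split; [lia | lia |].
    by case: ((x i).2).
  case: (sgzP (alpha i)) => _; first by rewrite mul0r inE eqxx.
    by rewrite mul1r inE mem_cat map_f ?orbT.
  rewrite mulN1r inE mem_cat; apply/orP; right; apply/orP; right.
  exact: (map_f (fun v : nat => - Posz v) hm).
- move=> c d i j hc hd.
  pose D := c%:P * pA i + (- d)%:P * pA j.
  have DE r : (0 < r)%N -> D.[Posz r] = c * A r i - d * A r j.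
    by move=> r0; rewrite /D hornerD (hornerCM c) (hornerCM (- d)) !pAE // mulNr.
  have Dm : majorizes (`|c|%:P * PA i + `|- d|%:P * PA j) D.
    by apply: majorizesD; apply: majorizesM => //; exact: majorizesC.
  have D1 : (`|c|%:P * PA i + `|- d|%:P * PA j).[1] < Posz R.
    rewrite hornerD (hornerCM `|c|) (hornerCM `|- d|) normrN; apply: (@le_lt_trans _ _ (Posz (sample_bound w))); last by rewrite ltz_nat.
    have sc k : k \in CZ -> (`|k| <= \sum_(c <- CZ) `|c|)%N.
      by move=> hk; rewrite (big_rem k) //= leq_addr.
    rewrite /sample_bound -/M.
    have h1 : `|c| * (PA i).[1] <= Posz (`|c|%N * M).
      by rewrite PoszM abszE; apply: ler_wpM2l.
    have h2 : `|d| * (PA j).[1] <= Posz (`|d|%N * M).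
      by rewrite PoszM abszE; apply: ler_wpM2l.
    apply: le_trans (lerD h1 h2) _; rewrite -PoszD lez_nat -mulnDl leq_mul2r.
    by apply/orP; right; have := sc c hc; have := sc d hd; lia.
  have -> : (c * A R i < d * A R j) = (c * A S i < d * A S j).
    rewrite -[LHS]subr_lt0 -[RHS]subr_lt0 -!DE; try lia.
    by rewrite -sgz_lt0 (transfer _ _ Dm D1) sgz_lt0.
  rewrite -[RHS](ltr_int rat) (intrM _ c) (intrM _ d) !AS !mulrA !(ltr_pM2r U0) !ab !mulrA.
  apply: cmp_transfer => // c0 d0.
  have nz (k : int) m : k%:~R * sg m != 0 -> k != 0 /\ `|k%:~R * sg m| = `|k|%N%:R :> rat.
    rewrite mulf_eq0 negb_or intr_eq0 sgr_eq0 => /andP[k0 m0]; split=> //.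
    by rewrite normrM normr_sg m0 mulr1 -intr_norm -abszE -pmulrn.
  have [cn ->] := nz _ _ c0; have [dn ->] := nz _ _ d0.
  exact: (bcmp i j _ (ratio_listP hc hd cn dn)).
- pose E := \sum_i (w i)%:P * pA i.
  have EE r : (0 < r)%N -> E.[Posz r] = \sum_i w i * A r i.
    by move=> r0; rewrite horner_sum; apply: eq_bigr => i _; rewrite hornerCM pAE.
  have Em : majorizes (\sum_i `|w i|%:P * PA i) E.
    by apply: majorizes_sum => i; apply: majorizesM => //; exact: majorizesC.
  have E1 : (\sum_i `|w i|%:P * PA i).[1] < Posz R.
    apply: (@le_lt_trans _ _ (Posz (sample_bound w))); last by rewrite ltz_nat.
    rewrite horner_sum /sample_bound -/M.
    apply: (@le_trans _ _ (Posz ((\sum_i `|w i|) * M))); last by rewrite lez_nat leq_mul2r leq_addr orbT.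
    rewrite big_distrl /= (big_morph Posz PoszD (erefl _)); apply: ler_sum => i _.
    by rewrite hornerCM PoszM abszE; apply: ler_wpM2l.
  rewrite -EE; last by lia.
  rewrite -sgz_le0 (transfer _ _ Em E1) sgz_le0 EE //.
  rewrite -(ler_int rat) rmorph_sum /=.
  under eq_bigr => i _ do rewrite intrM AS !mulrA.
  rewrite -mulr_suml pmulr_lle0 //; apply: le_trans bc _.
  by under eq_bigr => i _ do rewrite /wr -mulrA -ab.
Qed.

End Sample.

Local Close Scope ring_scope.

(** * Minimization of sums of submodular functions *)

Local Open Scope ring_scope.

Section SubmodularMinimization.

Variables (N E : eqType) (ns : seq N) (es : seq E).
Variable F : E -> (N -> bool) -> int.

Hypothesis uniq_ns : uniq ns.
Hypothesis uniq_es : uniq es.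
Hypothesis F_ext : forall e X Y, {in ns, X =1 Y} -> F e X = F e Y.
Hypothesis F0 : forall e, F e xpred0 = 0.
Hypothesis F_sub : forall e, e \in es -> forall X Y,
  F e (fun z => X z || Y z) + F e (fun z => X z && Y z) <= F e X + F e Y.

Definition rowsum (r : N -> int) (X : N -> bool) := \sum_(z <- ns | X z) r z.

(** The integer points of the base polytope of [F e]. *)
Definition base_row e (r : N -> int) :=
  (forall X, rowsum r X <= F e X) /\ rowsum r xpredT = F e xpredT.

Definition tight_set e (r : N -> int) X := rowsum r X = F e X.

Lemma rowsum_ext r X Y : {in ns, X =1 Y} -> rowsum r X = rowsum r Y.
Proof.
by move=> h; rewrite /rowsum big_seq_cond [RHS]big_seq_cond; apply: eq_bigl => z; case: (boolP (z \in ns)) => //= /h ->.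
Qed.

Lemma rowsumUI r X Y : rowsum r (fun z => X z || Y z) + rowsum r (fun z => X z && Y z) =
  rowsum r X + rowsum r Y.
Proof.
rewrite /rowsum big_mkcond [X in _ + X = _]big_mkcond [X in _ = X + _]big_mkcond.
rewrite [X in _ = _ + X]big_mkcond -!big_split /=; apply: eq_bigr => z _.
by case: (X z); case: (Y z); rewrite /= ?addr0 ?add0r.
Qed.

Lemma tight_setUI e r X Y : e \in es -> base_row e r -> tight_set e r X -> tight_set e r Y ->
  tight_set e r (fun z => X z || Y z) /\ tight_set e r (fun z => X z && Y z).
Proof.
move=> he [h _] tX tY; have := F_sub he X Y; have := rowsumUI r X Y.
have := h (fun z => X z || Y z); have := h (fun z => X z && Y z).
rewrite /tight_set in tX tY *; rewrite -tX -tY; lia.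
Qed.

Lemma tight_set0 e r : tight_set e r xpred0.
Proof. by rewrite /tight_set /rowsum big_pred0 // F0. Qed.

Lemma tight_setT e r : base_row e r -> tight_set e r xpredT.
Proof. by case. Qed.

(** The exchange capacity: the largest amount that can be moved from [u] to [v] inside the base
    polytope. How to compute it depends on the summand, so it is kept abstract. *)
Variable capf : E -> (N -> int) -> N -> N -> int.
Hypothesis capP : forall e r u v, e \in es -> u \in ns -> v \in ns -> u != v ->
  (forall X : N -> bool, X v -> ~~ X u -> capf e r u v <= F e X - rowsum r X) /\
  exists X : N -> bool, [/\ X v, ~~ X u & capf e r u v = F e X - rowsum r X].

(** A base of each summand, and a label for each node. The sum of the bases is a base of the total
    function, and pushes inside single summands shift its positive entries towards lower labels. *)
Definition sfm_state := ((E -> N -> int) * (N -> nat))%type.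

Definition excess (y : E -> N -> int) z := \sum_(e <- es) y e z.

Local Notation n := (size ns).

Definition active (s : sfm_state) z := (0 < excess s.1 z) && (s.2 z < n)%N.

Definition push_row (r : N -> int) u v dl z :=
  if z == u then r z - dl else if z == v then r z + dl else r z.

Definition amount (s : sfm_state) e u v :=
  let c := capf e (s.1 e) u v in
  if excess s.1 u <= c then excess s.1 u else c.

Definition admissible (s : sfm_state) u v :=
  [&& u != v, active s u & s.2 u == (s.2 v).+1].

Definition push u (s : sfm_state) (ev : E * N) : sfm_state :=
  if admissible s u ev.2 then
    (fun e => if e == ev.1 then push_row (s.1 e) u ev.2 (amount s ev.1 u ev.2) else s.1 e, s.2)
  else s.

Definition discharge (s : sfm_state) u : sfm_state :=
  foldl (push u) s [seq (e, v) | e <- es, v <- ns].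

Definition relabel (s : sfm_state) u : sfm_state :=
  if active s u then (s.1, fun z => if z == u then (s.2 z).+1 else s.2 z) else s.

Definition visit (s : sfm_state) u := relabel (discharge s u) u.

Definition pass (s : sfm_state) := foldl visit s ns.

(* For every m some tight set lies between the nodes of label < m and those of
   label <= m: this is the validity of the labelling. *)
Definition valid (s : sfm_state) := forall e m, e \in es -> exists X : N -> bool,
  [/\ tight_set e (s.1 e) X, forall z, z \in ns -> (s.2 z < m)%N -> X z &
      forall z, z \in ns -> X z -> (s.2 z <= m)%N].

Record invariant (s : sfm_state) : Prop := Invariant {
  inv_base : forall e, e \in es -> base_row e (s.1 e);
  inv_valid : valid s;
  inv_excess : forall z, z \in ns -> (0 < s.2 z)%N -> 0 <= excess s.1 z;
  inv_label : forall z, z \in ns -> (s.2 z <= n)%N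
}.

Lemma rowsum_push r u v dl X : u \in ns -> v \in ns -> u != v ->
  rowsum (push_row r u v dl) X = rowsum r X - dl *+ X u + dl *+ X v.
Proof.
move=> hu hv uv; rewrite /rowsum.
have S w : w \in ns -> \sum_(z <- ns | X z) (dl *+ (z == w)) = dl *+ X w.
  move=> hw; rewrite big_mkcond (bigD1_seq w) //= eqxx big1_seq ?addr0; first by case: (X w).
  by move=> z /andP[/negbTE -> _]; case: ifP.
rewrite -(S u hu) -(S v hv) -sumrN -!big_split /=; apply: eq_bigr => z _.
rewrite /push_row; have [->|zu] := eqVneq z u; first by rewrite (negbTE uv) mulr0n addr0.
by rewrite mulr0n oppr0 addr0; case: eqP; rewrite ?addr0.
Qed.

Lemma excess_push (s : sfm_state) u v e dl z : e \in es ->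
  excess (fun e' => if e' == e then push_row (s.1 e') u v dl else s.1 e') z =
  push_row (excess s.1) u v dl z.
Proof.
move=> he; rewrite /excess /push_row (bigD1_seq e) //= [in RHS](bigD1_seq e) //= eqxx.
rewrite [X in _ + X = _](eq_bigr (fun e' => s.1 e' z)); last by move=> e' /negbTE ->.
by rewrite /push_row; case: ifP => _; [ring | case: ifP => _; ring].
Qed.

Lemma cap_ge0 s e u v : invariant s -> e \in es -> u \in ns -> v \in ns -> u != v ->
  0 <= capf e (s.1 e) u v.
Proof.
move=> I he hu hv uv; have [_ [X [_ _ ->]]] := capP (s.1 e) he hu hv uv.
by have [h _] := inv_base I he; rewrite subr_ge0.
Qed.

Lemma amount_bounds s e u v : invariant s -> e \in es -> u \in ns -> v \in ns -> u != v ->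
  active s u -> [/\ 0 <= amount s e u v, amount s e u v <= excess s.1 u &
    amount s e u v <= capf e (s.1 e) u v].
Proof.
move=> I he hu hv uv /andP[a _]; have := cap_ge0 I he hu hv uv.
by rewrite /amount /=; case: (lerP (excess s.1 u)) => h1 h2; split=> //; exact: ltW.
Qed.

(* A tight set separating v from u blocks the push, all other sets keep their weight. *)
Lemma push_tight s e u v X : invariant s -> e \in es -> u \in ns -> v \in ns ->
  admissible s u v -> tight_set e (s.1 e) X -> ~~ (X u && ~~ X v) ->
  tight_set e (push_row (s.1 e) u v (amount s e u v)) X.
Proof.
move=> I he hu hv /and3P[uv act _] tX nX.
have [a0 _ a2] := amount_bounds I he hu hv uv act.
rewrite /tight_set rowsum_push //.
case Xu: (X u) nX; case Xv: (X v) => //= _; rewrite ?subr0 ?addr0 ?subrK //.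
have [h _] := capP (s.1 e) he hu hv uv.
have := h X Xv (negbT Xu); rewrite -tX subrr => h0.
have -> : amount s e u v = 0 by apply/eqP; rewrite eq_le (le_trans a2 h0) a0.
by rewrite addr0.
Qed.

Lemma push_inv s u ev : invariant s -> u \in ns -> ev.1 \in es -> ev.2 \in ns ->
  invariant (push u s ev).
Proof.
case: ev => e v /= I hu he hv; rewrite /push /=; case: ifP => // adm.
have /and3P[uv act /eqP dd] := adm.
have [a0 a1 a2] := amount_bounds I he hu hv uv act.
split=> /=.
- move=> e' he'; case: eqP => [->|_]; last exact: inv_base.
  have [hb1 hb2] := inv_base I he.
  split=> [X|]; rewrite rowsum_push //; last by rewrite /= subrK.
  have [h _] := capP (s.1 e) he hu hv uv; have := hb1 X.
  case Xu: (X u); case Xv: (X v); rewrite ?mulr0n ?mulr1n ?subr0 ?addr0 ?subrK //.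
    by move=> h2; apply: le_trans h2; rewrite gerBl.
  by move=> _; rewrite -lerBrDl; apply: le_trans a2 (h X Xv (negbT Xu)).
- move=> e' m he'; have [X [tX X1 X2]] := inv_valid I m he'.
  exists X; split=> //=; case: eqP => [e'e|_] //.
  (* If [X] contains [u], the label of [u] is at most [m]; that of [v] is smaller by one, so [X]
     contains [v] as well. *)
  rewrite e'e in tX *; apply: push_tight => //; apply/negP => /andP[Xu nv].
  have := X2 u hu Xu; rewrite dd => dm.
  by move: nv; rewrite X1.
- move=> z hz dz; rewrite excess_push // /push_row.
  case: eqP => [->|_]; first by rewrite subr_ge0.
  have h0 := inv_excess I hz dz.
  by case: eqP => // _; rewrite addr_ge0.
- exact: inv_label.
Qed.

Lemma mem_evs ev : ev \in [seq (e, v) | e <- es, v <- ns] -> ev.1 \in es /\ ev.2 \in ns.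
Proof. by case/allpairsP => -[e v] /= [he hv ->]. Qed.

Lemma push_label u s ev : (push u s ev).2 = s.2.
Proof. by rewrite /push; case: ifP. Qed.

Lemma push_excess u s ev z : ev.1 \in es -> excess (push u s ev).1 z =
  if admissible s u ev.2 then push_row (excess s.1) u ev.2 (amount s ev.1 u ev.2) z
  else excess s.1 z.
Proof.
case: ev => e v /= he; rewrite /push /=; case: ifP => //= _.
exact: excess_push.
Qed.

(** What a push along [ev] achieves and what later pushes from [u] preserve. When all pairs are
    blocked and [u] still has excess, tight sets justify a new label for [u]. *)
Definition blocked (s : sfm_state) u (ev : E * N) := excess s.1 u <= 0 \/
  (s.2 u = (s.2 ev.2).+1 -> exists X : N -> bool,
    [/\ tight_set ev.1 (s.1 ev.1) X, X ev.2 & ~~ X u]).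

Lemma push_blocked s u ev ev' : invariant s -> u \in ns -> ev.1 \in es -> ev.2 \in ns ->
  ev'.1 \in es -> ev'.2 \in ns -> (s.2 u < n)%N ->
  blocked s u ev' \/ ev' = ev -> blocked (push u s ev) u ev'.
Proof.
case: ev => e v /= I hu he hv he' hv' un hb.
rewrite /blocked push_label push_excess //=.
case: (boolP (admissible s u v)) => [adm|nadm].
  have /and3P[uv act /eqP dd] := adm.
  have [a0 a1 a2] := amount_bounds I he hu hv uv act.
  have exu : push_row (excess s.1) u v (amount s e u v) u = excess s.1 u - amount s e u v.
    by rewrite /push_row eqxx.
  rewrite exu; case: hb => [[hb|hb]|->].
  - by left; lia.
  - right=> d1; have [X [tX Xv nXu]] := hb d1; exists X; split=> //.
    rewrite /push adm /=; case: eqP => // e'e; rewrite e'e in tX *.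
    by apply: push_tight => //; rewrite (negbTE nXu).
  - rewrite /amount in exu *; set c := capf e (s.1 e) u v in exu *.
    have [h [X [Xv nXu cX]]] := capP (s.1 e) he hu hv uv; rewrite -/c in cX.
    case: (lerP (excess s.1 u) c) => ec; first by left; rewrite subrr.
    right=> /= _; exists X; split=> //.
    rewrite /push adm /= eqxx /tight_set rowsum_push // /amount -/c.
    rewrite (negbTE nXu) Xv mulr0n subr0 mulr1n cX leNgt -cX ec /= cX.
    by rewrite addrC subrK.
case: hb => [[hb|hb]|->]; first by left.
- by right; rewrite /push (negbTE nadm).
- have [h|h] := lerP (excess s.1 u) 0; first by left.
  right=> /= d1; move: nadm; rewrite /admissible /active h un d1 eqxx !andbT negbK.
  by move/eqP => euv; exfalso; move: d1; rewrite /= euv; lia.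
Qed.

Lemma active_push s u ev z : invariant s -> u \in ns -> ev.1 \in es -> ev.2 \in ns ->
  active (push u s ev) z -> active s z \/ (active s u /\ (s.2 z < s.2 u)%N).
Proof.
case: ev => e v /= I hu he hv; rewrite {1}/active push_label push_excess //=.
case: (boolP (admissible s u v)) => [adm|_]; last by move=> h; left.
have /and3P[uv act /eqP dd] := adm.
have [a0 a1 a2] := amount_bounds I he hu hv uv act.
rewrite /push_row => /andP[]; case: eqP => [-> _ _|_]; first by left.
case: eqP => [->|_] h1 h2; last by left; rewrite /active h1 h2.
by right; split=> //; rewrite dd.
Qed.

Lemma discharge_spec s u : invariant s -> u \in ns -> (s.2 u < n)%N ->
  let s' := discharge s u in
  [/\ invariant s', s'.2 = s.2,
   (forall e v, e \in es -> v \in ns -> blocked s' u (e, v)) &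
   (forall z, active s' z -> active s z \/ (active s u /\ (s.2 z < s.2 u)%N))].
Proof.
move=> I hu un; rewrite /discharge.
set L := [seq (e, v) | e <- es, v <- ns].
have H l : {subset l <= L} -> forall s1 done, {subset done <= L} ->
   invariant s1 -> s1.2 = s.2 -> {in done, forall ev, blocked s1 u ev} ->
   (forall z, active s1 z -> active s z \/ (active s u /\ (s.2 z < s.2 u)%N)) ->
   let s' := foldl (push u) s1 l in
   [/\ invariant s', s'.2 = s.2, {in done ++ l, forall ev, blocked s' u ev} &
   (forall z, active s' z -> active s z \/ (active s u /\ (s.2 z < s.2 u)%N))].
  elim: l => [|ev l IH] sl s1 dn sd I1 d1 b1 a1 /=; first by split=> //; rewrite cats0.
  have [he hv] := mem_evs (sl ev (mem_head _ _)).
  have [|||||| A1 A2 A3 A4] := IH _ (push u s1 ev) (rcons dn ev).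
  - by move=> x hx; apply: sl; rewrite inE hx orbT.
  - by move=> x; rewrite mem_rcons inE => /predU1P[->|/sd //]; apply: sl; rewrite mem_head.
  - exact: push_inv.
  - by rewrite push_label.
  - move=> ev'; rewrite mem_rcons inE => h.
    have [he' hv'] : ev'.1 \in es /\ ev'.2 \in ns.
      by apply: mem_evs; case/predU1P: h => [->|/sd //]; apply: sl; rewrite mem_head.
    apply: push_blocked; rewrite ?d1 //.
    by case/predU1P: h => [->|/b1 h]; [right | left].
  - move=> z /(active_push I1 hu he hv)[/a1 //|[/a1 au]]; rewrite d1 => zu.
    case: au => [au|[au uu]]; last by rewrite ltnn in uu.
    by right.
  by split=> //; rewrite -cats1 -catA in A3.
have sub0 : {subset [::] <= L} by [].
have A0 : {in [::], forall ev, blocked s u ev} by [].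
have A00 z : active s z -> active s z \/ (active s u /\ (s.2 z < s.2 u)%N) by left.
have [A1 A2 A3 A4] := H L (fun _ h => h) s [::] sub0 I erefl A0 A00.
split=> // e v he hv; apply: A3; by apply/allpairsP; exists (e, v).
Qed.

Lemma tight_cover e r u (l : seq N) : e \in es -> base_row e r ->
  (forall v, v \in l -> exists X : N -> bool, [/\ tight_set e r X, X v & ~~ X u]) ->
  exists X : N -> bool, [/\ tight_set e r X, forall v, v \in l -> X v & ~~ X u].
Proof.
move=> he hb; elim: l => [|v l IH] h; first by exists xpred0; split=> //; exact: tight_set0.
have [|X [tX X1 X2]] := IH; first by move=> w hw; apply: h; rewrite inE hw orbT.
have [Y [tY Y1 Y2]] := h v (mem_head _ _).
exists (fun z => X z || Y z); split; first by have [] := tight_setUI he hb tX tY.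
  by move=> w; rewrite inE => /predU1P[->|/X1 ->]; rewrite ?Y1 ?orbT.
by rewrite negb_or X2.
Qed.

Lemma relabel_inv s u : invariant s -> u \in ns ->
  (forall e v, e \in es -> v \in ns -> blocked s u (e, v)) -> invariant (relabel s u).
Proof.
move=> I hu hb; rewrite /relabel; case: ifP => // /andP[act un]; split=> /=.
- exact: inv_base.
- move=> e m he; have br := inv_base I he; have [X [tX X1 X2]] := inv_valid I m he.
  have [mu|mu] := eqVneq m (s.2 u); last first.
    exists X; split=> // z hz /=; case: eqP => [zu|_].
    - by move=> h; apply: X1 => //; rewrite ltnW.
    - exact: X1.
    - by move=> Xz; have := X2 z hz Xz; rewrite zu; lia.
    - exact: X2.
  (* Only the threshold equal to the old label of [u] needs a new set, one that avoids [u]. Nodes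
     two or more labels below are covered by the set for the preceding threshold, those one label
     below by the sets that blocked the pushes. *)
  have [Y [tY Y1 Y2]] : exists Y : N -> bool, [/\ tight_set e (s.1 e) Y,
      forall z, z \in ns -> (s.2 z < m)%N -> Y z & ~~ Y u].
    case: m mu {X tX X1 X2} => [|m] mu.
      by exists xpred0; split=> //; exact: tight_set0.
    have [Z [tZ Z1 Z2]] := inv_valid I m he.
    have [|W [tW W1 W2]] := @tight_cover e (s.1 e) u [seq z <- ns | s.2 z == m] he br.
      move=> v; rewrite mem_filter => /andP[/eqP vm hv].
      by case: (hb e v he hv) => [|h]; [rewrite leNgt act | apply: h; rewrite -mu /= vm].
    exists (fun z => Z z || W z); split; first by have [] := tight_setUI he br tZ tW.
      move=> z hz; rewrite ltnS leq_eqVlt => /orP[zm|zm].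
        by rewrite W1 ?orbT // mem_filter zm.
      by rewrite Z1.
    rewrite negb_or W2 andbT; apply/negP => /(Z2 u hu); rewrite -mu; lia.
  exists (fun z => X z && Y z); split.
  + by have [] := tight_setUI he br tX tY.
  + move=> z hz /=; case: eqP => [->|_] h; last by rewrite X1 // Y1.
    by exfalso; lia.
  + move=> z hz /= /andP[Xz Yz]; case: eqP => [zu|_]; last exact: X2.
    by rewrite zu (negbTE Y2) in Yz.
- by move=> z hz; case: eqP => [-> _|_]; [exact: ltW | exact: inv_excess].
- by move=> z hz; case: eqP => [->|_] //; exact: inv_label.
Qed.

Lemma push_inactive u s ev : ~~ active s u -> push u s ev = s.
Proof. by move=> h; rewrite /push /admissible (negbTE h) andbF. Qed.

Lemma discharge_inactive s u : ~~ active s u -> discharge s u = s.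
Proof.
move=> h; rewrite /discharge; elim: [seq _ | _ <- _, _ <- _] => //= ev l IH.
by rewrite push_inactive.
Qed.

Lemma visit_spec s u : invariant s -> u \in ns -> let s' := visit s u in
  [/\ invariant s', forall z, (s.2 z <= s'.2 z)%N &
   (\sum_(z <- ns) s.2 z < \sum_(z <- ns) s'.2 z)%N \/
   [/\ s'.2 = s.2, ~~ active s' u & forall z, active s' z ->
     active s z \/ (active s u /\ (s.2 z < s.2 u)%N)]].
Proof.
move=> I hu; rewrite /visit.
have [nact|/negPn act] := boolP (~~ active s u).
  rewrite discharge_inactive // /relabel (negbTE nact); split=> //; right.
  by split=> // z h; left.
have un : (s.2 u < n)%N by case/andP: act.
have [I1 d1 b1 a1] := discharge_spec I hu un.
set s1 := discharge s u in I1 d1 b1 a1 *; split; first exact: relabel_inv.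
  by move=> z; rewrite /relabel; case: ifP => _ /=; rewrite d1 //; case: ifP.
rewrite /relabel; case: ifP => act1 /=; last by right; split=> //; rewrite act1.
left; rewrite d1 (bigD1_seq u) //= [X in (_ < X)%N](bigD1_seq u) //= eqxx.
rewrite [X in (_ < _ + X)%N](eq_bigr s.2) ?ltn_add2r //.
by move=> z /negbTE ->.
Qed.

(** If no label grows, every visited node loses its excess and hands it to lower labels only, so
    whatever is active in the end is unvisited or lies below a node that was active at the start. *)
Lemma foldl_visit_spec l s : {subset l <= ns} -> invariant s ->
  let s' := foldl visit s l in
  [/\ invariant s', forall z, (s.2 z <= s'.2 z)%N &
   (\sum_(z <- ns) s.2 z < \sum_(z <- ns) s'.2 z)%N \/
   (s'.2 = s.2 /\ forall z, active s' z ->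
     (z \notin l /\ active s z) \/ exists2 u, active s u & (u \in ns) && (s.2 z < s.2 u)%N)].
Proof.
have mono (d1 d2 : N -> nat) : (forall z, (d1 z <= d2 z)%N) ->
    (\sum_(z <- ns) d1 z <= \sum_(z <- ns) d2 z)%N.
  by move=> h; apply: leq_sum => z _.
elim: l s => [|u l IH] s sl I /=; first by split=> //; right; split=> // z h; left.
have hu := sl u (mem_head _ _).
have [I1 m1 c1] := visit_spec I hu.
have [|I2 m2 c2] := IH (visit s u) _ I1; first by move=> x hx; apply: sl; rewrite inE hx orbT.
split=> //; first by move=> z; exact: leq_trans (m2 z).
case: c1 => [c1|[d1 n1 a1]]; first by left; apply: leq_trans c1 (mono _ _ m2).
case: c2 => [c2|[d2 a2]]; first by left; rewrite -d1.
right; split=> [|z]; first by rewrite d2.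
move=> /a2[[zl az]|[v av /andP[hv]]]; last first.
  rewrite d1 => zv; right; case: (a1 v av) => [sv|[su vu]]; first by exists v; rewrite ?hv.
  by exists u; rewrite ?hu //=; exact: ltn_trans vu.
have zu : z != u by apply/eqP => e; rewrite e (negbTE n1) in az.
case: (a1 z az) => [sz|[su zu']]; first by left; rewrite inE negb_or zu.
by right; exists u; rewrite ?hu.
Qed.

Lemma pass_inactive s : (forall z, z \in ns -> ~~ active s z) -> pass s = s.
Proof.
rewrite /pass => h; have : {subset ns <= ns} by [].
elim: {1 3}ns => //= u l IH sl.
have hu := h u (sl u (mem_head _ _)).
rewrite /visit discharge_inactive // /relabel (negbTE hu).
by apply: IH => x hx; apply: sl; rewrite inE hx orbT.
Qed.

Definition height s := (\max_(z <- ns | active s z) (s.2 z).+1)%N.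

(** A lexicographic measure: labels grow at most to [n], and a pass without relabelling lowers the
    greatest active label. *)
Definition potential s := ((n * n - \sum_(z <- ns) s.2 z) * n.+1 + height s)%N.

Lemma height_le s z : z \in ns -> active s z -> (s.2 z < height s)%N.
Proof. by move=> hz az; rewrite /height (big_rem z) //= az leq_maxl. Qed.

Lemma pass_progress s : invariant s -> invariant (pass s) /\
  ((forall z, z \in ns -> ~~ active s z) \/ (potential (pass s) < potential s)%N).
Proof.
move=> I; have [|I' m c] := @foldl_visit_spec ns s _ I; first by [].
rewrite -/(pass s) in I' m c; split=> //.
have [/hasP[z hz az]|/hasPn h] := boolP (has (active s) ns); [right | by left].
have hn (t : sfm_state) : invariant t -> (height t <= n)%N.
  move=> It; rewrite /height big_seq_cond; elim/big_ind: _ => // [a b ha hb|x /andP[hx /andP[_ hl]] //].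
  by rewrite geq_max ha hb.
have sn (t : sfm_state) : invariant t -> (\sum_(z <- ns) t.2 z <= n * n)%N.
  move=> It; apply: (@leq_trans (\sum_(z <- ns) n)); last by rewrite big_const_seq count_predT iter_addn_0.
  by rewrite big_seq [X in (_ <= X)%N]big_seq; apply: leq_sum => x /(inv_label It).
rewrite /potential; case: c => [c|[d' a']].
  by have := hn _ I'; have := sn _ I'; have := hn _ I; nia.
rewrite d' ltn_add2l.
have h0 : (0 < height s)%N by apply: leq_ltn_trans (height_le hz az).
rewrite {1}/height big_seq_cond; elim/big_ind: _ => // [a b ha hb|x /andP[hx ax]].
  by rewrite gtn_max ha hb.
case: (a' x ax) => [[nx _]|[u au /andP[hu xu]]]; first by rewrite hx in nx.
by rewrite d'; apply: leq_ltn_trans xu (height_le hu au).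
Qed.

Lemma iter_pass k s : invariant s -> invariant (iter k pass s) /\
  ((forall z, z \in ns -> ~~ active (iter k pass s) z) \/
   (potential (iter k pass s) + k <= potential s)%N).
Proof.
move=> I; elim: k => [|k [Ik ck]] /=; first by split=> //; right; rewrite addn0.
have [I' c'] := pass_progress Ik; split=> //.
case: ck => [h|h]; first by left; rewrite pass_inactive.
by case: c' => [h'|h']; [left; rewrite pass_inactive | right; lia].
Qed.

(** The min-max relation of Edmonds: the negative part of any base is a lower bound, and it is
    attained by a set that is tight for all summands and separates negative from positive excess. *)
Theorem optimal s : invariant s -> (forall z, z \in ns -> ~~ active s z) ->
  (forall X, \sum_(z <- ns) (if excess s.1 z <= 0 then excess s.1 z else 0)
     <= \sum_(e <- es) F e X) /\
  exists X, \sum_(e <- es) F e X = \sum_(z <- ns) (if excess s.1 z <= 0 then excess s.1 z else 0).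
Proof.
move=> I na.
have sw X : \sum_(e <- es) rowsum (s.1 e) X = \sum_(z <- ns | X z) excess s.1 z.
  by rewrite /rowsum exchange_big.
split=> [X|].
  apply: (@le_trans _ _ (\sum_(e <- es) rowsum (s.1 e) X)); last first.
    rewrite big_seq [X in _ <= X]big_seq; apply: ler_sum => e he.
    by have [h _] := inv_base I he.
  rewrite sw [X in _ <= X]big_mkcond; apply: ler_sum => z _.
  by case: (X z); case: (lerP (excess s.1 z) 0) => // h; exact: ltW.
have [l ln nl] : exists2 l, (l <= n)%N & l \notin map s.2 ns.
  apply: NNPP => no; have : {subset iota 0 n.+1 <= map s.2 ns}.
    move=> l; rewrite mem_iota => /andP[_ hl]; apply/negPn/negP => h; apply: no.
    by exists l.
  by move/(uniq_leq_size (iota_uniq _ _)); rewrite size_iota size_map ltnn.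
have lv z : z \in ns -> s.2 z != l.
  by move=> hz; apply: contra nl => /eqP <-; exact: map_f.
pose T z := (s.2 z < l)%N.
have tT e : e \in es -> rowsum (s.1 e) T = F e T.
  move=> he; have [X [tX X1 X2]] := inv_valid I l he.
  have XT : {in ns, X =1 T}.
    move=> z hz; apply/idP/idP => [Xz|]; last exact: X1.
    by rewrite /T ltn_neqAle lv //= X2.
  by rewrite -(rowsum_ext _ XT) -(F_ext e XT).
exists T; rewrite big_seq -(eq_bigr _ tT) -big_seq sw big_mkcond big_seq [RHS]big_seq.
apply: eq_bigr => z hz; rewrite /T; case: ltnP => hl.
  have := na z hz; rewrite /active negb_and -leNgt => /orP[->//|].
  by rewrite -leqNgt => h; have := leq_trans hl ln; rewrite ltnNge h.
have : (l < s.2 z)%N by rewrite ltn_neqAle eq_sym lv.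
move=> /(leq_ltn_trans (leq0n l))/(inv_excess I hz) h0.
by case: lerP => // h1; apply/eqP; rewrite eq_le h0 h1.
Qed.

Definition initial (y : E -> N -> int) : sfm_state := (y, fun=> 0%N).

Lemma initial_inv y : (forall e, e \in es -> base_row e (y e)) -> invariant (initial y).
Proof.
move=> h; split=> //= e [|m] he; last first.
  by exists xpredT; split=> //; exact: tight_setT (h e he).
by exists xpred0; split=> //; exact: tight_set0.
Qed.

Theorem minimize y k : (forall e, e \in es -> base_row e (y e)) -> (n * n * n.+1 + n < k)%N ->
  let s := iter k pass (initial y) in
  invariant s /\
  ((forall X, \sum_(z <- ns) (if excess s.1 z <= 0 then excess s.1 z else 0)
     <= \sum_(e <- es) F e X) /\
  exists X, \sum_(e <- es) F e X =
    \sum_(z <- ns) (if excess s.1 z <= 0 then excess s.1 z else 0)).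
Proof.
move=> hy hk; have I0 := initial_inv hy; have [I c] := iter_pass k I0.
split=> //; apply: optimal => //; case: c => // c.
have : (potential (initial y) <= n * n * n.+1 + n)%N; last by lia.
rewrite /potential leq_add //; first by rewrite leq_mul2r leq_subr orbT.
rewrite /height big_seq_cond; elim/big_ind: _ => // [a b ha hb|x /andP[hx /andP[_ hl]] //].
by rewrite geq_max ha hb.
Qed.

(** The greedy vertex of the base polytope: marginal values along the order [ns]. *)
Definition greedy e (z : N) : int :=
  F e (fun x => index x ns <= index z ns)%N - F e (fun x => index x ns < index z ns)%N.

Lemma greedy_base e : e \in es -> base_row e (greedy e).
Proof.
move=> he; pose pre k (X : N -> bool) x := X x && (index x ns < k)%N.
have H X k : (k <= n)%N -> \sum_(z <- take k ns | X z) greedy e z <= F e (pre k X) /\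
    (X = xpredT -> \sum_(z <- take k ns | X z) greedy e z = F e (pre k X)).
  elim: k => [|k IH] hk.
    rewrite take0 !big_nil (_ : pre 0%N X = xpred0) ?F0 //.
    by apply: functional_extensionality => x; rewrite /pre ltn0 andbF.
  have [IH1 IH2] := IH (ltnW hk).
  have [z0 _] : exists z0 : N, True by case: ns hk => // z0; exists z0.
  pose z := nth z0 ns k.
  have iz : index z ns = k by rewrite index_uniq.
  have TN : take k.+1 ns = rcons (take k ns) z by rewrite (take_nth z0).
  rewrite TN -cats1 big_cat big_cons big_nil.
  have mz x : x \in ns -> (index x ns == k) = (x == z).
    by move=> hx; apply/eqP/eqP => [e1|-> //]; rewrite /z -e1 nth_index.
  have [Xz|nXz] := boolP (X z); last first.
    have -> : F e (pre k.+1 X) = F e (pre k X).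
      apply: F_ext => x hx; rewrite /pre ltnS leq_eqVlt mz //.
      by case: eqP => [->|_] //=; rewrite (negbTE nXz).
    by rewrite /= addr0; split=> // eX; rewrite IH2.
  have E1 : F e (fun x => pre k.+1 X x || (index x ns < k)%N) = F e (fun x => index x ns <= k)%N.
    apply: F_ext => x hx; rewrite /pre ltnS leq_eqVlt mz //.
    by case: eqP => [->|_] /=; rewrite ?Xz //; case: (X x); case: (index x ns < k)%N.
  have E2 : F e (fun x => pre k.+1 X x && (index x ns < k)%N) = F e (pre k X).
    apply: F_ext => x hx; rewrite /pre -andbA; congr andb.
    by rewrite ltnS; case: ltnP => h; rewrite ?andbF // andbT ltnW.
  (* Diminishing returns: adding [z] to the whole prefix gains at most what adding it to the part
     inside [X] gains. *)
  have := F_sub he (pre k.+1 X) (fun x => index x ns < k)%N; rewrite E1 E2 => S1.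
  rewrite /= !addr0 /greedy iz; split=> [|eX].
    rewrite -lerBrDr; apply: le_trans IH1 _; rewrite opprB addrCA addrC.
    by rewrite addrAC lerBrDr [X in X <= _]addrC.
  rewrite IH2 // (_ : F e (pre k.+1 X) = F e (fun x => index x ns <= k)%N); last first.
    by apply: F_ext => x _; rewrite /pre eX.
  rewrite (_ : F e (pre k X) = F e (fun x => index x ns < k)%N); first by rewrite addrCA subrr addr0.
  by apply: F_ext => x _; rewrite /pre eX.
have FE X : F e (pre n X) = F e X.
  by apply: F_ext => x hx; rewrite /pre index_mem hx andbT.
split=> [X|]; rewrite /rowsum -{1}(take_size ns).
  by have [h _] := H X n (leqnn _); rewrite -(FE X).
by have [_ h] := H xpredT n (leqnn _); rewrite h // FE.
Qed.

End SubmodularMinimization.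

Local Close Scope ring_scope.

(** * Submodular constraints over a finite chain *)

Local Open Scope ring_scope.

(** The node [(v, a)] stands for the assertion that the value of variable [v] is at least [a]; an
    assignment is the set of its true assertions. *)
Definition node := (nat * int)%type.
Definition constr := (seq nat * seq (seq int * int))%type.
Definition problem := (seq int * seq nat * seq constr * int)%type.

(** Counts the occurrences of the variable of [z] in [args] at which the truth value [b] of the
    assertion [z] disagrees with the tuple [t]. *)
Definition mism (args : seq nat) (t : seq int) (z : node) (b : bool) : nat :=
  size [seq p <- zip args t | (p.1 == z.1) && (b != (z.2 <= p.2))].

Lemma mism_cons x args a t z b : mism (x :: args) (a :: t) z b =
  (((x == z.1) && (b != (z.2 <= a)%R)) + mism args t z b)%N.
Proof. by rewrite /mism /=; case: (_ && _). Qed.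

Lemma mism_le args t z b : (mism args t z b <= size args)%N.
Proof. by rewrite /mism size_filter (leq_trans (count_size _ _)) // size_zip geq_minl. Qed.

Definition zmax (t s : seq int) : seq int := [seq Num.max p.1 p.2 | p <- zip t s].
Definition zmin (t s : seq int) : seq int := [seq Num.min p.1 p.2 | p <- zip t s].

(** A lower bound on a maximum is a disjunction, one on a minimum a conjunction, so each position
    reduces to a check of truth values. *)
Lemma mism_sub args t s z b b' : size t = size args -> size s = size args ->
  (mism args (zmax t s) z (b || b') + mism args (zmin t s) z (b && b') <=
   mism args t z b + mism args s z b')%N.
Proof.
elim: args t s => [|x args IH] [|a t] [|c s] //= [et] [es].
rewrite /zmax /zmin /= -/(zmax t s) -/(zmin t s) !mism_cons le_max le_min.
have := IH t s et es.
by case: (x == z.1); case: (z.2 <= a); case: (z.2 <= c); case: (b); case: (b'); rewrite /=; lia.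
Qed.

Section Minv.
Variable T : eqType.

Definition minv (f : T -> int) (l : seq T) : int :=
  if l is p :: l' then minl (f p) [seq f q | q <- l'] else 0.

Lemma minv_le f l p : p \in l -> minv f l <= f p.
Proof.
case: l => // q l hp; apply: minl_le.
by rewrite -map_cons; apply: map_f.
Qed.

Lemma minv_mem f l : l != [::] -> exists2 p, p \in l & minv f l = f p.
Proof.
case: l => // q l _; have := minl_mem (f q) [seq f q | q <- l].
by rewrite -map_cons => /mapP[p hp e]; exists p.
Qed.
End Minv.

(** * Extension of constraint tables to set functions *)

Section Core.
Variable x : problem.

Definition vals := x.1.1.1.
Definition vars := x.1.1.2.
Definition cons_ := x.1.2.
Definition penalty := x.2.

Definition nodes : seq node := [seq (v, a) | v <- vars, a <- vals].
Definition eidx := iota 0 (size cons_).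
Definition con e : constr := nth ([::], [::]) cons_ e.

Definition score (c : constr) (X : node -> bool) (p : seq int * int) : int :=
  p.2 + \sum_(z <- nodes) penalty * Posz (mism c.1 p.1 z (X z)).

(** Defined for all sets of nodes, also those that encode no assignment: the cheapest table entry,
    with [penalty] charged for each mismatch. Minimizing over a table closed under [zmax] and [zmin]
    preserves submodularity. *)
Definition fhat (c : constr) (X : node -> bool) : int := minv (score c X) c.2.

Definition Fhat e X := fhat (con e) X - fhat (con e) xpred0.

Definition gain (c : constr) (r : node -> int) t z (b : bool) : int :=
  penalty * Posz (mism c.1 t z b) - (if b then r z else 0).

Definition capz (c : constr) r (u v : node) t z : int :=
  if z == v then gain c r t z true else if z == u then gain c r t z false
  else minz (gain c r t z true) (gain c r t z false).

Definition cap_score (c : constr) r (u v : node) (p : seq int * int) : int :=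
  p.2 + \sum_(z <- nodes) capz c r u v p.1 z.

(** The minimum over sets and the minimum over table entries are exchanged: for a fixed entry the
    slack is a sum over nodes, so each node is placed inside or outside independently, except that
    [v] is in and [u] is out. *)
Definition capf e r (u v : node) : int :=
  minv (cap_score (con e) r u v) (con e).2
  - fhat (con e) xpred0.

Definition abs_total : nat := \sum_(c <- cons_) \sum_(p <- c.2) `|p.2|%N.
Definition arg_total : nat := \sum_(c <- cons_) size c.1.

Record wf_problem : Prop := WfProblem {
  wf_vals : uniq vals;
  wf_vals0 : vals != [::];
  wf_vars : uniq vars;
  wf_args : forall c, c \in cons_ -> {subset c.1 <= vars};
  wf_nil : forall c, c \in cons_ -> c.2 != [::];
  wf_size : forall c p, c \in cons_ -> p \in c.2 -> size p.1 = size c.1;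
  wf_ent : forall c p, c \in cons_ -> p \in c.2 -> {subset p.1 <= vals};
  wf_sub : forall c p q, c \in cons_ -> p \in c.2 -> q \in c.2 ->
    exists p' q', [/\ p' \in c.2, q' \in c.2, p'.1 = zmax p.1 q.1, q'.1 = zmin p.1 q.1 &
      p'.2 + q'.2 <= p.2 + q.2];
  wf_pen : 0 <= penalty
}.

Hypothesis wf : wf_problem.

Lemma uniq_nodes : uniq nodes.
Proof.
by apply: allpairs_uniq; [exact: wf_vars | exact: wf_vals | move=> [? ?] [? ?] _ _ [-> ->]].
Qed.

Lemma con_mem e : e \in eidx -> con e \in cons_.
Proof. by rewrite mem_iota => h; apply: mem_nth. Qed.

Lemma fhat_ext c X Y : {in nodes, X =1 Y} -> fhat c X = fhat c Y.
Proof.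
move=> h; rewrite /fhat; congr minv; apply: functional_extensionality => p; rewrite /score; congr (_ + _).
by apply: eq_big_seq => z /h ->.
Qed.

Lemma fhat_mem c X : c \in cons_ -> exists2 p, p \in c.2 & fhat c X = score c X p.
Proof. by move=> hc; apply: minv_mem; apply: wf_nil hc. Qed.

Lemma fhat_le c p X : p \in c.2 -> fhat c X <= score c X p.
Proof. exact: minv_le. Qed.

Lemma fhat_sub c X Y : c \in cons_ ->
  fhat c (fun z => X z || Y z) + fhat c (fun z => X z && Y z) <= fhat c X + fhat c Y.
Proof.
move=> hc.
have [p hp ->] := fhat_mem X hc; have [q hq ->] := fhat_mem Y hc.
have [p' [q' [hp' hq' e1 e2 h]]] := wf_sub wf hc hp hq.
apply: le_trans (lerD (fhat_le _ hp') (fhat_le _ hq')) _.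
rewrite /score addrACA [leRHS]addrACA; apply: lerD => //.
rewrite -!big_split /=; apply: ler_sum => z _; rewrite -!mulrDr.
apply: ler_wpM2l; first exact: wf_pen.
by rewrite -!PoszD lez_nat e1 e2; apply: mism_sub; apply: wf_size.
Qed.

Lemma Fhat_ext e X Y : {in nodes, X =1 Y} -> Fhat e X = Fhat e Y.
Proof. by move=> h; rewrite /Fhat (fhat_ext _ h). Qed.

Lemma Fhat0 e : Fhat e xpred0 = 0.
Proof. exact: subrr. Qed.

Lemma Fhat_sub e : e \in eidx -> forall X Y,
  Fhat e (fun z => X z || Y z) + Fhat e (fun z => X z && Y z) <= Fhat e X + Fhat e Y.
Proof. by move=> /con_mem /(fhat_sub) h X Y; have := h X Y; rewrite /Fhat; lia. Qed.

Lemma rowsumE r X : rowsum nodes r X = \sum_(z <- nodes) (if X z then r z else 0).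
Proof. by rewrite /rowsum big_mkcond. Qed.

Lemma capf_le e r u v (X : node -> bool) : e \in eidx -> X v -> ~~ X u ->
  capf e r u v <= Fhat e X - rowsum nodes r X.
Proof.
move=> he Xv nXu; rewrite /capf /Fhat rowsumE.
have [p hp ->] := fhat_mem X (con_mem he); rewrite /score.
rewrite addrAC lerD2r -addrA -sumrB.
apply: le_trans (minv_le (cap_score (con e) r u v) hp) _.
rewrite lerD2l; apply: ler_sum => z _; rewrite /capz -/(gain (con e) r p.1 z (X z)).
case: eqP => [->|_]; first by rewrite Xv.
case: eqP => [->|_]; first by rewrite (negbTE nXu).
by rewrite /minz; case: (lerP (gain (con e) r p.1 z true)) => h; case: (X z) => //; exact: ltW.
Qed.

Lemma capP e r u v : e \in eidx -> u \in nodes -> v \in nodes -> u != v ->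
  (forall X : node -> bool, X v -> ~~ X u -> capf e r u v <= Fhat e X - rowsum nodes r X) /\
  exists X : node -> bool, [/\ X v, ~~ X u & capf e r u v = Fhat e X - rowsum nodes r X].
Proof.
move=> he _ _ uv; split=> [X|]; first exact: capf_le.
have [p hp E] := minv_mem (cap_score (con e) r u v) (wf_nil wf (con_mem he)).
pose X (z : node) := if z == v then true else if z == u then false
  else gain (con e) r p.1 z true <= gain (con e) r p.1 z false.
have Xv : X v by rewrite /X eqxx.
have Xu : ~~ X u by rewrite /X (negbTE uv) eqxx.
exists X; split=> //; apply/eqP; rewrite eq_le capf_le //=.
rewrite {1}/capf E /cap_score /Fhat rowsumE addrAC lerD2r lerBlDr -addrA -big_split /=.
apply: le_trans (fhat_le _ hp) _; rewrite lerD2l; apply: ler_sum => z _.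
rewrite /capz /X /minz; case: eqP => _; first by rewrite /gain subrK.
case: eqP => _; first by rewrite /gain subrK.
by case: ifP => _; rewrite /gain subrK.
Qed.

Definition row_bound : nat := (4 * (abs_total + `|penalty| * (size nodes * arg_total)))%N.

Lemma fhat_bound c X : c \in cons_ ->
  (`|fhat c X| <= abs_total + `|penalty| * (size nodes * arg_total))%N.
Proof.
move=> hc.
have [p hp ->] := fhat_mem X hc; rewrite /score.
have h1 : (`|p.2| <= abs_total)%N.
  rewrite /abs_total (big_rem c) //= (big_rem p) //= -addnA leq_addr //.
have h2 : (size c.1 <= arg_total)%N by rewrite /arg_total (big_rem c) //= leq_addr.
have h3 : 0 <= \sum_(z <- nodes) penalty * Posz (mism c.1 p.1 z (X z)).
  by apply: sumr_ge0 => z _; rewrite mulr_ge0 // wf_pen.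
have h4 : \sum_(z <- nodes) penalty * Posz (mism c.1 p.1 z (X z)) <=
    Posz (`|penalty| * (size nodes * arg_total)).
  apply: (@le_trans _ _ (\sum_(z <- nodes) Posz (`|penalty| * arg_total))).
    apply: ler_sum => z _; rewrite PoszM gez0_abs ?wf_pen // ler_wpM2l ?wf_pen //.
    by rewrite lez_nat (leq_trans (mism_le _ _ _ _)).
  by rewrite big_const_seq count_predT iter_addr_0 -mulr_natr mulnCA !PoszM natz [X in _ <= X]mulrC.
move: (\sum_(z <- _) _ : int) h3 h4 => S h3 h4; move: (p.2) h1 => q h1; lia.
Qed.

(** An entry is at most the value of its singleton and at least the marginal value of [z] over all
    other nodes. This keeps the numbers small during the whole run. *)
Lemma base_bound e r z : e \in eidx -> z \in nodes -> base_row nodes Fhat e r ->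
  (`|r z| <= row_bound)%N.
Proof.
move=> he hz [h1 h2].
have e1 : rowsum nodes r (pred1 z) = r z.
  by rewrite /rowsum -big_filter filter_pred1_uniq ?uniq_nodes // big_seq1.
have := rowsumUI nodes r (pred1 z) (fun y => y != z).
rewrite (@rowsum_ext _ _ _ (fun y => pred1 z y || (y != z)) xpredT); last by move=> y _ /=; case: eqP.
rewrite (@rowsum_ext _ _ _ (fun y => pred1 z y && (y != z)) xpred0); last by move=> y _ /=; case: eqP.
rewrite /(rowsum _ _ xpred0) big_pred0 // addr0 h2 e1.
move: (rowsum _ _ (fun y => y != z)) (h1 (fun y => y != z)) => w hw.
have := h1 (pred1 z); rewrite e1 /Fhat; move: hw; rewrite /Fhat.
have := fhat_bound xpredT (con_mem he); have := fhat_bound (pred1 z) (con_mem he).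
have := fhat_bound (fun y => y != z) (con_mem he); have := fhat_bound xpred0 (con_mem he).
rewrite /row_bound; move: (abs_total + _)%N => B.
move: (fhat _ _ : int) (fhat _ (fun y => y != z) : int) (fhat _ (pred1 z) : int) (fhat _ xpredT : int) (r z) w.
move=> a0 a1 a2 a3 a4 a5; lia.
Qed.

Definition solution (U : int) := exists (beta : nat -> int) (val : nat -> int),
  [/\ forall v, beta v \in vals,
      forall e, e \in eidx -> (map beta (con e).1, val e) \in (con e).2 &
      \sum_(e <- eidx) val e <= U].

Lemma mism_map (beta : nat -> int) args z : mism args (map beta args) z (z.2 <= beta z.1) = 0%N.
Proof.
elim: args => [|y args IH] //=; rewrite mism_cons IH addn0.
by case: (y =P z.1) => [->|] //=; rewrite eqxx.
Qed.

Lemma mism_eq0 args t z b i : size t = size args -> (i < size args)%N -> nth 0%N args i = z.1 ->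
  mism args t z b = 0%N -> b = (z.2 <= nth 0 t i).
Proof.
elim: args t i => [|y args IH] [|a t] [|i] //= [e] hi.
  by move=> ->; rewrite mism_cons eqxx /=; case: eqP.
by move=> hn; rewrite mism_cons => /eqP; rewrite addn_eq0 => /andP[_ /eqP]; apply: IH.
Qed.

(** The selected entries sum to at least [- abs_total], so a single mismatch already lifts the total
    above [U]. *)
Lemma fhat_solution U : (U + Posz abs_total < penalty) ->
  (exists X, \sum_(e <- eidx) fhat (con e) X <= U) <-> solution U.
Proof.
move=> hM; split=> [[X hX]|[beta [val [h1 h2 h3]]]]; last first.
  exists (fun z => z.2 <= beta z.1); apply: le_trans h3; rewrite big_seq [leRHS]big_seq.
  apply: ler_sum => e he; apply: le_trans (fhat_le _ (h2 e he)) _ => /=.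
  by rewrite /score big1 ?addr0 // => z _; rewrite mism_map mulr0.
pose G e := score (con e) X.
have [sel hsel] : exists sel : nat -> seq int * int, forall e, e \in eidx ->
    sel e \in (con e).2 /\ fhat (con e) X = G e (sel e).
  exists (fun e => nth ([::], 0) (con e).2 (find (fun p => fhat (con e) X == G e p) (con e).2)).
  move=> e he.
  have hh : has (fun p => fhat (con e) X == G e p) (con e).2.
    have [p hp E] := minv_mem (G e) (wf_nil wf (con_mem he)).
    by apply/hasP; exists p => //; rewrite -E.
  by split; [rewrite mem_nth // -has_find | exact/eqP/(nth_find ([::], 0) hh)].
have absS : - Posz abs_total <= \sum_(e <- eidx) (sel e).2.
  rewrite lerNl -sumrN /abs_total (big_nth ([::], [::])) big_mkord.
  rewrite (_ : eidx = index_iota 0 (size cons_)); last by rewrite /index_iota subn0.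
  rewrite big_mkord (big_morph Posz PoszD (erefl _)); apply: ler_sum => i _.
  have [|h _] := hsel i; first by rewrite mem_iota /=.
  rewrite -/(con i) (big_rem (sel i)) //= PoszD; lia.
have zero e : e \in eidx -> forall z, z \in nodes -> mism (con e).1 (sel e).1 z (X z) = 0%N.
  move=> he z hz; apply/eqP; rewrite -leqn0 leqNgt; apply/negP => hm.
  have hge e' : 0 <= \sum_(z <- nodes) penalty * Posz (mism (con e').1 (sel e').1 z (X z)).
    by apply: sumr_ge0 => y _; rewrite mulr_ge0 // wf_pen.
  have : penalty <= \sum_(e <- eidx) \sum_(z <- nodes) penalty * Posz (mism (con e).1 (sel e).1 z (X z)).
    rewrite (big_rem e) //= (big_rem z) //= -addrA -[leLHS]addr0; apply: lerD.
      by rewrite -[leLHS]mulr1; apply: ler_wpM2l; [exact: wf_pen | rewrite lez_nat].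
    by apply: addr_ge0; apply: sumr_ge0 => y _ //; rewrite mulr_ge0 // wf_pen.
  move: hX; rewrite big_seq (eq_bigr (fun e => G e (sel e))); last by move=> i hi; case: (hsel i hi).
  rewrite -big_seq /G /score big_split /=; move: absS hM.
  set S1 := (\sum_(_ <- _) (sel _).2); set S2 := (\sum_(_ <- _) \sum_(_ <- _) _).
  by move: (S1 : int) (S2 : int) => a b; lia.
(* Without mismatches [X] determines the value of each variable that occurs in a constraint, and
   that value is the only good one; other variables may get any value from [vals]. *)
pose good v (d : int) := all (fun a => X (v, a) == (a <= d)) vals.
pose beta v := nth (head 0 vals) vals (find (good v) vals).
have v0 : (0 < size vals)%N by rewrite lt0n size_eq0 wf_vals0.
have bE e : e \in eidx -> map beta (con e).1 = (sel e).1.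
  move=> he; have [hs _] := hsel e he; have hc := con_mem he.
  have es := wf_size wf hc hs.
  apply: (@eq_from_nth _ 0) => [|i]; rewrite size_map // => hi.
  rewrite (nth_map 0%N) //; set v := nth 0%N _ i; set d := nth 0 _ i.
  have hd : d \in vals by apply: (wf_ent wf hc hs); rewrite mem_nth // es.
  have hv : v \in vars by apply: (wf_args wf hc); rewrite mem_nth.
  have gd : good v d.
    apply/allP => a ha; apply/eqP; apply: (@mism_eq0 (con e).1 (sel e).1 (v, a) _ i) => //.
    by apply: zero => //; apply: allpairs_f.
  have hh : has (good v) vals by apply/hasP; exists d.
  have /allP gb := nth_find (head 0 vals) hh; rewrite -/(beta v) in gb.
  have hb : beta v \in vals by rewrite mem_nth // -has_find.
  move/allP: gd => gd; apply/eqP; rewrite eq_le.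
  have /eqP e1 := gb _ hb; have /eqP e2 := gd _ hb; have /eqP e3 := gb _ hd; have /eqP e4 := gd _ hd.
  by rewrite -e2 e1 lexx -e3 e4 lexx.
exists beta, (fun e => (sel e).2); split.
- move=> v; rewrite /beta; case: (ltnP (find (good v) vals) (size vals)) => h; first exact: mem_nth.
  by rewrite nth_default //; case: (vals) v0 => //= a l _; rewrite inE eqxx.
- by move=> e he; rewrite bE //; case: (hsel e he); case: (sel e).
- apply: le_trans hX; rewrite big_seq [leRHS]big_seq; apply: ler_sum => e he.
  have [_ ->] := hsel e he; rewrite /G /score lerDl; apply: sumr_ge0 => z _.
  by rewrite mulr_ge0 // wf_pen.
Qed.

End Core.

Local Close Scope ring_scope.

Local Open Scope ring_scope.

(** * The push-relabel algorithm on finite tables *)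

Definition flow_table := (seq ((nat * node) * int) * seq (node * nat))%type.
(** A push from the node along a pair, or with [None] a relabelling. As the schedule is fixed in
    advance, the whole run is a single fold over a list of operations. *)
Definition flow_op := (node * option (nat * node))%type.

Definition look (A : eqType) (B : Type) (d : B) (l : seq (A * B)) (k : A) : B :=
  head d [seq p.2 | p <- l & p.1 == k].

Lemma look_map (A : eqType) (B : Type) (d : B) (f : A -> B) (l : seq A) k :
  look d [seq (j, f j) | j <- l] k = if k \in l then f k else d.
Proof.
rewrite /look; elim: l => //= j l IH; rewrite inE eq_sym.
by case: (k =P j) => [->|_] /=.
Qed.

Section Run.
Variable x : problem.

Notation ns := (nodes x).
Notation es := (eidx x).
Notation st := (sfm_state node nat).

Definition opstep (s : st) (o : flow_op) : st :=
  if o.2 is Some ev then push ns es (capf x) o.1 s ev else relabel ns es s o.1.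

Definition visit_ops u : seq flow_op :=
  rcons [seq (u, Some ev) | ev <- [seq (e, v) | e <- es, v <- ns]] (u, None).

Definition pass_ops := flatten [seq visit_ops u | u <- ns].

Definition round_list : seq (node * node * option node) :=
  [seq (p, o) | p <- [seq (a, b) | a <- ns, b <- ns], o <- None :: [seq Some a | a <- ns]].

(** The outer list is only a unary counter of passes, two more than [n * n * n.+1 + n] for [n]
    nodes; [minimize] asks for more than that number. *)
Definition all_ops := flatten [seq pass_ops | _ <-
  ([seq None | _ <- iota 0 2] ++ [seq None | _ <- ns]) ++ [seq Some p | p <- round_list]].

Lemma visit_opsE s u : foldl opstep s (visit_ops u) = visit ns es (capf x) s u.
Proof.
rewrite /visit_ops -cats1 foldl_cat /= /opstep /= /visit /discharge; congr relabel.
by elim: [seq _ | _ <- _, _ <- _] s => //= ev l IH s; rewrite -IH.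
Qed.

Lemma foldl_flatten_map (A B C : Type) (f : B -> A -> B) (g : C -> seq A) s l :
  foldl f s (flatten (map g l)) = foldl (fun s c => foldl f s (g c)) s l.
Proof. by elim: l s => //= c l IH s; rewrite foldl_cat IH. Qed.

Lemma foldl_const (B C : Type) (f : B -> B) s (l : seq C) :
  foldl (fun s _ => f s) s l = iter (size l) f s.
Proof. by elim: l s => //= c l IH s; rewrite IH -iterSr. Qed.

Lemma pass_opsE s : foldl opstep s pass_ops = pass ns es (capf x) s.
Proof.
rewrite foldl_flatten_map /pass; congr (foldl _ s ns).
by apply: functional_extensionality => t; apply: functional_extensionality => u; exact: visit_opsE.
Qed.

Lemma all_opsE s : exists2 k, (size ns * size ns * (size ns).+1 + size ns < k)%N &
  foldl opstep s all_ops = iter k (pass ns es (capf x)) s.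
Proof.
rewrite foldl_flatten_map; set l := (_ ++ _).
exists (size l); last first.
  rewrite -foldl_const; congr (foldl _ s l).
  by apply: functional_extensionality => t; apply: functional_extensionality => u; exact: pass_opsE.
rewrite /l /round_list !size_cat !size_map size_iota; move: ns => N.
by rewrite !size_allpairs /= size_map; lia.
Qed.

Definition keys := [seq (e, z) | e <- es, z <- ns].

Definition read (t : flow_table) : st :=
  (fun e z => look 0 t.1 (e, z), fun z => look 0%N t.2 z).

Definition tabulate (s : st) : flow_table :=
  ([seq (k, s.1 k.1 k.2) | k <- keys], [seq (z, s.2 z) | z <- ns]).

Definition small (t : flow_table) :=
  all (fun p => `|p.2| <= row_bound x)%N t.1 && all (fun p => p.2 <= size ns)%N t.2.

(* The guard makes the size of the table bounded on ill-formed problems too. *)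
Definition guard_step (t : flow_table) (o : flow_op) : flow_table :=
  let t' := tabulate (opstep (read t) o) in if small t' then t' else t.

(** Tables have value 0 outside their keys, so exactly these states survive [tabulate]. *)
Definition supported (s : st) :=
  (forall e z, ~~ ((e \in es) && (z \in ns)) -> s.1 e z = 0) /\
  (forall z, z \notin ns -> s.2 z = 0%N).

Lemma mem_keys e z : ((e, z) \in keys) = (e \in es) && (z \in ns).
Proof.
apply/idP/andP => [h|[h1 h2]]; first by have := mem_evs h.
exact: allpairs_f.
Qed.

Lemma tabulateK s : supported s -> read (tabulate s) = s.
Proof.
move=> [h1 h2]; rewrite /read /tabulate /= [RHS]surjective_pairing; congr pair.
  apply: functional_extensionality => e; apply: functional_extensionality => z.
  rewrite look_map mem_keys /=; case: ifP => // /negbT h; exact/esym/h1.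
apply: functional_extensionality => z; rewrite look_map.
by case: ifP => // /negbT h; exact/esym/h2.
Qed.

Definition op_ok (o : flow_op) := if o.2 is Some ev then (ev.1 \in es) && (ev.2 \in ns) else true.

Lemma mem_all_ops (o : flow_op) : o \in all_ops ->
  o.1 \in ns /\ op_ok o.
Proof.
move=> /flattenP[l /mapP[_ _ ->]] /flattenP[l' /mapP[u hu ->]].
rewrite mem_rcons inE => /orP[/eqP -> //|/mapP[ev hev ->]] /=; split=> //.
by rewrite /op_ok /=; have [-> ->] := mem_evs hev.
Qed.

Lemma supported_step s o : o.1 \in ns ->
  op_ok o ->
  supported s -> supported (opstep s o).
Proof.
case: o => u [[e v]|] /= hu; last first.
  move=> _ [h1 h2]; rewrite /opstep /relabel /=; case: ifP => // _; split=> //= z hz.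
  by case: eqP => [e|_]; [rewrite e hu in hz | exact: h2].
move=> /andP[he hv] [h1 h2]; rewrite /opstep /push /=; case: ifP => // _; split=> //= e' z hz.
case: eqP => [ee|_]; last exact: h1.
rewrite ee he /= in hz *; rewrite /push_row.
case: eqP => [e1|_]; first by rewrite e1 hu in hz.
case: eqP => [e1|_]; first by rewrite e1 hv in hz.
by apply: h1; rewrite he.
Qed.

Definition init_row e z : int := if (e \in es) && (z \in ns) then greedy ns (Fhat x) e z else 0.

Definition init_table : flow_table := tabulate (initial init_row).

Definition final_table := foldl guard_step init_table all_ops.

Definition optimum : int :=
  sumz [seq fhat x (con x e) xpred0 | e <- es] +
  sumz [seq minz (excess es (read final_table).1 z) 0 | z <- ns].

Hypothesis wf : wf_problem x.

Lemma init_base e : e \in es -> base_row ns (Fhat x) e (init_row e).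
Proof.
move=> he; have [h1 h2] := greedy_base (uniq_nodes wf) (@Fhat_ext x) (@Fhat0 x) (Fhat_sub wf) he.
have E X : rowsum ns (init_row e) X = rowsum ns (greedy ns (Fhat x) e) X.
  rewrite /rowsum big_seq_cond [RHS]big_seq_cond; apply: eq_bigr => z /andP[hz _].
  by rewrite /init_row he hz.
by split=> [X|]; rewrite E.
Qed.

(** Size bounds must hold after every single operation. Validity of the labels is a matter of whole
    visits, as a relabelling relies on the discharge before it. *)
Definition admitted (s : st) := [/\ supported s,
  forall e, e \in es -> base_row ns (Fhat x) e (s.1 e) &
  forall z, z \in ns -> (s.2 z <= size ns)%N].

Lemma admitted_step s (o : flow_op) : o \in all_ops -> admitted s -> admitted (opstep s o).
Proof.
move=> /mem_all_ops[hu ho] [h1 h2 h3]; split; first exact: supported_step.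
- case: o hu ho => u [[e v]|] /= hu; last first.
    by move=> _ e he; rewrite /opstep /relabel; case: ifP => _; exact: h2.
  move=> /andP[he hv] e' he'; rewrite /opstep /push /=; case: ifP => [/and3P[uv act _]|_]; last exact: h2.
  rewrite /=; case: eqP => [->|_]; last exact: h2.
  have [b1 b2] := h2 e he.
  have [c1 [X [_ _ c2]]] := capP wf (s.1 e) he hu hv uv.
  have c0 : 0 <= capf x e (s.1 e) u v by rewrite c2 subr_ge0.
  have d0 : 0 <= amount es (capf x) s e u v.
    by rewrite /amount; case: ifP => // _; apply: ltW; case/andP: act.
  have d1 : amount es (capf x) s e u v <= capf x e (s.1 e) u v.
    by rewrite /amount; case: ifP => // /negbT; rewrite -ltNge => /ltW.
  split=> [Y|]; rewrite rowsum_push ?(uniq_nodes wf) //; last by rewrite addrAC addrK.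
  have := b1 Y; have := c1 Y; case: (Y u); case: (Y v) => //= h; rewrite ?mulr0n ?mulr1n ?subr0 ?addr0.
  + by rewrite subrK.
  + by move=> h'; apply: le_trans h'; rewrite lerBlDr lerDl.
  + by move=> _; rewrite -lerBrDl; apply: le_trans d1 _; exact: h.
  + by [].
- case: o hu ho => u [ev|] /= hu _ z hz.
    by rewrite /opstep push_label; exact: h3.
  rewrite /opstep /relabel /=; case: ifP => [/andP[_ act]|_] /=; last exact: h3.
  by case: eqP => [->|_] //; exact: h3.
Qed.

Lemma small_admitted s : admitted s -> small (tabulate s).
Proof.
move=> [_ h1 h2]; apply/andP; split; apply/allP => p /mapP[k hk ->] /=; last exact: h2.
have [/=] := mem_evs hk; case: k {hk} => e z /= he hz.
exact: (base_bound wf he hz (h1 e he)).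
Qed.

Lemma init_admitted : admitted (initial init_row).
Proof.
split=> //; last exact: init_base.
by split=> //= e z /negbTE h; rewrite /init_row h.
Qed.

Lemma final_tableE : read final_table = foldl opstep (initial init_row) all_ops.
Proof.
suff H l s : {subset l <= all_ops} -> admitted s ->
    foldl guard_step (tabulate s) l = tabulate (foldl opstep s l) /\ admitted (foldl opstep s l).
  rewrite /final_table; have [//|-> [h _ _]] := H all_ops _ _ init_admitted.
  exact: tabulateK.
elim: l s => //= o l IH s hl hs; have [sup _ _] := hs.
have ho : o \in all_ops by apply: hl; rewrite inE eqxx.
have ha := admitted_step ho hs.
rewrite {2}/guard_step tabulateK // small_admitted //; apply: IH => // y hy.
by apply: hl; rewrite inE hy orbT.
Qed.

Lemma optimumP U : (optimum <= U) <-> exists X, \sum_(e <- es) fhat x (con x e) X <= U.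
Proof.
have [k hk E] := all_opsE (initial init_row).
have [_ [h1 [X h2]]] := minimize (uniq_nodes wf) (iota_uniq _ _ : uniq es) (@Fhat_ext x) (@Fhat0 x)
  (Fhat_sub wf) (capP wf) init_base hk.
have FE Y : \sum_(e <- es) fhat x (con x e) Y =
    \sum_(e <- es) fhat x (con x e) xpred0 + \sum_(e <- es) Fhat x e Y.
  by rewrite -big_split /=; apply: eq_bigr => e _; rewrite /Fhat addrC subrK.
have OE : optimum = \sum_(e <- es) fhat x (con x e) xpred0 + \sum_(e <- es) Fhat x e X.
  rewrite /optimum !sumzE !big_map h2 final_tableE E; by congr (_ + _).
split=> [h|[Y hY]]; first by exists X; rewrite FE -OE.
by apply: le_trans hY; rewrite OE (FE Y) h2; apply: lerD => //; exact: h1.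
Qed.

Lemma optimum_solution U : U + Posz (abs_total x) < penalty x -> (optimum <= U) <-> solution x U.
Proof. by move=> hU; rewrite optimumP; exact: fhat_solution. Qed.
End Run.

Local Close Scope ring_scope.

Local Open Scope ring_scope.

(** * Polynomial running time of the minimization *)

Ltac pt_hyp := match goal with
  | H : PT ?g |- PT (fun p => ?g (@?f p)) => apply: (PT_comp H)
  | H : PT (fun q => ?g q.1 q.2) |- PT (fun p => ?g (@?a p) (@?b p)) => apply: (PT_comp2 H)
  end.

Ltac pt_user ::= first [ pt_hyp | pt_base ].

Section PTLemmas.
Context {X : Type} {EX : Enc X}.

Lemma PT_minv (T : eqType) (ET : Enc T) (f : X -> T -> int) (l : X -> seq T) :
  PT (fun p : X * T => f p.1 p.2) -> PT l -> PT (fun x => minv (f x) (l x)).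
Proof.
move=> Pf Pl; rewrite /minv.
apply: (@PT_case _ _ _ _ _ _ l (fun=> 0) (fun x p l' => minl (f x p) [seq f x q | q <- l'])); pt.
Qed.

Lemma PT_bigsum (T : Type) (ET : Enc T) (f : X -> T -> int) (l : X -> seq T) :
  PT (fun p : X * T => f p.1 p.2) -> PT l -> PT (fun x => \sum_(z <- l x) f x z).
Proof.
move=> Pf Pl; apply: (@PT_ext _ _ _ _ (fun x => sumz [seq f x z | z <- l x])); first by pt.
by move=> x; rewrite sumzE big_map.
Qed.

Lemma PT_bigsumn (T : Type) (ET : Enc T) (f : X -> T -> nat) (l : X -> seq T) :
  PT (fun p : X * T => f p.1 p.2) -> PT l -> PT (fun x => (\sum_(z <- l x) f x z)%N).
Proof.
move=> Pf Pl; have P : PT (fun x => absz (\sum_(z <- l x) Posz (f x z))) by apply: PT_absz; apply: PT_bigsum; pt.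
by apply: (PT_ext P) => x; rewrite -(big_morph Posz PoszD (erefl _)).
Qed.

Definition index_acc (T : eqType) (a : T) (l : seq unit) (b : T) : seq unit :=
  if b == a then [::] else tt :: l.

Lemma PT_index (T : eqType) (ET : Enc T) (a : X -> T) (l : X -> seq T) :
  PT a -> PT l -> PT (fun x => index (a x) (l x)).
Proof.
move=> Pa Pl.
apply: (@PT_ext _ _ _ _ (fun x => size (foldl (index_acc (a x)) [::] (rev (l x))))); last first.
  by move=> x; rewrite foldl_rev; elim: (l x) => //= b m IH; rewrite {1}/index_acc; case: eqP => //= _; rewrite IH.
apply: PT_size.
apply: (@PT_foldl_grow _ _ _ _ _ _ (fun x => index_acc (a x)) (fun=> [::]) (fun x => rev (l x)) (sz tt).+1).
- by rewrite /index_acc; pt.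
- by pt.
- by pt.
- move=> x b c; rewrite /index_acc; case: ifP => _; rewrite ?sz_cons ?sz_nil; last by lia.
  by have := sz_gt0 b; lia.
Qed.

Lemma PT_look (A : eqType) (B : Type) (EA : Enc A) (EB : Enc B) (d : X -> B)
    (l : X -> seq (A * B)) (k : X -> A) :
  PT d -> PT l -> PT k -> PT (fun x => look (d x) (l x) (k x)).
Proof. by move=> Pd Pl Pk; rewrite /look; pt. Qed.

Variable x : X -> problem.
Hypothesis Px : PT x.

Lemma PT_vals : PT (fun a => vals (x a)).
Proof. by rewrite /vals; pt. Qed.

Lemma PT_vars : PT (fun a => vars (x a)).
Proof. by rewrite /vars; pt. Qed.

Lemma PT_cons_ : PT (fun a => cons_ (x a)).
Proof. by rewrite /cons_; pt. Qed.

Lemma PT_penalty : PT (fun a => penalty (x a)).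
Proof. by rewrite /penalty; pt. Qed.

Lemma PT_nodes : PT (fun a => nodes (x a)).
Proof.
have Pv := PT_vars; have Pw := PT_vals.
rewrite /nodes; apply: PT_allpairs; [by pt | by [] |].
exact: (PT_comp Pw (PT_fst PT_id)).
Qed.

Lemma PT_eidx : PT (fun a => eidx (x a)).
Proof. by rewrite /eidx; apply: PT_iota; exact: PT_cons_. Qed.

Lemma PT_con (e : X -> nat) : PT e -> PT (fun a => con (x a) (e a)).
Proof. by move=> Pe; rewrite /con; apply: PT_nth; pt; exact: PT_cons_. Qed.

Lemma PT_mism (c : X -> seq nat) (t : X -> seq int) (z : X -> node) (b : X -> bool) :
  PT c -> PT t -> PT z -> PT b -> PT (fun a => mism (c a) (t a) (z a) (b a)).
Proof.
move=> Pc Pt Pz Pb; rewrite /mism; pt.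
Qed.
End PTLemmas.

Ltac pt_problem := match goal with
  | |- PT (fun p => nodes (@?x p)) => apply: PT_nodes
  | |- PT (fun p => eidx (@?x p)) => apply: PT_eidx
  | |- PT (fun p => vals (@?x p)) => apply: PT_vals
  | |- PT (fun p => vars (@?x p)) => apply: PT_vars
  | |- PT (fun p => cons_ (@?x p)) => apply: PT_cons_
  | |- PT (fun p => penalty (@?x p)) => apply: PT_penalty
  | |- PT (fun p => con (@?x p) (@?e p)) => apply: PT_con
  | |- PT (fun p => mism (@?x p) (@?e p) (@?z p) (@?b p)) => apply: PT_mism
  | |- PT (fun p => look (@?x p) (@?e p) (@?z p)) => apply: PT_look
  | |- PT (fun p => index (@?e p) (@?z p)) => apply: PT_index
  end.

Ltac pt_user ::= first [ pt_hyp | pt_problem | pt_base ].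

Section PTScore.
Context {X : Type} {EX : Enc X}.
Variables (x : X -> problem) (c : X -> constr) (S : X -> node -> bool).
Hypotheses (Px : PT x) (Pc : PT c) (PS : PT (fun p : X * node => S p.1 p.2)).

Lemma PT_fhat : PT (fun a => fhat (x a) (c a) (S a)).
Proof.
rewrite /fhat; apply: PT_minv; last by pt.
rewrite /score; apply: PT_addz; first by pt.
apply: (@PT_bigsum _ _ _ _ (fun (p : X * (seq int * int)) z => penalty (x p.1) * Posz (mism (c p.1).1 p.2.1 z (S p.1 z)))); pt.
Qed.
End PTScore.

Section PTCap.
Context {X : Type} {EX : Enc X}.
Variables (x : X -> problem) (e : X -> nat) (r : X -> node -> int) (u v : X -> node).
Hypotheses (Px : PT x) (Pe : PT e) (Pr : PT (fun p : X * node => r p.1 p.2)) (Pu : PT u) (Pv : PT v).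

Lemma PT_gain {Y : Type} {EY : Enc Y} (y : Y -> X) (c : Y -> constr) (t : Y -> seq int) (z : Y -> node) (b : bool) :
  PT y -> PT c -> PT t -> PT z -> PT (fun a => gain (x (y a)) (c a) (r (y a)) (t a) (z a) b).
Proof.
move=> Py Pc Pt Pz; by rewrite /gain; case: b; pt.
Qed.

Lemma PT_capf : PT (fun a => capf (x a) (e a) (r a) (u a) (v a)).
Proof.
rewrite /capf; apply: PT_addz; last first.
  by apply: PT_oppz; apply: PT_fhat; pt.
apply: PT_minv; last by pt.
rewrite /cap_score; apply: PT_addz; first by pt.
apply: (@PT_bigsum _ _ _ _ (fun (p : X * (seq int * int)) z => capz (x p.1) (con (x p.1) (e p.1)) (r p.1) (u p.1) (v p.1) p.2.1 z)); last by pt.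
have Pc : PT (fun p : X * (seq int * int) * node => con (x p.1.1) (e p.1.1)).
  by pt.
have Pg b : PT (fun p : X * (seq int * int) * node =>
    gain (x p.1.1) (con (x p.1.1) (e p.1.1)) (r p.1.1) p.1.2.1 p.2 b).
  by apply: (@PT_gain _ _ (fun p : X * (seq int * int) * node => p.1.1)); pt.
by rewrite /capz /minz; apply: PT_if; pt.
Qed.
End PTCap.

Section PTStep.
Context {X : Type} {EX : Enc X}.
Variables (x : X -> problem) (t : X -> flow_table).
Hypotheses (Px : PT x) (Pt : PT t).

Lemma PT_read1 (e : X -> nat) (z : X -> node) : PT e -> PT z -> PT (fun a => (read (t a)).1 (e a) (z a)).
Proof. by move=> Pe Pz; rewrite /read /=; apply: PT_look; pt. Qed.

Lemma PT_read2 (z : X -> node) : PT z -> PT (fun a => (read (t a)).2 (z a)).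
Proof. by move=> Pz; rewrite /read /=; apply: PT_look; pt. Qed.

Lemma PT_excess (z : X -> node) : PT z -> PT (fun a => excess (eidx (x a)) (read (t a)).1 (z a)).
Proof.
move=> Pz; rewrite /excess; apply: (@PT_bigsum _ _ _ _ (fun a e => (read (t a)).1 e (z a))); last by pt.
by rewrite /read /=; pt.
Qed.

Lemma PT_active (z : X -> node) : PT z -> PT (fun a => active (nodes (x a)) (eidx (x a)) (read (t a)) (z a)).
Proof.
move=> Pz; rewrite /active; apply: PT_andb; first by apply: PT_ltz; [pt | exact: PT_excess].
by apply: PT_ltn; [exact: PT_read2 | pt].
Qed.

Lemma PT_amount (e : X -> nat) (u v : X -> node) : PT e -> PT u -> PT v ->
  PT (fun a => amount (eidx (x a)) (capf (x a)) (read (t a)) (e a) (u a) (v a)).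
Proof.
move=> Pe Pu Pv; rewrite /amount.
have Pc : PT (fun a => capf (x a) (e a) ((read (t a)).1 (e a)) (u a) (v a)).
  by apply: PT_capf => //; rewrite /read /=; pt.
have Px' := PT_excess Pu; by apply: PT_if; [apply: PT_lez | |].
Qed.

Lemma PT_admissible (u v : X -> node) : PT u -> PT v ->
  PT (fun a => admissible (nodes (x a)) (eidx (x a)) (read (t a)) (u a) (v a)).
Proof.
move=> Pu Pv; rewrite /admissible; apply: PT_andb; first by pt.
apply: PT_andb; first exact: PT_active.
apply: PT_eq; first exact: PT_read2.
apply: (@PT_ext _ _ _ _ (fun a => (read (t a)).2 (v a) + 1)%N) => [|a]; last by rewrite addn1.
by apply: PT_addn; [exact: PT_read2 | pt].
Qed.
End PTStep.

Ltac pt_flow := match goal with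
  | |- PT (fun p => (read (@?t p)).1 (@?e p) (@?z p)) => apply: PT_read1
  | |- PT (fun p => (read (@?t p)).2 (@?z p)) => apply: PT_read2
  | |- PT (fun p => excess _ _ _) => apply: PT_excess
  | |- PT (fun p => active _ _ _ _) => apply: PT_active
  | |- PT (fun p => amount _ _ _ _ _ _) => apply: PT_amount
  | |- PT (fun p => admissible _ _ _ _ _) => apply: PT_admissible
  end.

Ltac pt_user ::= first [ pt_hyp | pt_problem | pt_flow | pt_base ].

(** The entrywise form has no updated functions as intermediate values, so the closure lemmas apply
    to it. *)
Lemma opstep1E x t (o : flow_op) e z : (opstep x (read t) o).1 e z =
  if o.2 is Some ev then
    if admissible (nodes x) (eidx x) (read t) o.1 ev.2 then
      if e == ev.1 then
        if z == o.1 then (read t).1 e z - amount (eidx x) (capf x) (read t) ev.1 o.1 ev.2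
        else if z == ev.2 then (read t).1 e z + amount (eidx x) (capf x) (read t) ev.1 o.1 ev.2
        else (read t).1 e z
      else (read t).1 e z
    else (read t).1 e z
  else (read t).1 e z.
Proof.
rewrite /opstep; case: o => u [[e' v]|] /=; last by rewrite /relabel; case: ifP.
by rewrite /push /=; case: ifP => //= _; case: eqP => // ->.
Qed.

Lemma opstep2E x t (o : flow_op) z : (opstep x (read t) o).2 z =
  if o.2 is Some _ then (read t).2 z
  else if active (nodes x) (eidx x) (read t) o.1 then
    if z == o.1 then ((read t).2 z + 1)%N else (read t).2 z
  else (read t).2 z.
Proof.
rewrite /opstep; case: o => u [ev|] /=; first by rewrite push_label.
by rewrite /relabel; case: ifP => //= _; rewrite addn1.
Qed.

Lemma PT_tabulate {X : Type} {EX : Enc X} (x : X -> problem) (s : X -> sfm_state node nat) : PT x ->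
  PT (fun p : X * (nat * node) => (s p.1).1 p.2.1 p.2.2) ->
  PT (fun p : X * node => (s p.1).2 p.2) -> PT (fun a => tabulate (x a) (s a)).
Proof.
move=> Px P1 P2; rewrite /tabulate /keys; apply: PT_pair.
  apply: (@PT_map _ _ _ _ _ _ (fun a k => (k, (s a).1 k.1 k.2))); first by pt.
  by pt.
apply: (@PT_map _ _ _ _ _ _ (fun a k => (k, (s a).2 k))); by pt.
Qed.

Lemma PT_row_bound {X : Type} {EX : Enc X} (x : X -> problem) : PT x -> PT (fun a => row_bound (x a)).
Proof.
move=> Px; rewrite /row_bound; apply: PT_muln; first by pt.
apply: PT_addn; last first.
  apply: PT_muln; first by pt.
  apply: PT_muln; first by pt.
  by rewrite /arg_total; apply: (@PT_bigsumn _ _ _ _ (fun _ (c : constr) => size c.1)); pt.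
rewrite /abs_total; apply: (@PT_bigsumn _ _ _ _ (fun _ (c : constr) => (\sum_(p <- c.2) `|p.2|)%N)); last by pt.
by apply: (@PT_bigsumn _ _ _ _ (fun _ (p : seq int * int) => `|p.2|%N)); pt.
Qed.

Lemma PT_guard_step : PT (fun p : problem * flow_table * flow_op => guard_step p.1.1 p.1.2 p.2).
Proof.
have P : PT (fun p : problem * flow_table * flow_op => tabulate p.1.1 (opstep p.1.1 (read p.1.2) p.2)).
  apply: PT_tabulate; first by pt.
  - apply: (@PT_ext _ _ _ _ _ _ _ (fun p => esym (opstep1E p.1.1.1 p.1.1.2 p.1.2 p.2.1 p.2.2))).
    by pt.
  - apply: (@PT_ext _ _ _ _ _ _ _ (fun p => esym (opstep2E p.1.1.1 p.1.1.2 p.1.2 p.2))).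
    by pt.
rewrite /guard_step; apply: PT_if; [|by []|by pt].
rewrite /small; apply: PT_andb.
  apply: PT_all; last by apply: PT_fst.
  by apply: PT_leq; [pt | apply: PT_row_bound; pt].
apply: PT_all; last by apply: PT_snd.
by pt.
Qed.

Lemma PT_init_table : PT init_table.
Proof.
rewrite /init_table; apply: PT_tabulate; [by pt | | by rewrite /=; pt].
rewrite /= /init_row /greedy /Fhat; apply: PT_if; [by pt | | by pt].
by apply: PT_addz; [|apply: PT_oppz]; apply: PT_addz; try apply: PT_oppz; apply: PT_fhat; pt.
Qed.

Lemma PT_all_ops : PT all_ops.
Proof.
have Pn := PT_nodes (@PT_id problem _); have Pe := PT_eidx (@PT_id problem _).
have Pp : PT pass_ops.
  rewrite /pass_ops; apply: PT_flatten; apply: PT_map; last by pt.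
  rewrite /visit_ops.
  apply: (@PT_ext _ _ _ _ (fun p : problem * node => [seq (p.2, Some ev) | ev <- [seq (e, v) | e <- eidx p.1, v <- nodes p.1]] ++ [:: (p.2, None)])); last by move=> p; rewrite cats1.
  by pt.
by rewrite /all_ops /round_list; pt.
Qed.

Lemma sz_graph (T V : eqType) (ET : Enc T) (EV : Enc V) (g : T -> V) (l : seq T) c :
  (forall a, a \in l -> sz (g a) <= c)%N ->
  (sz [seq (a, g a) | a <- l] <= size l * (sz l + c + 2) + 1)%N.
Proof.
elim: l => [|a l IH] h /=; first by rewrite sz_nil.
have := h a (mem_head _ _).
have := IH (fun b hb => h b (mem_behead (s := a :: l) hb)).
rewrite !sz_cons sz_pair; nia.
Qed.

Lemma sz_small x s : small x (tabulate x s) ->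
  (sz (tabulate x s) <= size (keys x) * (sz (keys x) + 4 * sz (row_bound x) + 10) +
     size (nodes x) * (sz (nodes x) + 4 * sz (size (nodes x)) + 10) + 5)%N.
Proof.
move=> /andP[/allP h1 /allP h2]; rewrite /tabulate sz_pair.
apply: (@leq_trans ((size (keys x) * (sz (keys x) + (4 * sz (row_bound x) + 5) + 2) + 1) +
     (size (nodes x) * (sz (nodes x) + (4 * sz (size (nodes x)) + 5) + 2) + 1)).+1)%N; last by nia.
rewrite ltnS; apply: leq_add; apply: sz_graph => k hk.
- have /= := h1 _ (map_f (fun k => (k, s.1 k.1 k.2)) hk) => hb.
  exact: sz_int (leq_ltn_trans hb (ltn_sz (row_bound x))).
- have /= := h2 _ (map_f (fun k => (k, s.2 k)) hk) => hb.
  by apply: leq_trans (sz_nat_le (leq_ltn_trans hb (ltn_sz (size (nodes x))))) _; lia.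
Qed.

Lemma PT_final_table : PT final_table.
Proof.
have Pk : PT keys.
  by apply: PT_allpairs; [pt | exact: (PT_eidx PT_id) | apply: PT_nodes; pt].
have Pn := PT_nodes (@PT_id problem _).
have Pr := PT_row_bound (@PT_id problem _).
have Pi := PT_init_table.
have b1 := PT_PB Pk; have b2 := PT_PB Pn; have b3 := PT_PB Pr; have b4 := PT_PB Pi.
have b5 := PT_PB (PT_size Pk); have b6 : PT (fun x => size (nodes x)) by exact: PT_size.
have b7 := PT_PB b6.
have c1 : PB sz (fun x => size (keys x)) by apply: PB_le b1 _ => x; exact: size_sz.
have c2 : PB sz (fun x => size (nodes x)) by apply: PB_le b2 _ => x; exact: size_sz.
rewrite /final_table.
apply: (PT_foldl (q := fun x => (sz (init_table x) + (size (keys x) * (sz (keys x) + 4 * sz (row_bound x) + 10) +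
     size (nodes x) * (sz (nodes x) + 4 * sz (size (nodes x)) + 10) + 5))%N)).
- exact: PT_guard_step.
- exact: PT_init_table.
- exact: PT_all_ops.
- by pb.
move=> x k; elim/last_ind: (take k _) => [|l o IH] /=; first exact: leq_addr.
rewrite foldl_rcons {1}/guard_step; case: ifP => // h.
by apply: leq_trans (sz_small h) _; exact: leq_addl.
Qed.

Lemma PT_optimum : PT optimum.
Proof.
have Pn := PT_nodes (@PT_id problem _); have Pe := PT_eidx (@PT_id problem _).
have Pf := PT_final_table.
rewrite /optimum; apply: PT_addz; apply: PT_sumz; apply: PT_map; try by pt.
  by apply: PT_fhat; pt.
by rewrite /minz; pt.
Qed.

(** An empty table makes the problem infeasible, but [minv] returns 0 on it, so this case is tested
    separately. *)
Definition decide (p : problem * int) : bool :=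
  all (fun c : constr => ~~ nilp c.2) (cons_ p.1) && (optimum p.1 <= p.2).

Lemma PT_decide : PT decide.
Proof.
by have Po := PT_optimum; rewrite /decide; pt.
Qed.

Local Close Scope ring_scope.

(** * Tractability *)

Section Decoders.

Definition decoder (A : Type) := seq bool -> A * seq bool.

Definition decodes (A : Type) (dec : decoder A) (enc : A -> seq bool) :=
  forall a r, dec (enc a ++ r) = (a, r).

(* Bounds the size of the result by the number of bits consumed. *)
Definition tame {A : Type} {EA : Enc A} (dec : decoder A) := exists K, forall l,
  (size (dec l).2 <= size l) /\
  (sz (dec l).1 + K * size (dec l).2 <= K * size l + K).

Definition dec_bit : decoder bool := fun l => (head false l, behead l).

Definition dec_pair (A B : Type) (da : decoder A) (db : decoder B) : decoder (A * B) :=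
  fun l => let p := da l in let q := db p.2 in ((p.1, q.1), q.2).

(** The input serves as clock: each element uses up at least its marker bit, so one round per bit
    suffices. The flag freezes the state after the terminator. *)
Definition seq_step (A : Type) (dec : decoder A) (s : seq A * seq bool * bool) (_ : bool) :
    seq A * seq bool * bool :=
  if s.2 then s else
  if head false s.1.2 then let p := dec (behead s.1.2) in ((p.1 :: s.1.1, p.2), false)
  else ((s.1.1, behead s.1.2), true).

Definition dec_seq (A : Type) (dec : decoder A) : decoder (seq A) := fun l =>
  let s := foldl (seq_step dec) (([::], l), false) l in (rev s.1.1, s.1.2).

Lemma dec_bitP : decodes dec_bit (fun b => [:: b]).
Proof. by []. Qed.

Lemma dec_pairP (A B : Type) (da : decoder A) (db : decoder B) ea eb :
  decodes da ea -> decodes db eb -> decodes (dec_pair da db) (fun p => ea p.1 ++ eb p.2).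
Proof. by move=> ha hb [a b] r; rewrite /dec_pair /= -catA ha /= hb. Qed.

Lemma foldl_done (A : Type) (dec : decoder A) (s : seq A * seq bool * bool) (l : seq bool) : s.2 -> foldl (seq_step dec) s l = s.
Proof. by move=> h; elim: l => //= b l IH; rewrite /seq_step h. Qed.

Lemma dec_seqP (A : Type) (dec : decoder A) ea : decodes dec ea ->
  decodes (dec_seq dec) (encode_seq ea).
Proof.
move=> h a r; rewrite /dec_seq.
have H (s : seq A) acc (l : seq bool) : size s < size l ->
    foldl (seq_step dec) ((acc, encode_seq ea s ++ r), false) l = ((catrev s acc, r), true).
  elim: s acc l => [|x s IH] acc [|b l] //= hl.
    by rewrite /seq_step /=; exact: foldl_done.
  rewrite {2}/seq_step /= /encode_seq /= -!catA h.
  by have := IH (x :: acc) l hl; rewrite /encode_seq -catA.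
rewrite H; first by rewrite /= -[catrev a [::]]/(rev a) revK.
rewrite /encode_seq -catA size_cat /= addnS ltnS (leq_trans _ (leq_addr _ _)) //.
by elim: (a) => //= x s IH; rewrite size_cat; lia.
Qed.

Lemma tame_bit : tame dec_bit.
Proof.
exists 3 => -[|b l] /=; first by split.
have h : sz b <= 3 by case: b.
by split=> //; lia.
Qed.

Lemma tame_pair (A B : Type) (EA : Enc A) (EB : Enc B) (da : decoder A) (db : decoder B) :
  tame da -> tame db -> tame (dec_pair da db).
Proof.
move=> [K hK] [K' hK']; exists (2 * (K + K') + 1) => l; rewrite /dec_pair /=.
have [a1 a2] := hK l; have [b1 b2] := hK' (da l).2; split; first exact: leq_trans a1.
by rewrite sz_pair /=; nia.
Qed.

Lemma tame_seq_step (A : Type) (EA : Enc A) (dec : decoder A) K l n :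
  (forall l, (size (dec l).2 <= size l) /\ (sz (dec l).1 + K * size (dec l).2 <= K * size l + K)) ->
  let s := foldl (seq_step dec) (([::], l), false) (take n l) in
  size s.1.2 <= size l /\ sz s.1.1 + K.+1 * size s.1.2 <= K.+1 * size l + 1.
Proof.
move=> h /=; elim/last_ind: (take n l) => [|m b [IH1 IH2]].
  by rewrite /= sz_nil; split=> //; lia.
rewrite foldl_rcons {1 3 4}/seq_step; move: (foldl _ _ m) IH1 IH2 => [[acc r] d] /= IH1 IH2.
case: d => //; case: r IH1 IH2 => [|[] r] /= IH1 IH2; rewrite ?sz_cons //=.
  have [h1 h2] := h r; split; first by lia.
  by move: IH2 h2; rewrite !mulSn !mulnS; lia.
by split; [lia | move: IH2; rewrite !mulSn !mulnS; lia].
Qed.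

Lemma tame_seq (A : Type) (EA : Enc A) (dec : decoder A) : tame dec -> tame (dec_seq dec).
Proof.
move=> [K hK]; exists K.+1 => l.
have [h1 h2] := tame_seq_step l (size l) hK; rewrite take_size in h1 h2.
by rewrite /dec_seq sz_rev /=; split=> //; lia.
Qed.

Lemma PT_dec_bit : PT dec_bit.
Proof. by rewrite /dec_bit; pt. Qed.

Lemma PT_dec_pair (A B : Type) (EA : Enc A) (EB : Enc B) (da : decoder A) (db : decoder B) :
  PT da -> PT db -> PT (dec_pair da db).
Proof. by move=> Pa Pb; rewrite /dec_pair; pt. Qed.

Lemma PT_dec_seq (A : Type) (EA : Enc A) (dec : decoder A) : PT dec -> tame dec -> PT (dec_seq dec).
Proof.
move=> Pd [K hK]; rewrite /dec_seq.
have P : PT (fun l : seq bool => foldl (seq_step dec) (([::], l), false) l).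
  apply: (@PT_foldl _ _ _ _ _ _ (fun _ => seq_step dec) (fun l => (([::], l), false)) id
    (fun l => K.+1 * sz l + 1 + (4 * sz l + 1) + 10)).
  - by rewrite /seq_step; pt.
  - exact: (PT_pair (PT_pair (PT_const _) PT_id) (PT_const _)).
  - by pt.
  - by pb.
  - move=> l n; have [h1 h2] := tame_seq_step l n hK.
    move: (foldl _ _ _) h1 h2 => [[acc r] d] /= h1 h2; rewrite !sz_pair.
    have := sz_bits_le r; pose proof (size_sz l) as hl; have : sz d <= 3 by case: d.
    have : K.+1 * size l <= K.+1 * sz l by rewrite leq_mul2l hl orbT.
    by lia.
by pt.
Qed.
End Decoders.

Notation dec_bits := (dec_seq dec_bit).
Notation dec_args := (dec_seq dec_bits).
Notation dec_summand := (dec_pair dec_bits dec_args).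
Notation dec_signed := (dec_pair dec_bit dec_bits).

Definition dec_head := dec_pair dec_args (dec_seq dec_summand).

Definition instance_data := (seq nat * seq (nat * seq nat) * (int * int))%type.

Definition signed (p : bool * seq bool) : int := mkint p.1 (bval p.2).

(** A pair [(num, den)] is read as the condition [den * c <= num]; the threshold +oo becomes
    [(0, 0)], which every finite cost satisfies. *)
Definition dec_threshold (l : seq bool) : int * int :=
  if head false l then
    let p := (dec_pair dec_signed dec_signed (behead l)).1 in (signed p.1, signed p.2)
  else (0%R, 0%R).

Definition parse_bits (l : seq bool) : instance_data :=
  let p := dec_head l in
  (map bval p.1.1, [seq (bval s.1, map bval s.2) | s <- p.1.2], dec_threshold p.2).

Lemma PT_bval {X : Type} {EX : Enc X} (f : X -> seq bool) : PT f -> PT (fun x => bval (f x)).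
Proof.
move=> Pf; apply: (@PT_ext _ _ _ _ (fun x => bval (rev (rev (f x))))).
  by apply: PT_strip; pt.
by move=> x; rewrite revK.
Qed.

Lemma PT_dec_bits : PT dec_bits.
Proof. by apply: PT_dec_seq; [exact: PT_dec_bit | exact: tame_bit]. Qed.

Lemma tame_bits : tame dec_bits.
Proof. exact: tame_seq tame_bit. Qed.

Lemma PT_parse : PT parse_bits.
Proof.
have P1 := PT_dec_bits.
have P2 : PT dec_args by apply: PT_dec_seq => //; exact: tame_bits.
have P3 : PT dec_summand by exact: PT_dec_pair.
have P4 : PT dec_head.
  apply: PT_dec_pair => //; apply: PT_dec_seq => //; apply: tame_pair; first exact: tame_bits.
  exact: tame_seq tame_bits.
have P5 : PT dec_signed by apply: PT_dec_pair => //; exact: PT_dec_bit.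
have P6 : PT (dec_pair dec_signed dec_signed) by exact: PT_dec_pair.
have P7 : PT signed by rewrite /signed; apply: PT_mkint; [pt | apply: PT_bval; pt].
have P8 : PT dec_threshold by rewrite /dec_threshold; pt.
rewrite /parse_bits; pt; by apply: PT_bval; pt.
Qed.

Lemma bval_binary n : bval (binary n) = n.
Proof.
rewrite /binary.
have H k m : m < 2 ^ k -> bval [seq odd (m %/ 2 ^ i) | i <- iota 0 k] = m.
  elim: k m => [|k IH] m; first by rewrite expn0 ltnS leqn0 => /eqP ->.
  move=> hm; rewrite -[k.+1]add1n iotaD map_cat /= expn0 divn1 add0n.
  rewrite -[1]addn0 iotaDl -map_comp.
  rewrite (eq_map (g := fun i => odd (m./2 %/ 2 ^ i))); last first.
    by move=> i /=; rewrite addnC addn1 expnS divnMA divn2.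
  rewrite IH; first by rewrite odd_double_half.
  by move: hm; rewrite expnS mul2n; lia.
by apply: H; exact: trunc_log_ltn.
Qed.

Arguments binary : simpl never.
Arguments bval : simpl never.

Lemma signedE (z : int) : signed ((z < 0)%R, binary `|z|) = z.
Proof. rewrite /signed [X in bval X](_ : _ = binary `|z|) // bval_binary /mkint [(_, _).1]/=.
by case: ifP; lia. Qed.

Definition cost_data (c : cost) : int * int := if c is Some q then (numq q, denq q) else (0%R, 0%R).

Lemma map_encode_seq (A B : Type) (f : A -> B) (e : B -> seq bool) s :
  encode_seq (fun x => e (f x)) s = encode_seq e (map f s).
Proof. by rewrite /encode_seq -map_comp. Qed.

Lemma parse_instance (D : Type) (G : fin_vlang D) (I : instance G) :
  parse_bits (encode_instance I) =
  (iota 0 (nvars I),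
   [seq (nat_of_ord (enum_rank (tag t)), map (@nat_of_ord (nvars I)) (tval (tagged t))) | t <- summands I],
   cost_data (threshold I)).
Proof.
pose raw := ([seq binary (nat_of_ord v) | v <- enum 'I_(nvars I)],
  [seq (binary (enum_rank (tag t)), [seq binary (nat_of_ord v) | v <- tval (tagged t)]) | t <- summands I]).
have B := dec_seqP dec_bitP; have A := dec_seqP B.
have H := dec_pairP A (dec_seqP (dec_pairP B A)).
have E : encode_instance I = (encode_seq (encode_seq (fun b => [:: b])) raw.1 ++
    encode_seq (fun p => encode_seq (fun b => [:: b]) p.1 ++
      encode_seq (encode_seq (fun b => [:: b])) p.2) raw.2) ++ encode_cost (threshold I).
  rewrite /encode_instance catA; congr (_ ++ _); congr (_ ++ _).
    exact: (map_encode_seq (fun v : 'I_(nvars I) => binary v)).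
  rewrite -[raw.2]/(map _ _) -map_encode_seq; congr encode_seq.
  apply: functional_extensionality => t; congr (_ ++ _).
  exact: (map_encode_seq (fun v : 'I_(nvars I) => binary v)).
rewrite /parse_bits /dec_head E (H raw) /=; congr (_, _, _).
- rewrite -map_comp -[RHS]val_enum_ord; apply: eq_map => v /=; exact: bval_binary.
- rewrite -map_comp; apply: eq_map => t /=; rewrite bval_binary; congr pair.
  by rewrite -map_comp; apply: eq_map => v /=; exact: bval_binary.
- case: (threshold I) => [q|] //; rewrite /encode_cost /encode_rat /dec_threshold [head _ _]/= [behead _]/=.
  have S := dec_pairP dec_bitP B.
  have E2 : dec_pair dec_signed dec_signed (encode_int (numq q) ++ encode_int (denq q)) =
      ((((numq q < 0)%R, binary `|numq q|), ((denq q < 0)%R, binary `|denq q|)), [::]).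
    have := dec_pairP S S (((numq q < 0)%R, binary `|numq q|), ((denq q < 0)%R, binary `|denq q|)) [::].
    by rewrite cats0.
  by rewrite E2 [fst _]/= [fst _]/= [snd _]/= !signedE.
Qed.

(** * Construction of the finite problem from an instance *)

Definition powl (b m k : nat) : nat := b ^ size [seq i <- iota 0 k | i < m].

Lemma powlE b m k : m <= k -> powl b m k = b ^ m.
Proof.
move=> h; rewrite /powl; congr (b ^ _).
by have := filter_iota_ltn 0 h; rewrite add0n => ->; rewrite size_iota.
Qed.

Lemma eq_allpairs_mem (S T : eqType) (U : Type) (f g : S -> T -> U) s t :
  (forall a b, a \in s -> b \in t -> f a b = g a b) ->
  [seq f a b | a <- s, b <- t] = [seq g a b | a <- s, b <- t].
Proof.
move=> h; congr flatten; apply/eq_in_map => a ha; apply/eq_in_map => b hb.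
exact: h.
Qed.

Section SamplePT.
Context {X : Type} {EX : Enc X}.
Variables (u : X -> seq nat).
Hypothesis Pu : PT u.

Lemma PT_int_monomials l : PT (fun x => int_monomials (size (u x)) l).
Proof.
elim: l => [|p l IH]; first by rewrite /=; pt.
apply: (@PT_ext _ _ _ _ (fun x => [seq powl p.1 m (size (u x)) * powl p.2 (size (u x) - m) (size (u x)) * y |
   m <- iota 0 (size (0 :: u x)), y <- int_monomials (size (u x)) l])).
  apply: PT_allpairs; [|by pt|exact: (PT_comp IH (PT_fst PT_id))].
  by apply: PT_muln; [apply: PT_muln; rewrite /powl; apply: PT_expn; pt | pt].
move=> x; rewrite -[RHS]/[seq p.1 ^ m * p.2 ^ (size (u x) - m) * y |
  m <- iota 0 (size (0 :: u x)), y <- int_monomials (size (u x)) l].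
apply: eq_allpairs_mem => m y; rewrite mem_iota add0n ltnS => hm _.
by rewrite !powlE // leq_subr.
Qed.

Lemma PT_denominator l : PT (fun x => denominator (size (u x)) l).
Proof. by elim: l => [|p l IH] /=; pt; apply: PT_expn; pt. Qed.

Lemma PT_monomial_bound l : PT (fun x => monomial_bound (size (u x)) l).
Proof. by elim: l => [|p l IH] /=; pt; apply: PT_expn; pt. Qed.

Lemma PT_unit_value CZ (R : X -> nat) : PT R -> PT (fun x => unit_value CZ (size (u x)) (R x)).
Proof.
move=> PR; rewrite /unit_value; apply: PT_Posz; apply: PT_muln; first exact: PT_denominator.
apply: (@PT_ext _ _ _ _ (fun x => (R x - 1) ^ size (u x) * R x ^ size (u x ++ u x))).
  by pt; apply: PT_expn; pt.
by move=> x; rewrite subn1 size_cat addnn mul2n.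
Qed.

Lemma PT_sample CZ (R : X -> nat) : PT R -> PT (fun x => sample CZ (size (u x)) (R x)).
Proof.
move=> PR.
have P : PT (fun x => sample_abs CZ (size (u x)) (R x)).
  apply: (@PT_ext _ _ _ _ (fun x => [seq (K * (powl (R x - 1) ab.1 (size (u x ++ u x)) *
      powl (R x) ab.2 (size ((u x ++ u x) ++ (u x ++ u x)))))%N | K <- int_monomials (size (u x)) (ratio_list CZ),
     ab <- [seq (a, b) | a <- iota 0 (size (0 :: u x ++ u x)), b <- iota 0 (size (0 :: (u x ++ u x) ++ (u x ++ u x)))]])).
    have Pi2 : PT (fun x => iota 0 (size (0 :: u x ++ u x))) by pt.
    have Pi4 : PT (fun x => iota 0 (size (0 :: (u x ++ u x) ++ (u x ++ u x)))) by pt.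
    have Pab : PT (fun x => [seq (a, b) | a <- iota 0 (size (0 :: u x ++ u x)),
        b <- iota 0 (size (0 :: (u x ++ u x) ++ (u x ++ u x)))]).
      by apply: PT_allpairs; [pt | exact: Pi2 | exact: (PT_comp Pi4 (PT_fst PT_id))].
    apply: PT_allpairs; last exact: (PT_comp Pab (PT_fst PT_id)).
      by apply: PT_muln; [pt|apply: PT_muln; rewrite /powl; apply: PT_expn; pt].
    exact: PT_int_monomials.
  move=> x; have e2 : size (u x ++ u x) = 2 * size (u x) by rewrite size_cat addnn mul2n.
  have e4 : size ((u x ++ u x) ++ (u x ++ u x)) = 4 * size (u x) by rewrite !size_cat; lia.
  rewrite /sample_abs -subn1 -[size (0 :: u x ++ u x)]/(size (u x ++ u x)).+1.
  rewrite -[size (0 :: (u x ++ u x) ++ (u x ++ u x))]/(size ((u x ++ u x) ++ (u x ++ u x))).+1 e2 e4.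
  apply: eq_allpairs_mem => K ab _ /allpairsP[[a b] [ha hb ->]].
  by rewrite !mem_iota !add0n !ltnS in ha hb; rewrite !powlE.
by rewrite /sample; pt.
Qed.

End SamplePT.

Fixpoint tuples (A : Type) (k : nat) (D : seq A) : seq (seq A) :=
  if k is k'.+1 then [seq a :: t | a <- D, t <- tuples k' D] else [:: [::]].

Lemma PT_tuples {X A : Type} {EX : Enc X} {EA : Enc A} k (D : X -> seq A) : PT D ->
  PT (fun x => tuples k (D x)).
Proof. by move=> PD; elim: k => [|k IH] /=; [pt | apply: PT_allpairs; [pt|pt|exact: (PT_comp IH (PT_fst PT_id))]]. Qed.

Lemma size_tuples (A : Type) k (D : seq A) : size (tuples k D) = size D ^ k.
Proof. by elim: k => //= k IH; rewrite size_allpairs IH expnS. Qed.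

Lemma mem_tuples (A : eqType) k (D : seq A) t : (t \in tuples k D) = (size t == k) && all (mem D) t.
Proof.
elim: k t => [|k IH] [|a t] //=.
  by apply/allpairsP => -[[b s] [_ _]].
rewrite eqSS; apply/allpairsP/idP => [[[b s] [/= hb hs [-> ->]]]|/and3P[h1 h2 h3]].
  by move: hs; rewrite IH => /andP[-> ->]; rewrite andbT.
by exists (a, t); split=> //; rewrite IH h1.
Qed.

Definition dedup (T : eqType) (l : seq T) : seq T :=
  foldl (fun acc a => if a \in acc then acc else a :: acc) [::] l.

Lemma dedupP (T : eqType) (l : seq T) : uniq (dedup l) /\ dedup l =i l.
Proof.
rewrite /dedup; elim/last_ind: l => [|l a [h1 h2]]; first by [].
rewrite foldl_rcons; case: ifP => ha; last first.
  by rewrite /= ha; split=> // b; rewrite mem_rcons !inE h2.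
split=> // b; rewrite mem_rcons inE h2; case: eqP => // ->.
by rewrite -h2.
Qed.

Lemma PT_dedup {X : Type} {EX : Enc X} (T : eqType) (ET : Enc T) (l : X -> seq T) : PT l ->
  PT (fun x => dedup (l x)).
Proof.
move=> Pl; have sl := PT_PB Pl; rewrite /dedup.
apply: (@PT_foldl _ _ _ _ _ _ (fun _ (acc : seq T) a => if a \in acc then acc else a :: acc) (fun=> [::]) l
  (fun x => sz (l x))) => //; try by pt.
move=> x n; apply: leq_trans (sz_take n (l x)).
elim/last_ind: (take n _) => [|m a IH] //.
rewrite foldl_rcons -cats1; pose proof (sz_cat m [:: a]) as hc; rewrite sz_cons sz_nil in hc.
by case: ifP => _; rewrite ?sz_cons; lia.
Qed.

Definition sdesc := (nat * (seq int * seq (seq bool * option (int * nat))))%type.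

Local Open Scope ring_scope.

Definition isig (C : seq int) n (A : seq int) : seq bool :=
  [seq q.1.1 * nth 0 A q.2.1 < q.1.2 * nth 0 A q.2.2 | q <-
    [seq (p, r) | p <- [seq (c, d) | c <- C, d <- C],
                  r <- [seq (i, j) | i <- idx n, j <- idx n]]].

Definition ilookup (d : sdesc) (A : seq int) := lookup (isig d.2.1 d.1 A) d.2.2.

Definition ieval (d : sdesc) (Q : int) (t : seq int) : option int :=
  omap (fun p => p.1 * nth 0 (Q :: t) p.2) (ilookup d (Q :: t)).

(** All tuples over the grid are listed; there are polynomially many because the arity is a constant
    of the language. *)
Definition table_of (d : sdesc) (D : seq int) (Q den : int) : seq (seq int * int) :=
  flatten [seq (if ieval d Q t is Some v then [:: (t, den * v)] else [::]) | t <- tuples d.1 D].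

Lemma mem_table_of d D Q den p : p \in table_of d D Q den <->
  [/\ size p.1 = d.1, {subset p.1 <= D} & exists2 v, ieval d Q p.1 = Some v & p.2 = den * v].
Proof.
split=> [/flattenP[l /mapP[t]]|[h1 h2 [v h3 h4]]].
  rewrite mem_tuples => /andP[/eqP ht /allP hD] ->.
  case E: (ieval d Q t) => [v|] //; rewrite inE => /eqP -> /=; split=> //; exists v => //.
apply/flattenP; exists [:: p]; last by rewrite inE.
apply/mapP; exists p.1; first by rewrite mem_tuples h1 eqxx; apply/allP.
by rewrite h3 -h4; case: (p).
Qed.

Section TablePT.
Context {X : Type} {EX : Enc X}.
Variables (D : X -> seq int) (Q den : X -> int).
Hypotheses (PD : PT D) (PQ : PT Q) (Pd : PT den).

Lemma PT_table_of (d : sdesc) : PT (fun x => table_of d (D x) (Q x) (den x)).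
Proof.
have PL : PT (fun A : seq int => ilookup d A) by rewrite /ilookup /lookup /isig; pt.
rewrite /table_of; apply: PT_flatten; apply: PT_map; last exact: PT_tuples.
rewrite /ieval.
apply: (@PT_ext _ _ _ _ (fun p : X * seq int => if ilookup d (Q p.1 :: p.2) is Some q
  then [:: (p.2, den p.1 * (q.1 * nth 0 (Q p.1 :: p.2) q.2))] else [::])); last first.
  by move=> p; case: ilookup.
by apply: PT_omatch; pt.
Qed.

Lemma PT_table_nth (L : seq sdesc) (s : X -> nat) : PT s ->
  PT (fun x => table_of (nth (0%N, ([::], [::])) L (s x)) (D x) (Q x) (den x)).
Proof.
elim: L s => [|d L IH] s Ps.
  apply: (@PT_ext _ _ _ _ (fun x => table_of (0%N, ([::], [::])) (D x) (Q x) (den x))).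
    exact: PT_table_of.
  by move=> x; rewrite nth_nil.
apply: (@PT_ext _ _ _ _ (fun x => if s x == 0%N then table_of d (D x) (Q x) (den x) else
  table_of (nth (0%N, ([::], [::])) L (s x - 1)) (D x) (Q x) (den x))).
  apply: PT_if; first by pt.
    exact: PT_table_of.
  by apply: (IH (fun x => s x - 1)%N); pt.
by move=> x; case: (s x) => [|k] //=; rewrite subn1.
Qed.
End TablePT.

Section Build.
Variables (L : seq sdesc) (CZ : seq int) (CM E : nat).

(** Exceeds [sample_bound] for the weights of the instance, to which a summand contributes at most
    [|den| CM] and the threshold [|num| E]. It is exponentially large with polynomially many
    digits. *)
Definition resolution (x : instance_data) : nat :=
  ((`|x.2.2| * CM * size x.1.2 + `|x.2.1| * E + 2 * \sum_(c <- CZ) `|c|) *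
   (monomial_bound (size x.1.1) (ratio_list CZ) * 4 ^ size x.1.1) + 2)%N.

Definition scale (x : instance_data) : int := unit_value CZ (size x.1.1) (resolution x).

Definition grid (x : instance_data) : seq int := dedup (sample CZ (size x.1.1) (resolution x)).

Definition constraints (x : instance_data) : seq constr :=
  [seq (s.2, table_of (nth (0%N, ([::], [::])) L s.1) (grid x) (scale x) x.2.2) | s <- x.1.2].

(** Table values are costs multiplied by [den], by the common denominator [E] and by the image
    [scale] of 1; the threshold is multiplied accordingly. *)
Definition bound (x : instance_data) : int := x.2.1 * Posz E * scale x.

Definition build (x : instance_data) : problem :=
  (grid x, x.1.1, constraints x,
   Posz (`|bound x| + abs_total (grid x, x.1.1, constraints x, 0%Z) + 1)%N).

Definition solve (x : instance_data) : bool := decide (build x, bound x).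

Lemma PT_solve : PT solve.
Proof.
have Pl : PT (fun x : instance_data => x.1.1) by pt.
have PR : PT resolution.
  rewrite /resolution; apply: PT_addn; last by pt.
  apply: PT_muln; first by pt.
  by apply: PT_muln; [exact: (PT_monomial_bound Pl) | apply: PT_expn; pt].
have PS : PT scale by exact: (PT_unit_value Pl).
have PG : PT grid by apply: PT_dedup; exact: (PT_sample Pl).
have PC : PT constraints.
  rewrite /constraints; apply: PT_map; last by pt.
  by apply: PT_pair; [pt|apply: PT_table_nth; pt].
have PB : PT bound by rewrite /bound; pt.
have PP : PT build.
  rewrite /build; apply: PT_pair; first by pt.
  apply: PT_Posz; apply: PT_addn; last by pt.
  apply: PT_addn; first by pt.
  rewrite /abs_total; apply: (@PT_bigsumn _ _ _ _ (fun _ (c : constr) => (\sum_(p <- c.2) `|p.2|)%N)); last by pt.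
  by apply: (@PT_bigsumn _ _ _ _ (fun _ (p : seq int * int) => `|p.2|%N)); pt.
have Pd := PT_decide.
by rewrite /solve; pt.
Qed.
End Build.

Local Close Scope ring_scope.

Local Open Scope ring_scope.

(** * Correctness of the reduction to the grid *)

Definition gsig (T : Type) (C : seq T) n (cmp : T -> nat -> T -> nat -> bool) : seq bool :=
  [seq cmp q.1.1 q.2.1 q.1.2 q.2.2 | q <-
    [seq (p, r) | p <- [seq (c, d) | c <- C, d <- C],
                  r <- [seq (i, j) | i <- idx n, j <- idx n]]].

Lemma gsig_map (S T : Type) (g : S -> T) C n cmp :
  gsig (map g C) n cmp = gsig C n (fun c i d j => cmp (g c) i (g d) j).
Proof.
have E1 : [seq (c, d) | c <- map g C, d <- map g C] =
    map (fun p => (g p.1, g p.2)) [seq (c, d) | c <- C, d <- C].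
  by rewrite allpairs_mapl allpairs_mapr map_allpairs.
by rewrite /gsig E1 allpairs_mapl !map_allpairs.
Qed.

Lemma eq_gsig (T : eqType) (C : seq T) n cmp cmp' :
  (forall c i d j, c \in C -> d \in C -> (i <= n)%N -> (j <= n)%N -> cmp c i d j = cmp' c i d j) ->
  gsig C n cmp = gsig C n cmp'.
Proof.
move=> h; apply/eq_in_map => q /allpairsP[[p r] [hp hr ->]].
move: hp hr => /allpairsP[[c d] [hc hd ->]] /allpairsP[[i j] [hi hj ->]].
by rewrite !mem_idx in hi hj; exact: h.
Qed.

Lemma isig_signature (C : seq int) n (a : seq rat) (A : seq int) :
  (forall c d i j, c \in C -> d \in C -> (i <= n)%N -> (j <= n)%N ->
    (c%:~R * ext a i < d%:~R * ext a j) = (c * nth 0 A i < d * nth 0 A j)) ->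
  isig C n A = signature (map intr C) n a.
Proof.
move=> h; rewrite -[RHS]/(gsig _ n (fun c i d j => c * ext a i < d * ext a j)) gsig_map.
rewrite -[LHS]/(gsig C n (fun c i d j => c * nth 0 A i < d * nth 0 A j)).
by apply: eq_gsig => c i d j hc hd hi hj; rewrite h.
Qed.

Lemma lookup_map (S T : Type) (g : S -> T) s tbl :
  lookup s [seq (r.1, omap g r.2) | r <- tbl] = omap g (lookup s tbl).
Proof. by rewrite /lookup; elim: tbl => //= -[r o] tbl IH /=; case: ifP. Qed.

Lemma lookup_mem (T : eqType) s (tbl : seq (seq bool * option T)) p :
  lookup s tbl = Some p -> (s, Some p) \in tbl.
Proof.
rewrite /lookup; elim: tbl => //= -[r o] tbl IH /=; rewrite inE.
by case: eqP => [-> /= ->|_ /IH ->]; rewrite ?eqxx ?orbT.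
Qed.

Lemma sum_addc (T : Type) (F : T -> cost) (s : seq T) :
  \big[addc/Some 0]_(t <- s) F t =
  if all (fun t => F t) s then Some (\sum_(t <- s) odflt 0 (F t)) else None.
Proof.
elim: s => [|t s IH]; first by rewrite !big_nil.
rewrite !big_cons IH /=; case: (F t) => [v|] //=; by case: all.
Qed.

Lemma ext_scale (t : seq int) (Q : int) i : 0 < Q ->
  ext [seq z%:~R / Q%:~R | z <- t] i = (nth 0 (Q :: t) i)%:~R / Q%:~R.
Proof.
move=> Q0; case: i => [|i]; first by rewrite /ext /= divff // intr_eq0 gt_eqF.
rewrite /ext /=; case: (ltnP i (size t)) => h; first by rewrite (nth_map 0).
by rewrite !nth_default ?size_map // mul0r.
Qed.

Lemma look_mem (A B : eqType) (d : B) (l : seq (A * B)) k v :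
  (forall p, p \in l -> p.1 = k -> p.2 = v) -> (k, v) \in l -> look d l k = v.
Proof.
rewrite /look => h; elim: l h => //= p l IH h; rewrite inE.
case: (eqVneq p.1 k) => [e _|ne] /=; first by apply: h => //; rewrite inE eqxx.
case/predU1P => [e|hm]; first by rewrite -e eqxx in ne.
by apply: IH => // q hq; apply: h; rewrite inE hq orbT.
Qed.

Lemma solution_look (P : problem) U :
  (forall c p q, c \in cons_ P -> p \in c.2 -> q \in c.2 -> p.1 = q.1 -> p.2 = q.2) ->
  solution P U <-> exists beta : nat -> int, [/\ forall v, beta v \in vals P,
    forall c, c \in cons_ P -> exists v, (map beta c.1, v) \in c.2 &
    \sum_(c <- cons_ P) look 0 c.2 (map beta c.1) <= U].
Proof.
move=> fn.
have S beta : \sum_(e <- eidx P) look 0 (con P e).2 (map beta (con P e).1) =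
    \sum_(c <- cons_ P) look 0 c.2 (map beta c.1).
  by rewrite [RHS](big_nth ([::], [::])) /eidx /index_iota subn0.
have K beta c v : c \in cons_ P -> (map beta c.1, v) \in c.2 -> look 0 c.2 (map beta c.1) = v.
  by move=> hc hv; apply: look_mem => // p hp ep; exact: (fn c p _ hc hp hv).
split=> [[beta [val [h1 h2 h3]]]|[beta [h1 h2 h3]]]; exists beta.
  split=> // [c hc|].
    exists (val (index c (cons_ P))).
    have := h2 (index c (cons_ P)); rewrite mem_iota /= index_mem hc => /(_ isT).
    by rewrite /con nth_index.
  apply: le_trans h3; rewrite -S big_seq [leRHS]big_seq; apply: ler_sum => e he.
  by rewrite (K _ _ _ (con_mem he) (h2 e he)).
exists (fun e => look 0 (con P e).2 (map beta (con P e).1)); split=> //; last by rewrite S.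
move=> e he; have [v hv] := h2 _ (con_mem he).
by rewrite (K _ _ _ (con_mem he) hv).
Qed.

(** Each summand is a multiple of one coordinate; collecting by coordinates gives the linear form
    required by [sample_exists], with the threshold [k] as weight of coordinate 0. *)
Lemma sum_pos_weights (R : comNzRingType) (T : Type) n (s : seq T) (pos : T -> 'I_n.+1) (c : T -> R) (k : R)
    (z : 'I_n.+1 -> R) :
  \sum_i (\sum_(t <- s) (if pos t == i then c t else 0) - (if i == ord0 then k else 0)) * z i =
  \sum_(t <- s) c t * z (pos t) - k * z ord0.
Proof.
under eq_bigr => i _ do rewrite mulrBl mulr_suml.
rewrite sumrB exchange_big /=; congr (_ - _).
  apply: eq_bigr => t _; rewrite (bigD1 (pos t)) //= eqxx big1 ?addr0 // => i /negbTE h.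
  by rewrite eq_sym h mul0r.
by rewrite (bigD1 ord0) //= big1 ?addr0 // => i /negbTE ->; rewrite mul0r.
Qed.

Lemma abs_pos_weights (T : Type) n (s : seq T) (pos : T -> 'I_n.+1) (c : T -> int) (k : int) :
  (\sum_i `|(\sum_(t <- s) (if pos t == i then c t else 0) - (if i == ord0 then k else 0))%R| <=
  \sum_(t <- s) `|c t| + `|k|)%N.
Proof.
apply: (@leq_trans (\sum_(i < n.+1) (\sum_(t <- s) (if pos t == i then `|c t| else 0) +
    (if i == ord0 then `|k| else 0)))%N).
  apply: leq_sum => i _; rewrite -lez_nat abszE PoszD.
  apply: le_trans (ler_normB _ _) _; apply: lerD; last by case: ifP; rewrite ?normr0 ?abszE.
  apply: le_trans (ler_norm_sum _ _ _) _; rewrite (big_morph Posz PoszD (erefl _)).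
  by apply: ler_sum => t _; case: ifP; rewrite ?normr0 ?abszE.
rewrite big_split /= exchange_big /=; apply: leq_add.
  apply: leq_sum => t _; rewrite (bigD1 (pos t)) //= eqxx big1 ?addn0 // => i /negbTE h.
  by rewrite eq_sym h.
by rewrite (bigD1 ord0) //= big1 ?addn0 // => i /negbTE ->.
Qed.

Section Correct.
Variables (G : fin_vlang rat) (d : fsymb G -> sdesc) (CZ : seq int) (CM E : nat).
Hypothesis E0 : (0 < E)%N.
Hypothesis CZ1 : 1 \in CZ.

Record desc_ok (f : fsymb G) : Prop := DescOk {
  dk_ar : (d f).1 = arity (finterp f);
  dk_C : {subset (d f).2.1 <= CZ};
  dk_tbl : forall s p, (s, Some p) \in (d f).2.2 -> (p.2 <= arity (finterp f))%N && (`|p.1| <= CM)%N;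
  dk_val : forall a : (arity (finterp f)).-tuple rat, finterp f a =
    omap (fun p => p.1%:~R * ext a p.2 / E%:R)
      (lookup (signature (map intr (d f).2.1) (arity (finterp f)) a) (d f).2.2)
}.

Hypothesis ok : forall f, desc_ok f.

Lemma finterp_ieval f (t : seq int) (a : (arity (finterp f)).-tuple rat) (Q : int) : 0 < Q ->
  a = [seq z%:~R / Q%:~R | z <- t] :> seq rat ->
  finterp f a = omap (fun v => v%:~R / (E%:R * Q%:~R)) (ieval (d f) Q t).
Proof.
move=> Q0 ea; have Qr : 0 < Q%:~R :> rat by rewrite ltr0z.
rewrite (dk_val (ok f)) /ieval /ilookup (dk_ar (ok f)) ea -(isig_signature (A := Q :: t)); last first.
  move=> c e i j _ _ _ _; rewrite !ext_scale // !mulrA ltr_pM2r ?invr_gt0 //.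
  by rewrite -!intrM ltr_int.
case: lookup => //= p; rewrite ext_scale // intrM invfM; congr Some.
by rewrite -!mulrA; congr (_ * (_ * _)); rewrite mulrC.
Qed.

Section Instance.
Variables (I : instance G) (num den : int).
Hypothesis den0 : 0 <= den.

Local Notation n := (nvars I).
Local Notation summand := {f : fsymb G & (arity (finterp f)).-tuple 'I_n}.
Local Notation L := [seq d f | f <- enum (fsymb G)].

Definition args_of (t : summand) : seq nat := [seq nat_of_ord v | v <- tval (tagged t)].

Definition data : instance_data :=
  (iota 0 n, [seq (nat_of_ord (enum_rank (tag t)), args_of t) | t <- summands I], (num, den)).

Local Notation Q := (scale CZ CM E data).
Local Notation D := (grid CZ CM E data).
Local Notation P := (build L CZ CM E data).

Lemma scale_gt0 : 0 < Q.
Proof.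
rewrite /scale /unit_value ltz_nat !muln_gt0 !expn_gt0.
have /andP[-> _] := int_monomials_bound (n := size data.1.1) (ratio_list_pos CZ) (denominator_mem (size data.1.1) (ratio_list CZ)).
have : (1 < resolution CZ CM E data)%N by rewrite /resolution; lia.
by case: (resolution _ _ _ _) => [|[|R]].
Qed.

Definition con_of (t : summand) : constr := (args_of t, table_of (d (tag t)) D Q den).

Lemma consE : cons_ P = [seq con_of t | t <- summands I].
Proof.
rewrite /cons_ /= /constraints -map_comp; apply: eq_map => t /=; rewrite /con_of; congr (_, table_of _ _ _ _).
by rewrite (nth_map (tag t)) ?nth_enum_rank // -cardE.
Qed.

Lemma mem_gridE z : (z \in D) = (z \in sample CZ n (resolution CZ CM E data)).
Proof. by rewrite /grid (dedupP _).2 /= size_iota. Qed.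

Lemma table_fun c p q : c \in cons_ P -> p \in c.2 -> q \in c.2 -> p.1 = q.1 -> p.2 = q.2.
Proof.
rewrite consE => /mapP[t _ ->] /mem_table_of[_ _ [v e1 ->]] /mem_table_of[_ _ [w e2 ->]] e.
by move: e1; rewrite e e2 => -[->].
Qed.

Lemma args_size t : size (args_of t) = arity (finterp (tag t)).
Proof. by rewrite size_map size_tuple. Qed.

Section Submodular.
Hypothesis sub : forall f : fsymb G, submodular (finterp f).

Lemma tuple_of_seq k (s : seq rat) : size s = k -> exists a : k.-tuple rat, a = s :> seq rat.
Proof. by move=> /eqP h; exists (Tuple h). Qed.

Lemma table_sub (f : fsymb G) p q :
  p \in table_of (d f) D Q den -> q \in table_of (d f) D Q den ->
  exists p' q', [/\ p' \in table_of (d f) D Q den, q' \in table_of (d f) D Q den,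
    p'.1 = zmax p.1 q.1, q'.1 = zmin p.1 q.1 & p'.2 + q'.2 <= p.2 + q.2].
Proof.
case: p => t v0; case: q => s w0 /mem_table_of[/= ht Dt [v ev ->]] /mem_table_of[/= hs Ds [w ew ->]].
have Q0 := scale_gt0; have Qr : 0 < Q%:~R :> rat by rewrite ltr0z.
rewrite (dk_ar (ok f)) in ht hs.
pose sc (u : seq int) : seq rat := [seq z%:~R / Q%:~R | z <- u].
have [a ea] := @tuple_of_seq (arity (finterp f)) (sc t) ltac:(by rewrite size_map).
have [b eb] := @tuple_of_seq (arity (finterp f)) (sc s) ltac:(by rewrite size_map).
have sm : size (zmax t s) = arity (finterp f) by rewrite size_map size_zip ht hs minnn.
have sn : size (zmin t s) = arity (finterp f) by rewrite size_map size_zip ht hs minnn.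
have nz i (op : int -> int -> int) : (i < arity (finterp f))%N ->
    nth 0 [seq op z.1 z.2 | z <- zip t s] i = op (nth 0 t i) (nth 0 s i).
  by move=> hi; rewrite (nth_map (0, 0)) ?nth_zip ?size_zip ?ht ?hs ?minnn.
have emax : tuple_max a b = sc (zmax t s) :> seq rat.
  apply: (@eq_from_nth _ 0) => [|i]; first by rewrite size_tuple size_map sm.
  rewrite size_tuple => hi; rewrite -(tnth_nth _ _ (Ordinal hi)) tnth_mktuple.
  rewrite !(tnth_nth 0) ea eb /sc !(nth_map (0 : int)) ?ht ?hs ?sm //.
  rewrite -[(zmax t s)`_i]/(nth 0 [seq (fun x y => Num.max x y) z.1 z.2 | z <- zip t s] i) nz //.
  by rewrite /Order.max ltr_pM2r ?invr_gt0 // ltr_int; case: ifP.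
have emin : tuple_min a b = sc (zmin t s) :> seq rat.
  apply: (@eq_from_nth _ 0) => [|i]; first by rewrite size_tuple size_map sn.
  rewrite size_tuple => hi; rewrite -(tnth_nth _ _ (Ordinal hi)) tnth_mktuple.
  rewrite !(tnth_nth 0) ea eb /sc !(nth_map (0 : int)) ?ht ?hs ?sn //.
  rewrite -[(zmin t s)`_i]/(nth 0 [seq (fun x y => Num.min x y) z.1 z.2 | z <- zip t s] i) nz //.
  by rewrite /Order.min ltr_pM2r ?invr_gt0 // ltr_int; case: ifP.
have := @sub f a b; rewrite (finterp_ieval Q0 ea) (finterp_ieval Q0 eb) (finterp_ieval Q0 emax).
rewrite (finterp_ieval Q0 emin) ev ew.
have sD (op : int -> int -> int) : (forall x y, op x y = x \/ op x y = y) ->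
    {subset [seq op z.1 z.2 | z <- zip t s] <= D}.
  move=> hop y /(nthP 0)[i]; rewrite size_map size_zip ht hs minnn => hi <-; rewrite nz //.
  by case: (hop (nth 0 t i) (nth 0 s i)) => ->; [apply: Dt|apply: Ds]; rewrite mem_nth ?ht ?hs.
case e1: (ieval _ _ (zmax t s)) => [v'|] //=; case e2: (ieval _ _ (zmin t s)) => [w'|] //=.
rewrite -!mulrDl ler_pM2r; last by rewrite invr_gt0 mulr_gt0 // ltr0n.
rewrite -!intrD ler_int => hle.
exists (zmax t s, den * v'), (zmin t s, den * w'); split=> //.
- apply/mem_table_of; split; [by rewrite sm (dk_ar (ok f)) | | by exists v'].
  by apply: sD => x y; rewrite /Num.max; case: ifP; [right|left].
- apply/mem_table_of; split; [by rewrite sn (dk_ar (ok f)) | | by exists w'].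
  by apply: sD => x y; rewrite /Num.min; case: ifP; [left|right].
- by rewrite /= -!mulrDr; apply: ler_wpM2l.
Qed.

Lemma build_wf : (forall c, c \in cons_ P -> c.2 != [::]) -> wf_problem P.
Proof.
move=> nn; split=> //.
- exact: (dedupP _).1.
- apply/eqP => e; have : 0 \in D by rewrite mem_gridE inE eqxx.
  by rewrite -[D]/(vals P) e.
- exact: iota_uniq.
- move=> c; rewrite consE => /mapP[t _ ->] v /mapP[i _ ->].
  by rewrite mem_iota /=.
- move=> c p; rewrite consE => /mapP[t _ ->] /mem_table_of[-> _ _].
  by rewrite (dk_ar (ok _)) args_size.
- by move=> c p; rewrite consE => /mapP[t _ ->] /mem_table_of[].
- by move=> c p q; rewrite consE => /mapP[t _ ->]; exact: table_sub.
Qed.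
End Submodular.

Lemma alpha_of_solution : solution P (bound CZ CM E data) ->
  exists (alpha : 'I_n -> rat) c, assignment_cost alpha = Some c /\ den%:~R * c <= num%:~R.
Proof.
move=> /(solution_look _ table_fun)[beta [_ h2 h3]].
have Q0 := scale_gt0; have Qr : 0 < Q%:~R :> rat by rewrite ltr0z.
pose alpha (v : 'I_n) : rat := (beta v)%:~R / Q%:~R.
pose val (t : summand) := odflt 0 (ieval (d (tag t)) Q (map beta (args_of t))).
have F t : t \in summands I -> finterp (tag t) (map_tuple alpha (tagged t)) =
    Some ((val t)%:~R / (E%:R * Q%:~R)) /\ look 0 (con_of t).2 (map beta (args_of t)) = den * val t.
  move=> ht; have hc : con_of t \in cons_ P by rewrite consE map_f.
  have [v hv] := h2 _ hc; have /mem_table_of[_ _ [w /= ew evw]] := hv.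
  rewrite (@finterp_ieval (tag t) (map beta (args_of t)) _ Q) //; last first.
    by rewrite /= -!map_comp.
  rewrite /val ew /=; split=> //; rewrite -evw; apply: look_mem => // p hp ep.
  exact: (table_fun hc hp hv).
exists alpha, (\sum_(t <- summands I) (val t)%:~R / (E%:R * Q%:~R)).
have EQ : 0 < E%:R * Q%:~R :> rat by rewrite mulr_gt0 // ltr0n.
split.
  rewrite /assignment_cost sum_addc (_ : all _ _ = true); last by apply/allP => t /F[-> _].
  by congr Some; apply: eq_big_seq => t /F[-> _].
rewrite -mulr_suml mulrA ler_pdivrMr //.
have -> : num%:~R * (E%:R * Q%:~R) = (bound CZ CM E data)%:~R :> rat.
  by rewrite /bound !intrM -pmulrn mulrA.
rewrite -rmorph_sum -intrM ler_int; apply: le_trans h3.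
by rewrite consE big_map mulr_sumr big_seq [leRHS]big_seq; apply: ler_sum => t /F[_ ->].
Qed.

(** Coordinate 0 is the constant 1, so variables are shifted by one. *)
Definition crd (t : summand) (j : nat) : 'I_n.+1 :=
  inord (nth 0%N (0%N :: [seq v.+1 | v <- args_of t]) j).

Lemma crdE t (R : Type) (r0 : R) (z : 'I_n.+1 -> R) (b : 'I_n -> R) j :
  (forall v, z (lift ord0 v) = b v) -> (j <= arity (finterp (tag t)))%N ->
  nth r0 (z ord0 :: [seq b v | v <- tval (tagged t)]) j = z (crd t j).
Proof.
move=> h; case: j => [|j] hj; rewrite /crd /=.
  by congr z; apply: val_inj; rewrite /= inordK.
have [v0 _] : exists v0 : 'I_n, True.
  by case: (tagged t) hj => -[|v s] /= /eqP hs; [rewrite -hs | exists v].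
rewrite (nth_map v0) ?size_tuple // (nth_map 0%N) ?args_size // (nth_map v0) ?size_tuple //.
rewrite -h; congr z; apply: val_inj; rewrite /= inordK // ltnS; exact: ltn_ord.
Qed.

(** For a fixed sign pattern the total cost is linear. [sample_exists] moves [alpha] into the grid
    with the same pattern, so every table selects the same term, and the threshold is still met. *)
Lemma solution_of_alpha (alpha : 'I_n -> rat) c :
  assignment_cost alpha = Some c -> den%:~R * c <= num%:~R -> solution P (bound CZ CM E data).
Proof.
rewrite /assignment_cost sum_addc; case: ifP => // /allP fin [<-] hc.
pose look_t (t : summand) := lookup (signature (map intr (d (tag t)).2.1) (arity (finterp (tag t)))
  (map_tuple alpha (tagged t))) (d (tag t)).2.2.
pose p t := odflt (0, 0%N) (look_t t).
have lp t : t \in summands I -> look_t t = Some (p t).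
  by move=> /fin; rewrite (dk_val (ok _)) /p /look_t; case: lookup.
have pb t : t \in summands I -> ((p t).2 <= arity (finterp (tag t)))%N && (`|(p t).1| <= CM)%N.
  by move=> /lp /lookup_mem /(dk_tbl (ok _)).
pose av (i : 'I_n.+1) : rat := if unlift ord0 i is Some v then alpha v else 1.
have avl v : av (lift ord0 v) = alpha v by rewrite /av liftK.
have av0 : av ord0 = 1 by rewrite /av unlift_none.
have extE t j : (j <= arity (finterp (tag t)))%N -> ext (map_tuple alpha (tagged t)) j = av (crd t j).
  by move=> hj; rewrite -(crdE 0 avl hj) av0.
have valE t : t \in summands I -> finterp (tag t) (map_tuple alpha (tagged t)) =
    Some ((p t).1%:~R * av (crd t (p t).2) / E%:R).
  move=> ht; rewrite (dk_val (ok _)) -/(look_t t) lp //= extE //.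
  by case/andP: (pb t ht).
pose pos t := crd t (p t).2.
pose w (i : 'I_n.+1) : int := \sum_(t <- summands I) (if pos t == i then den * (p t).1 else 0) -
  (if i == ord0 then num * Posz E else 0).
have wr i : (w i)%:~R = \sum_(t <- summands I) (if pos t == i then (den * (p t).1)%:~R else 0) -
  (if i == ord0 then (num * Posz E)%:~R else 0) :> rat.
  rewrite /w intrB rmorph_sum; congr (_ - _); last by case: ifP.
  by apply: eq_bigr => t _; case: ifP.
have Er : 0 < E%:R :> rat by rewrite ltr0n.
have hw : \sum_i (w i)%:~R * av i <= 0.
  under eq_bigr => i _ do rewrite wr.
  rewrite sum_pos_weights av0 mulr1 subr_le0 intrM -pmulrn.
  rewrite -ler_pdivrMr //; apply: le_trans hc.
  rewrite mulr_suml mulr_sumr big_seq [leRHS]big_seq; apply: ler_sum => t ht.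
  by rewrite valE //= intrM -!mulrA.
have R1 : (1 < resolution CZ CM E data)%N by rewrite /resolution; lia.
have hR : (sample_bound CZ w < resolution CZ CM E data)%N.
  rewrite /sample_bound /resolution /= !size_iota addn2 ltnS; apply: leqW.
  rewrite leq_mul2r leq_add2r; apply/orP; right.
  apply: leq_trans (abs_pos_weights _ _ _ _) _; rewrite abszM leq_add2r size_map.
  apply: (@leq_trans (\sum_(t <- summands I) `|den| * CM)%N).
    rewrite big_seq [leqRHS]big_seq; apply: leq_sum => t ht; rewrite abszM leq_mul2l.
    by have /andP[_ ->] := pb t ht; rewrite orbT.
  by rewrite big_const_seq count_predT iter_addn_0.
have [A [A0 As Ac Aw]] := sample_exists CZ1 av0 hw R1 hR.
have QE : Q = A ord0 by rewrite A0 /scale /= size_iota.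
(* Numbers that are no variables get 0, which belongs to the grid. *)
pose beta (v : nat) : int := if insub v is Some i then A (lift ord0 i) else 0.
have betaE (v : 'I_n) : beta v = A (lift ord0 v) by rewrite /beta valK.
have mapE t : map beta (args_of t) = [seq A (lift ord0 v) | v <- tval (tagged t)].
  by rewrite -map_comp; apply: eq_map => v /=.
have nthE t j : (j <= arity (finterp (tag t)))%N -> nth 0 (Q :: map beta (args_of t)) j = A (crd t j).
  by move=> hj; rewrite mapE QE; apply: (crdE 0 (z := A)).
have ieE t : t \in summands I -> ieval (d (tag t)) Q (map beta (args_of t)) = Some ((p t).1 * A (pos t)).
  move=> ht; rewrite /ieval /ilookup (dk_ar (ok _)).
  rewrite (isig_signature (a := map_tuple alpha (tagged t))); last first.
    move=> c1 c2 i j h1 h2 hi hj; rewrite !extE // !nthE //; by apply: Ac; apply: (dk_C (ok (tag t))).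
  by rewrite -/(look_t t) lp //= nthE //; case/andP: (pb t ht).
have inD v : beta v \in D.
  by rewrite mem_gridE /beta; case: insub => [i|]; [exact: As | rewrite inE eqxx].
apply/(solution_look _ table_fun); exists beta; split=> // [c1|].
  rewrite consE => /mapP[t ht ->]; exists (den * ((p t).1 * A (pos t))).
  apply/mem_table_of; split=> /=; first by rewrite size_map args_size (dk_ar (ok _)).
    by move=> y /mapP[v _ ->].
  by exists ((p t).1 * A (pos t)); first exact: ieE.
have lk t : t \in summands I -> look 0 (con_of t).2 (map beta (con_of t).1) = den * (p t).1 * A (pos t).
  move=> ht; have hm : (map beta (args_of t), den * (p t).1 * A (pos t)) \in (con_of t).2.
    apply/mem_table_of; split=> /=; first by rewrite size_map args_size (dk_ar (ok _)).
      by move=> y /mapP[v _ ->].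
    by exists ((p t).1 * A (pos t)); [exact: ieE | rewrite mulrA].
  apply: look_mem => // q hq eq_; apply: (table_fun _ hq hm) => //.
  by rewrite consE map_f.
rewrite consE big_map big_seq (eq_bigr (fun t => den * (p t).1 * A (pos t))); last by move=> t; exact: lk.
rewrite -big_seq /bound QE -subr_le0 -(sum_pos_weights (summands I) pos) //.
Qed.

Lemma penalty_big : bound CZ CM E data + Posz (abs_total P) < penalty P.
Proof.
rewrite -[abs_total P]/(abs_total (D, data.1.1, constraints L CZ CM E data, 0%Z)).
by rewrite /penalty /build [snd _]/=; move: (bound _ _ _ _) (abs_total _) => b k; lia.
Qed.

Lemma solve_correct : (forall f : fsymb G, submodular (finterp f)) ->
  solve L CZ CM E data <->
  exists (alpha : 'I_n -> rat) c, assignment_cost alpha = Some c /\ den%:~R * c <= num%:~R.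
Proof.
move=> sub; rewrite /solve /decide /=; split=> [/andP[/allP h1 h2]|[alpha [c [h1 h2]]]].
  apply: alpha_of_solution; apply/(optimum_solution (build_wf sub _)) => //.
    by move=> c /h1; case: c => a [].
  exact: penalty_big.
have := solution_of_alpha h1 h2 => sol.
have nn c1 : c1 \in cons_ P -> c1.2 != [::].
  move: sol => /(solution_look _ table_fun)[beta [_ h _]] /h[v].
  by case: (c1.2).
apply/andP; split; first by apply/allP => c1 /nn; case: (c1.2).
by apply/(optimum_solution (build_wf sub nn)) => //; exact: penalty_big.
Qed.
End Instance.
End Correct.

Lemma common_denominator (l : seq rat) : exists2 E : nat, (0 < E)%N &
  forall q, q \in l -> (numq (q * E%:R))%:~R = q * E%:R.
Proof.
exists (\prod_(q <- l) `|denq q|)%N.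
  by rewrite big_seq; apply: prodn_cond_gt0 => q _; rewrite absz_gt0 denq_neq0.
move=> q hq; rewrite (big_rem q) //=; set r := (\prod_(_ <- _) _)%N.
have -> : q * (`|denq q| * r)%:R = (numq q * Posz r)%:~R.
  rewrite natrM mulrA intrM -[r%:~R]pmulrn; congr (_ * _).
  rewrite pmulrn gez0_abs ?denq_ge0 // -{1}(divq_num_den q) divfK //.
  by rewrite intr_eq0 denq_neq0.
by rewrite numq_int.
Qed.

Theorem submodular_tractable (G : fin_vlang rat) :
  (forall f : fsymb G, submodular (finterp f)) -> (forall f : fsymb G, PLH (finterp f)) ->
  VCSP_polytime G.
Proof.
move=> sub plh.
pose Pf (f : fsymb G) (u : seq rat * seq (seq bool * option (rat * nat))) :=
  (forall p o, (p, o) \in u.2 -> if o is Some q then q.2 <= arity (finterp f) else true)%N /\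
  forall a : (arity (finterp f)).-tuple rat,
    finterp f a = desc_value a (lookup (signature u.1 (arity (finterp f)) a) u.2).
have [u hu] : exists u, forall f, Pf f (u f).
  apply: (@fin_all_exists _ _ Pf) => f; have [C [tbl h]] := PLH_table (plh f).
  by exists (C, tbl).
pose coefs f : seq rat := [seq (odflt (0, 0%N) r.2).1 | r <- (u f).2].
pose lr := flatten [seq (u f).1 ++ coefs f | f <- enum (fsymb G)].
have [E E0 hE] := common_denominator lr.
(* Multiplying all coefficients by [E] makes them integers without affecting comparisons; values are
   divided by [E] again in [desc_ok]. *)
pose zs (q : rat) : int := numq (q * E%:R).
have lrC f q : q \in (u f).1 ++ coefs f -> (zs q)%:~R = q * E%:R.
  by move=> hq; apply: hE; apply/flattenP; exists ((u f).1 ++ coefs f) => //; apply/mapP; exists f => //; rewrite mem_enum.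
pose d f : sdesc := (arity (finterp f), (map zs (u f).1,
  [seq (r.1, omap (fun p => (zs p.1, p.2)) r.2) | r <- (u f).2])).
pose CZ := 1 :: flatten [seq map zs (u f).1 | f <- enum (fsymb G)].
pose CM := (\sum_(q <- lr) `|zs q|)%N.
have Er : 0 < E%:R :> rat by rewrite ltr0n.
have ok f : desc_ok d CZ CM E f.
  have [h1 h2] := hu f; split=> //.
  - move=> c hc; rewrite inE; apply/orP; right; apply/flattenP.
    by exists (map zs (u f).1) => //; apply/mapP; exists f => //; rewrite mem_enum.
  - move=> s p /mapP[[r [q|]] hr] //= [_ ->] /=; rewrite (h1 _ _ hr) /=.
    rewrite /CM (big_rem q.1) /= ?leq_addr //; apply/flattenP.
    exists ((u f).1 ++ coefs f); first by apply/mapP; exists f => //; rewrite mem_enum.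
    by rewrite mem_cat; apply/orP; right; apply/mapP; exists (r, Some q).
  - move=> a; rewrite h2 /= lookup_map.
    have -> : signature [seq intr z | z <- map zs (u f).1] (arity (finterp f)) a =
        signature (u f).1 (arity (finterp f)) a.
      rewrite -[LHS]/(gsig _ _ (fun c i d j => c * ext a i < d * ext a j)) !gsig_map.
      rewrite -[RHS]/(gsig _ _ (fun c i d j => c * ext a i < d * ext a j)).
      apply: eq_gsig => c i c' j hc hc' _ _.
      rewrite !(lrC f) ?mem_cat ?hc ?hc' // ![_ * E%:R]mulrC -!mulrA ltr_pM2l //.
    case e: (lookup _ _) => [q|] //=.
    have -> : (zs q.1)%:~R = q.1 * E%:R.
      apply: (lrC f); rewrite mem_cat; apply/orP; right; apply/mapP.
      by exists (signature (u f).1 (arity (finterp f)) a, Some q) => //; exact: lookup_mem e.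
    by congr Some; rewrite mulrAC mulfK // gt_eqF.
have CZ1 : 1 \in CZ by rewrite inE eqxx.
pose L := [seq d f | f <- enum (fsymb G)].
have Ps := PT_solve L CZ CM E; have Pp := PT_parse.
split.
(* Finiteness is the threshold condition [0 * c <= 0]. *)
- exists (fun w => solve L CZ CM E ((parse_bits w).1, (0, 0))); split; first by apply: PT_polytime; pt.
  move=> I; rewrite parse_instance.
  have := solve_correct E0 CZ1 ok I 0 (lexx _) sub.
  rewrite /data /= => H; split.
    move=> [alpha h]; apply/H; exists alpha; move: h; case: assignment_cost => // c _.
    by exists c; rewrite mul0r.
  by move=> /H[alpha [c [h _]]]; exists alpha; rewrite h.
- exists (fun w => solve L CZ CM E (parse_bits w)); split; first by apply: PT_polytime; pt.
  move=> I; rewrite parse_instance.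
  have nd0 : 0 <= (cost_data (threshold I)).2 by case: (threshold I) => [q|] //=.
  have := solve_correct E0 CZ1 ok I (cost_data (threshold I)).1 nd0 sub.
  rewrite /data -surjective_pairing => H.
  have K c : lec (Some c) (threshold I) = ((cost_data (threshold I)).2%:~R * c <= (cost_data (threshold I)).1%:~R).
    case: (threshold I) => [q|] /=; last by rewrite mul0r lexx.
    by rewrite -{1}(divq_num_den q) ler_pdivlMr ?ltr0z ?denq_gt0 // mulrC.
  split.
    move=> [alpha [h1 h2]]; apply/H; exists alpha; move: h1 h2; case: assignment_cost => // c _.
    by rewrite K => h; exists c.
  by move=> /H[alpha [c [h1 h2]]]; exists alpha; rewrite h1 K.
Qed.

Local Close Scope ring_scope.

(** * Computations as independent sets *)

Lemma fin_enc_inj (T : finType) : injective (fun x : T => enc (nat_of_ord (enum_rank x))).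
Proof. by move=> x y h; apply: enum_rank_inj; apply: val_inj; exact: (@enc_inj nat _ _ _ h). Qed.

Definition Enc_fin (T : finType) : Enc T := {| enc_inj := @fin_enc_inj T |}.

(** On a finite type any function is a table, so transition functions need no analysis. *)
Lemma PT_finite (T : finType) {X B : Type} {EX : Enc X} {EB : Enc B} (b0 : B) (f : T -> B) (g : X -> T) :
  @PT X T EX (Enc_fin T) g -> PT (fun x => f (g x)).
Proof.
move=> Pg; pose proof (Enc_fin T) as ET.
apply: (@PT_ext _ _ _ _ (fun x => look b0 [seq (y, f y) | y <- enum T] (g x))).
  by apply: (@PT_look _ _ _ _ (Enc_fin T) _ (fun=> b0) (fun=> [seq (y, f y) | y <- enum T])); pt.
by move=> x; rewrite look_map mem_enum.
Qed.

Lemma poly_nat_le (p : {poly nat}) : exists d, forall x y, x <= y -> (p.[x])%R <= (y + 2) ^ d.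
Proof.
pose S := \sum_(i < size p) (p`_i)%R; exists (S + size p) => x y xy.
rewrite horner_coef.
apply: (@leq_trans (\sum_(i < size p) (p`_i)%R * (y + 2) ^ size p)).
  have E (a b : nat) (k : nat) : (a * b ^+ k)%R = a * b ^ k.
    by congr muln; elim: k => // k IH; rewrite expnS -IH GRing.exprS.
  apply: (big_ind2 leq) => // [a b c e h1 h2|i _]; first exact: leq_add.
  rewrite E leq_mul2l; apply/orP; right.
  apply: (@leq_trans ((y + 2) ^ i)); first by case: (i : nat) => // k; rewrite leq_exp2r //; lia.
  by rewrite leq_exp2l ?addn2 // ltnW.
rewrite -big_distrl /= expnD leq_mul2r; apply/orP; right.
apply: leq_trans (ltnW (ltn_expl S (isT : 1 < 2))) _.
by case: (S) => // k; rewrite leq_exp2r // addn2.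
Qed.

Lemma PT_horner {X : Type} {EX : Enc X} (p : {poly nat}) (f : X -> nat) : PT f ->
  PT (fun x => (p.[f x])%R : nat).
Proof.
move=> Pf; rewrite /horner; elim: (polyseq p) => [|c s IH] /=; first by pt.
apply: (@PT_ext _ _ _ _ (fun x => (horner_rec s (f x) : nat) * f x + c)) => //.
by pt.
Qed.

(** * Runs of a machine in absolute tape coordinates *)

Section Runs.
Variable M : machine.
Local Notation I := 'I_(ntapes M).+1.
Local Notation sym := (tape_symbol (extra M)).
Local Notation local := (Defs.state M * {ffun I -> sym})%type.

Definition act (z : local) : Defs.state M * {ffun I -> sym * move} :=
  if halting z.1 then (z.1, [ffun i => (z.2 i, Stay)]) else trans z.1 z.2.

Definition scans (c : config M) : local := (c.1, [ffun i => tscan (c.2 i)]).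

Lemma step_act c : step c =
  ((act (scans c)).1, [ffun i => write_and_move (c.2 i) ((act (scans c)).2 i).1 ((act (scans c)).2 i).2]).
Proof.
rewrite /step /act /=; case: ifP => // _; rewrite [LHS]surjective_pairing /=; congr pair.
by apply/ffunP => i; rewrite !ffunE /=; case: (c.2 i).
Qed.

Definition shift (m : move) (h : nat) : nat :=
  match m with MoveLeft => h.-1 | MoveRight => h.+1 | Stay => h end.

Definition cell (tp : tape (extra M)) (h p : nat) : sym :=
  if p < h then nth None (tleft tp) (h - p).-1
  else if p == h then tscan tp else nth None (tright tp) (p - h).-1.

Lemma cell_head tp h : cell tp h h = tscan tp.
Proof. by rewrite /cell ltnn eqxx. Qed.

Lemma cell_move tp a m h p : 0 < h ->
  cell (write_and_move tp a m) (shift m h) p = if p == h then a else cell tp h p.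
Proof.
move=> h0; case: tp => l s r; rewrite /cell /write_and_move; case: m => /=.
- case: (ltngtP p h) => hp.
  + case: (ltngtP p h.-1) => hp'; [|lia|].
      rewrite (_ : (h - p).-1 = (h.-1 - p).-1.+1); last by lia.
      by case: l => //=; rewrite nth_nil.
    by rewrite hp' (_ : (h - h.-1).-1 = 0); [case: l | lia].
  + have -> : (p < h.-1) = false by lia.
    have -> : (p == h.-1) = false by lia.
    rewrite (_ : (p - h.-1).-1 = (p - h).-1.+1); last by lia.
    by case: l.
  + have -> : (p < h.-1) = false by lia.
    have -> : (p == h.-1) = false by lia.
    by rewrite (_ : (p - h.-1).-1 = 0); [case: l | lia].
- case: (ltngtP p h) => hp.
  + have -> : p < h.+1 by lia.
    by rewrite (_ : (h.+1 - p).-1 = (h - p).-1.+1); [case: r | lia].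
  + have -> : (p < h.+1) = false by lia.
    case: (eqVneq p h.+1) => [e|ne].
      by rewrite e (_ : (h.+1 - h).-1 = 0); [case: r | lia].
    rewrite (_ : (p - h).-1 = (p - h.+1).-1.+1); last by lia.
    by case: r => //=; rewrite nth_nil.
  + have -> : p < h.+1 by lia.
    by rewrite (_ : (h.+1 - p).-1 = 0); [case: r | lia].
- by case: (ltngtP p h).
Qed.

Variables (T : nat) (inp : seq bool).

Definition conf s := iter s (@step M) (init_config M inp).
Definition loc s : local := scans (conf s).

(** Heads start at position [T], so that positions remain natural numbers during [T] steps. *)
Fixpoint hp s (i : I) : nat :=
  if s is s'.+1 then shift ((act (loc s')).2 i).2 (hp s' i) else T.

(** A cell contains what was written at its last visit. Recording the time of that visit makes the
    scanned symbol depend on a single earlier step, and so the consistency of a run becomes a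
    condition on pairs. *)
Fixpoint lastv s (i : I) (p : nat) : option nat :=
  if s is s'.+1 then if hp s' i == p then Some s' else lastv s' i p else None.

Definition init_cell (i : I) (p : nat) : sym :=
  if (i == ord0) && (T <= p) then nth None [seq Some (inl b) | b <- inp] (p - T) else None.

Lemma hp_bound s i : s <= T -> T - s <= hp s i <= T + s.
Proof.
elim: s => [|s IH] hs /=; first by lia.
by have := IH (ltnW hs); case: ((act (loc s)).2 i).2 => /=; lia.
Qed.

Lemma locS s : (loc s.+1).1 = (act (loc s)).1.
Proof. by rewrite /loc /conf iterS step_act. Qed.

Lemma content s i p : s <= T -> cell ((conf s).2 i) (hp s i) p =
  if lastv s i p is Some s' then ((act (loc s')).2 i).1 else init_cell i p.
Proof.
elim: s => [|s IH] hs.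
  rewrite /conf /= ffunE /init_cell; case: eqP => [_|_] /=; last first.
    by rewrite /cell /=; case: ltnP => _; rewrite ?nth_nil //; case: eqP; rewrite ?nth_nil.
  rewrite /cell; case: ltngtP => h; case: (inp) => [|b l] /=; rewrite ?nth_nil //.
    by rewrite (_ : p - T = (p - T).-1.+1) //; lia.
  by rewrite h subnn.
rewrite /conf iterS -/(conf s) step_act /= ffunE cell_move; last by have := hp_bound i (ltnW hs); lia.
rewrite eq_sym; case: eqP => // _; exact: IH (ltnW hs).
Qed.

Lemma scan_content s i : s <= T -> (loc s).2 i =
  if lastv s i (hp s i) is Some s' then ((act (loc s')).2 i).1 else init_cell i (hp s i).
Proof. by move=> hs; rewrite -content // cell_head /loc /scans /= ffunE. Qed.

Lemma lastv_some s i p r : lastv s i p = Some r ->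
  [/\ r < s, hp r i = p & forall r', r < r' -> r' < s -> hp r' i <> p].
Proof.
elim: s => //= s IH; case: eqP => [e [<-]|ne /IH[h1 h2 h3]].
  by split=> // r' h1 h2; lia.
split=> //; first exact: ltnW.
by move=> r' h4; rewrite ltnS leq_eqVlt => /predU1P[-> //|]; exact: h3.
Qed.

Lemma lastv_none s i p : lastv s i p = None -> forall r, r < s -> hp r i <> p.
Proof.
elim: s => //= s IH; case: eqP => // ne /IH h r.
by rewrite ltnS leq_eqVlt => /predU1P[-> //|]; exact: h.
Qed.

Lemma lastv_eq_none s i p : (forall r, r < s -> hp r i <> p) -> lastv s i p = None.
Proof. by case E: (lastv s i p) => [r|] // h; have [h1 h2 _] := lastv_some E; case: (h r). Qed.

Lemma lastv_eq_some s i p r : r < s -> hp r i = p ->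
  (forall r', r < r' -> r' < s -> hp r' i <> p) -> lastv s i p = Some r.
Proof.
move=> h1 h2 h3; case E: (lastv s i p) => [r'|]; last by case: (lastv_none E h1).
have [e1 e2 e3] := lastv_some E; congr Some.
by have [h|h|//] := ltngtP r' r; [case: (e3 r) | case: (h3 r')].
Qed.

Lemma conf_halt s s' : halting (conf s).1 -> s <= s' -> conf s' = conf s.
Proof.
move=> h /subnKC <-; elim: (s' - s) => [|k IH]; first by rewrite addn0.
by rewrite addnS /conf iterS -/(conf (s + k)) IH /step h.
Qed.

(** A halted machine keeps its configuration, so acceptance can be read at the uniform time [T]. *)
Lemma output_true (v : bool) s : s <= T -> halting (conf s).1 -> output (conf s) = [:: v] ->
  v = ((loc T).2 ord0 == Some (inl true)).
Proof.
move=> hs hh; rewrite -(conf_halt hh hs) /output /loc /scans /= ffunE.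
by case: (tscan _) => [[[]|]|] //= [].
Qed.
End Runs.

Lemma PT_finite2 (T1 T2 : finType) {X B : Type} {EX : Enc X} {EB : Enc B} (b0 : B) (f : T1 -> T2 -> B)
    (g1 : X -> T1) (g2 : X -> T2) :
  @PT X T1 EX (Enc_fin T1) g1 -> @PT X T2 EX (Enc_fin T2) g2 -> PT (fun x => f (g1 x) (g2 x)).
Proof.
move=> P1 P2; pose F z := [seq (y, f z y) | y <- enum T2].
have PF : @PT X (seq (T2 * B)) EX (Enc_seq (Enc_prod (Enc_fin T2) EB)) (fun x => F (g1 x)).
  exact: (@PT_finite T1 X (seq (T2 * B)) EX _ [::] F g1 P1).
apply: (@PT_ext _ _ _ _ (fun x => look b0 (F (g1 x)) (g2 x))).
  by apply: (@PT_look _ _ _ _ (Enc_fin T2) _ (fun=> b0) (fun x => F (g1 x))); pt.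
by move=> x; rewrite look_map mem_enum.
Qed.

Arguments loc : simpl never.

(** * Local views and their compatibility *)

Section Views.
Variable M : machine.
Local Notation I := 'I_(ntapes M).+1.
Local Notation sym := (tape_symbol (extra M)).
Local Notation local := (Defs.state M * {ffun I -> sym})%type.

(** Time, certificate length, state with scanned symbols, head positions, times of the previous
    visits. The certificate length decides which cells are blank at the start, so all views have to
    agree on it. *)
Definition view := (nat * nat * (local * (seq nat * seq (option nat))))%type.

Definition vt (v : view) := v.1.1.
Definition vm (v : view) := v.1.2.
Definition vz (v : view) := v.2.1.
Definition vpos (v : view) (i : I) := nth 0 v.2.2.1 i.
Definition vlast (v : view) (i : I) := nth None v.2.2.2 i.

(** Meant for [v] earlier than [v']. Besides the step from one time to the next, [v] checks the
    claims of [v'] about previous visits: at the claimed time the head was there and wrote the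
    symbol, and at later times, or at all times if none is claimed, it was elsewhere. *)
Definition compat (v v' : view) : bool :=
  [&& vm v == vm v',
      (vt v' == vt v + 1) ==> ((vz v').1 == (act (vz v)).1) &&
        all (fun i => vpos v' i == shift ((act (vz v)).2 i).2 (vpos v i)) (enum I) &
      all (fun i => if vlast v' i is Some s then
          if vt v == s then (vpos v i == vpos v' i) && ((vz v').2 i == ((act (vz v)).2 i).1)
          else (s < vt v) ==> (vpos v i != vpos v' i)
        else vpos v i != vpos v' i) (enum I)].

(** Views of equal time always conflict, so an independent set has at most one view for each
    time. *)
Definition conflict (v v' : view) : bool :=
  ~~ (if vt v < vt v' then compat v v' else if vt v' < vt v then compat v' v else false).

Definition is_bit (a : sym) := if a is Some (inl _) then true else false.

(** The input is the known word [e] followed by [m] bits of certificate; on the cells of the latter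
    any bit is accepted, which is the nondeterministic guess. *)
Definition init_ok (T : nat) (e : seq bool) (m : nat) (i : I) (a : sym) (p : nat) : bool :=
  if (i == ord0) && ((T <= p) && (p < T + (size e + m))) then
    if p - T < size e then a == Some (inl (nth false e (p - T))) else is_bit a
  else a == None.

Definition view_ok (T : nat) (e : seq bool) (v : view) : bool :=
  [&& (vt v == 0) ==> ((vz v).1 == start M) && all (fun i => vpos v i == T) (enum I),
      all (fun i => if vlast v i is Some s then s < vt v
        else init_ok T e (vm v) i ((vz v).2 i) (vpos v i)) (enum I) &
      (vt v == T) ==> ((vz v).2 ord0 == Some (inl true))].

Section Correspondence.
Variables (T : nat) (e : seq bool).

Definition run_view (c : seq bool) s : view :=
  ((s, size c), (loc M (e ++ c) s, ([seq hp T (e ++ c) s i | i <- enum I],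
    [seq lastv T (e ++ c) s i (hp T (e ++ c) s i) | i <- enum I]))).

Lemma run_vpos c s i : vpos (run_view c s) i = hp T (e ++ c) s i.
Proof. by rewrite /vpos /= (nth_map i) ?size_enum_ord // nth_ord_enum. Qed.

Lemma run_vlast c s i : vlast (run_view c s) i = lastv T (e ++ c) s i (hp T (e ++ c) s i).
Proof. by rewrite /vlast /= (nth_map i) ?size_enum_ord // nth_ord_enum. Qed.

Lemma init_cell_ok c i p : init_ok T e (size c) i (init_cell T (e ++ c) i p) p.
Proof.
rewrite /init_ok /init_cell; case: (i == ord0) => //=; case: (leqP T p) => //= hp.
case: ltnP => h; last by rewrite nth_default // size_map size_cat; lia.
rewrite (nth_map false) ?size_cat ?nth_cat; last by lia.
by case: ltnP.
Qed.

Lemma run_view_ok c s : s <= T -> (loc M (e ++ c) T).2 ord0 = Some (inl true) ->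
  view_ok T e (run_view c s).
Proof.
move=> hs acc; apply/and3P; split.
- apply/implyP => /eqP /= e0; rewrite /vt /= in e0; rewrite e0 /vz /= eqxx /=.
  by apply/allP => i _; rewrite run_vpos.
- apply/allP => i _; rewrite run_vlast run_vpos /vz /vt /vm /= (@scan_content M T) //.
  case E: lastv => [r|]; first by have [] := lastv_some E.
  exact: init_cell_ok.
- by apply/implyP => /eqP /= e0; rewrite /vt /= in e0; rewrite /vz /= e0 acc.
Qed.

Lemma run_compat c s s' : s < s' -> s' <= T -> compat (run_view c s) (run_view c s').
Proof.
move=> ss hs; apply/and3P; split=> //.
- apply/implyP => /eqP e1; have e2 : s' = s.+1 by move: e1; rewrite /vt /= addn1.
  rewrite e2 in hs *.
  rewrite -[(vz (run_view c s.+1)).1]/((loc M (e ++ c) s.+1).1) locS eqxx /=.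
  by apply/allP => i _; rewrite !run_vpos.
- apply/allP => i _; rewrite run_vlast !run_vpos /vz /vt /= (scan_content _ _ hs).
  case E: lastv => [r|]; last by apply/eqP; exact: (lastv_none E).
  have [h1 h2 h3] := lastv_some E; case: (eqVneq s r) => [->|ne]; first by rewrite h2 !eqxx.
  by apply/implyP => h; apply/eqP; exact: h3.
Qed.

Section Sound.
Variables (vw : nat -> view) (m : nat).
Hypothesis vw_t : forall s, s <= T -> vt (vw s) = s.
Hypothesis vw_m : forall s, s <= T -> vm (vw s) = m.
Hypothesis vw_ok : forall s, s <= T -> view_ok T e (vw s).
Hypothesis vw_compat : forall s s', s < s' -> s' <= T -> compat (vw s) (vw s').

Definition reader j s := (vlast (vw s) ord0 == None) && (vpos (vw s) ord0 == T + (size e + j)).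

(** A bit is what the view scanning its cell for the first time claims to see. If no view visits the
    cell, the search runs out of range and the bit is arbitrary. *)
Definition certificate : seq bool :=
  [seq (vz (vw (find (reader j) (iota 0 T.+1)))).2 ord0 == Some (inl true) | j <- iota 0 m].

Lemma vw_last s s' i : s < s' -> s' <= T ->
  if vlast (vw s') i is Some r then
    if s == r then (vpos (vw s) i == vpos (vw s') i) && ((vz (vw s')).2 i == ((act (vz (vw s))).2 i).1)
    else (r < s) ==> (vpos (vw s) i != vpos (vw s') i)
  else vpos (vw s) i != vpos (vw s') i.
Proof.
move=> h1 h2; have /and3P[_ _ /allP/(_ i)] := vw_compat h1 h2.
by rewrite mem_enum vw_t; [apply | lia].
Qed.

Lemma vw_init s : s <= T -> vlast (vw s) ord0 = None ->
  init_cell T (e ++ certificate) ord0 (vpos (vw s) ord0) = (vz (vw s)).2 ord0.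
Proof.
move=> hs ln; have /and3P[_ /allP/(_ ord0)] := vw_ok hs.
rewrite mem_enum ln => /(_ isT); rewrite /init_ok eqxx /= /init_cell eqxx /= vw_m //.
case: (leqP T (vpos (vw s) ord0)) => hp /=; last by move=> /eqP.
have sc : size certificate = m by rewrite size_map size_iota.
case: ltnP => h; last by move=> /eqP -> _; rewrite nth_default // size_map size_cat sc; lia.
rewrite (nth_map false) ?size_cat ?nth_cat ?sc; last by lia.
case: ltnP => h' ; first by move=> /eqP ->.
set j := _ - size e; have hj : j < m by rewrite /j; lia.
have rs : reader j s by rewrite /reader ln eqxx /=; apply/eqP; rewrite /j; lia.
rewrite /certificate (nth_map 0) ?size_iota // nth_iota // add0n.
have hh : has (reader j) (iota 0 T.+1) by apply/hasP; exists s; rewrite ?mem_iota.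
set f := find _ _; have fT : f <= T by move: hh; rewrite has_find size_iota ltnS.
have /andP[/eqP lf /eqP pf] : reader j f.
  by have := nth_find 0 hh; rewrite nth_iota // ltnS.
(* Two different times cannot both be the first visit of the same cell. *)
have -> : f = s.
  have [/eqP _ /eqP ps] := andP rs; have [fs|fs|//] := ltngtP f s.
    by have := vw_last ord0 fs hs; rewrite ln pf ps eqxx.
  by have := vw_last ord0 fs fT; rewrite lf pf ps eqxx.
by case: ((vz (vw s)).2 ord0) => [[[]|]|].
Qed.

(** Strong induction on time: state and positions come from the preceding view, previous visits from
    all earlier views, and a scanned symbol from the view of the last visit or from the initial
    tape. *)
Lemma vw_run s : s <= T -> [/\ vz (vw s) = loc M (e ++ certificate) s,
  forall i, vpos (vw s) i = hp T (e ++ certificate) s i &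
  forall i, vlast (vw s) i = lastv T (e ++ certificate) s i (hp T (e ++ certificate) s i)].
Proof.
elim/ltn_ind: s => s IH hs.
have [q P] : (vz (vw s)).1 = (loc M (e ++ certificate) s).1 /\
    forall i, vpos (vw s) i = hp T (e ++ certificate) s i.
  case: s IH hs => [|s] IH hs.
    have /and3P[/implyP/(_ _) h _ _] := vw_ok hs.
    have := h; rewrite vw_t // eqxx => /(_ isT)/andP[/eqP -> /allP hpos]; split=> // i.
    by apply/eqP/hpos; rewrite mem_enum.
  have [z ps _] := IH s (ltnSn s) (ltnW hs).
  have /and3P[_ /implyP h _] := vw_compat (ltnSn s) hs.
  move: h; rewrite !vw_t ?(ltnW hs) // addn1 eqxx => /(_ isT)/andP[/eqP -> /allP hpos]; split.
    by rewrite locS z.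
  by move=> i; have := hpos i; rewrite mem_enum => /(_ isT)/eqP ->; rewrite z ps.
have old r : r < s -> [/\ vz (vw r) = loc M (e ++ certificate) r &
    forall i, vpos (vw r) i = hp T (e ++ certificate) r i].
  by move=> h; have [] := IH r h (leq_trans (ltnW h) hs).
have Lst i : vlast (vw s) i = lastv T (e ++ certificate) s i (hp T (e ++ certificate) s i).
  case E: (vlast (vw s) i) => [r|]; apply/esym; last first.
    apply: lastv_eq_none => r hr; have := vw_last i hr hs; rewrite E P => /eqP.
    by have [_ ->] := old r hr.
  have rs : r < s.
    have /and3P[_ /allP/(_ i)] := vw_ok hs; rewrite mem_enum E vw_t // => /(_ isT) //.
  apply: lastv_eq_some => //.
    have := vw_last i rs hs; rewrite E eqxx P => /andP[/eqP h _].
    by have [_ <-] := old r rs.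
  move=> r' h1 h2; have := vw_last i h2 hs; rewrite E (gtn_eqF h1) h1 P /= => /eqP.
  by have [_ ->] := old r' h2.
split=> //; rewrite [LHS]surjective_pairing [RHS]surjective_pairing q; congr pair.
apply/ffunP => i; rewrite (@scan_content M T) // -Lst.
case E: (vlast (vw s) i) => [r|].
  have rs : r < s by have := Lst i; rewrite E => /esym/lastv_some[].
  have := vw_last i rs hs; rewrite E eqxx => /andP[_ /eqP ->].
  by have [-> _] := old r rs.
have [i0|i0] := eqVneq i ord0; first by rewrite i0 -P vw_init // -i0.
have /and3P[_ /allP/(_ i)] := vw_ok hs; rewrite mem_enum E => /(_ isT).
by rewrite /init_ok /init_cell (negbTE i0) /= => /eqP.
Qed.

Lemma vw_accept : size certificate = m /\ (loc M (e ++ certificate) T).2 ord0 = Some (inl true).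
Proof.
split; first by rewrite size_map size_iota.
have [<- _ _] := vw_run (leqnn T); have /and3P[_ _] := vw_ok (leqnn T).
by rewrite vw_t // eqxx => /eqP.
Qed.
End Sound.
End Correspondence.
End Views.

(** * Polynomial-time computation of the graph of views *)

Section ViewsPT.
Variable M : machine.
Local Notation I := 'I_(ntapes M).+1.
Local Notation sym := (tape_symbol (extra M)).
Local Notation local := (Defs.state M * {ffun I -> sym})%type.

#[local] Instance Enc_local : Enc local := Enc_fin _.
#[local] Instance Enc_tape : Enc I := Enc_fin _.
#[local] Instance Enc_sym : Enc sym := Enc_fin _.

Lemma PT_tape_index {X : Type} {EX : Enc X} (i : X -> I) : PT i -> PT (fun x => nat_of_ord (i x)).
Proof. exact: (@PT_finite _ X nat EX _ 0 (@nat_of_ord _)). Qed.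

Lemma PT_shift {X : Type} {EX : Enc X} (z : X -> local) (i : X -> I) (h : X -> nat) :
  PT z -> PT i -> PT h -> PT (fun x => shift ((act (z x)).2 (i x)).2 (h x)).
Proof.
move=> Pz Pi Ph.
pose isl (z : local) (i : I) := if ((act z).2 i).2 is MoveLeft then true else false.
pose isr (z : local) (i : I) := if ((act z).2 i).2 is MoveRight then true else false.
have P1 : PT (fun x => isl (z x) (i x)) by apply: (PT_finite2 false).
have P2 : PT (fun x => isr (z x) (i x)) by apply: (PT_finite2 false).
apply: (@PT_ext _ _ _ _ (fun x => if isl (z x) (i x) then h x - 1 else if isr (z x) (i x) then h x + 1 else h x)).
  by apply: PT_if => //; [pt | apply: PT_if => //; pt].
by move=> x; rewrite /isl /isr; case: ((act (z x)).2 (i x)).2; rewrite /= ?subn1 ?addn1.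
Qed.

Lemma PT_vpos {X : Type} {EX : Enc X} (v : X -> view M) (i : X -> I) : PT v -> PT i ->
  PT (fun x => vpos (v x) (i x)).
Proof. by move=> Pv Pi; rewrite /vpos; apply: PT_nth; [pt | pt | exact: PT_tape_index]. Qed.

Lemma PT_vlast {X : Type} {EX : Enc X} (v : X -> view M) (i : X -> I) : PT v -> PT i ->
  PT (fun x => vlast (v x) (i x)).
Proof. by move=> Pv Pi; rewrite /vlast; apply: PT_nth; [pt | pt | exact: PT_tape_index]. Qed.

Lemma PT_implyb {X : Type} {EX : Enc X} (a b : X -> bool) : PT a -> PT b -> PT (fun x => a x ==> b x).
Proof.
move=> Pa Pb; apply: (@PT_ext _ _ _ _ (fun x => if a x then b x else true)); first by pt.
by move=> x; case: (a x).
Qed.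

Lemma PT_compat : PT (fun p : view M * view M => compat p.1 p.2).
Proof.
rewrite /compat /vm /vt /vz; apply: PT_andb; first by pt.
apply: PT_andb.
  apply: PT_implyb; first by pt.
  apply: PT_andb.
    apply: (@PT_finite2 _ _ _ _ _ _ false (fun a b : local => a.1 == (act b).1) (fun p : view M * view M => p.2.2.1) (fun p => p.1.2.1)); pt.
  apply: PT_all; last by pt.
  by apply: PT_eq; [apply: PT_vpos; pt | apply: PT_shift; [pt | pt | apply: PT_vpos; pt]].
apply: PT_all; last by pt.
have Pne : PT (fun p : view M * view M * I => vpos p.1.1 p.2 != vpos p.1.2 p.2).
  by apply: PT_negb; apply: PT_eq; apply: PT_vpos; pt.
apply: PT_omatch; [by apply: PT_vlast; pt | by [] |].
apply: PT_if; first by pt.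
  apply: PT_andb; first by apply: PT_eq; apply: PT_vpos; pt.
  apply: PT_eq.
    apply: (@PT_finite2 _ _ _ _ _ Enc_sym None (fun (z : local) (i : I) => z.2 i)); pt.
  apply: (@PT_finite2 _ _ _ _ _ Enc_sym None (fun (z : local) (i : I) => ((act z).2 i).1)); pt.
by apply: PT_implyb; [pt | exact: (PT_comp Pne (PT_fst PT_id))].
Qed.

Lemma PT_conflict : PT (fun p : view M * view M => conflict p.1 p.2).
Proof.
rewrite /conflict /vt; apply: PT_negb; apply: PT_if; first by pt.
  exact: PT_compat.
apply: PT_if; [by pt | | by pt].
by apply: (PT_comp2 PT_compat); pt.
Qed.

Lemma PT_view_ok {X : Type} {EX : Enc X} (T : X -> nat) (e : X -> seq bool) (v : X -> view M) :
  PT T -> PT e -> PT v -> PT (fun x => view_ok (T x) (e x) (v x)).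
Proof.
move=> PT_ Pe Pv; rewrite /view_ok /vt /vz /vm.
have Pz : PT (fun x => (v x).2.1) by pt.
have Ps : PT (fun p : X * I => (v p.1).2.1.2 p.2).
  by apply: (@PT_finite2 _ _ _ _ _ Enc_sym None (fun (z : local) (i : I) => z.2 i)); pt.
apply: PT_andb.
  apply: PT_implyb; first by pt.
  apply: PT_andb; first exact: (@PT_finite _ _ _ _ _ false (fun z : local => z.1 == start M)).
  by apply: PT_all; [apply: PT_eq; [apply: PT_vpos; pt | pt] | pt].
apply: PT_andb; last first.
  apply: PT_implyb; first by pt.
  exact: (@PT_finite _ _ _ _ _ false (fun z : local => z.2 ord0 == Some (inl true))).
apply: PT_all; last by pt.
apply: PT_omatch; [by apply: PT_vlast; pt | | by pt].
have Pp : PT (fun p : X * I => vpos (v p.1) p.2) by apply: PT_vpos; pt.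
rewrite /init_ok; apply: PT_if.
- apply: PT_andb; first by apply: (@PT_finite _ _ _ _ _ false (fun i : I => i == ord0)); pt.
  by apply: PT_andb; [apply: PT_leq; pt | apply: PT_ltn; pt].
- apply: PT_if; first by pt.
    apply: PT_eq => //.
    have Pn : PT (fun p : X * I => nth false (e p.1) (vpos (v p.1) p.2 - T p.1)) by pt.
    apply: (@PT_ext _ _ _ _ (fun p : X * I => if nth false (e p.1) (vpos (v p.1) p.2 - T p.1)
      then (Some (inl true) : sym) else Some (inl false))).
      by apply: PT_if => //; exact: PT_const.
    by move=> q; case: nth.
  exact: (@PT_finite _ _ _ _ _ false (@is_bit M) _ Ps).
- exact: (@PT_finite _ _ _ _ _ false (fun a : sym => a == None) _ Ps).
Qed.

Definition Enc_view : Enc (view M) :=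
  Enc_prod (Enc_prod Enc_nat Enc_nat) (Enc_prod Enc_local
    (Enc_prod (Enc_seq Enc_nat) (Enc_seq (Enc_option Enc_nat)))).

(** [TL] and [B] are unary bounds on the time and on the certificate length; the exact bound [mmax]
    is a binary number and can only filter. The number of tapes is a constant, so the tuples are
    polynomially many. *)
Definition candidates (TL B : seq bool) (mmax : nat) : seq (view M) :=
  [seq (tm, zz) | tm <- [seq (t, m) | t <- iota 0 (size (false :: TL)),
                                      m <- [seq m <- iota 0 (size (false :: B)) | m <= mmax]],
                  zz <- [seq (z, pl) | z <- enum {: local},
                           pl <- [seq (ps, ls) | ps <- tuples (ntapes M).+1 (iota 0 (size (false :: TL ++ TL))),
                              ls <- tuples (ntapes M).+1 (None :: [seq Some s | s <- iota 0 (size TL)])]]].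

Lemma PT_candidates {X : Type} {EX : Enc X} (TL B : X -> seq bool) (mmax : X -> nat) :
  PT TL -> PT B -> PT mmax -> PT (fun x => candidates (TL x) (B x) (mmax x)).
Proof.
move=> P1 P2 P3; rewrite /candidates.
have Pps : PT (fun x => tuples (ntapes M).+1 (iota 0 (size (false :: TL x ++ TL x)))).
  by apply: PT_tuples; pt.
have Pls : PT (fun x => tuples (ntapes M).+1 (None :: [seq Some s | s <- iota 0 (size (TL x))])).
  by apply: PT_tuples; pt.
have Ppl : PT (fun x => [seq (ps, ls) | ps <- tuples (ntapes M).+1 (iota 0 (size (false :: TL x ++ TL x))),
    ls <- tuples (ntapes M).+1 (None :: [seq Some s | s <- iota 0 (size (TL x))])]).
  by apply: PT_allpairs; [pt | exact: Pps | exact: (PT_comp Pls (PT_fst PT_id))].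
have Pm : PT (fun x => [seq m <- iota 0 (size (false :: B x)) | m <= mmax x]) by pt.
have Ptm : PT (fun x => [seq (t, m) | t <- iota 0 (size (false :: TL x)),
    m <- [seq m <- iota 0 (size (false :: B x)) | m <= mmax x]]).
  by apply: PT_allpairs; [pt | pt | exact: (PT_comp Pm (PT_fst PT_id))].
apply: PT_allpairs; [by pt | exact: Ptm |].
apply: PT_allpairs; [by pt | exact: PT_const |].
exact: (PT_comp Ppl (PT_fst (PT_fst PT_id))).
Qed.

Lemma mem_candidates TL B mmax t m z ps ls : t <= size TL -> m <= size B -> m <= mmax ->
  size ps = (ntapes M).+1 -> size ls = (ntapes M).+1 -> all (fun p => p <= size TL + size TL) ps ->
  all (fun o => if o is Some s then s < size TL else true) ls ->
  ((t, m), (z, (ps, ls))) \in candidates TL B mmax.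
Proof.
move=> ht hm hm' s1 s2 /allP a1 /allP a2; rewrite /candidates.
apply: allpairs_f; first by apply: allpairs_f; rewrite ?mem_filter mem_iota /= ?hm' ltnS.
apply: allpairs_f; first by rewrite mem_enum.
apply: allpairs_f; rewrite mem_tuples ?s1 ?s2 eqxx andTb; apply/allP.
  move=> q /a1 h; suff: q \in iota 0 (size (false :: TL ++ TL)) by [].
  by rewrite mem_iota add0n /= ltnS size_cat.
move=> o /a2 h; suff: o \in None :: [seq Some s | s <- iota 0 (size TL)] by [].
case: o h => // s h; rewrite inE; apply/orP; right; apply/mapP; exists s => //.
by rewrite mem_iota.
Qed.

Lemma candidates_bound TL B mmax v : v \in candidates TL B mmax -> vt v <= size TL /\ vm v <= mmax.
Proof.
move=> /allpairsP[[tm zz] [htm _ ->]]; rewrite /vt /vm.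
move: htm => /allpairsP[[t m] [ht hm /= ->]].
by move: ht hm; rewrite mem_filter !mem_iota /= ltnS => ? /andP[].
Qed.
End ViewsPT.

Theorem NP_graph (L : seq bool -> Prop) : in_NP L ->
  exists (A : eqType) (EA : Enc A) (vs : seq bool -> seq A) (K : seq bool -> nat) (cf : A -> A -> bool),
  [/\ PT vs, PT K, PT (fun p : A * A => cf p.1 p.2), forall w, uniq (vs w) /\ 0 < K w &
   forall w, L w <-> exists S : seq A, [/\ uniq S, {subset S <= vs w}, size S = K w &
     forall a b, a \in S -> b \in S -> a != b -> ~~ cf a b]].
Proof.
move=> [V [p [[M [pM HM]] HL]]].
have [d1 h1] := poly_nat_le p; have [d2 h2] := poly_nat_le pM.
pose ep (w : seq bool) := encode_seq (fun b => [:: b]) w.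
(* A unary bound on the length of the verifier's input, namely of [w] with any admissible
   certificate. The length of [TL w] in turn bounds the running time on such inputs. *)
pose B (w : seq bool) : seq bool := ep w ++ [seq false | _ <- tuples d1 (false :: false :: w)].
pose TL w : seq bool := [seq false | _ <- tuples d2 (false :: false :: B w)].
pose cand w := candidates M (TL w) (B w) (p.[size w])%R.
pose vs w : seq (view M) := dedup [seq v <- cand w | view_ok (size (TL w)) (ep w) v].
have Pe : PT ep by rewrite /ep /encode_seq; pt.
have Pt1 : PT (fun w : seq bool => tuples d1 (false :: false :: w)).
  by apply: PT_tuples; exact: (PT_cons (PT_const _) (PT_cons (PT_const _) PT_id)).
have PB : PT B by apply: (PT_cat Pe); apply: (@PT_map _ _ _ _ _ _ (fun _ _ => false)) Pt1; exact: PT_const.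
have Pt2 : PT (fun w : seq bool => tuples d2 (false :: false :: B w)).
  by apply: PT_tuples; exact: (PT_cons (PT_const _) (PT_cons (PT_const _) PB)).
have PTL : PT TL by apply: (@PT_map _ _ _ _ _ _ (fun _ _ => false)) Pt2; exact: PT_const.
exists (view M : eqType), (Enc_view M), vs, (fun w => (size (TL w)).+1), (@conflict M).
have sB w : size (B w) = size (ep w) + (size w + 2) ^ d1.
  by rewrite size_cat size_map size_tuples /= addn2.
have sT w : size (TL w) = (size (B w) + 2) ^ d2 by rewrite size_map size_tuples /= addn2.
have acc w c : size c <= (p.[size w])%R -> V (encode_pair w c) = ((loc M (ep w ++ c) (size (TL w))).2 ord0 == Some (inl true)).
  move=> hc; have [t ht [hh ho]] := HM (encode_pair w c).
  apply: (@output_true M (size (TL w)) (ep w ++ c) _ t) => //.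
  apply: leq_trans ht _; rewrite sT; apply: h2; rewrite /encode_pair size_cat sB leq_add2l.
  by apply: leq_trans hc _; apply: h1.
split.
- apply: PT_dedup; apply: PT_filter.
    by apply: PT_view_ok; pt.
  by apply: PT_candidates => //; apply: PT_horner; pt.
- apply: (@PT_ext _ _ _ _ (fun w => size (false :: TL w))) => //; by pt.
- exact: PT_conflict.
- by move=> w; split=> //; exact: (dedupP _).1.
move=> w; set T := size (TL w).
have mvs v : (v \in vs w) = view_ok T (ep w) v && (v \in cand w).
  by rewrite (dedupP _).2 mem_filter.
split=> [/HL[c hc]|[S [uS sS zS cS]]].
  rewrite acc // => /eqP ac; exists [seq run_view M T (ep w) c s | s <- iota 0 T.+1]; split.
  - by rewrite map_inj_uniq ?iota_uniq // => s s' [].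
  - move=> v /mapP[s]; rewrite mem_iota add0n ltnS => hs ->.
    rewrite mvs run_view_ok //=; apply: mem_candidates => //.
    + by rewrite sB (leq_trans _ (leq_addl _ _)) // (leq_trans hc) // h1.
    + by rewrite size_map size_enum_ord.
    + by rewrite size_map size_enum_ord.
    + apply/allP => q /mapP[i _ ->]; have := hp_bound (ep w ++ c) i hs; rewrite -/T; lia.
    + apply/allP => o /mapP[i _ ->]; case E: lastv => [r|] //.
      by have [h _ _] := lastv_some E; exact: leq_trans h hs.
  - by rewrite size_map size_iota.
  - move=> a b /mapP[s]; rewrite mem_iota add0n ltnS => hs -> /mapP[s']; rewrite mem_iota add0n ltnS => hs' -> ne.
    rewrite /conflict negbK /vt /=; case: ltngtP => h; try exact: run_compat.
    by rewrite h eqxx in ne.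
have tS : {in S, forall v, vt v <= T}.
  by move=> v /sS; rewrite mvs => /andP[_ /candidates_bound[]].
(* The times are distinct and at most [T], and there are [T + 1] of them, so every time occurs. *)
have ut : uniq (map (@vt M) S).
  rewrite map_inj_in_uniq // => a b ha hb e; apply/eqP/negP => /negP ne.
  by have := cS a b ha hb ne; rewrite /conflict e ltnn.
have full s : s <= T -> s \in map (@vt M) S.
  have sub : {subset map (@vt M) S <= iota 0 T.+1}.
    by move=> t /mapP[v hv ->]; rewrite mem_iota add0n ltnS; exact: tS.
  have [|_ E] := uniq_min_size ut sub; first by rewrite size_map size_iota zS.
  by move=> hs; rewrite E mem_iota add0n ltnS.
have v0 : view M by case: S zS {uS sS cS tS ut full} => // v.
pose vw s := nth v0 S (index s (map (@vt M) S)).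
have vwS s : s <= T -> vw s \in S /\ vt (vw s) = s.
  move=> hs; have hi : index s (map (@vt M) S) < size S by rewrite -(size_map (@vt M)) index_mem full.
  by split; [exact: mem_nth | rewrite /vw -(nth_map _ 0) // nth_index // full].
have vw_t s : s <= T -> vt (vw s) = s by move=> /vwS[].
have vw_ok s : s <= T -> view_ok T (ep w) (vw s).
  by move=> /vwS[/sS]; rewrite mvs => /andP[].
have vw_c s s' : s < s' -> s' <= T -> compat (vw s) (vw s').
  move=> h hs'; have hs := leq_trans (ltnW h) hs'.
  have := cS _ _ (vwS s hs).1 (vwS s' hs').1; rewrite /conflict negbK !vw_t // h; apply.
  by apply/eqP => E; have := vw_t s hs; rewrite E vw_t // => e; rewrite e ltnn in h.
have vw_m s : s <= T -> vm (vw s) = vm (vw 0).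
  case: s => // s hs; have /and3P[/eqP <- _ _] := vw_c 0 s.+1 isT hs.
  by [].
have [sc ac] := vw_accept vw_t vw_m vw_ok vw_c.
apply/HL; exists (certificate T (ep w) vw (vm (vw 0))).
  by rewrite sc; have [/sS] := vwS 0 (leq0n _); rewrite mvs => /andP[_ /candidates_bound[]].
rewrite acc; first by rewrite ac.
by rewrite sc; have [/sS] := vwS 0 (leq0n _); rewrite mvs => /andP[_ /candidates_bound[]].
Qed.

(** * Hardness *)

Lemma addcA : associative addc.
Proof. by move=> [a|] [b|] [c|] //=; rewrite addrA. Qed.

Lemma addcC : commutative addc.
Proof. by move=> [a|] [b|] //=; rewrite addrC. Qed.

Lemma add0c : left_id (Some 0%R) addc.
Proof. by move=> [a|] //=; rewrite add0r. Qed.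

HB.instance Definition _ := Monoid.isComLaw.Build cost (Some 0%R) addc addcA addcC add0c.

Lemma binaryE n : binary n = if n == 0 then [:: false] else bits n.
Proof.
case: eqP => [-> //|/eqP n0].
rewrite -{2}(bval_binary n) bvalK //.
rewrite /binary -[X in iota 0 X]addn1 iotaD map_cat last_cat /= add0n.
have n1 : 0 < n by rewrite lt0n.
have /andP[h1 h2] := trunc_log_bounds (isT : 1 < 2) n1.
suff -> : n %/ 2 ^ trunc_log 2 n = 1 by [].
by apply/eqP; rewrite eqn_leq -ltnS ltn_divLR ?expn_gt0 // divn_gt0 ?expn_gt0 // -expnS h2 h1.
Qed.

Lemma PT_encode_seq {X A : Type} {EX : Enc X} {EA : Enc A} (f : A -> seq bool) (l : X -> seq A) :
  PT f -> PT l -> PT (fun x => encode_seq f (l x)).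
Proof. by move=> Pf Pl; rewrite /encode_seq; pt. Qed.

Lemma PT_encode_nat : PT encode_nat.
Proof.
apply: (@PT_ext _ _ _ _ (fun n => encode_seq (fun b => [:: b]) (if n == 0 then [:: false] else bits n))).
  by apply: PT_encode_seq; [pt | apply: PT_if; [pt | pt | apply: PT_bits; pt]].
by move=> n; rewrite /encode_nat binaryE.
Qed.

Lemma sum_enum_card (T : finType) (S : pred T) : \sum_(i <- enum T) S i = #|S|.
Proof.
rewrite big_enum /= -sum1_card [RHS]big_mkcond /=.
by apply: eq_bigr => j _; rewrite unfold_in; case: (S j).
Qed.

(** * Reduction from independent sets by gadgets *)

Section Gadgets.
Variable G : fin_vlang rat.

Definition gadget (P : Type) := seq {f : fsymb G & (arity (finterp f)).-tuple P}.

Definition gcost (P : Type) (z : P -> rat) (g : gadget P) : cost :=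
  \big[addc/Some 0%R]_(t <- g) finterp (tag t) (map_tuple z (tagged t)).

Definition gmap (P Q : Type) (h : P -> Q) (g : gadget P) : gadget Q :=
  [seq Tagged (fun f => (arity (finterp f)).-tuple Q) (map_tuple h (tagged t)) | t <- g].

Lemma gcost_map (P Q : Type) (h : P -> Q) z (g : gadget P) :
  gcost z (gmap h g) = gcost (fun p => z (h p)) g.
Proof.
rewrite /gcost /gmap big_map; apply: eq_bigr => t _ /=; congr (finterp _ _).
by apply: val_inj; rewrite /= -map_comp.
Qed.

Lemma gcost_flatten (P S : Type) (z : P -> rat) (g : S -> gadget P) (l : seq S) :
  gcost z (flatten [seq g s | s <- l]) = \big[addc/Some 0%R]_(s <- l) gcost z (g s).
Proof. by rewrite /gcost big_flatten big_map. Qed.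

Lemma gcost_cat (P : Type) (z : P -> rat) (g g' : gadget P) :
  gcost z (g ++ g') = addc (gcost z g) (gcost z g').
Proof. by rewrite /gcost big_cat. Qed.

Definition gdata (P : Type) (h : P -> nat) (g : gadget P) : seq (nat * seq nat) :=
  [seq (nat_of_ord (enum_rank (tag t)), [seq h v | v <- tval (tagged t)]) | t <- g].

Lemma gdata_map (P Q : Type) (k : Q -> nat) (h : P -> Q) (g : gadget P) :
  gdata k (gmap h g) = gdata (fun p => k (h p)) g.
Proof. by rewrite /gdata /gmap -map_comp; apply: eq_map => t /=; rewrite -map_comp. Qed.

Lemma gdata_cat (P : Type) (h : P -> nat) (g g' : gadget P) : gdata h (g ++ g') = gdata h g ++ gdata h g'.
Proof. exact: map_cat. Qed.

Lemma gdata_flatten (P S : Type) (h : P -> nat) (g : S -> gadget P) (l : seq S) :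
  gdata h (flatten [seq g s | s <- l]) = flatten [seq gdata h (g s) | s <- l].
Proof. by rewrite /gdata map_flatten -map_comp. Qed.

Variables (b : nat) (VG : gadget 'I_b) (EG : gadget ('I_b + 'I_b)) (Sel Uns : 'I_b -> rat).

Definition join2 (Q : Type) (z z' : 'I_b -> Q) (p : 'I_b + 'I_b) : Q :=
  match p with inl i => z i | inr i => z' i end.

Local Open Scope ring_scope.

(** A vertex is a block of [b] variables with two admissible states. Selection earns 1, and
    selecting both ends of an edge costs at least 1, possibly +oo. *)
Record good_gadget : Prop := GoodGadget {
  gg_fin : forall z, isSome (gcost z VG) -> z = Sel \/ z = Uns;
  gg_sel : gcost Sel VG = Some (- 1);
  gg_uns : gcost Uns VG = Some 0;
  gg_uu : gcost (join2 Uns Uns) EG = Some 0;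
  gg_su : gcost (join2 Sel Uns) EG = Some 0;
  gg_us : gcost (join2 Uns Sel) EG = Some 0;
  gg_ss : forall c, gcost (join2 Sel Sel) EG = Some c -> 1 <= c
}.

Section Instance.
Variables (N : nat) (edges : seq ('I_N * 'I_N)) (K : nat).

Lemma block_var_lt (j : 'I_N) (i : 'I_b) : (j * b + i < N * b)%N.
Proof. by case: j i => j hj [i hi] /=; apply: (@leq_trans (j.+1 * b)); rewrite ?leq_mul2r ?hj ?orbT // mulSn addnC ltn_add2r. Qed.

Definition block_var (j : 'I_N) (i : 'I_b) : 'I_(N * b) := Ordinal (block_var_lt j i).

(** Each edge is taken [N] times, so that one violated edge outweighs the reward for selecting all
    vertices. *)
Definition repeated : seq (nat * ('I_N * 'I_N)) := [seq (k, p) | k <- iota 0 N, p <- edges].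

Definition graph_instance : instance G := @Instance rat G (N * b)
  (flatten [seq gmap (block_var j) VG | j <- enum 'I_N] ++
   flatten [seq gmap (join2 (block_var kp.2.1) (block_var kp.2.2)) EG | kp <- repeated])
  (Some (- K%:R)).

Lemma graph_costE (alpha : 'I_(N * b) -> rat) (z : 'I_N -> 'I_b -> rat) :
  (forall j i, alpha (block_var j i) = z j i) ->
  assignment_cost (I := graph_instance) alpha =
  addc (\big[addc/Some 0]_(j <- enum 'I_N) gcost (z j) VG)
       (\big[addc/Some 0]_(kp <- repeated) gcost (join2 (z kp.2.1) (z kp.2.2)) EG).
Proof.
move=> h; rewrite -[LHS]/(gcost alpha _) gcost_cat !gcost_flatten; congr addc.
  by apply: eq_bigr => j _; rewrite gcost_map; congr gcost; apply: functional_extensionality => i.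
apply: eq_bigr => kp _; rewrite gcost_map; congr gcost.
by apply: functional_extensionality => -[i|i] /=.
Qed.

Hypothesis good : good_gadget.
Hypothesis K0 : (0 < K)%N.

Definition state_of (s : bool) : 'I_b -> rat := if s then Sel else Uns.

Lemma below_of_independent (S : pred 'I_N) : #|S| = K ->
  (forall p, p \in edges -> ~~ (S p.1 && S p.2)) -> has_cost_below graph_instance.
Proof.
move=> cS hS.
pose val (s : bool) (k : nat) : rat := if insub k is Some i then state_of s i else 0.
pose alpha (v : 'I_(N * b)) : rat := if insub (v %/ b)%N is Some j then val (S j) (v %% b)%N else 0.
have E j i : alpha (block_var j i) = state_of (S j) i.
  have b0 : (0 < b)%N by apply: leq_ltn_trans (ltn_ord i).
  rewrite /alpha /= divnMDl // divn_small // addn0 valK modnMDl modn_small //.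
  by rewrite /val valK.
exists alpha; rewrite (graph_costE E) !sum_addc.
rewrite (_ : all _ (enum 'I_N) = true); last first.
  by apply/allP => j _; rewrite /state_of; case: ifP; rewrite ?(gg_sel good) ?(gg_uns good).
have H kp : kp \in repeated -> gcost (join2 (state_of (S kp.2.1)) (state_of (S kp.2.2))) EG = Some 0.
  move=> /allpairsP[[k p] [_ hp ->]] /=; have := hS _ hp; rewrite /state_of.
  by case: (S p.1); case: (S p.2) => //= _; rewrite ?(gg_uu good) ?(gg_su good) ?(gg_us good).
rewrite (_ : all _ repeated = true); last by apply/allP => kp /H ->.
split=> //=; rewrite [X in _ + X]big_seq [X in _ + X]big1; last by move=> kp /H ->.
rewrite addr0 (eq_bigr (fun j => - (S j)%:R)); last first.
  by move=> j _; rewrite /state_of; case: (S j); rewrite ?(gg_sel good) ?(gg_uns good) /= ?oppr0.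
rewrite sumrN lerN2 -cS -natr_sum ler_nat.
by rewrite sum_enum_card.
Qed.

Lemma independent_of_below : has_cost_below graph_instance -> exists S : pred 'I_N,
  (K <= #|S|)%N /\ forall p, p \in edges -> ~~ (S p.1 && S p.2).
Proof.
move=> [alpha]; pose z j i := alpha (block_var j i).
rewrite (@graph_costE alpha z) // !sum_addc.
case: ifP => [/allP hV|]; last by move=> _ [].
case: ifP => [/allP hE|]; last by move=> _ [].
move=> [_ /= hle].
pose S : pred 'I_N := fun j => gcost (z j) VG == Some (- 1).
have zS j : z j = state_of (S j).
  have := gg_fin good (hV j (mem_enum _ _)); rewrite /S /state_of.
  by case=> ->; rewrite ?(gg_sel good) ?(gg_uns good) ?eqxx.
have vS j : odflt 0 (gcost (z j) VG) = - (S j)%:R.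
  by rewrite zS /state_of; case: (S j); rewrite ?(gg_sel good) ?(gg_uns good) /= ?oppr0.
have eS kp : kp \in repeated -> (S kp.2.1 && S kp.2.2)%:R <= odflt 0 (gcost (join2 (z kp.2.1) (z kp.2.2)) EG).
  move=> /hE; rewrite !zS /state_of.
  case: (S kp.2.1); case: (S kp.2.2) => /=; rewrite ?(gg_uu good) ?(gg_su good) ?(gg_us good) //.
  by case e: gcost => [c|] //= _; exact: (gg_ss good e).
have e0 kp : kp \in repeated -> 0 <= odflt 0 (gcost (join2 (z kp.2.1) (z kp.2.2)) EG).
  by move=> h; apply: le_trans (eS kp h); case: (_ && _).
have VE : \sum_(j <- enum 'I_N) odflt 0 (gcost (z j) VG) = - (#|S|%:R).
  rewrite (eq_bigr (fun j => - (S j)%:R)) // sumrN -natr_sum; congr (- _%:R).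
  exact: sum_enum_card.
exists S; split.
  rewrite -(ler_nat rat) -lerN2 -VE; apply: le_trans hle; rewrite lerDl big_seq; exact: sumr_ge0.
move=> p hp; apply/negP => hS.
(* With a violated edge the total cost would be at least [N - #|S|], which is not negative, against
   a threshold [- K] below 0. *)
have : N%:R <= \sum_(kp <- repeated) odflt 0 (gcost (join2 (z kp.2.1) (z kp.2.2)) EG) :> rat.
  have e1 k : k \in iota 0 N -> 1 <= \sum_(q <- edges) odflt 0 (gcost (join2 (z q.1) (z q.2)) EG).
    move=> hk; have hm q : q \in edges -> (k, q) \in repeated by move=> hq; apply: allpairs_f.
    rewrite (big_rem p) //=; apply: ler_wpDr.
      rewrite big_seq; apply: sumr_ge0 => q hq; exact: (e0 _ (hm q (mem_rem hq))).
    by have := eS _ (hm p hp); rewrite /= hS.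
  rewrite big_allpairs /= -[N in N%:R](size_iota 0) -sum1_size natr_sum.
  by rewrite big_seq [leRHS]big_seq; apply: ler_sum.
move=> hN; have : #|S|%:R <= N%:R :> rat by rewrite ler_nat -[N in (_ <= N)%N]card_ord max_card.
have : 0 < K%:R :> rat by rewrite ltr0n.
by move: hle; rewrite VE; lra.
Qed.

Lemma encode_graph_instance : encode_instance graph_instance =
  encode_seq encode_nat (iota 0 (N * b)) ++
  encode_seq (fun s : nat * seq nat => encode_nat s.1 ++ encode_seq encode_nat s.2)
    (flatten [seq gdata (fun i : 'I_b => (j * b + i)%N) VG | j <- iota 0 N] ++
     flatten [seq gdata (join2 (fun i : 'I_b => (kp.2.1 * b + i)%N) (fun i : 'I_b => (kp.2.2 * b + i)%N)) EG |
       kp <- [seq (k, p) | k <- iota 0 N, p <- [seq (nat_of_ord p.1, nat_of_ord p.2) | p <- edges]]]) ++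
  (true :: (true :: encode_nat K) ++ (false :: encode_nat 1)).
Proof.
rewrite /encode_instance; congr (_ ++ _); first by rewrite (map_encode_seq (fun v : 'I_(N * b) => nat_of_ord v)) val_enum_ord.
congr (_ ++ _); last first.
  rewrite /graph_instance /= /encode_rat.
  have -> : - (K%:R) = (- (Posz K))%:~R :> rat by rewrite mulrNz.
  by rewrite numq_int denq_int /encode_int abszN oppr_lt0 ltz_nat K0.
transitivity (encode_seq (fun s : nat * seq nat => encode_nat s.1 ++ encode_seq encode_nat s.2)
  (gdata (fun v : 'I_(N * b) => nat_of_ord v) (summands graph_instance))).
  rewrite /gdata -map_encode_seq; congr encode_seq; apply: functional_extensionality => t.
  by congr (_ ++ _); exact: map_encode_seq.
congr encode_seq; rewrite gdata_cat !gdata_flatten; congr (flatten _ ++ flatten _).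
  rewrite -[iota 0 N]val_enum_ord -map_comp; apply: eq_map => j.
  exact: (gdata_map (fun v : 'I_(N * b) => nat_of_ord v)).
rewrite /repeated !map_allpairs allpairs_mapr; apply: eq_allpairs => k p /=.
rewrite [LHS](gdata_map (fun v : 'I_(N * b) => nat_of_ord v)); congr gdata.
by apply: functional_extensionality => -[i|i].
Qed.
End Instance.
End Gadgets.

Theorem gadget_hard (G : fin_vlang rat) b (VG : gadget G 'I_b) (EG : gadget G ('I_b + 'I_b)) Sel Uns :
  good_gadget VG EG Sel Uns -> VCSP_NP_hard G.
Proof.
move=> good L /NP_graph[A [EA [vs [K [cf [Pvs PK Pcf uK HL]]]]]].
pose lab w := [seq (j, tnth (in_tuple (vs w)) j) | j <- enum 'I_(size (vs w))].
pose edges w := [seq (p.1.1, p.2.1) | p <- [seq (x, y) | x <- lab w, y <- lab w] &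
  (p.1.1 != p.2.1) && cf p.1.2 p.2.2].
exists (fun w => graph_instance VG EG (edges w) (K w)); split.
  pose labn w := zip (iota 0 (size (vs w))) (vs w).
  pose edgesn w := [seq (p.1.1, p.2.1) | p <- [seq (x, y) | x <- labn w, y <- labn w] &
    (p.1.1 != p.2.1) && cf p.1.2 p.2.2].
  have labE w : labn w = [seq (nat_of_ord p.1, p.2) | p <- lab w].
    rewrite /labn /lab -map_comp.
    transitivity (zip (map val (enum 'I_(size (vs w)))) (map (tnth (in_tuple (vs w))) (enum 'I_(size (vs w))))).
      by rewrite val_enum_ord map_tnth_enum.
    by rewrite zip_map.
  have edE w : edgesn w = [seq (nat_of_ord p.1, nat_of_ord p.2) | p <- edges w].
    rewrite /edgesn /edges labE allpairs_mapl allpairs_mapr.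
    rewrite -[[seq (_, _) | x <- lab w, y <- lab w]](map_allpairs (fun p : _ * _ =>
      ((nat_of_ord p.1.1, p.1.2), (nat_of_ord p.2.1, p.2.2))) (fun x y => (x, y))).
    by rewrite filter_map -!map_comp; congr map.
  have Pl : PT labn by rewrite /labn; pt.
  have Pe : PT edgesn.
    have Pp : PT (fun w => [seq (x, y) | x <- labn w, y <- labn w]).
      by apply: PT_allpairs; [pt | exact: Pl | exact: (PT_comp Pl (PT_fst PT_id))].
    by rewrite /edgesn; apply: PT_map; [pt | apply: PT_filter; [pt | exact: Pp]].
  have Pn := PT_encode_nat.
  have Pg (P : eqType) (Q : Type) (EQ : Enc Q) (EP : Enc P) (h : Q -> P -> nat) (g : gadget G P) :
      PT (fun q : Q * P => h q.1 q.2) -> PT (fun q => gdata (h q) g).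
    move=> Ph; rewrite /gdata.
    apply: (@PT_ext _ _ _ _ (fun q => [seq (s.1, [seq h q v | v <- s.2]) |
      s <- [seq (nat_of_ord (enum_rank (tag t)), tval (tagged t)) | t <- g]])).
      apply: PT_map; last exact: PT_const.
      by apply: PT_pair; [pt | apply: PT_map; [apply: (PT_comp2 Ph); pt | pt]].
    by move=> q; rewrite -map_comp.
  apply: PT_polytime; apply: (@PT_ext _ _ _ _ (fun w =>
    encode_seq encode_nat (iota 0 (size [seq (v, i) | v <- vs w, i <- iota 0 b])) ++
    encode_seq (fun s : nat * seq nat => encode_nat s.1 ++ encode_seq encode_nat s.2)
    (flatten [seq gdata (fun i : 'I_b => (j * b + i)%N) VG | j <- iota 0 (size (vs w))] ++
     flatten [seq gdata (join2 (fun i : 'I_b => (kp.2.1 * b + i)%N) (fun i : 'I_b => (kp.2.2 * b + i)%N)) EG |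
       kp <- [seq (k, p) | k <- iota 0 (size (vs w)), p <- edgesn w]]) ++
    (true :: (true :: encode_nat (K w)) ++ (false :: encode_nat 1)))); last first.
    move=> w; have [_ K0] := uK w.
    by rewrite (encode_graph_instance _ _ _ K0) edE size_allpairs size_iota.
  have Ps : PT (fun s : nat * seq nat => encode_nat s.1 ++ encode_seq encode_nat s.2).
    by apply: PT_cat; [pt | apply: PT_encode_seq; pt].
  have Po (X : Type) (EX : Enc X) (i : X -> 'I_b) : @PT _ _ EX (Enc_fin _) i -> PT (fun x => nat_of_ord (i x)).
    exact: (@PT_finite _ X nat EX _ 0 (@nat_of_ord _)).
  apply: PT_cat; first by apply: PT_encode_seq => //; pt.
  apply: PT_cat; last first.
    by apply: PT_cons; [pt | apply: PT_cat; [apply: PT_cons; pt | exact: PT_const]].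
  apply: PT_encode_seq => //; apply: PT_cat; apply: PT_flatten; apply: PT_map.
  - have P1 : PT (fun j : nat => gdata (fun i : 'I_b => (j * b + i)%N) VG).
      apply: (@Pg _ _ _ (Enc_fin _) (fun j (i : 'I_b) => (j * b + i)%N)).
      apply: PT_addn; first by pt.
      by apply: Po; exact: (@PT_snd _ _ _ _ _ (Enc_fin _) _ PT_id).
    exact: (PT_comp P1 (PT_snd PT_id)).
  - by pt.
  - have P1 : PT (fun p : nat * (nat * nat) => gdata (join2 (fun i : 'I_b => (p.2.1 * b + i)%N)
        (fun i : 'I_b => (p.2.2 * b + i)%N)) EG).
      apply: (@Pg _ _ _ (Enc_fin _) (fun p : nat * (nat * nat) => join2 (fun i : 'I_b => (p.2.1 * b + i)%N)
        (fun i : 'I_b => (p.2.2 * b + i)%N))).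
      pose side (q : 'I_b + 'I_b) := if q is inl _ then true else false.
      pose num (q : 'I_b + 'I_b) : nat := match q with inl i => i | inr i => i end.
      have P2 : @PT _ _ (Enc_prod _ (Enc_fin _)) _ (fun q : nat * (nat * nat) * ('I_b + 'I_b) => side q.2).
        by apply: (PT_finite false); exact: (@PT_snd _ _ _ _ _ (Enc_fin _) _ PT_id).
      have P3 : @PT _ _ (Enc_prod _ (Enc_fin _)) _ (fun q : nat * (nat * nat) * ('I_b + 'I_b) => num q.2).
        by apply: (PT_finite 0); exact: (@PT_snd _ _ _ _ _ (Enc_fin _) _ PT_id).
      have P4 : @PT _ _ (Enc_prod _ (Enc_fin _)) _ (fun q : nat * (nat * nat) * ('I_b + 'I_b) =>
          if side q.2 then (q.1.2.1 * b + num q.2)%N else (q.1.2.2 * b + num q.2)%N).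
        by apply: (PT_if P2); apply: PT_addn P3; apply: PT_muln; pt.
      by apply: (PT_ext P4) => -[p [i|i]].
    exact: (PT_comp P1 (PT_snd PT_id)).
  - by apply: PT_allpairs; [pt | pt | exact: (PT_comp Pe (PT_fst PT_id))].
move=> w; have [uvs K0] := uK w; rewrite HL; set N := size (vs w).
pose val (j : 'I_N) := tnth (in_tuple (vs w)) j.
have vinj : injective val.
  by have /tuple_uniqP h : uniq (in_tuple (vs w)) by [].
have medge p : (p \in edges w) = (p.1 != p.2) && cf (val p.1) (val p.2).
  apply/mapP/idP => [[[[i a] [j a']]]|h].
    rewrite mem_filter => /andP[h /allpairsP[[x y] [/mapP[i' _ ->] /mapP[j' _ ->] [e1 e2 e3 e4]]]] ->.
    by move: h; rewrite /= e1 e2 e3 e4 /= => /andP[-> ->].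
  exists ((p.1, val p.1), (p.2, val p.2)); last by case: (p).
  rewrite mem_filter /= h /=.
  by apply: allpairs_f; apply: (map_f (fun j => (j, val j))); rewrite mem_enum.
split=> [[S [uS sS zS cS]]|/(independent_of_below good K0)[S [cS hS]]].
  apply: (below_of_independent good (S := fun j => val j \in S)).
    rewrite -zS cardE -(size_map val); apply/eqP; rewrite -(uniq_size_uniq _ _) ?map_inj_uniq ?enum_uniq //.
    move=> a; apply/idP/mapP => [ha|[j]]; last by rewrite mem_enum => h ->.
    have /tnthP[j e] : a \in in_tuple (vs w) := sS a ha.
    exists j => //.
    suff: val j \in S by rewrite mem_enum.
    by rewrite /val -e.
  move=> p; rewrite medge => /andP[ne c]; apply/negP => /andP[h1 h2].
  by have := cS _ _ h1 h2; rewrite (inj_eq vinj) ne c => /(_ isT).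
(* The instance yields at least [K w] independent vertices; any [K w] of them are independent
   too. *)
exists (take (K w) [seq val j | j <- enum S]); split.
- by rewrite take_uniq // map_inj_uniq // enum_uniq.
- by move=> a /mem_take/mapP[j _ ->]; exact: mem_tnth.
- by rewrite size_takel // size_map -cardE.
- move=> a a' /mem_take/mapP[i hi ->] /mem_take/mapP[j hj ->]; rewrite (inj_eq vinj) => ne.
  rewrite !mem_enum in hi hj; apply/negP => c.
  have {}hi : S i := hi; have {}hj : S j := hj.
  by have := hS (i, j); rewrite medge /= ne c => /(_ isT); rewrite hi hj.
Qed.

Local Open Scope ring_scope.

(** * Submodular cost functions with finite support *)

Definition smax (s t : seq rat) : seq rat := [seq Num.max p.1 p.2 | p <- zip s t].
Definition smin (s t : seq rat) : seq rat := [seq Num.min p.1 p.2 | p <- zip s t].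

Lemma tuple_maxE n (x y : n.-tuple rat) : tuple_max x y = smax x y :> seq rat.
Proof.
apply: (@eq_from_nth _ 0) => [|i]; first by rewrite size_tuple size_map size_zip !size_tuple minnn.
rewrite size_tuple => hi; rewrite -(tnth_nth _ _ (Ordinal hi)) tnth_mktuple !(tnth_nth 0) /=.
by rewrite (nth_map (0, 0)) ?size_zip ?size_tuple ?minnn // nth_zip ?size_tuple.
Qed.

Lemma tuple_minE n (x y : n.-tuple rat) : tuple_min x y = smin x y :> seq rat.
Proof.
apply: (@eq_from_nth _ 0) => [|i]; first by rewrite size_tuple size_map size_zip !size_tuple minnn.
rewrite size_tuple => hi; rewrite -(tnth_nth _ _ (Ordinal hi)) tnth_mktuple !(tnth_nth 0) /=.
by rewrite (nth_map (0, 0)) ?size_zip ?size_tuple ?minnn // nth_zip ?size_tuple.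
Qed.

Lemma smax_cat s t s' t' : size s = size s' -> smax (s ++ t) (s' ++ t') = smax s s' ++ smax t t'.
Proof. by move=> h; rewrite /smax zip_cat // map_cat. Qed.

Lemma smin_cat s t s' t' : size s = size s' -> smin (s ++ t) (s' ++ t') = smin s s' ++ smin t t'.
Proof. by move=> h; rewrite /smin zip_cat // map_cat. Qed.

Lemma smaxx s : smax s s = s.
Proof. by elim: s => //= a s IH; rewrite /smax /= -/(smax s s) IH maxxx. Qed.

Lemma sminx s : smin s s = s.
Proof. by elim: s => //= a s IH; rewrite /smin /= -/(smin s s) IH minxx. Qed.

Section FiniteSupport.
Variables (n : nat) (l : seq (seq rat * rat)).

Definition fs_val (t : seq rat) : cost := ohead [seq p.2 | p <- l & p.1 == t].

Definition fin_support : cost_fun rat := CostFun (fun t : n.-tuple rat => fs_val t).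

Lemma fs_mem t c : fs_val t = Some c -> (t, c) \in l.
Proof.
rewrite /fs_val; elim: l => //= -[s v] m IH /=; rewrite inE.
by case: eqP => [-> [->]|_ /IH ->]; rewrite ?eqxx ?orbT.
Qed.

Lemma fin_support_submodular : (forall p q, p \in l -> q \in l ->
    exists c c', [/\ fs_val (smax p.1 q.1) = Some c, fs_val (smin p.1 q.1) = Some c' & c + c' <= p.2 + q.2]) ->
  submodular fin_support.
Proof.
move=> h x y /=; rewrite tuple_maxE tuple_minE.
case ex: (fs_val x) => [a|]; last by case: addc.
case ey: (fs_val y) => [b|]; last by case: addc.
have [c [c' [-> -> hc]]] := h _ _ (fs_mem ex) (fs_mem ey); exact: hc.
Qed.

Definition const_term (m : nat) (c : rat) : term m := Scale c (One m).

Fixpoint big_and (m : nat) (s : seq (formula m)) : formula m :=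
  if s is f :: s' then FAnd f (big_and s') else FEq (One m) (One m).

Fixpoint big_or (m : nat) (s : seq (formula m)) : formula m :=
  if s is f :: s' then FOr f (big_or s') else FLt (One m) (One m).

Lemma big_andP m (s : seq (formula m)) e : holds (big_and s) e <-> forall f, List.In f s -> holds f e.
Proof.
elim: s => [|f s IH] /=; first by split.
rewrite IH; split=> [[h1 h2] g [<- //|]|h]; first exact: h2.
by split=> [|g hg]; apply: h; [left|right].
Qed.

Lemma big_orP m (s : seq (formula m)) e : holds (big_or s) e <-> exists2 f, List.In f s & holds f e.
Proof.
elim: s => [|f s IH] /=; first by split=> [|[]//]; rewrite ltxx.
rewrite IH; split=> [[h|[g h1 h2]]|[g [<-|h1] h2]]; [by exists f; [left|]|by exists g; [right|]|by left|by right; exists g].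
Qed.

Definition entry_formula (p : seq rat * rat) : formula n.+1 :=
  big_and [seq FEq (Var i) (const_term n.+1 (nth 0 (p.2 :: p.1) i)) | i <- enum 'I_n.+1].

Lemma List_In_map (A B : eqType) (C : Type) (f : A -> C) (s : seq A) c :
  List.In c (map f s) <-> exists2 a, a \in s & f a = c.
Proof.
elim: s => [|a s IH] /=; first by split=> // -[].
rewrite IH; split=> [[<-|[b hb <-]]|[b]]; [by exists a; rewrite ?inE ?eqxx|by exists b; rewrite ?inE ?hb ?orbT|].
by rewrite inE => /predU1P[->|hb] <-; [left|right; exists b].
Qed.

(** The graph is a finite set of rational points, and each coordinate is fixed by an equation with a
    multiple of the constant 1. *)
Lemma fin_support_PLH : uniq (map fst l) -> (forall p, p \in l -> size p.1 = n) -> PLH fin_support.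
Proof.
move=> ul sl; exists (big_or [seq entry_formula p | p <- l]) => a0 a.
have E p : p \in l -> holds (entry_formula p) (cons_tuple a0 a) <-> p = (tval a, a0).
  move=> hp; rewrite big_andP; split=> [h|-> f].
    have H i : nth 0 (a0 :: tval a) i = nth 0 (p.2 :: p.1) i.
      case: (ltnP i n.+1) => hi; last by rewrite !nth_default //= ?size_tuple ?(sl p hp).
      have := h (FEq (Var (Ordinal hi)) (const_term n.+1 (nth 0 (p.2 :: p.1) (Ordinal hi)))).
      rewrite /= mulr1 (tnth_nth 0) => -> //.
      by apply/(List_In_map nat); exists (Ordinal hi); rewrite ?mem_enum.
    have := H 0%N; case: p hp h H => s c hp h H /= ->; congr pair.
    apply: (@eq_from_nth _ 0) => [|i _]; first by rewrite size_tuple (sl _ hp).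
    by have := H i.+1.
  move=> /(List_In_map nat)[i _ <-] /=; by rewrite mulr1 (tnth_nth 0).
rewrite big_orP; split.
  move=> [f /(List_In_map nat)[p hp <-] /(E p hp) ep]; rewrite ep in hp.
  rewrite /= /fs_val; elim: l ul hp {sl E} => //= -[s c] m IH /= /andP[hn um]; rewrite inE.
  case: (eqVneq s (tval a)) => [es|ne] /=; last by case/predU1P => [[es]|/IH]; [rewrite es eqxx in ne | apply].
  case/predU1P => [[_ ->] //|hm]; case/negP: hn; rewrite es.
  exact: (map_f fst hm).
move=> /fs_mem hm; exists (entry_formula (tval a, a0)); last by apply/E.
by apply/(List_In_map nat); exists (tval a, a0).
Qed.
End FiniteSupport.

Local Close Scope ring_scope.

Local Open Scope ring_scope.

Lemma smax_min_max n (x y : n.-tuple rat) : let lo := tuple_min x y in let hi := tuple_max x y in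
  [/\ smax lo hi = hi, smax hi lo = hi, smin lo hi = lo & smin hi lo = lo].
Proof.
have le i : tnth (tuple_min x y) i <= tnth (tuple_max x y) i.
  by rewrite !tnth_mktuple; case: (leP (tnth x i) (tnth y i)) => // /ltW.
by split; rewrite -?tuple_maxE -?tuple_minE; congr tval; apply: eq_from_tnth => i;
  rewrite [LHS]tnth_mktuple ?(max_idPr (le i)) ?(max_idPl (le i)) ?(min_idPl (le i)) ?(min_idPr (le i)).
Qed.

Section Supports.
Variables (n : nat) (lo hi : n.-tuple rat).
Hypothesis lohi : [/\ smax lo hi = hi, smax hi lo = hi, smin lo hi = lo & smin hi lo = lo].
Hypothesis lo_hi : (tval lo == tval hi) = false.

Let hi_lo : (tval hi == tval lo) = false.
Proof. by rewrite eq_sym. Qed.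

(** On two comparable tuples any costs are submodular, so a block can be restricted to [lo] and [hi]
    with arbitrary unary costs. *)
Definition chain_list (r0 r1 : rat) : seq (seq rat * rat) := [:: (tval lo, r0); (tval hi, r1)].

Lemma chain_good r0 r1 : submodular (fin_support n (chain_list r0 r1)) /\ PLH (fin_support n (chain_list r0 r1)).
Proof.
have [e1 e2 e3 e4] := lohi; split.
  apply: fin_support_submodular => p q; rewrite !inE.
  move=> /orP[]/eqP -> /orP[]/eqP -> /=; rewrite ?smaxx ?sminx ?e1 ?e2 ?e3 ?e4 /fs_val /= ?eqxx ?lo_hi ?hi_lo /=;
  do 2 eexists; split; try reflexivity; lra.
apply: fin_support_PLH; first by rewrite /= inE lo_hi.
by move=> p; rewrite !inE => /orP[]/eqP -> /=; rewrite size_tuple.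
Qed.

(** Costs for two blocks. The two inequalities assumed in [square_good] say together that the
    function is modular. *)
Definition square_list (m00 m01 m10 m11 : rat) : seq (seq rat * rat) :=
  [:: (lo ++ lo, m00); (lo ++ hi, m01); (hi ++ lo, m10); (hi ++ hi, m11)].

Lemma square_good m00 m01 m10 m11 : m11 + m00 <= m01 + m10 -> m01 + m10 <= m11 + m00 ->
  submodular (fin_support (n + n) (square_list m00 m01 m10 m11)) /\
  PLH (fin_support (n + n) (square_list m00 m01 m10 m11)).
Proof.
have [e1 e2 e3 e4] := lohi; move=> h h'; split.
  apply: fin_support_submodular => p q; rewrite !inE.
  move=> /or4P[]/eqP -> /or4P[]/eqP -> /=; rewrite ?smax_cat ?smin_cat ?size_tuple //;
  rewrite ?smaxx ?sminx ?e1 ?e2 ?e3 ?e4 /fs_val /= ?eqseq_cat ?size_tuple // ?eqxx ?lo_hi ?hi_lo /= ?eqxx /=;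
  do 2 eexists; split; try reflexivity; lra.
apply: fin_support_PLH.
  by rewrite /= !inE !eqseq_cat ?size_tuple // !eqxx ?lo_hi ?hi_lo.
by move=> p; rewrite !inE => /or4P[]/eqP -> /=; rewrite size_cat !size_tuple.
Qed.

(** The relation that the first block implies the second; it is closed under maxima and minima.
    Applied to a block and itself it only restricts the block to [lo] and [hi]. *)
Definition imply_list : seq (seq rat * rat) := [:: (lo ++ lo, 0); (lo ++ hi, 0); (hi ++ hi, 0)].

Lemma imply_good : submodular (fin_support (n + n) imply_list) /\ PLH (fin_support (n + n) imply_list).
Proof.
have [e1 e2 e3 e4] := lohi; split.
  apply: fin_support_submodular => p q; rewrite !inE.
  move=> /or3P[]/eqP -> /or3P[]/eqP -> /=; rewrite ?smax_cat ?smin_cat ?size_tuple //;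
  rewrite ?smaxx ?sminx ?e1 ?e2 ?e3 ?e4 /fs_val /= ?eqseq_cat ?size_tuple // ?eqxx ?lo_hi ?hi_lo /= ?eqxx /=;
  do 2 eexists; split; try reflexivity; lra.
apply: fin_support_PLH.
  by rewrite /= !inE !eqseq_cat ?size_tuple // !eqxx ?lo_hi ?hi_lo.
by move=> p; rewrite !inE => /or3P[]/eqP -> /=; rewrite size_cat !size_tuple.
Qed.

Definition pick_chain (s : bool) : n.-tuple rat := if s then hi else lo.

Lemma chain_val r (s : bool) : fs_val (chain_list (r false) (r true)) (pick_chain s) = Some (r s).
Proof. by rewrite /fs_val /=; case: s; rewrite /= ?eqxx ?lo_hi ?hi_lo. Qed.

Lemma chain_inv r0 r1 (t : n.-tuple rat) : isSome (fs_val (chain_list r0 r1) t) -> exists s, t = pick_chain s.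
Proof.
case e: fs_val => [c|] // _; have := fs_mem e; rewrite !inE.
by move=> /orP[]/eqP[/val_inj -> _]; [exists false|exists true].
Qed.

Lemma square_val m (s s' : bool) :
  fs_val (square_list (m false false) (m false true) (m true false) (m true true)) (pick_chain s ++ pick_chain s') = Some (m s s').
Proof.
rewrite /fs_val /= !eqseq_cat ?size_tuple //.
by case: s; case: s'; rewrite /= ?eqxx ?lo_hi ?hi_lo.
Qed.

Lemma imply_val (s s' : bool) : fs_val imply_list (pick_chain s ++ pick_chain s') = if s && ~~ s' then None else Some 0.
Proof.
rewrite /fs_val /= !eqseq_cat ?size_tuple //.
by case: s; case: s'; rewrite /= ?eqxx ?lo_hi ?hi_lo.
Qed.

Lemma imply_inv (t : n.-tuple rat) : isSome (fs_val imply_list (t ++ t)) -> exists s, t = pick_chain s.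
Proof.
case e: fs_val => [c|] // _; have := fs_mem e; rewrite !inE.
move=> /or3P[]/eqP[h _]; move/eqP: h; rewrite eqseq_cat ?size_tuple // => /andP[/eqP/val_inj -> _];
  [by exists false | by exists false | by exists true].
Qed.
End Supports.

(** * The three-function language and its gadgets *)

Section Language.
Variables (f : cost_fun rat) (l1 l2 : seq (seq rat * rat)).
Local Notation n := (arity f).

Definition lang3 : fin_vlang rat := @FinVLang rat (option bool) (fun s =>
  match s with None => f | Some true => fin_support n l1 | Some false => fin_support (n + n) l2 end).

Definition use_f (P : Type) (t : n.-tuple P) : {s : fsymb lang3 & (arity (finterp s)).-tuple P} :=
  existT (fun s : fsymb lang3 => (arity (finterp s)).-tuple P) None t.
Definition use_1 (P : Type) (t : n.-tuple P) : {s : fsymb lang3 & (arity (finterp s)).-tuple P} :=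
  existT (fun s : fsymb lang3 => (arity (finterp s)).-tuple P) (Some true) t.
Definition use_2 (P : Type) (t : (n + n).-tuple P) : {s : fsymb lang3 & (arity (finterp s)).-tuple P} :=
  existT (fun s : fsymb lang3 => (arity (finterp s)).-tuple P) (Some false) t.

Lemma gcost_nil (P : Type) (z : P -> rat) : gcost (G := lang3) z [::] = Some 0.
Proof. by rewrite /gcost big_nil. Qed.

Lemma gcost_f (P : Type) (z : P -> rat) (t : n.-tuple P) (g : gadget lang3 P) :
  gcost (G := lang3) z (use_f t :: g) = addc (f (map_tuple z t)) (gcost z g).
Proof. by rewrite /gcost big_cons. Qed.

Lemma gcost_1 (P : Type) (z : P -> rat) (t : n.-tuple P) (g : gadget lang3 P) :
  gcost (G := lang3) z (use_1 t :: g) = addc (fs_val l1 [seq z v | v <- t]) (gcost z g).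
Proof. by rewrite /gcost big_cons. Qed.

Lemma gcost_2 (P : Type) (z : P -> rat) (t : (n + n).-tuple P) (g : gadget lang3 P) :
  gcost (G := lang3) z (use_2 t :: g) = addc (fs_val l2 [seq z v | v <- t]) (gcost z g).
Proof. by rewrite /gcost big_cons. Qed.

Lemma gcost_repeat (P : Type) (z : P -> rat) (g : gadget lang3 P) k :
  gcost z (flatten (nseq k.+1 g)) = omap (fun c => c *+ k.+1) (gcost z g).
Proof.
elim: k => [|k IH]; first by rewrite /= cats0; case: gcost => //= c.
have -> : flatten (nseq k.+2 g) = g ++ flatten (nseq k.+1 g) by [].
rewrite gcost_cat IH.
by case: gcost => //= c; rewrite [in RHS]mulrS.
Qed.
End Language.

Section Mixing.
Variables (n : nat) (x y : n.-tuple rat).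

(** Where [x] exceeds [y] the argument comes from the first block, elsewhere from the second. With
    blocks in [{lo, hi}] the four mixtures are [lo], [x], [y] and [hi], so [f] is seen on a square
    of truth values. *)
Definition mix_pos : n.-tuple ('I_n + 'I_n) :=
  [tuple (if tnth y i < tnth x i then inl i else inr i) | i < n].

Definition mix (z z' : 'I_n -> rat) : n.-tuple rat := map_tuple (join2 z z') mix_pos.

Lemma mixE z z' i : tnth (mix z z') i = if tnth y i < tnth x i then z i else z' i.
Proof. by rewrite tnth_map tnth_mktuple; case: ifP. Qed.

Lemma mix_chain (s s' : bool) :
  let p b := tnth (pick_chain (tuple_min x y) (tuple_max x y) b) in
  mix (p s) (p s') = if s then if s' then tuple_max x y else x else if s' then y else tuple_min x y.
Proof.
apply: eq_from_tnth => i; rewrite mixE.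
by case: s; case: s'; rewrite /pick_chain /= ?tnth_mktuple /Order.max /Order.min;
  case: (ltgtP (tnth x i) (tnth y i)) => // ->.
Qed.

Definition all_pos : (n + n).-tuple ('I_n + 'I_n) :=
  cat_tuple (map_tuple inl (ord_tuple n)) (map_tuple inr (ord_tuple n)).

Lemma map_ord_tuple (t : n.-tuple rat) : [seq tnth t i | i <- ord_tuple n] = t.
Proof. exact: map_tnth_enum. Qed.

Lemma map_ord_comp (P : Type) (g : 'I_n -> P) (z : P -> rat) (t : n.-tuple rat) :
  (forall i, z (g i) = tnth t i) -> [seq z v | v <- map g (ord_tuple n)] = t.
Proof. by move=> h; rewrite -map_comp -[RHS]map_ord_tuple; apply: eq_map => i; exact: h. Qed.

Lemma all_posE (t t' : n.-tuple rat) : [seq join2 (tnth t) (tnth t') v | v <- all_pos] = t ++ t'.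
Proof.
rewrite -[tval all_pos]/(map inl (ord_tuple n) ++ map inr (ord_tuple n)) map_cat.
by congr (_ ++ _); apply: map_ord_comp.
Qed.

Lemma fun_tuple (z : 'I_n -> rat) : exists2 t : n.-tuple rat, z = tnth t & [seq z i | i <- ord_tuple n] = t.
Proof.
exists (map_tuple z (ord_tuple n)) => //; apply: functional_extensionality => i.
by rewrite tnth_map tnth_ord_tuple.
Qed.
End Mixing.

Section Hardness.
Variables (f : cost_fun rat) (x y : (arity f).-tuple rat).
Local Notation n := (arity f).
Local Notation lo := (tuple_min x y).
Local Notation hi := (tuple_max x y).
Local Notation pc := (pick_chain lo hi).
Hypothesis lo_hi : (tval lo == tval hi) = false.

Definition hard_extension (l1 l2 : seq (seq rat * rat)) : Prop :=
  [/\ submodular (fin_support n l1) /\ PLH (fin_support n l1),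
      submodular (fin_support (n + n) l2) /\ PLH (fin_support (n + n) l2) &
      VCSP_NP_hard (lang3 f l1 l2)].

(* The unary part of the costs of two blocks is cancelled by the modular
   function, so that only the excess cost of selecting both remains. *)
Lemma hard_one_sided (s : bool) (al be ga : rat) :
  f (mix x y (tnth (pc (~~ s))) (tnth (pc (~~ s)))) = Some al ->
  f (mix x y (tnth (pc s)) (tnth (pc (~~ s)))) = Some be ->
  f (mix x y (tnth (pc (~~ s))) (tnth (pc s))) = Some ga ->
  (forall d, f (mix x y (tnth (pc s)) (tnth (pc s))) = Some d -> be + ga < d + al) ->
  exists l1 l2, hard_extension l1 l2.
Proof.
move=> hal hbe hga hd; have lh := smax_min_max x y.
(* The negated modular function through the three given values of [f]: adding it gives 0 there and a
   positive excess, or +oo, when both blocks are selected. *)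
pose m (a b : bool) : rat := - (al + (if a == s then be - al else 0) + (if b == s then ga - al else 0)).
pose r (a : bool) : rat := if a == s then -1 else 0.
pose l1 := chain_list lo hi (r false) (r true).
pose l2 := square_list lo hi (m false false) (m false true) (m true false) (m true true).
exists l1, l2; split; [exact: chain_good | by apply: square_good => //; rewrite /m; case: (s); rewrite /=; lra |].
(* The edge gadget is repeated [k + 1] times to raise the excess to at least 1. *)
have [k hk] : exists k : nat, forall d, f (mix x y (tnth (pc s)) (tnth (pc s))) = Some d ->
    1 <= (d + m s s) *+ k.+1.
  case: (f (mix x y (tnth (pc s)) (tnth (pc s)))) hd => [d|] hd; last by exists 0%N.
  have w0 : 0 < d + m s s by rewrite /m eqxx; have := hd d erefl; lra.
  have [k hk] := exists_nat_ge [:: (d + m s s)^-1]; exists k => _ [<-].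
  have h := hk _ (mem_head _ _); rewrite -[leRHS]mulr_natr -ler_pdivrMl // mulr1.
  by apply: le_trans h _; rewrite ler_nat.
pose EG : gadget (lang3 f l1 l2) ('I_n + 'I_n) :=
  flatten (nseq k.+1 [:: use_f l1 l2 (mix_pos x y); use_2 l1 l2 (all_pos n)]).
apply: (@gadget_hard (lang3 f l1 l2) n [:: use_1 l1 l2 (ord_tuple n)] EG (tnth (pc s)) (tnth (pc (~~ s)))).
have EC a b : gcost (join2 (tnth (pc a)) (tnth (pc b))) EG =
    omap (fun c => c *+ k.+1) (addc (f (mix x y (tnth (pc a)) (tnth (pc b)))) (Some (m a b))).
  by rewrite gcost_repeat gcost_f gcost_2 gcost_nil all_posE /l2 square_val //= addr0.
split.
- move=> z; have [t -> et] := fun_tuple z; rewrite gcost_1 gcost_nil et.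
  case e: (fs_val _ _) => [c|] // _.
  have [s' ->] : exists s', t = pc s' by apply: (@chain_inv _ _ _ (r false) (r true)); rewrite -/l1 e.
  by case: (s); case: s'; [left|right|right|left].
- by rewrite gcost_1 gcost_nil map_ord_tuple /l1 chain_val // /r eqxx /= addr0.
- rewrite gcost_1 gcost_nil map_ord_tuple /l1 chain_val // /r /= addr0.
  by case: (s).
- by rewrite EC hal /m /=; case: (s); rewrite /= ?addr0 ?subrr ?mul0rn.
- rewrite EC hbe /=; congr Some; rewrite /m eqxx (_ : (~~ s == s) = false); last by case: (s).
  by rewrite (_ : be + _ = 0) ?mul0rn //; lra.
- rewrite EC hga /=; congr Some; rewrite /m eqxx (_ : (~~ s == s) = false); last by case: (s).
  by rewrite (_ : ga + _ = 0) ?mul0rn //; lra.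
- move=> c; rewrite EC; case e: (f _) => [d|] //= [<-].
  exact: hk.
Qed.

(* Here f forces two blocks to be complementary, and a complement turns the
   implication, which is submodular, into a conflict. *)
Lemma hard_two_sided (be ga : rat) : f hi = None -> f lo = None -> f x = Some be -> f y = Some ga ->
  exists l1 l2, hard_extension l1 l2.
Proof.
move=> fhi flo fx fy; have lh := smax_min_max x y.
(* The vertex gadget contains [f], which costs [be] on a selected and [ga] on an unselected vertex;
   together this gives -1 and 0. *)
pose r (a : bool) : rat := if a then -1 - be else - ga.
exists (chain_list lo hi (r false) (r true)), (imply_list lo hi).
split; [exact: chain_good | exact: imply_good |].
pose inj2 (p : 'I_n + 'I_n) : 'I_(n + n) := match p with inl i => lshift n i | inr i => rshift n i end.
pose tR : n.-tuple 'I_(n + n) := map_tuple (fun i => rshift n i) (ord_tuple n).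
(* A vertex is a block followed by its complement: both halves are restricted to [lo] and [hi], and
   [f], infinite at both corners, forces them to differ. *)
pose VG : gadget (lang3 f (chain_list lo hi (r false) (r true)) (imply_list lo hi)) 'I_(n + n) :=
  [:: use_1 _ _ (map_tuple (fun i => lshift n i) (ord_tuple n)); use_2 _ _ (cat_tuple tR tR);
      use_f _ _ (map_tuple inj2 (mix_pos x y))].
(* If the first vertex is selected, the complement half of the second must be [hi], so the second is
   not selected. *)
pose EG : gadget (lang3 f (chain_list lo hi (r false) (r true)) (imply_list lo hi)) ('I_(n + n) + 'I_(n + n)) :=
  [:: use_2 _ _ (cat_tuple (map_tuple (fun i => inl (lshift n i)) (ord_tuple n))
     (map_tuple (fun i => inr (rshift n i)) (ord_tuple n)))].
have zE (z : 'I_(n + n) -> rat) (t1 t2 : n.-tuple rat) : (forall i, z (lshift n i) = tnth t1 i) ->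
    (forall i, z (rshift n i) = tnth t2 i) -> gcost z VG =
    addc (fs_val (chain_list lo hi (r false) (r true)) t1)
      (addc (fs_val (imply_list lo hi) (t2 ++ t2)) (f (mix x y (tnth t1) (tnth t2)))).
  move=> h1 h2; rewrite gcost_1 gcost_2 gcost_f gcost_nil.
  have e1 : [seq z v | v <- map_tuple (fun i => lshift n i) (ord_tuple n)] = t1 by exact: map_ord_comp.
  have e2 : [seq z v | v <- tR] = t2 by exact: map_ord_comp.
  have e3 : map_tuple z (map_tuple inj2 (mix_pos x y)) = mix x y (tnth t1) (tnth t2).
    apply: val_inj; rewrite /= -map_comp; apply: eq_map => -[i|i] /=; [exact: h1|exact: h2].
  by rewrite e1 e3 -[tval (cat_tuple tR tR)]/(tR ++ tR) map_cat e2 [addc (f _) _]addcC add0c.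
pose Z s : 'I_(n + n) -> rat := tnth (cat_tuple (pc s) (pc (~~ s))).
have Zl s i : Z s (lshift n i) = tnth (pc s) i by rewrite /Z tnth_lshift.
have Zr s i : Z s (rshift n i) = tnth (pc (~~ s)) i by rewrite /Z tnth_rshift.
have EC a b : gcost (join2 (Z a) (Z b)) EG = if a && b then None else Some 0.
  rewrite gcost_2 gcost_nil.
  rewrite -[tval (cat_tuple _ _)]/(map (fun i => inl (lshift n i)) (ord_tuple n) ++
    map (fun i => inr (rshift n i)) (ord_tuple n)) map_cat.
  rewrite (map_ord_comp (t := pc a)); last by move=> i; exact: Zl.
  rewrite (map_ord_comp (t := pc (~~ b))); last by move=> i; exact: Zr.
  by rewrite imply_val // negbK; case: (a && b) => //=; rewrite addr0.
have ZV s : gcost (Z s) VG = Some (if s then -1 else 0).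
  rewrite (zE _ _ _ (Zl s) (Zr s)) chain_val // imply_val // mix_chain.
  by case: s; rewrite /= ?fx ?fy /=; congr Some; rewrite /r; lra.
apply: (@gadget_hard _ _ VG EG (Z true) (Z false)); split; rewrite ?ZV ?EC //.
move=> z.
have [t1 z1 _] := fun_tuple (fun i => z (lshift n i)).
have [t2 z2 _] := fun_tuple (fun i => z (rshift n i)).
rewrite (zE z t1 t2); [|by move=> i; rewrite -z1|by move=> i; rewrite -z2].
case e1: (fs_val _ t1) => [c1|] //; case e2: (fs_val _ (t2 ++ t2)) => [c2|] //.
have [s1 E1] : exists s, t1 = pc s by apply: (@chain_inv _ _ _ (r false) (r true)); rewrite e1.
have [s2 E2] : exists s, t2 = pc s by apply: (@imply_inv _ lo hi); rewrite e2.
rewrite E1 E2 mix_chain => h.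
have {h}ns : s2 = ~~ s1 by move: h; case: (s1); case: (s2); rewrite /= ?fhi ?flo.
have zZ : z = Z s1.
  apply: functional_extensionality => i; case: (split_ordP i) => j ->.
    by rewrite Zl -E1 -[LHS]/((fun i => z (lshift n i)) j) z1.
  by rewrite Zr -ns -E2 -[LHS]/((fun i => z (rshift n i)) j) z2.
by rewrite zZ; case: (s1); [left|right].
Qed.

(** Failure of submodularity makes [f x] and [f y] finite. If one of [f lo] and [f hi] is finite,
    that corner is taken as the unselected state of both blocks. *)
Lemma hard_extension_exists :
  ~~ lec (addc (f (tuple_max x y)) (f (tuple_min x y))) (addc (f x) (f y)) ->
  exists l1 l2, hard_extension l1 l2.
Proof.
have M := mix_chain x y.
case fx: (f x) => [be|]; last by case: addc.
case fy: (f y) => [ga|]; last by case: addc.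
case fhi: (f hi) => [d|] /=; case flo: (f lo) => [al|] /=.
- rewrite -ltNge => h; apply: (@hard_one_sided true al be ga); rewrite ?M //= => d'.
  by rewrite fhi => -[<-].
- move=> _; apply: (@hard_one_sided false d ga be); rewrite ?M //= => d'.
  by rewrite flo.
- move=> _; apply: (@hard_one_sided true al be ga); rewrite ?M //= => d'.
  by rewrite fhi.
- by move=> _; apply: hard_two_sided fx fy.
Qed.
End Hardness.

Lemma not_submodularP (f : cost_fun rat) : ~ submodular f -> exists x y : (arity f).-tuple rat,
  (tval (tuple_min x y) == tval (tuple_max x y)) = false /\
  ~~ lec (addc (f (tuple_max x y)) (f (tuple_min x y))) (addc (f x) (f y)).
Proof.
move=> nf; have [x hx] := not_all_ex_not _ _ nf; have [y hy] := not_all_ex_not _ _ hx.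
exists x, y; split; last exact/negP.
apply/eqP => e; apply: hy.
have xy : x = y.
  apply: eq_from_tnth => i; have := congr1 (fun t => tnth t i) (val_inj e).
  rewrite /= !tnth_mktuple /Order.max /Order.min.
  by case: (ltgtP (tnth x i) (tnth y i)) => // _ ->.
rewrite xy; have -> : tuple_max y y = y by apply: val_inj; rewrite /= tuple_maxE smaxx.
have -> : tuple_min y y = y by apply: val_inj; rewrite /= tuple_minE sminx.
by case: (f y) => //= c.
Qed.

Theorem theorem7 :
  (forall G' : fin_vlang rat,
     sublanguage G' submodular_PLH -> VCSP_polytime G') /\
  (forall Delta : vlang rat,
     (forall f : symb Delta, PLH (interp f)) ->
     sublanguage submodular_PLH Delta ->
     (exists f : symb Delta, ~ submodular (interp f)) ->
     exists Delta' : fin_vlang rat,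
       sublanguage Delta' Delta /\ VCSP_NP_hard Delta').
Proof.
split=> [G' [h [_ hE]]|Delta _ [h0 [inj0 E0]] [fs nf]].
  have H (f : fsymb G') : submodular (finterp f) /\ PLH (finterp f).
    have e : finterp f = sval (h f) := hE f.
    by rewrite e; exact: (svalP (h f)).
  by apply: submodular_tractable => f; case: (H f).
set f := interp fs in nf.
have [x [y [lh nl]]] := not_submodularP nf.
have [l1 [l2 [g1 g2 hard]]] := hard_extension_exists lh nl.
pose s1 : symb submodular_PLH := exist _ _ g1.
pose s2 : symb submodular_PLH := exist _ _ g2.
exists (lang3 f l1 l2); split=> //.
exists (fun s : option bool => match s with None => fs | Some true => h0 s1 | Some false => h0 s2 end).
(* Hence the arities [n] and [n + n] differ, and the two added functions are different symbols. *)
have n0 : (0 < arity f)%N.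
  rewrite lt0n; apply/eqP => n0; move/eqP: lh; apply.
  apply: (@eq_from_nth _ 0) => [|i]; rewrite !size_tuple // => hi.
  by have : (i < 0)%N by rewrite -n0.
(* Symbols in the image of [h0] are submodular, so [fs] is different from both added ones and the
   embedding is injective. *)
have nf_sub s : fs <> h0 s.
  by move=> e; apply: nf; rewrite /f e -E0; case: (svalP s).
have n12 : h0 s1 <> h0 s2.
  move=> /inj0 e; have := congr1 (fun s : symb submodular_PLH => arity (sval s)) e.
  by rewrite /= -[LHS]addn0 => /addnI /esym; move: n0; case: (arity f).
split; last by case=> [[]|] //=; rewrite -E0.
case=> [[]|] [[]|] //= e; exfalso.
all: by first [exact: (n12 e) | exact: (n12 (esym e)) | exact: (nf_sub _ e) | exact: (nf_sub _ (esym e))].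
Qed.
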